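(* Let $\alpha$ be a real number with $0\le\alpha<1/2$. Then the equality $$\int_{0}^{\infty}\frac{\arg\bigl(\zeta(1/2+\alpha+it)\,(-1/2+\alpha+it)\bigr)}{\bigl((1/2-\alpha)^2+t^2\bigr)^{3/2}}\,dt+\int_{1/2+\alpha}^{1}\frac{\ln\bigl(\zeta(\sigma)(\sigma-1)\bigr)}{(1-\sigma)^{3/2}(\sigma-2\alpha)^{3/2}}\,d\sigma=0$$ holds if and only if the Riemann zeta function $\zeta$ has no zeros $\sigma+it$ with $\sigma>1/2+\alpha$. In particular, for $\alpha=0$ this equality is equivalent to the Riemann hypothesis.
   Context: $\zeta$ denotes the Riemann zeta function. For real $\sigma\in(1/2+\alpha,1)$, $\zeta(\sigma)(\sigma-1)>0$ and $\ln$ is the real logarithm. For $s=\sigma+it$ with $t>0$, $\arg(\zeta(s)(s-1))$ denotes the imaginary part of the branch of $\ln(\zeta(s)(s-1))$ obtained by continuous variation along the horizontal line $\operatorname{Im}s=t$ starting from real values of $s$ far to the right, the branch being real on the real half-line $\sigma>1/2+\alpha$; if a zero of $\zeta$ lies on the path, the value is taken as the limit from above. The Riemann hypothesis is the statement that $\zeta$ has no zeros with real part $>1/2$. *)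

(* Defs.v *)
From Stdlib Require Import Reals ClassicalEpsilon.
From Coquelicot Require Import Coquelicot.
Open Scope R_scope.

Definition cpow (x : R) (z : C) : C :=
  (exp (Re z * ln x) * cos (Im z * ln x), exp (Re z * ln x) * sin (Im z * ln x)).

(** The Riemann zeta function on the half plane Re s > 0 (s <> 1), given by the
    classical analytic continuation formula
      zeta(s) = s/(s-1) - s * \int_1^oo {x} x^(-s-1) dx,
    where {x} is the fractional part.  (Outside Re s > 0 the value is junk; only
    Re s > 0 is used below.) *)
Definition zeta_tail (s : C) : C :=
  @RInt_gen C_R_CompleteNormedModule
    (fun x => scal (frac_part x) (cpow x (Copp s - 1)%C))
    (at_point 1) (Rbar_locally p_infty).

Definition zeta (s : C) : C := (s / (s - 1) - s * zeta_tail s)%C.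

Definition zetaF (s : C) : C := (zeta s * (s - 1))%C.

(** theta0 is the value at sigma of the branch of arg(zetaF(x + i t)), x >= sigma,
    obtained by continuous variation along Im s = t from far to the right,
    normalized so that it tends to 0 as x -> +oo (which is the continuation of
    the branch that is real on the real axis far to the right). *)
Definition arg_branch (sigma t theta0 : R) : Prop :=
  exists theta : R -> R,
    (forall x, continuous theta x) /\
    (forall x, sigma <= x ->
       zetaF (x, t) = (Cmod (zetaF (x, t)) * cos (theta x),
                       Cmod (zetaF (x, t)) * sin (theta x))) /\
    is_lim theta p_infty 0 /\
    theta sigma = theta0.

(** The branch value when no zero lies on the path (otherwise junk). *)
Definition arg_nz (sigma t : R) : R := epsilon (inhabits 0) (arg_branch sigma t).

(** arg(zeta(s)(s-1)) at s = sigma + i t: the continuous branch when there is no zero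
    on the path, and otherwise the limit from above (t' -> t+). *)
Definition arg_zetaF (sigma t : R) : R :=
  if excluded_middle_informative (exists th, arg_branch sigma t th)
  then arg_nz sigma t
  else epsilon (inhabits 0)
         (fun l => filterlim (arg_nz sigma) (at_right t) (locally l)).

(* Main.v *)
Require Import Defs.
From Stdlib Require Import Reals Lra Lia List ClassicalEpsilon Ranalysis5.
From Coquelicot Require Import Coquelicot.
Open Scope R_scope.

(** Put [a = 1/2 - alpha] and map the half plane [Re s > 1 - a] to the unit disc by a Cayley
    transform sending [s = 1] to [0] and the line [s = 1 - a + i t], [t = a cot p], to the
    arc [w = e^(2 i p)].  In the variable [p] the first integral of the theorem is
    [a^-2] times the integral of [arg * sin p] over [0, PI/2], and with [w = -y^2] the second is
    [(2 a^2)^-1] times the integral of [(1 + 1/y^2) ln (zeta(s)(s-1))] over [0, 1].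

    On an arc [|w| = q^2 < 1] a zero-free function contributes nothing to
    [2 q * int arg * sin p + int_0^q (1 + q^2/y^2) ln |.|]: this is Cauchy's theorem for
    its logarithm against a kernel adapted to [w = tau^2].  On a bounded strip
    [zeta(s)(s-1)] is a finite product of conjugate pairs of zeros times a zero-free
    function.  A pair outside the arc contributes nothing, while a pair inside contributes
    a nonnegative amount, bounded below as [q -> 1]; here its argument is compared with that
    of the function reflected in the circle, the comparison being an explicit integral.
    Letting [q -> 1], Backlund's bound [arg = O(t^(3/2))] controls the small [p], and the
    jumps of the argument at the heights of the zeros are absorbed by narrow bumps. *)

(** * Complex differentiability *)

(** On [Re s = 1 - a] one has [a^2 + t^2 = (1 - s)(s - 2 alpha)]. Both integrals are thus sides of
    one boundary integral of [ln (zeta(s)(s-1))] against [((1 - s)(s - 2 alpha))^(-3/2)]. That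
    weight branches at [s = 1], that is at [w = 0], which is why one passes to [w = tau^2]: on the
    quarter disc in [tau] the arc retains the argument and the imaginary axis the modulus. The line
    itself is out of reach at first, because of the zeros on or near it and the lack of control at
    infinity ([w = 1]). An arc [|w| = q^2 < 1] meets only finitely many zeros, and [q] can be chosen
    to avoid them. A zero to the right of the line never lowers the sum. So one such zero bounds the
    sum below, and for the implication from the equality to the absence of zeros a one-sided
    comparison of arguments suffices. The exponent [3/2] in the growth bound fits the weight: with
    [t] of order [1/sin p], the product [t^(3/2) * sin p] has order [(sin p)^(-1/2)], which is
    integrable at [0] uniformly in [q]. *)

Ltac rring := match goal with |- @eq _ ?a ?b => change (@eq R a b); ring end.
(** Many equalities arise in the carrier of an algebraic structure; restating them at [R] or [C]
    lets [ring] recognise the operations. *)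
Ltac cring := match goal with |- @eq _ ?a ?b => change (@eq C a b); ring end.
Ltac creal := apply injective_projections; simpl.

Lemma Re_le_Cmod (z : C) : Rabs (Re z) <= Cmod z.
Proof. exact (Rle_trans _ _ _ (Rmax_l _ _) (Rmax_Cmod z)). Qed.

Lemma Im_le_Cmod (z : C) : Rabs (Im z) <= Cmod z.
Proof. exact (Rle_trans _ _ _ (Rmax_r _ _) (Rmax_Cmod z)). Qed.

Lemma Cmod_le_abs (z : C) : Cmod z <= Rabs (Re z) + Rabs (Im z).
Proof.
  replace z with (RtoC (Re z) + Ci * RtoC (Im z))%C at 1
    by (destruct z; creal; ring).
  eapply Rle_trans; [apply Cmod_triangle|].
  rewrite Cmod_mult, Cmod_Ci, !Cmod_R; lra.
Qed.

Lemma Cmod_sqr (z : C) : Cmod z * Cmod z = Re z * Re z + Im z * Im z.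
Proof.
  unfold Cmod; rewrite sqrt_sqrt; [unfold Re, Im; simpl; ring|].
  generalize (pow2_ge_0 (fst z)) (pow2_ge_0 (snd z)); lra.
Qed.

Lemma Cmod_pos (z : C) : z <> RtoC 0 -> 0 < Cmod z.
Proof. intros; apply Cmod_gt_0; auto. Qed.

Lemma Cmod_sub_sym (z w : C) : Cmod (z - w) = Cmod (w - z).
Proof. rewrite <- Cmod_opp; f_equal; ring. Qed.

Lemma Cmod_sub_ge (z w : C) : Cmod z - Cmod w <= Cmod (z - w).
Proof.
  generalize (Cmod_triangle (z - w) w).
  replace (z - w + w)%C with z by ring; lra.
Qed.

Lemma continuous_ReC {U : UniformSpace} (f : U -> C) (x : U) :
  continuous f x -> continuous (fun u => Re (f u)) x.
Proof.
  intros H; apply (continuous_comp f (fun c : C => Re c)); auto.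
  destruct (f x); apply continuous_fst.
Qed.

Lemma continuous_ImC {U : UniformSpace} (f : U -> C) (x : U) :
  continuous f x -> continuous (fun u => Im (f u)) x.
Proof.
  intros H; apply (continuous_comp f (fun c : C => Im c)); auto.
  destruct (f x); apply continuous_snd.
Qed.

Lemma continuous_pairC {U : UniformSpace} (f g : U -> R) (x : U) :
  continuous f x -> continuous g x -> continuous (fun u => (f u, g u) : C) x.
Proof.
  intros Hf Hg P [e HP]; unfold filtermap.
  apply (filter_imp (fun u => ball (f x) e (f u) /\ ball (g x) e (g u))).
  - intros u [H1 H2]; apply HP; split; auto.
  - apply filter_and; [apply Hf|apply Hg]; apply locally_ball.
Qed.

Lemma continuous_extC {U V : UniformSpace} (f g : U -> V) (x : U) :
  (forall u, f u = g u) -> continuous f x -> continuous g x.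
Proof.
  intros H Hf; unfold continuous in *; rewrite <- H.
  apply filterlim_ext with f; auto.
Qed.

Lemma continuous_ofR {U : UniformSpace} (f : U -> C) (x : U) :
  continuous (fun u => Re (f u)) x -> continuous (fun u => Im (f u)) x ->
  continuous f x.
Proof.
  intros H1 H2.
  apply continuous_extC with (fun u => (Re (f u), Im (f u)) : C).
  - intros u; destruct (f u); reflexivity.
  - apply continuous_pairC; auto.
Qed.

Lemma continuous_Rplus {U : UniformSpace} (f g : U -> R) (x : U) :
  continuous f x -> continuous g x -> continuous (fun u => f u + g u) x.
Proof. exact (continuous_plus (V := R_NormedModule) f g x). Qed.

Lemma continuous_Rminus {U : UniformSpace} (f g : U -> R) (x : U) :
  continuous f x -> continuous g x -> continuous (fun u => f u - g u) x.
Proof. exact (continuous_minus (V := R_NormedModule) f g x). Qed.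

Lemma continuous_Rmult {U : UniformSpace} (f g : U -> R) (x : U) :
  continuous f x -> continuous g x -> continuous (fun u => f u * g u) x.
Proof. exact (continuous_mult (K := R_AbsRing) f g x). Qed.

Lemma continuous_Rinv' {U : UniformSpace} (f : U -> R) (x : U) :
  continuous f x -> f x <> 0 -> continuous (fun u => / f u) x.
Proof.
  intros H H0; apply (continuous_comp f Rinv); auto.
  apply continuous_Rinv; auto.
Qed.

Lemma continuous_Rdiv {U : UniformSpace} (f g : U -> R) (x : U) :
  continuous f x -> continuous g x -> g x <> 0 ->
  continuous (fun u => f u / g u) x.
Proof.
  intros; apply continuous_Rmult; auto; apply continuous_Rinv'; auto.
Qed.

Lemma continuous_Cplus {U : UniformSpace} (f g : U -> C) (x : U) :
  continuous f x -> continuous g x -> continuous (fun u => f u + g u)%C x.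
Proof.
  intros Hf Hg; apply continuous_ofR; simpl;
    apply continuous_Rplus; auto using continuous_ReC, continuous_ImC.
Qed.

Lemma continuous_Cminus {U : UniformSpace} (f g : U -> C) (x : U) :
  continuous f x -> continuous g x -> continuous (fun u => f u - g u)%C x.
Proof.
  intros Hf Hg; apply continuous_ofR; simpl;
    apply continuous_Rminus; auto using continuous_ReC, continuous_ImC.
Qed.

Lemma continuous_Cmult {U : UniformSpace} (f g : U -> C) (x : U) :
  continuous f x -> continuous g x -> continuous (fun u => f u * g u)%C x.
Proof.
  intros Hf Hg; apply continuous_ofR; simpl;
    [apply continuous_Rminus | apply continuous_Rplus];
    apply continuous_Rmult;
    first [exact (continuous_ReC _ _ Hf) | exact (continuous_ImC _ _ Hf)
          |exact (continuous_ReC _ _ Hg) | exact (continuous_ImC _ _ Hg)].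
Qed.

Lemma Cnormsq_pos (z : C) : z <> RtoC 0 -> 0 < Re z * Re z + Im z * Im z.
Proof.
  intros H; rewrite <- Cmod_sqr; generalize (Cmod_pos _ H); intros.
  apply Rmult_lt_0_compat; auto.
Qed.

Lemma continuous_Cinv {U : UniformSpace} (f : U -> C) (x : U) :
  continuous f x -> f x <> RtoC 0 -> continuous (fun u => / f u)%C x.
Proof.
  intros Hf H0.
  assert (H1 := Cnormsq_pos _ H0).
  assert (Hn : continuous (fun u => fst (f u) ^ 2 + snd (f u) ^ 2) x).
  { apply continuous_extC with
      (fun u => Re (f u) * Re (f u) + Im (f u) * Im (f u)).
    - intros; unfold Re, Im; rring.
    - apply continuous_Rplus; apply continuous_Rmult;
        auto using continuous_ReC, continuous_ImC. }
  assert (fst (f x) ^ 2 + snd (f x) ^ 2 <> 0) by (unfold Re, Im in H1; nra).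
  apply continuous_ofR; simpl; apply continuous_Rdiv; auto.
  - exact (continuous_ReC _ _ Hf).
  - apply (continuous_opp (V := R_NormedModule)); exact (continuous_ImC _ _ Hf).
Qed.

(** The uniform structure of [C] is that of a product, so its balls are squares; halving radii
    passes between squares and the modulus. *)
Lemma continuous_C_eps (f : C -> C) (z : C) :
  continuous f z <->
  (forall e, 0 < e -> exists d, 0 < d /\
     forall w, Cmod (w - z) < d -> Cmod (f w - f z) < e).
Proof.
  split.
  - intros H e He.
    assert (H2 : 0 < e / 2) by lra.
    assert (H1 : locally (f z) (ball (f z) (mkposreal _ H2))) by apply locally_ball.
    destruct (H _ H1) as [d Hd].
    exists d; split; [apply cond_pos|].
    intros w Hw.
    assert (B : ball (M := C_UniformSpace) z d w).
    { split; simpl; unfold ball; simpl; unfold AbsRing_ball, abs, minus, plus, opp; simpl.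
      - eapply Rle_lt_trans; [|exact Hw]; exact (Re_le_Cmod (w - z)).
      - eapply Rle_lt_trans; [|exact Hw]; exact (Im_le_Cmod (w - z)). }
    destruct (Hd w B) as [B1 B2].
    unfold ball in B1, B2; simpl in B1, B2;
      unfold AbsRing_ball, abs, minus, plus, opp in B1, B2; simpl in B1, B2.
    eapply Rle_lt_trans; [apply Cmod_le_abs|].
    unfold Re, Im; simpl; lra.
  - intros H P [e HP].
    destruct (H e (cond_pos e)) as [d [Hd H1]].
    assert (Hd2 : 0 < d / 2) by lra.
    exists (mkposreal _ Hd2); intros w [B1 B2].
    unfold ball in B1, B2; simpl in B1, B2;
      unfold AbsRing_ball, abs, minus, plus, opp in B1, B2; simpl in B1, B2.
    assert (Hw : Cmod (w - z) < d).
    { eapply Rle_lt_trans; [apply Cmod_le_abs|]; unfold Re, Im; simpl; lra. }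
    specialize (H1 w Hw); apply HP; split; unfold ball; simpl;
      unfold AbsRing_ball, abs, minus, plus, opp; simpl.
    + eapply Rle_lt_trans; [|exact H1]; exact (Re_le_Cmod (f w - f z)).
    + eapply Rle_lt_trans; [|exact H1]; exact (Im_le_Cmod (f w - f z)).
Qed.

(** Carathéodory's form of complex differentiability: the slope function is
    unconstrained away from the base point, so the rules of differentiation
    reduce to ring identities and continuity. *)
Definition cdiff (f : C -> C) (z l : C) : Prop :=
  exists q : C -> C, (forall w, f w = f z + q w * (w - z))%C /\
    q z = l /\ continuous q z.

Lemma cdiff_eps (f : C -> C) (z l : C) :
  cdiff f z l <->
  (forall e, 0 < e -> exists d, 0 < d /\
     forall w, Cmod (w - z) < d ->
       Cmod (f w - f z - l * (w - z)) <= e * Cmod (w - z)).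
Proof.
  split.
  - intros [q [Hq [H0 Hc]]] e He.
    destruct (proj1 (continuous_C_eps q z) Hc e He) as [d [Hd H]].
    exists d; split; auto; intros w Hw.
    replace (f w - f z - l * (w - z))%C with ((q w - q z) * (w - z))%C
      by (rewrite (Hq w), H0; ring).
    rewrite Cmod_mult; apply Rmult_le_compat_r; [apply Cmod_ge_0|].
    left; auto.
  - intros H.
    exists (fun w => if Ceq_dec w z then l else ((f w - f z) / (w - z))%C).
    split; [|split].
    + intros w; destruct (Ceq_dec w z) as [->|Hn]; [ring|].
      field; intros E; apply Hn; replace w with (w - z + z)%C by ring;
        rewrite E; ring.
    + destruct (Ceq_dec z z); [auto|tauto].
    + apply continuous_C_eps; intros e He.
      assert (He2 : 0 < e / 2) by lra.
      destruct (H _ He2) as [d [Hd H1]].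
      exists d; split; auto; intros w Hw.
      destruct (Ceq_dec z z) as [_|]; [|tauto].
      destruct (Ceq_dec w z) as [->|Hn].
      * replace (l - l)%C with (RtoC 0) by ring; rewrite Cmod_0; auto.
      * assert (Hwz : (w - z)%C <> RtoC 0).
        { intros E; apply Hn; replace w with (w - z + z)%C by ring;
            rewrite E; ring. }
        replace ((f w - f z) / (w - z) - l)%C
          with ((f w - f z - l * (w - z)) / (w - z))%C by (field; auto).
        rewrite Cmod_div; auto.
        generalize (Cmod_pos _ Hwz); intros Hp.
        apply Rle_lt_trans with (e / 2); [|lra].
        apply Rmult_le_reg_r with (Cmod (w - z)); auto.
        unfold Rdiv at 1; rewrite Rmult_assoc, Rinv_l, Rmult_1_r by lra.
        auto.
Qed.

Lemma cdiff_ext_loc (f g : C -> C) (z l : C) (d : R) :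
  0 < d -> (forall w, Cmod (w - z) < d -> f w = g w) ->
  cdiff f z l -> cdiff g z l.
Proof.
  intros Hd He H; apply cdiff_eps; intros e Hep.
  destruct (proj1 (cdiff_eps f z l) H e Hep) as [d' [Hd' H']].
  exists (Rmin d d'); split; [apply Rmin_glb_lt; auto|].
  intros w Hw.
  rewrite <- (He w), <- (He z).
  - apply H'; eapply Rlt_le_trans; [exact Hw|apply Rmin_r].
  - replace (z - z)%C with (RtoC 0) by ring; rewrite Cmod_0; auto.
  - eapply Rlt_le_trans; [exact Hw|apply Rmin_l].
Qed.

Lemma cdiff_eq (f : C -> C) (z l l' : C) : cdiff f z l -> l = l' -> cdiff f z l'.
Proof. intros H <-; auto. Qed.

Lemma cdiff_continuous (f : C -> C) (z l : C) : cdiff f z l -> continuous f z.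
Proof.
  intros [q [Hq [_ Hc]]].
  apply continuous_extC with (fun w => f z + q w * (w - z))%C.
  - intros; symmetry; apply Hq.
  - apply continuous_Cplus; [apply continuous_const|].
    apply continuous_Cmult; auto.
    apply continuous_Cminus; [apply continuous_id|apply continuous_const].
Qed.

Lemma cdiff_const (c z : C) : cdiff (fun _ => c) z 0.
Proof.
  exists (fun _ => RtoC 0); repeat split; [intros; cring|apply continuous_const].
Qed.

Lemma cdiff_id (z : C) : cdiff (fun w => w) z 1.
Proof.
  exists (fun _ => RtoC 1); repeat split; [intros; cring|apply continuous_const].
Qed.

Lemma cdiff_plus (f g : C -> C) (z l m : C) :
  cdiff f z l -> cdiff g z m -> cdiff (fun w => f w + g w)%C z (l + m).
Proof.
  intros [p [Hp [<- Cp]]] [q [Hq [<- Cq]]].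
  exists (fun w => p w + q w)%C; repeat split.
  - intros; rewrite (Hp w), (Hq w); ring.
  - apply continuous_Cplus; auto.
Qed.

Lemma cdiff_minus (f g : C -> C) (z l m : C) :
  cdiff f z l -> cdiff g z m -> cdiff (fun w => f w - g w)%C z (l - m).
Proof.
  intros [p [Hp [<- Cp]]] [q [Hq [<- Cq]]].
  exists (fun w => p w - q w)%C; repeat split.
  - intros; rewrite (Hp w), (Hq w); ring.
  - apply continuous_Cminus; auto.
Qed.

Lemma cdiff_mult (f g : C -> C) (z l m : C) :
  cdiff f z l -> cdiff g z m ->
  cdiff (fun w => f w * g w)%C z (l * g z + f z * m).
Proof.
  intros Hf Hg; generalize (cdiff_continuous _ _ _ Hg); intros Cg.
  destruct Hf as [p [Hp [<- Cp]]], Hg as [q [Hq [<- Cq]]].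
  exists (fun w => p w * g w + f z * q w)%C; repeat split.
  - intros; rewrite (Hp w), (Hq w); ring.
  - apply continuous_Cplus; apply continuous_Cmult; auto.
    apply continuous_const.
Qed.

Lemma cdiff_comp (f g : C -> C) (z l m : C) :
  cdiff f (g z) l -> cdiff g z m -> cdiff (fun w => f (g w)) z (l * m).
Proof.
  intros Hf Hg; generalize (cdiff_continuous _ _ _ Hg); intros Cg.
  destruct Hf as [p [Hp [<- Cp]]], Hg as [q [Hq [<- Cq]]].
  exists (fun w => p (g w) * q w)%C; repeat split.
  - intros; rewrite (Hp (g w)), (Hq w); ring.
  - apply continuous_Cmult; auto.
    apply (continuous_comp g p); auto.
Qed.

Lemma cdiff_Cinv (z : C) : z <> RtoC 0 -> cdiff Cinv z (- / (z * z)).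
Proof.
  intros Hz.
  (* The slope of [1/w] from [z] is [-1/(z w)], which has no meaning at [w = 0]. The function is
     altered there to the value for which the slope is [-1/z^2], so that the slope identity holds
     for every [w]. *)
  apply cdiff_ext_loc with
    (fun w => if Ceq_dec w 0 then (/ z - / (z * z) * (- z))%C else (/ w)%C) (Cmod z).
  - apply Cmod_pos; auto.
  - intros w Hw; destruct (Ceq_dec w 0) as [->|]; auto.
    replace (0 - z)%C with (- z)%C in Hw by ring; rewrite Cmod_opp in Hw; lra.
  - assert (Hc : continuous (fun w => - / (z * w))%C z).
    { apply continuous_extC with (fun w => RtoC 0 - / (z * w))%C; [intros; cring|].
      apply continuous_Cminus; [apply continuous_const|].
      apply continuous_Cinv; [|apply Cmult_neq_0; auto].
      apply continuous_Cmult; [apply continuous_const|apply continuous_id]. }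
    exists (fun w => if Ceq_dec w 0 then (- / (z * z))%C else (- / (z * w))%C).
    destruct (Ceq_dec z 0) as [|_]; [tauto|].
    repeat split.
    + intros w; destruct (Ceq_dec w 0) as [->|]; field; auto.
    + apply continuous_C_eps; intros e He.
      destruct (proj1 (continuous_C_eps _ _) Hc e He) as [d [Hd H]].
      exists (Rmin d (Cmod z)); split.
      { apply Rmin_glb_lt; auto; apply Cmod_pos; auto. }
      intros w Hw; destruct (Ceq_dec z 0) as [|_]; [tauto|].
      destruct (Ceq_dec w 0) as [->|].
      * exfalso; generalize (Rmin_r d (Cmod z)).
        replace (0 - z)%C with (- z)%C in Hw by ring; rewrite Cmod_opp in Hw; lra.
      * apply H; eapply Rlt_le_trans; [exact Hw|apply Rmin_l].
Qed.

Lemma cdiff_inv (f : C -> C) (z l : C) :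
  f z <> RtoC 0 -> cdiff f z l -> cdiff (fun w => / f w)%C z (- / (f z * f z) * l).
Proof. intros H0 H; apply (cdiff_comp Cinv f); auto; apply cdiff_Cinv; auto. Qed.

(** Since [u] vanishes at [t], continuity of [v] is enough. This is the product rule needed for a
    Carathéodory slope, which is only continuous. *)
Lemma is_derive_mult_zero (u v : R -> R) (t d : R) :
  is_derive u t d -> u t = 0 -> continuous v t ->
  is_derive (fun x => u x * v x) t (d * v t).
Proof.
  intros Hu H0 Hv.
  apply is_derive_Reals; apply is_derive_Reals in Hu.
  intros e He.
  assert (Hv' : forall e, 0 < e -> exists d, 0 < d /\
     forall h, Rabs h < d -> Rabs (v (t + h) - v t) < e).
  { intros e' He'.
    destruct (Hv _ (locally_ball (v t) (mkposreal e' He'))) as [dd Hdd].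
    exists dd; split; [apply cond_pos|]; intros h Hh.
    apply (Hdd (t + h)); unfold ball; simpl; unfold AbsRing_ball, abs, minus, plus, opp; simpl.
    replace (t + h + - t) with h by ring; auto. }
  set (e1 := Rmin 1 (e / (2 * (Rabs d + Rabs (v t) + 2)))).
  assert (HB : 0 < Rabs d + Rabs (v t) + 2)
    by (generalize (Rabs_pos d) (Rabs_pos (v t)); lra).
  assert (He1 : 0 < e1).
  { unfold e1; apply Rmin_glb_lt; [lra|]. apply Rdiv_lt_0_compat; lra. }
  assert (He1' : e1 * (2 * (Rabs d + Rabs (v t) + 2)) <= e).
  { apply Rle_trans with (e / (2 * (Rabs d + Rabs (v t) + 2)) * (2 * (Rabs d + Rabs (v t) + 2))).
    - apply Rmult_le_compat_r; [lra|apply Rmin_r].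
    - right; field; lra. }
  destruct (Hu e1 He1) as [d1 Hd1].
  destruct (Hv' e1 He1) as [d2 [Hd2 H2]].
  assert (Hd : 0 < Rmin d1 d2) by (apply Rmin_glb_lt; auto; apply cond_pos).
  exists (mkposreal _ Hd); intros h Hh Hlt; simpl in Hlt.
  assert (A1 := Hd1 h Hh (Rlt_le_trans _ _ _ Hlt (Rmin_l _ _))).
  assert (A2 := H2 h (Rlt_le_trans _ _ _ Hlt (Rmin_r _ _))).
  rewrite H0 in *. rewrite Rminus_0_r in A1.
  set (A := u (t + h) / h - d) in *; set (B := v (t + h) - v t) in *.
  replace ((u (t + h) * v (t + h) - 0 * v t) / h - d * v t) with
    (A * v t + A * B + d * B) by (unfold A, B; field; auto).
  assert (E1 : e1 <= 1) by apply Rmin_l.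
  eapply Rle_lt_trans; [apply Rabs_triang|].
  eapply Rle_lt_trans; [apply Rplus_le_compat_r; apply Rabs_triang|].
  rewrite !Rabs_mult.
  generalize (Rabs_pos A) (Rabs_pos B) (Rabs_pos d) (Rabs_pos (v t)); intros.
  assert (Rabs A * Rabs (v t) <= e1 * Rabs (v t)) by (apply Rmult_le_compat_r; lra).
  assert (Rabs A * Rabs B <= e1 * 1) by (apply Rmult_le_compat; lra).
  assert (Rabs d * Rabs B <= Rabs d * e1) by (apply Rmult_le_compat_l; lra).
  nra.
Qed.

Lemma is_derive_extR (f g : R -> R) (x l : R) :
  (forall u, f u = g u) -> is_derive f x l -> is_derive g x l.
Proof. intros H; apply is_derive_ext; exact H. Qed.

Lemma is_derive_eq (f : R -> R) (x l l' : R) :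
  is_derive f x l -> l = l' -> is_derive f x l'.
Proof. intros H <-; auto. Qed.

Lemma is_derive_Rconst (c x : R) : is_derive (fun _ => c) x 0.
Proof. exact (is_derive_const (V := R_NormedModule) c x). Qed.

Lemma is_derive_Rplus (f g : R -> R) (x l m : R) :
  is_derive f x l -> is_derive g x m -> is_derive (fun u => f u + g u) x (l + m).
Proof. exact (is_derive_plus (V := R_NormedModule) f g x l m). Qed.

Lemma is_derive_Rminus (f g : R -> R) (x l m : R) :
  is_derive f x l -> is_derive g x m -> is_derive (fun u => f u - g u) x (l - m).
Proof. exact (is_derive_minus (V := R_NormedModule) f g x l m). Qed.

Lemma is_derive_Rmult (f g : R -> R) (x l m : R) :
  is_derive f x l -> is_derive g x m ->
  is_derive (fun u => f u * g u) x (l * g x + f x * m).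
Proof. intros; apply (is_derive_mult f g); auto; apply Rmult_comm. Qed.

Lemma is_derive_Rminus_const (f : R -> R) (x l c : R) :
  is_derive f x l -> is_derive (fun u => f u - c) x l.
Proof.
  intros; eapply is_derive_eq;
    [apply is_derive_Rminus; [eauto|apply is_derive_Rconst]|ring].
Qed.

(** Along the path, [f (g u) - f (g t)] is the slope times [g u - g t], a factor vanishing at [t],
    so [is_derive_mult_zero] applies to each coordinate. *)
Lemma cdiff_path (f : C -> C) (g : R -> C) (t dx dy : R) (l : C) :
  cdiff f (g t) l ->
  is_derive (fun u => Re (g u)) t dx -> is_derive (fun u => Im (g u)) t dy ->
  is_derive (fun u => Re (f (g u))) t (Re (l * (dx, dy))%C) /\
  is_derive (fun u => Im (f (g u))) t (Im (l * (dx, dy))%C).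
Proof.
  intros [q [Hq [H0 Hc]]] Hx Hy.
  assert (Cg : continuous g t).
  { apply continuous_ofR; apply (ex_derive_continuous (V := R_NormedModule)); eexists; eauto. }
  assert (Cq : continuous (fun u => q (g u)) t) by (apply (continuous_comp g q); auto).
  assert (CR := continuous_ReC _ _ Cq); assert (CI := continuous_ImC _ _ Cq).
  assert (Dx : is_derive (fun u => Re (g u) - Re (g t)) t dx).
  { apply is_derive_Rminus_const; auto. }
  assert (Dy : is_derive (fun u => Im (g u) - Im (g t)) t dy).
  { apply is_derive_Rminus_const; auto. }
  assert (A1 := is_derive_mult_zero _ _ _ _ Dx (Rminus_diag_eq _ _ eq_refl) CR).
  assert (A2 := is_derive_mult_zero _ _ _ _ Dy (Rminus_diag_eq _ _ eq_refl) CI).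
  assert (A3 := is_derive_mult_zero _ _ _ _ Dx (Rminus_diag_eq _ _ eq_refl) CI).
  assert (A4 := is_derive_mult_zero _ _ _ _ Dy (Rminus_diag_eq _ _ eq_refl) CR).
  cbv beta in A1, A2, A3, A4; rewrite H0 in A1, A2, A3, A4.
  split.
  - apply is_derive_extR with (fun u => Re (f (g t)) +
      ((Re (g u) - Re (g t)) * Re (q (g u)) - (Im (g u) - Im (g t)) * Im (q (g u)))).
    { intros u; rewrite (Hq (g u)); unfold Re, Im; simpl; rring. }
    eapply is_derive_eq; [apply is_derive_Rplus; [apply is_derive_Rconst|];
      apply is_derive_Rminus; eauto|unfold Re, Im; simpl; rring].
  - apply is_derive_extR with (fun u => Im (f (g t)) +
      ((Re (g u) - Re (g t)) * Im (q (g u)) + (Im (g u) - Im (g t)) * Re (q (g u)))).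
    { intros u; rewrite (Hq (g u)); unfold Re, Im; simpl; rring. }
    eapply is_derive_eq; [apply is_derive_Rplus; [apply is_derive_Rconst|];
      apply is_derive_Rplus; eauto|unfold Re, Im; simpl; rring].
Qed.

Lemma ex_RInt_Rscal (f : R -> R) c a b : ex_RInt f a b ->
  ex_RInt (fun x => c * f x) a b.
Proof. exact (ex_RInt_scal (V := R_NormedModule) f a b c). Qed.

Lemma RInt_Rplus (f g : R -> R) a b : ex_RInt f a b -> ex_RInt g a b ->
  RInt (fun x => f x + g x) a b = RInt f a b + RInt g a b.
Proof. exact (RInt_plus (V := R_CompleteNormedModule) f g a b). Qed.

Lemma RInt_Rminus (f g : R -> R) a b : ex_RInt f a b -> ex_RInt g a b ->
  RInt (fun x => f x - g x) a b = RInt f a b - RInt g a b.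
Proof. exact (RInt_minus (V := R_CompleteNormedModule) f g a b). Qed.

Lemma RInt_Rscal (f : R -> R) c a b : ex_RInt f a b ->
  RInt (fun x => c * f x) a b = c * RInt f a b.
Proof. exact (RInt_scal (V := R_CompleteNormedModule) f a b c). Qed.

Lemma is_RInt_Rplus (f g : R -> R) a b l m : is_RInt f a b l -> is_RInt g a b m ->
  is_RInt (fun x => f x + g x) a b (l + m).
Proof. exact (is_RInt_plus (V := R_NormedModule) f g a b l m). Qed.

Lemma is_RInt_Rminus (f g : R -> R) a b l m : is_RInt f a b l -> is_RInt g a b m ->
  is_RInt (fun x => f x - g x) a b (l - m).
Proof. exact (is_RInt_minus (V := R_NormedModule) f g a b l m). Qed.

Lemma is_RInt_Rscal (f : R -> R) c a b l : is_RInt f a b l ->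
  is_RInt (fun x => c * f x) a b (c * l).
Proof. exact (is_RInt_scal (V := R_NormedModule) f a b c l). Qed.

Lemma is_RInt_extR (f g : R -> R) a b l : a <= b ->
  (forall x, a < x < b -> f x = g x) -> is_RInt f a b l -> is_RInt g a b l.
Proof.
  intros Hab H; apply is_RInt_ext; rewrite Rmin_left, Rmax_right by lra; exact H.
Qed.

Lemma RInt_extR (f g : R -> R) a b : a <= b ->
  (forall x, a < x < b -> f x = g x) -> RInt f a b = RInt g a b.
Proof.
  intros Hab H; apply RInt_ext; rewrite Rmin_left, Rmax_right by lra; exact H.
Qed.

(** * Complex differentiability of finite order *)

Definition copen (D : C -> Prop) : Prop :=
  forall z, D z -> exists d, 0 < d /\ forall w, Cmod (w - z) < d -> D w.

(** The order is counted explicitly instead of being deduced from Cauchy's theory: forming [g'/g]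
    uses up one derivative, and integrating along segments keeps the order. *)
Fixpoint Cn (n : nat) (D : C -> Prop) (f : C -> C) : Prop :=
  match n with
  | O => forall z, D z -> continuous f z
  | S m => exists f' : C -> C, (forall z, D z -> cdiff f z (f' z)) /\ Cn m D f'
  end.

Lemma Cn_continuous n D f z : Cn n D f -> D z -> continuous f z.
Proof.
  destruct n; simpl; auto.
  intros [f' [H _]] Hz; exact (cdiff_continuous _ _ _ (H z Hz)).
Qed.

Lemma Cn_pred n D f : Cn (S n) D f -> Cn n D f.
Proof.
  revert f; induction n; intros f [f' [H H']].
  - intros z Hz; exact (cdiff_continuous _ _ _ (H z Hz)).
  - exists f'; split; auto.
Qed.

Lemma Cn_sub n (D D' : C -> Prop) f :
  (forall z, D' z -> D z) -> Cn n D f -> Cn n D' f.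
Proof.
  intros HD; revert f; induction n; simpl; auto.
  intros f [f' [H H']]; exists f'; split; auto.
Qed.

Lemma Cn_ext n D f g :
  copen D -> (forall z, D z -> f z = g z) -> Cn n D f -> Cn n D g.
Proof.
  intros HD H; destruct n; simpl.
  - intros Hf z Hz; destruct (HD z Hz) as [d [Hd Hw]].
    apply continuous_C_eps; intros e He.
    destruct (proj1 (continuous_C_eps _ _) (Hf z Hz) e He) as [d' [Hd' H']].
    exists (Rmin d d'); split; [apply Rmin_glb_lt; auto|].
    intros w Hwz; rewrite <- !H; auto.
    + apply H'; eapply Rlt_le_trans; [exact Hwz|apply Rmin_r].
    + apply Hw; eapply Rlt_le_trans; [exact Hwz|apply Rmin_l].
  - intros [f' [Hf Hf']]; exists f'; split; auto.
    intros z Hz; destruct (HD z Hz) as [d [Hd Hw]].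
    apply cdiff_ext_loc with f d; auto.
Qed.

Lemma Cn_const n D c : Cn n D (fun _ => c).
Proof.
  revert c; induction n; simpl; intros c.
  - intros; apply continuous_const.
  - exists (fun _ => RtoC 0); split; auto; intros; apply cdiff_const.
Qed.

Lemma Cn_id n D : Cn n D (fun z => z).
Proof.
  destruct n; simpl.
  - intros; apply continuous_id.
  - exists (fun _ => RtoC 1); split; [intros; apply cdiff_id|apply Cn_const].
Qed.

Lemma Cn_plus n D f g : Cn n D f -> Cn n D g -> Cn n D (fun z => f z + g z)%C.
Proof.
  revert f g; induction n; simpl; intros f g.
  - intros Hf Hg z Hz; apply continuous_Cplus; auto.
  - intros [f' [Hf Hf']] [g' [Hg Hg']].
    exists (fun z => f' z + g' z)%C; split; auto.
    intros; apply cdiff_plus; auto.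
Qed.

Lemma Cn_minus n D f g : Cn n D f -> Cn n D g -> Cn n D (fun z => f z - g z)%C.
Proof.
  revert f g; induction n; simpl; intros f g.
  - intros Hf Hg z Hz; apply continuous_Cminus; auto.
  - intros [f' [Hf Hf']] [g' [Hg Hg']].
    exists (fun z => f' z - g' z)%C; split; auto.
    intros; apply cdiff_minus; auto.
Qed.

Lemma Cn_mult n D f g : Cn n D f -> Cn n D g -> Cn n D (fun z => f z * g z)%C.
Proof.
  revert f g; induction n; intros f g Hf Hg.
  - intros z Hz; apply continuous_Cmult; auto.
  - generalize (Cn_pred _ _ _ Hf) (Cn_pred _ _ _ Hg); intros Pf Pg.
    destruct Hf as [f' [Hf Hf']], Hg as [g' [Hg Hg']].
    exists (fun z => f' z * g z + f z * g' z)%C; split.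
    + intros; apply cdiff_mult; auto.
    + apply Cn_plus; auto.
Qed.

Lemma Cn_inv n D f :
  (forall z, D z -> f z <> RtoC 0) -> Cn n D f -> Cn n D (fun z => / f z)%C.
Proof.
  intros H0; revert f H0; induction n; intros f H0 Hf.
  - intros z Hz; apply continuous_Cinv; auto.
  - generalize (Cn_pred _ _ _ Hf); intros Pf.
    destruct Hf as [f' [Hf Hf']].
    exists (fun z => (0 - / f z * / f z) * f' z)%C; split.
    + intros z Hz; eapply cdiff_eq; [apply cdiff_inv; auto|].
      cring || (rewrite Cinv_mult; [|auto..]; ring) || idtac.
      field; auto.
    + apply Cn_mult; auto; apply Cn_minus; [apply Cn_const|].
      apply Cn_mult; auto.
Qed.

Lemma Cn_div n D f g :
  (forall z, D z -> g z <> RtoC 0) -> Cn n D f -> Cn n D g ->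
  Cn n D (fun z => f z / g z)%C.
Proof. intros; apply Cn_mult; auto; apply Cn_inv; auto. Qed.

Lemma Cn_comp n D D' f g :
  (forall z, D z -> D' (g z)) -> Cn n D' f -> Cn n D g ->
  Cn n D (fun z => f (g z)).
Proof.
  intros H; revert f; induction n; intros f Hf Hg.
  - intros z Hz; apply (continuous_comp g f); auto.
  - generalize (Cn_pred _ _ _ Hg); intros Pg.
    destruct Hf as [f' [Hf Hf']], Hg as [g' [Hg Hg']].
    exists (fun z => f' (g z) * g' z)%C; split.
    + intros; apply cdiff_comp; auto.
    + apply Cn_mult; auto.
Qed.

Lemma choice_fun {A B : Type} (P : A -> B -> Prop) :
  (forall x, exists y, P x y) -> exists f : A -> B, forall x, P x (f x).
Proof.
  intros H.
  exists (fun x => proj1_sig (constructive_indefinite_description _ (H x))).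
  intros x; destruct (constructive_indefinite_description _ (H x)); auto.
Qed.

Lemma continuous_RC_eps (g : R -> C) (t : R) :
  continuous g t -> forall e, 0 < e -> exists d, 0 < d /\
    forall u, Rabs (u - t) < d -> Cmod (g u - g t) < e.
Proof.
  intros H e He.
  assert (H2 : 0 < e / 2) by lra.
  destruct (H _ (locally_ball (g t) (mkposreal _ H2))) as [d Hd].
  exists d; split; [apply cond_pos|]; intros u Hu.
  destruct (Hd u Hu) as [B1 B2].
  unfold ball in B1, B2; simpl in B1, B2;
    unfold AbsRing_ball, abs, minus, plus, opp in B1, B2; simpl in B1, B2.
  eapply Rle_lt_trans; [apply Cmod_le_abs|]; unfold Re, Im; simpl; lra.
Qed.

(** Compactness of [[a, b]] makes the modulus of continuity uniform along the curve, while [w] may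
    leave the curve. *)
Lemma tube (f : C -> C) (g : R -> C) (a b : R) :
  (forall t, a <= t <= b -> continuous g t) ->
  (forall t, a <= t <= b -> continuous f (g t)) ->
  forall e, 0 < e -> exists d, 0 < d /\
    forall t w, a <= t <= b -> Cmod (w - g t) < d -> Cmod (f w - f (g t)) < e.
Proof.
  intros Hg Hf e He.
  assert (H : forall t, exists d : posreal, a <= t <= b ->
    forall u w, Rabs (u - t) < d -> Cmod (w - g u) < d ->
      Cmod (f w - f (g t)) < e / 2 /\ Cmod (f (g u) - f (g t)) < e / 2).
  { intros t; destruct (excluded_middle_informative (a <= t <= b)) as [Ht|Ht];
      [|exists (mkposreal 1 Rlt_0_1); tauto].
    destruct (proj1 (continuous_C_eps _ _) (Hf t Ht) (e / 2)) as [d [Hd H]]; [lra|].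
    destruct (continuous_RC_eps _ _ (Hg t Ht) (d / 2)) as [d' [Hd' H']]; [lra|].
    assert (Hm : 0 < Rmin (d / 2) d') by (apply Rmin_glb_lt; lra).
    exists (mkposreal _ Hm); intros _ u w Hu Hw; simpl in *.
    assert (A1 : Cmod (g u - g t) < d / 2)
      by (apply H'; eapply Rlt_le_trans; [exact Hu|apply Rmin_r]).
    assert (A2 : Cmod (w - g u) < d / 2)
      by (eapply Rlt_le_trans; [exact Hw|apply Rmin_l]).
    split; apply H; [|lra].
    replace (w - g t)%C with ((w - g u) + (g u - g t))%C by ring.
    eapply Rle_lt_trans; [apply Cmod_triangle|lra]. }
  destruct (choice_fun _ H) as [dl Hdl].
  destruct (compactness_value_1d a b dl) as [d Hd].
  exists d; split; [apply cond_pos|]; intros t w Ht Hw.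
  destruct (Rlt_or_le (Cmod (f w - f (g t))) e) as [|Hle]; auto.
  (* The compactness lemma only gives a doubly negated witness; arguing by contradiction makes it
     usable. *)
  exfalso; apply (Hd t Ht); intros [s [Hs [Hts Hds]]].
  destruct (Hdl s Hs t w Hts) as [B1 B2]; [lra|].
  assert (Cmod (f w - f (g t)) < e); [|lra].
  replace (f w - f (g t))%C with ((f w - f (g s)) - (f (g t) - f (g s)))%C by ring.
  unfold Cminus at 1.
  eapply Rle_lt_trans; [apply Cmod_triangle|rewrite Cmod_opp; lra].
Qed.

Definition seg (c s : C) (u : R) : C := (c + u * (s - c))%C.

Lemma seg_1 c s : seg c s 1 = s.
Proof. unfold seg; ring. Qed.

Lemma seg_0 c s : seg c s 0 = c.
Proof. unfold seg; ring. Qed.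

Lemma continuous_RtoC (t : R) : continuous RtoC t.
Proof. apply continuous_ofR; [apply continuous_id|apply continuous_const]. Qed.

Lemma continuous_seg c s t : continuous (seg c s) t.
Proof.
  apply continuous_Cplus; [apply continuous_const|].
  apply continuous_Cmult; [apply continuous_RtoC|apply continuous_const].
Qed.

Lemma is_derive_seg_Re c s (t : R) : is_derive (fun u => Re (seg c s u)) t (Re (s - c)%C).
Proof.
  apply is_derive_extR with (fun u => Re c + u * Re (s - c)%C).
  - intros u; unfold seg, Re; simpl; rring.
  - eapply is_derive_eq; [apply is_derive_Rplus; [apply is_derive_Rconst|];
      apply is_derive_Rmult; [apply is_derive_id|apply is_derive_Rconst]|].
    unfold one; simpl; ring.
Qed.

Lemma is_derive_seg_Im c s (t : R) : is_derive (fun u => Im (seg c s u)) t (Im (s - c)%C).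
Proof.
  apply is_derive_extR with (fun u => Im c + u * Im (s - c)%C).
  - intros u; unfold seg, Im; simpl; rring.
  - eapply is_derive_eq; [apply is_derive_Rplus; [apply is_derive_Rconst|];
      apply is_derive_Rmult; [apply is_derive_id|apply is_derive_Rconst]|].
    unfold one; simpl; ring.
Qed.

Lemma cdiff_seg f c s (t : R) l : cdiff f (seg c s t) l ->
  is_derive (fun u => Re (f (seg c s u))) t (Re (l * (s - c))%C) /\
  is_derive (fun u => Im (f (seg c s u))) t (Im (l * (s - c))%C).
Proof.
  intros H.
  replace (l * (s - c))%C with (l * (Re (s - c)%C, Im (s - c)%C))%C
    by (f_equal; destruct (s - c)%C; reflexivity).
  apply cdiff_path; auto using is_derive_seg_Re, is_derive_seg_Im.
Qed.

Lemma continuous_continuity_pt (f : R -> R) (x : R) :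
  continuous f x -> continuity_pt f x.
Proof. intros; apply continuity_pt_filterlim; auto. Qed.

Lemma is_derive_continuous (f : R -> R) (x l : R) :
  is_derive f x l -> continuous f x.
Proof. intros; apply (ex_derive_continuous (V := R_NormedModule)); eexists; eauto. Qed.

Lemma MVT_bound (f df : R -> R) (M : R) :
  (forall x, 0 <= x <= 1 -> is_derive f x (df x)) ->
  (forall x, 0 <= x <= 1 -> Rabs (df x) <= M) -> Rabs (f 1 - f 0) <= M.
Proof.
  intros H HM.
  destruct (MVT_gen f 0 1 df) as [c [Hc E]]; rewrite ?Rmin_left, ?Rmax_right in * by lra.
  - intros; apply H; lra.
  - intros x Hx; apply continuous_continuity_pt.
    exact (is_derive_continuous _ _ _ (H x Hx)).
  - rewrite E, Rminus_0_r, Rmult_1_r; auto.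
Qed.

(** The mean value theorem is applied to the real and imaginary parts separately, whence the factor
    2. *)
Lemma cdiff_remainder (f f' : C -> C) (z w : C) (M : R) :
  (forall v, 0 <= v <= 1 -> cdiff f (seg z w v) (f' (seg z w v))) ->
  (forall v, 0 <= v <= 1 -> Cmod (f' (seg z w v) - f' z) <= M) ->
  Cmod (f w - f z - f' z * (w - z)) <= 2 * (M * Cmod (w - z)).
Proof.
  intros H HM.
  assert (B : forall v, 0 <= v <= 1 ->
    Cmod ((f' (seg z w v) - f' z) * (w - z)) <= M * Cmod (w - z)).
  { intros; rewrite Cmod_mult; apply Rmult_le_compat_r; auto; apply Cmod_ge_0. }
  eapply Rle_trans; [apply Cmod_le_abs|].
  assert (A1 : Rabs (Re (f w - f z - f' z * (w - z))%C) <= M * Cmod (w - z)).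
  { set (p := fun v => Re (f (seg z w v)) - v * Re (f' z * (w - z))%C).
    replace (Re (f w - f z - f' z * (w - z))%C) with (p 1 - p 0)
      by (unfold p; rewrite seg_1, seg_0; unfold Re; simpl; ring).
    apply MVT_bound with (fun v => Re ((f' (seg z w v) - f' z) * (w - z))%C).
    - intros x Hx; destruct (cdiff_seg _ _ _ _ _ (H x Hx)) as [D _].
      eapply is_derive_eq; [apply is_derive_Rminus; [exact D|]|].
      + apply is_derive_Rmult; [apply is_derive_id|apply is_derive_Rconst].
      + unfold Re; simpl; unfold one; simpl; ring.
    - intros; eapply Rle_trans; [apply Re_le_Cmod|auto]. }
  assert (A2 : Rabs (Im (f w - f z - f' z * (w - z))%C) <= M * Cmod (w - z)).
  { set (p := fun v => Im (f (seg z w v)) - v * Im (f' z * (w - z))%C).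
    replace (Im (f w - f z - f' z * (w - z))%C) with (p 1 - p 0)
      by (unfold p; rewrite seg_1, seg_0; unfold Im; simpl; ring).
    apply MVT_bound with (fun v => Im ((f' (seg z w v) - f' z) * (w - z))%C).
    - intros x Hx; destruct (cdiff_seg _ _ _ _ _ (H x Hx)) as [_ D].
      eapply is_derive_eq; [apply is_derive_Rminus; [exact D|]|].
      + apply is_derive_Rmult; [apply is_derive_id|apply is_derive_Rconst].
      + unfold Im; simpl; unfold one; simpl; ring.
    - intros; eapply Rle_trans; [apply Im_le_Cmod|auto]. }
  lra.
Qed.

(** * Integrals along segments and primitives *)

Definition Cint (p : R -> C) : C :=
  (RInt (fun u => Re (p u)) 0 1, RInt (fun u => Im (p u)) 0 1).

Definition cont01 (p : R -> C) : Prop := forall u, 0 <= u <= 1 -> continuous p u.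

Lemma ex_RInt_cont (f : R -> R) (a b : R) :
  a <= b -> (forall x, a <= x <= b -> continuous f x) -> ex_RInt f a b.
Proof.
  intros Hab H; apply (ex_RInt_continuous (V := R_CompleteNormedModule)).
  rewrite Rmin_left, Rmax_right by lra; auto.
Qed.

Lemma cont01_Re p : cont01 p -> ex_RInt (fun u => Re (p u)) 0 1.
Proof. intros H; apply ex_RInt_cont; [lra|]; intros; apply continuous_ReC; auto. Qed.

Lemma cont01_Im p : cont01 p -> ex_RInt (fun u => Im (p u)) 0 1.
Proof. intros H; apply ex_RInt_cont; [lra|]; intros; apply continuous_ImC; auto. Qed.

Lemma Cint_minus p q : cont01 p -> cont01 q ->
  Cint (fun u => p u - q u)%C = (Cint p - Cint q)%C.
Proof.
  intros Hp Hq; unfold Cint; creal; apply RInt_Rminus;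
    auto using cont01_Re, cont01_Im.
Qed.

Lemma Cint_scal c p : cont01 p -> Cint (fun u => c * p u)%C = (c * Cint p)%C.
Proof.
  intros Hp; generalize (cont01_Re _ Hp) (cont01_Im _ Hp); intros H1 H2.
  unfold Cint; creal; rewrite <- !RInt_Rscal by auto;
    [apply RInt_Rminus|apply RInt_Rplus]; auto using ex_RInt_Rscal.
Qed.

Lemma Cint_bound p M : cont01 p ->
  (forall u, 0 <= u <= 1 -> Cmod (p u) <= M) -> Cmod (Cint p) <= 2 * M.
Proof.
  intros Hp HM; eapply Rle_trans; [apply Cmod_le_abs|].
  assert (A1 : Rabs (RInt (fun u => Re (p u)) 0 1) <= (1 - 0) * M).
  { apply abs_RInt_le_const; [lra|auto using cont01_Re|].
    intros; eapply Rle_trans; [apply Re_le_Cmod|auto]. }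
  assert (A2 : Rabs (RInt (fun u => Im (p u)) 0 1) <= (1 - 0) * M).
  { apply abs_RInt_le_const; [lra|auto using cont01_Im|].
    intros; eapply Rle_trans; [apply Im_le_Cmod|auto]. }
  unfold Cint; simpl in *; lra.
Qed.

(** Differentiating [q (seg c s u)] in [s] brings out a factor [u]; the weight [u ^ j] makes the
    family closed under differentiation. *)
Definition segint (j : nat) (q : C -> C) (c s : C) : C :=
  Cint (fun u => RtoC (u ^ j) * q (seg c s u))%C.

Definition star (D : C -> Prop) (c : C) : Prop :=
  forall s u, D s -> 0 <= u <= 1 -> D (seg c s u).

Lemma cont01_segint j (D : C -> Prop) q c s :
  star D c -> (forall z, D z -> continuous q z) -> D s ->
  cont01 (fun u => RtoC (u ^ j) * q (seg c s u))%C.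
Proof.
  intros HD Hq Hs u Hu; apply continuous_Cmult.
  - apply (continuous_comp (fun u => u ^ j) RtoC); [|apply continuous_RtoC].
    apply (ex_derive_continuous (V := R_NormedModule)); auto_derive; auto.
  - apply (continuous_comp (seg c s) q); [apply continuous_seg|auto].
Qed.

Lemma pow01 j u : 0 <= u <= 1 -> 0 <= u ^ j <= 1.
Proof.
  intros H; split; [apply pow_le; lra|].
  rewrite <- (pow1 j); apply pow_incr; auto.
Qed.

Lemma seg_dist c s w u :
  0 <= u <= 1 -> Cmod (seg c w u - seg c s u) <= Cmod (w - s).
Proof.
  intros H; unfold seg.
  replace (c + u * (w - c) - (c + u * (s - c)))%C with (u * (w - s))%C by ring.
  rewrite Cmod_mult, Cmod_R, Rabs_pos_eq by lra.
  rewrite <- (Rmult_1_l (Cmod (w - s))) at 2.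
  apply Rmult_le_compat_r; [apply Cmod_ge_0|lra].
Qed.

Lemma segint_continuous j D q c :
  copen D -> star D c -> (forall z, D z -> continuous q z) ->
  forall s, D s -> continuous (segint j q c) s.
Proof.
  intros HO HD Hq s Hs; apply continuous_C_eps; intros e He.
  destruct (tube q (seg c s) 0 1 (fun t _ => continuous_seg c s t)
    (fun t Ht => Hq _ (HD s t Hs Ht)) (e / 4)) as [d [Hd H]]; [lra|].
  destruct (HO s Hs) as [d' [Hd' H']].
  exists (Rmin d d'); split; [apply Rmin_glb_lt; auto|]; intros w Hw.
  assert (Dw : D w) by (apply H'; eapply Rlt_le_trans; [exact Hw|apply Rmin_r]).
  assert (C1 := cont01_segint j D q c s HD Hq Hs).
  assert (C2 := cont01_segint j D q c w HD Hq Dw).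
  unfold segint; rewrite <- Cint_minus; auto.
  apply Rle_lt_trans with (2 * (e / 4)); [|lra].
  apply Cint_bound.
  - intros u Hu; apply continuous_Cminus; auto.
  - intros u Hu.
    replace (RtoC (u ^ j) * q (seg c w u) - RtoC (u ^ j) * q (seg c s u))%C
      with (RtoC (u ^ j) * (q (seg c w u) - q (seg c s u)))%C by ring.
    rewrite Cmod_mult, Cmod_R.
    generalize (pow01 j u Hu); intros Hp; rewrite Rabs_pos_eq by lra.
    rewrite <- (Rmult_1_l (e / 4)); apply Rmult_le_compat;
      [lra|apply Cmod_ge_0|lra|].
    left; apply H; auto; eapply Rle_lt_trans; [apply seg_dist; auto|].
    eapply Rlt_le_trans; [exact Hw|apply Rmin_l].
Qed.

Lemma seg_seg c s w u v : 
  seg (seg c s u) (seg c w u) v = seg c (seg s w v) u.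
Proof. unfold seg; ring. Qed.

(** By [seg_seg] the segment joining [seg c s u] to [seg c w u] is the image of the one joining [s]
    to [w], so [tube] bounds the remainder uniformly in [u]. The tolerance [e / 4] absorbs one
    factor 2 from [cdiff_remainder] and one from [Cint_bound]. *)
Lemma segint_cdiff j D q q' c :
  copen D -> star D c -> (forall z, D z -> cdiff q z (q' z)) ->
  (forall z, D z -> continuous q' z) ->
  forall s, D s -> cdiff (segint j q c) s (segint (S j) q' c s).
Proof.
  intros HO HD Hq Hq' s Hs; apply cdiff_eps; intros e He.
  assert (Cq : forall z, D z -> continuous q z)
    by (intros z Hz; exact (cdiff_continuous _ _ _ (Hq z Hz))).
  destruct (tube q' (seg c s) 0 1 (fun t _ => continuous_seg c s t)
    (fun t Ht => Hq' _ (HD s t Hs Ht)) (e / 4)) as [d [Hd H]]; [lra|].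
  destruct (HO s Hs) as [d' [Hd' H']].
  exists (Rmin d d'); split; [apply Rmin_glb_lt; auto|]; intros w Hw.
  assert (Sg : forall v, 0 <= v <= 1 -> Cmod (seg s w v - s) <= Cmod (w - s)).
  { intros v Hv; generalize (seg_dist s s w v Hv).
    replace (seg s s v) with s by (unfold seg; ring); auto. }
  assert (Dw : forall v, 0 <= v <= 1 -> D (seg s w v)).
  { intros v Hv; apply H'; eapply Rle_lt_trans; [apply Sg; auto|].
    eapply Rlt_le_trans; [exact Hw|apply Rmin_r]. }
  assert (Dw1 : D w) by (rewrite <- (seg_1 s w); apply Dw; lra).
  assert (C1 := cont01_segint j D q c s HD Cq Hs).
  assert (C2 := cont01_segint j D q c w HD Cq Dw1).
  assert (C3 := cont01_segint (S j) D q' c s HD Hq' Hs).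
  assert (C4 : cont01 (fun u => (w - s) * (RtoC (u ^ S j) * q' (seg c s u)))%C).
  { intros u Hu; apply continuous_Cmult; [apply continuous_const|auto]. }
  assert (C5 : cont01 (fun u => RtoC (u ^ j) * q (seg c w u) - RtoC (u ^ j) * q (seg c s u))%C).
  { intros u Hu; apply continuous_Cminus; auto. }
  replace (segint j q c w - segint j q c s - segint (S j) q' c s * (w - s))%C with
    (Cint (fun u => RtoC (u ^ j) * q (seg c w u) - RtoC (u ^ j) * q (seg c s u) -
       (w - s) * (RtoC (u ^ S j) * q' (seg c s u))))%C.
  2:{ unfold segint; rewrite (Cint_minus _ _ C5 C4), (Cint_minus _ _ C2 C1),
        (Cint_scal _ _ C3); ring. }
  apply Rle_trans with (2 * (2 * (e / 4 * Cmod (w - s)))); [|right; field].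
  apply Cint_bound.
  - intros u Hu; apply continuous_Cminus; auto.
  - intros u Hu.
    replace (RtoC (u ^ j) * q (seg c w u) - RtoC (u ^ j) * q (seg c s u) -
       (w - s) * (RtoC (u ^ S j) * q' (seg c s u)))%C with
     (RtoC (u ^ j) * (q (seg c w u) - q (seg c s u) -
        q' (seg c s u) * (seg c w u - seg c s u)))%C.
    2:{ unfold seg at 4 5; simpl pow; rewrite RtoC_mult; ring. }
    rewrite Cmod_mult, Cmod_R.
    generalize (pow01 j u Hu); intros Hp; rewrite Rabs_pos_eq by lra.
    rewrite <- (Rmult_1_l (2 * _)); apply Rmult_le_compat;
      [lra|apply Cmod_ge_0|lra|].
    eapply Rle_trans; [apply (cdiff_remainder q q' _ _ (e / 4))|].
    + intros v Hv; rewrite seg_seg; apply Hq; apply HD; auto.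
    + intros v Hv; rewrite seg_seg; left; apply H; auto.
      eapply Rle_lt_trans; [apply seg_dist; auto|].
      eapply Rle_lt_trans; [apply Sg; auto|].
      eapply Rlt_le_trans; [exact Hw|apply Rmin_l].
    + apply Rmult_le_compat_l; [lra|]; apply Rmult_le_compat_l; [lra|].
      apply seg_dist; auto.
Qed.

Lemma segint_Cn n j D q c :
  copen D -> star D c -> Cn n D q -> Cn n D (segint j q c).
Proof.
  intros HO HD; revert j q; induction n; intros j q Hq.
  - intros s Hs; apply segint_continuous with D; auto.
  - destruct Hq as [q' [Hq Hq']]; exists (segint (S j) q' c); split; auto.
    intros s Hs; apply segint_cdiff with D; auto.
    intros; eapply Cn_continuous; eauto.
Qed.

Lemma Cint_derive (p p' : R -> C) :
  (forall u, 0 <= u <= 1 -> is_derive (fun u => Re (p u)) u (Re (p' u)) /\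
     is_derive (fun u => Im (p u)) u (Im (p' u))) ->
  cont01 p' -> Cint p' = (p 1 - p 0)%C.
Proof.
  intros H Hc; unfold Cint; creal; apply is_RInt_unique;
    [apply (is_RInt_derive (V := R_CompleteNormedModule) (fun u => Re (p u)) (fun u => Re (p' u)))
    |apply (is_RInt_derive (V := R_CompleteNormedModule) (fun u => Im (p u)) (fun u => Im (p' u)))];
    rewrite Rmin_left, Rmax_right by lra; intros x Hx; try (apply H; auto);
    [apply continuous_ReC | apply continuous_ImC]; auto.
Qed.

(** Integration by parts in [u]: the derivative of [u * q (seg c s u)] is [q (seg c s u)] plus
    [u * q' (seg c s u) * (s - c)], and its integral over [[0, 1]] is [q s]. *)
Lemma segint_primitive n D q c :
  copen D -> star D c -> Cn (S n) D q ->
  forall s, D s -> cdiff (fun s => (s - c) * segint 0 q c s)%C s (q s).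
Proof.
  intros HO HD Hq s Hs.
  assert (Cq : forall z, D z -> continuous q z)
    by (intros; eapply Cn_continuous; eauto).
  destruct Hq as [q' [Hq Hq']].
  assert (Cq' : forall z, D z -> continuous q' z)
    by (intros; eapply Cn_continuous; eauto).
  eapply cdiff_eq.
  { apply cdiff_mult.
    - apply cdiff_minus; [apply cdiff_id|apply cdiff_const].
    - apply segint_cdiff with D; eauto. }
  assert (C0 := cont01_segint 0 D q c s HD Cq Hs).
  assert (C1 := cont01_segint 1 D q' c s HD Cq' Hs).
  assert (C2 : cont01 (fun u => (RtoC (u ^ 1) * q' (seg c s u)) * (s - c))%C).
  { intros u Hu; apply continuous_Cmult; [auto|apply continuous_const]. }
  assert (E : Cint (fun u => RtoC (u ^ 0) * q (seg c s u) -
     (0 - (s - c)) * (RtoC (u ^ 1) * q' (seg c s u)))%C = (q s - 0)%C).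
  { replace (q s - 0)%C with (RtoC 1 * q (seg c s 1) - RtoC 0 * q (seg c s 0))%C
      by (rewrite seg_1; ring).
    apply (Cint_derive (fun u => RtoC u * q (seg c s u))%C).
    - intros u Hu; destruct (cdiff_seg _ _ _ _ _ (Hq _ (HD s u Hs Hu))) as [D1 D2].
      split.
      + apply is_derive_extR with (fun u => u * Re (q (seg c s u))).
        { intros; unfold Re; simpl; rring. }
        eapply is_derive_eq; [apply is_derive_Rmult; [apply is_derive_id|exact D1]|].
        unfold one, Re; simpl; ring.
      + apply is_derive_extR with (fun u => u * Im (q (seg c s u))).
        { intros; unfold Im; simpl; rring. }
        eapply is_derive_eq; [apply is_derive_Rmult; [apply is_derive_id|exact D2]|].
        unfold one, Im, Re; simpl; ring.
    - intros u Hu; apply continuous_Cminus; [apply C0; auto|].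
      apply continuous_Cmult; [apply continuous_const|auto]. }
  rewrite Cint_minus, Cint_scal in E; auto.
  2:{ intros u Hu; apply continuous_Cmult; [apply continuous_const|auto]. }
  fold (segint 0 q c s) in E; fold (segint 1 q' c s) in E.
  replace (q s) with (q s - 0)%C by ring; rewrite <- E; ring.
Qed.

(** * Logarithms and mean values *)

Definition cexp (z : C) : C := (exp (Re z) * cos (Im z), exp (Re z) * sin (Im z)).

Lemma sin2cos2 x : cos x * cos x + sin x * sin x = 1.
Proof. generalize (sin2_cos2 x); unfold Rsqr; lra. Qed.

(** This is the equation [g' = g h'] in real coordinates: the functions [p] and [q] of the proof are
    the two parts of [g exp(-h)], and both are constant. *)
Lemma exp_ode (gr gi hr hi qr qi : R -> R) :
  (forall u, 0 <= u <= 1 ->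
     is_derive gr u (gr u * qr u - gi u * qi u) /\
     is_derive gi u (gr u * qi u + gi u * qr u) /\
     is_derive hr u (qr u) /\ is_derive hi u (qi u)) ->
  gr 0 = 1 -> gi 0 = 0 -> hr 0 = 0 -> hi 0 = 0 ->
  gr 1 = exp (hr 1) * cos (hi 1) /\ gi 1 = exp (hr 1) * sin (hi 1).
Proof.
  intros H G0 G1 H0 H1.
  set (p := fun u => exp (- hr u) * (gr u * cos (hi u) + gi u * sin (hi u))).
  set (q := fun u => exp (- hr u) * (gi u * cos (hi u) - gr u * sin (hi u))).
  assert (Dp : Rabs (p 1 - p 0) <= 0).
  { apply MVT_bound with (fun _ => 0).
    - intros u Hu; destruct (H u Hu) as [A1 [A2 [A3 A4]]]; unfold p; auto_derive.
      + repeat split; eexists; eauto.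
      + erewrite (is_derive_unique (fun x => gr x)), (is_derive_unique (fun x => gi x)),
          (is_derive_unique (fun x => hr x)), (is_derive_unique (fun x => hi x)) by eauto.
        ring.
    - intros; rewrite Rabs_R0; lra. }
  assert (Dq : Rabs (q 1 - q 0) <= 0).
  { apply MVT_bound with (fun _ => 0).
    - intros u Hu; destruct (H u Hu) as [A1 [A2 [A3 A4]]]; unfold q; auto_derive.
      + repeat split; eexists; eauto.
      + erewrite (is_derive_unique (fun x => gr x)), (is_derive_unique (fun x => gi x)),
          (is_derive_unique (fun x => hr x)), (is_derive_unique (fun x => hi x)) by eauto.
        ring.
    - intros; rewrite Rabs_R0; lra. }
  assert (P0 : p 0 = 1)
    by (unfold p; rewrite G0, G1, H0, H1, Ropp_0, exp_0, cos_0, sin_0; ring).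
  assert (Q0 : q 0 = 0)
    by (unfold q; rewrite G0, G1, H0, H1, Ropp_0, exp_0, cos_0, sin_0; ring).
  assert (P1 : p 1 = 1) by (revert Dp; unfold Rabs; destruct Rcase_abs; lra).
  assert (Q1 : q 1 = 0) by (revert Dq; unfold Rabs; destruct Rcase_abs; lra).
  unfold p, q in P1, Q1.
  generalize (sin2cos2 (hi 1)); intros SC.
  assert (E : exp (hr 1) * exp (- hr 1) = 1)
    by (rewrite <- exp_plus, Rplus_opp_r, exp_0; auto).
  set (e := exp (hr 1)) in *; set (e' := exp (- hr 1)) in *.
  set (c := cos (hi 1)) in *; set (s := sin (hi 1)) in *.
  assert (A : gr 1 * c + gi 1 * s = e)
    by (transitivity (e * (e' * (gr 1 * c + gi 1 * s))); [rewrite <- Rmult_assoc, E; ring|rewrite P1; ring]).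
  assert (B : gi 1 * c - gr 1 * s = 0)
    by (transitivity (e * (e' * (gi 1 * c - gr 1 * s))); [rewrite <- Rmult_assoc, E; ring|rewrite Q1; ring]).
  split.
  - transitivity ((gr 1 * c + gi 1 * s) * c - (gi 1 * c - gr 1 * s) * s).
    + transitivity (gr 1 * (c * c + s * s)); [rewrite SC; ring|ring].
    + rewrite A, B; ring.
  - transitivity ((gr 1 * c + gi 1 * s) * s + (gi 1 * c - gr 1 * s) * c).
    + transitivity (gi 1 * (c * c + s * s)); [rewrite SC; ring|ring].
    + rewrite A, B; ring.
Qed.

Lemma is_derive_loc_zero (f : R -> R) (x l d : R) :
  0 < d -> (forall u, Rabs (u - x) < d -> f u = 0) -> is_derive f x l -> l = 0.
Proof.
  intros Hd H Hf.
  assert (A : is_derive f x 0).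
  { apply (is_derive_ext_loc (V := R_NormedModule) (fun _ => 0)).
    - exists (mkposreal d Hd); intros y Hy; symmetry; apply H; exact Hy.
    - apply is_derive_Rconst. }
  rewrite <- (is_derive_unique _ _ _ Hf); apply is_derive_unique; auto.
Qed.

Lemma cdiff_real (D : C -> Prop) (g g' : C -> C) (x : R) :
  copen D -> (forall t : R, D t -> Im (g t) = 0) -> D x -> cdiff g x (g' x) ->
  Im (g' x) = 0.
Proof.
  intros HO Hg Hx Hd.
  destruct (cdiff_path g RtoC x 1 0 (g' x)) as [_ H]; auto.
  - apply is_derive_extR with (fun u => u); [reflexivity|apply (is_derive_id (K := R_AbsRing))].
  - apply is_derive_extR with (fun u => 0); [reflexivity|apply is_derive_Rconst].
  - destruct (HO _ Hx) as [d [Hp Hw]].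
    unfold Im in *; simpl in H.
    replace (snd (g' x)) with (fst (g' x) * 0 + snd (g' x) * 1) by ring.
    apply (is_derive_loc_zero _ _ _ d Hp) with (2 := H).
    intros u Hu; apply Hg; apply Hw; rewrite <- RtoC_minus, Cmod_R; auto.
Qed.

Lemma RtoC_Im0 (z : C) : Im z = 0 -> z = RtoC (Re z).
Proof. intros H; creal; auto. Qed.

(** The logarithm is the primitive of [g'/g] vanishing at [c]. It is returned as [(s - c) * k s]
    because the arc identity divides it by a power of the variable, and the explicit zero cancels
    that singularity. *)
Lemma log_exists n (D : C -> Prop) (g : C -> C) (c : R) :
  copen D -> star D c -> Cn (S (S n)) D g -> (forall z, D z -> g z <> RtoC 0) ->
  g c = RtoC 1 -> D c -> (forall t : R, D t -> Im (g t) = 0) ->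
  exists k, Cn (S n) D k /\
    (forall s, D s -> g s = cexp ((s - c) * k s)) /\
    (forall t : R, D t -> Im (k t) = 0).
Proof.
  intros HO HD Hg H0 Hc Dc Hr.
  assert (Pg := Cn_pred _ _ _ Hg); destruct Hg as [g' [Hg Hg']].
  set (q := fun z => (g' z / g z)%C).
  assert (Hq : Cn (S n) D q) by (apply Cn_div; auto).
  assert (Cq : forall z, D z -> continuous q z)
    by (intros; eapply Cn_continuous; eauto).
  exists (segint 0 q c); split; [apply segint_Cn; auto|split].
  - intros s Hs.
    set (h := fun s => ((s - c) * segint 0 q c s)%C).
    assert (Hh : forall z, D z -> cdiff h z (q z))
      by (intros; apply (segint_primitive n D); auto).
    change (g s = cexp (h s)).
    assert (A := exp_ode (fun u => Re (g (seg c s u))) (fun u => Im (g (seg c s u)))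
      (fun u => Re (h (seg c s u))) (fun u => Im (h (seg c s u)))
      (fun u => Re (q (seg c s u) * (s - c))%C) (fun u => Im (q (seg c s u) * (s - c))%C)).
    cbv beta in A; rewrite seg_1, seg_0, Hc in A.
    assert (h c = RtoC 0) as E by (unfold h; ring); rewrite E in A.
    destruct A as [A1 A2]; auto.
    { intros u Hu; assert (Du := HD s u Hs Hu).
      destruct (cdiff_seg _ _ _ _ _ (Hg _ Du)) as [B1 B2].
      destruct (cdiff_seg _ _ _ _ _ (Hh _ Du)) as [B3 B4].
      assert (E1 : (g' (seg c s u) * (s - c) = g (seg c s u) * (q (seg c s u) * (s - c)))%C)
        by (unfold q; field; auto).
      rewrite E1 in B1, B2.
      split; [eapply is_derive_eq; [exact B1|unfold Re, Im; simpl; rring]|].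
      split; [eapply is_derive_eq; [exact B2|unfold Im, Re; simpl; rring]|auto]. }
    unfold cexp; rewrite <- A1, <- A2; destruct (g s); reflexivity.
  - intros t Ht; unfold segint, Cint; simpl.
    (* On the real axis [g] and [g'] are real, so the integrand [g'/g] has imaginary part 0. *)
    rewrite <- (RInt_extR (fun _ => 0)).
    + rewrite RInt_const; unfold scal; simpl; unfold mult; simpl; ring.
    + lra.
    + intros u Hu.
      assert (Du : D (RtoC (c + u * (t - c)))).
      { replace (RtoC (c + u * (t - c))) with (seg c t u); [apply HD; auto; lra|].
        unfold seg; rewrite RtoC_plus, RtoC_mult, RtoC_minus; auto. }
      replace (seg c t u) with (RtoC (c + u * (t - c)))
        by (unfold seg; rewrite RtoC_plus, RtoC_mult, RtoC_minus; auto).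
      set (x := c + u * (t - c)) in *; unfold q.
      assert (E1 := cdiff_real D g g' x HO Hr Du (Hg _ Du)).
      rewrite (RtoC_Im0 _ E1), (RtoC_Im0 _ (Hr _ Du)).
      assert (Re (g x) <> 0).
      { intros E; apply (H0 _ Du); rewrite (RtoC_Im0 _ (Hr _ Du)), E; auto. }
      simpl; field; auto.
Qed.

Lemma continuity_2d_of (f : R -> R -> R) (x y : R) :
  continuous (fun p : R * R => f (fst p) (snd p)) (x, y) -> continuity_2d_pt f x y.
Proof. intros H; apply continuity_2d_pt_filterlim; exact H. Qed.

Lemma param_derive (f df : R -> R -> R) (a b x d : R) :
  a <= b -> 0 < d ->
  (forall y t, Rabs (y - x) < d -> is_derive (fun u => f u t) y (df y t)) ->
  (forall t, continuous (fun p : R * R => df (fst p) (snd p)) (x, t)) ->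
  (forall y t, Rabs (y - x) < d -> continuous (f y) t) ->
  is_derive (fun y => RInt (f y) a b) x (RInt (df x) a b).
Proof.
  intros Hab Hd H Hc Hf.
  replace (RInt (df x) a b) with (RInt (fun t => Derive (fun u => f u t) x) a b).
  2:{ apply RInt_extR; auto; intros; apply is_derive_unique; apply H.
      rewrite Rminus_diag, Rabs_R0; auto. }
  apply is_derive_RInt_param.
  - exists (mkposreal d Hd); intros y Hy t _; eexists; apply H; exact Hy.
  - intros t _; apply continuity_2d_pt_ext_loc with df.
    + exists (mkposreal d Hd); intros u v Hu _; symmetry; apply is_derive_unique; auto.
    + apply continuity_2d_of; auto.
  - exists (mkposreal d Hd); intros y Hy; apply ex_RInt_cont; auto.
Qed.

Definition circ (c : C) (y t : R) : C := (c + ((y * cos t)%R, (y * sin t)%R))%C.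

Lemma circ_dist c y t : Cmod (circ c y t - c) = Rabs y.
Proof.
  unfold circ; replace (c + ((y * cos t)%R, (y * sin t)%R) - c)%C with
    (RtoC y * (cos t, sin t))%C by (creal; ring).
  rewrite Cmod_mult, Cmod_R; replace (Cmod (cos t, sin t)) with 1; [ring|].
  unfold Cmod; simpl; rewrite !Rmult_1_r, sin2cos2, sqrt_1; auto.
Qed.

Lemma continuous_circ c y t : continuous (fun p : R * R => circ c (fst p) (snd p)) (y, t).
Proof.
  apply continuous_Cplus; [apply continuous_const|].
  apply continuous_pairC; apply continuous_Rmult; try apply continuous_fst.
  - apply (continuous_comp snd cos); [apply continuous_snd|apply continuous_cos].
  - apply (continuous_comp snd sin); [apply continuous_snd|apply continuous_sin].
Qed.

Lemma continuous_2d_fix {V : UniformSpace} (f : R * R -> V) (y t : R) :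
  continuous f (y, t) -> continuous (fun t => f (y, t)) t.
Proof.
  intros H; apply (continuous_comp (fun t => (y, t)) f); auto.
  apply (continuous_comp_2 (fun _ : R => y) (fun t : R => t) (fun a b => (a, b))).
  - apply continuous_const.
  - apply continuous_id.
  - apply continuous_ext with (fun p => p); [intros []; auto|apply continuous_id].
Qed.

Lemma circ_derive_y f c y t l : cdiff f (circ c y t) l ->
  is_derive (fun u => Re (f (circ c u t))) y (Re (l * (cos t, sin t))%C) /\
  is_derive (fun u => Im (f (circ c u t))) y (Im (l * (cos t, sin t))%C).
Proof.
  intros H; apply (cdiff_path f (fun u => circ c u t)); auto.
  - apply is_derive_extR with (fun u => Re c + u * cos t); [reflexivity|].
    auto_derive; auto; ring.
  - apply is_derive_extR with (fun u => Im c + u * sin t); [reflexivity|].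
    auto_derive; auto; ring.
Qed.

Lemma circ_derive_t f c y t l : cdiff f (circ c y t) l ->
  is_derive (fun u => Re (f (circ c y u))) t (Re (l * ((- y * sin t)%R, (y * cos t)%R))%C) /\
  is_derive (fun u => Im (f (circ c y u))) t (Im (l * ((- y * sin t)%R, (y * cos t)%R))%C).
Proof.
  intros H; apply (cdiff_path f (fun u => circ c y u)); auto.
  - apply is_derive_extR with (fun u => Re c + y * cos u); [reflexivity|].
    auto_derive; auto; ring.
  - apply is_derive_extR with (fun u => Im c + y * sin u); [reflexivity|].
    auto_derive; auto; ring.
Qed.

(** The radius times the radial derivative of the circle mean is the integral of a derivative around
    a closed circle, hence 0. The mean is therefore constant down to radius 0. *)
Lemma mean_value (D : C -> Prop) f c Rd :
  Cn 1 D f -> 0 < Rd -> (exists e, 0 < e /\ forall z, Cmod (z - c) < Rd + e -> D z) ->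
  RInt (fun t => Re (f (circ c Rd t))) 0 (2 * PI) = 2 * PI * Re (f c).
Proof.
  intros Hf HR [e [He HD]].
  generalize PI_RGT_0; intros HPI.
  assert (Cf : forall z, D z -> continuous f z) by (intros; eapply Cn_continuous; eauto).
  destruct Hf as [f' [Hf Cf']].
  assert (Dc : forall y t, Rabs y < Rd + e -> D (circ c y t))
    by (intros; apply HD; rewrite circ_dist; auto).
  assert (Dsh : forall x y, 0 <= x <= Rd -> Rabs (y - x) < e -> Rabs y < Rd + e).
  { intros x y Hx Hy; replace y with ((y - x) + x) by ring.
    eapply Rle_lt_trans; [apply Rabs_triang|]; rewrite (Rabs_pos_eq x) by lra; lra. }
  set (A := fun y => RInt (fun t => Re (f (circ c y t))) 0 (2 * PI)).
  set (dA := fun y t => Re (f' (circ c y t) * (cos t, sin t))%C).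
  assert (DA : forall y, 0 <= y <= Rd -> is_derive A y (RInt (dA y) 0 (2 * PI))).
  { intros x Hx; apply (param_derive (fun y t => Re (f (circ c y t))) dA) with e; auto; try lra.
    - intros y t Hy; apply circ_derive_y; apply Hf; apply Dc; eauto.
    - intros t; apply continuous_ReC; apply continuous_Cmult.
      + apply (continuous_comp (fun p => circ c (fst p) (snd p)) f');
          [apply continuous_circ|apply Cf'; apply Dc; simpl; apply (Dsh x); auto].
        rewrite Rminus_diag, Rabs_R0; auto.
      + apply continuous_pairC;
          [apply (continuous_comp snd cos)|apply (continuous_comp snd sin)];
          try apply continuous_snd; [apply continuous_cos|apply continuous_sin].
    - intros y t Hy; apply continuous_ReC.
      apply (continuous_comp (fun t => circ c y t) f); [|apply Cf; apply Dc; eauto].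
      exact (continuous_2d_fix _ _ _ (continuous_circ c y t)). }
  assert (Z : forall y, 0 < y <= Rd -> RInt (dA y) 0 (2 * PI) = 0).
  { intros y Hy.
    assert (I : is_RInt (fun t => Im (f' (circ c y t) * ((- y * sin t)%R, (y * cos t)%R))%C) 0 (2 * PI)
       (Im (f (circ c y (2 * PI))) - Im (f (circ c y 0)))).
    { assert (Dy : forall t, D (circ c y t)) by (intros; apply Dc; rewrite Rabs_pos_eq; lra).
      apply (is_RInt_derive (V := R_CompleteNormedModule) (fun t => Im (f (circ c y t)))).
      - intros t _; apply circ_derive_t; auto.
      - intros t _; apply continuous_ImC; apply continuous_Cmult.
        + apply (continuous_comp (fun t => circ c y t) f'); [|auto].
          exact (continuous_2d_fix _ _ _ (continuous_circ c y t)).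
        + apply continuous_pairC; apply continuous_Rmult; try apply continuous_const;
            [apply continuous_sin|apply continuous_cos]. }
    replace (circ c y (2 * PI)) with (circ c y 0) in I
      by (unfold circ; rewrite cos_2PI, sin_2PI, cos_0, sin_0; auto).
    rewrite Rminus_diag in I.
    apply (is_RInt_Rscal _ (/ y)) in I.
    rewrite Rmult_0_r in I; apply is_RInt_unique.
    apply is_RInt_extR with (3 := I); [lra|].
    intros t _; unfold dA, Im, Re; simpl; field; lra. }
  assert (E : A Rd - A 0 = 0).
  { destruct (MVT_cor2 A (fun y => RInt (dA y) 0 (2 * PI)) 0 Rd) as [u [E Hu]]; auto.
    - intros u Hu; apply is_derive_Reals; apply DA; auto.
    - rewrite E, Z by lra; ring. }
  fold (A Rd); replace (A Rd) with (A 0) by lra; unfold A.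
  rewrite (RInt_extR _ (fun _ => Re (f c))); try lra.
  - rewrite RInt_const; unfold scal; simpl; unfold mult; simpl; ring.
  - intros t _; unfold circ; do 2 f_equal; creal; ring.
Qed.

(** The mean value is applied to [Cconj (f c) * f], whose value at the centre is the real number
    [|f c|^2]. *)
Lemma mean_value_le (D : C -> Prop) f c Rd M :
  Cn 1 D f -> 0 < Rd -> (exists e, 0 < e /\ forall z, Cmod (z - c) < Rd + e -> D z) ->
  (forall z, Cmod (z - c) = Rd -> Cmod (f z) <= M) -> Cmod (f c) <= M.
Proof.
  intros Hf HR HD HM; generalize PI_RGT_0; intros HPI.
  assert (Hg : Cn 1 D (fun z => Cconj (f c) * f z)%C)
    by (apply Cn_mult; [apply Cn_const|auto]).
  assert (E := mean_value D _ c Rd Hg HR HD).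
  assert (N : Re (Cconj (f c) * f c)%C = Cmod (f c) * Cmod (f c))
    by (rewrite Cmod_sqr; unfold Re, Im; simpl; ring).
  cbv beta in E; rewrite N in E.
  assert (Dc : forall t, D (circ c Rd t)).
  { destruct HD as [e [He HD]]; intros t; apply HD.
    rewrite circ_dist, Rabs_pos_eq; lra. }
  assert (B : RInt (fun t => Re (Cconj (f c) * f (circ c Rd t))%C) 0 (2 * PI)
     <= RInt (fun t => Cmod (f c) * M) 0 (2 * PI)).
  { apply RInt_le; [lra| |apply ex_RInt_const|].
    - apply ex_RInt_cont; [lra|]; intros x _; apply continuous_ReC.
      apply continuous_Cmult; [apply continuous_const|].
      apply (continuous_comp (fun t => circ c Rd t) f).
      + exact (continuous_2d_fix _ _ _ (continuous_circ c Rd x)).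
      + apply (Cn_continuous 1 D); auto.
    - intros t _; eapply Rle_trans; [apply Rle_abs|].
      eapply Rle_trans; [apply Re_le_Cmod|].
      rewrite Cmod_mult, Cmod_conj; apply Rmult_le_compat_l; [apply Cmod_ge_0|].
      apply HM; rewrite circ_dist, Rabs_pos_eq; lra. }
  rewrite E, RInt_const in B; unfold scal in B; simpl in B; unfold mult in B; simpl in B.
  destruct (Rle_or_lt (Cmod (f c)) M) as [|Hlt]; auto.
  assert (0 <= M).
  { eapply Rle_trans; [apply Cmod_ge_0|apply (HM (circ c Rd 0))].
    rewrite circ_dist, Rabs_pos_eq; lra. }
  assert (0 < Cmod (f c)) by lra.
  assert (Cmod (f c) * M < Cmod (f c) * Cmod (f c)) by (apply Rmult_lt_compat_l; auto).
  nra.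
Qed.

(** * Blaschke factors and Jensen's inequality *)

Definition zprod (l : list C) (z : C) : C :=
  fold_right (fun rho acc => ((z - rho) * acc)%C) (RtoC 1) l.

Definition bprod (l : list C) (X Rd : R) (z : C) : C :=
  fold_right (fun rho acc =>
    ((RtoC (Rd * Rd) - Cconj (rho - X) * (z - X)) * acc)%C) (RtoC 1) l.

Lemma Cn_bprod n D l (X Rd : R) : Cn n D (bprod l X Rd).
Proof.
  induction l; [exact (Cn_const n D 1)|]; unfold bprod; simpl.
  apply Cn_mult; auto; apply Cn_minus; [apply Cn_const|].
  apply Cn_mult; [apply Cn_const|]; apply Cn_minus; [apply Cn_id|apply Cn_const].
Qed.

(** On the circle [Rd * Rd] is [z - X] times its conjugate, so each factor equals
    [(z - X) * Cconj (z - rho)]. *)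
Lemma bprod_circle l (X Rd : R) z : Cmod (z - X) = Rd ->
  Cmod (bprod l X Rd z) = Rd ^ length l * Cmod (zprod l z).
Proof.
  intros H; induction l as [|r l IH]; simpl.
  - rewrite Cmod_1; ring.
  - rewrite !Cmod_mult, IH.
    replace (RtoC (Rd * Rd) - Cconj (r - X) * (z - X))%C with
      ((z - X) * Cconj (z - r))%C.
    + rewrite Cmod_mult, Cmod_conj, H; ring.
    + rewrite <- H, Cmod_sqr; creal; unfold Re, Im; simpl; ring.
Qed.

Lemma bprod_center l (X Rd : R) : bprod l X Rd X = RtoC ((Rd * Rd) ^ length l).
Proof.
  induction l as [|r l IH]; simpl; auto.
  rewrite IH, <- RtoC_minus, Rminus_diag; creal; ring.
Qed.

Lemma zprod_center l (X : R) r0 : 0 < r0 ->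
  (forall rho, In rho l -> Cmod (rho - X) <= r0) -> Cmod (zprod l X) <= r0 ^ length l.
Proof.
  intros H0 H; induction l as [|r l IH]; simpl in *; [rewrite Cmod_1; lra|].
  rewrite Cmod_mult; apply Rmult_le_compat; auto; try apply Cmod_ge_0.
  rewrite Cmod_sub_sym; auto.
Qed.

(** Multiplying by the Blaschke numerators makes the modulus on the circle a
    constant multiple of that of [f], while the value at the centre is amplified
    by [(Rd / r0)] for each zero. *)
Lemma jensen (D : C -> Prop) (f g : C -> C) (X Rd r0 M : R) (l : list C) :
  Cn 1 D g -> 0 < Rd -> 0 < r0 ->
  (exists e, 0 < e /\ forall z, Cmod (z - X) < Rd + e -> D z) ->
  (forall z, D z -> f z = (zprod l z * g z)%C) ->
  (forall rho, In rho l -> Cmod (rho - X) <= r0) ->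
  (forall z, Cmod (z - X) = Rd -> Cmod (f z) <= M) ->
  Cmod (f X) * Rd ^ length l <= M * r0 ^ length l.
Proof.
  intros Hg HR H0 HD Hf Hl HM.
  assert (DX : forall z, Cmod (z - X) <= Rd -> D z).
  { destruct HD as [e [He HD]]; intros z Hz; apply HD; lra. }
  assert (B : Cmod (g X * bprod l X Rd X) <= Rd ^ length l * M).
  { apply (mean_value_le D (fun z => g z * bprod l X Rd z)%C X Rd); auto.
    - apply Cn_mult; auto; apply Cn_bprod.
    - intros z Hz; rewrite Cmod_mult, bprod_circle by auto.
      replace (Cmod (g z) * (Rd ^ length l * Cmod (zprod l z))) with
        (Rd ^ length l * Cmod (f z)).
      + apply Rmult_le_compat_l; auto; apply pow_le; lra.
      + rewrite Hf, Cmod_mult; [ring|apply DX; lra]. }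
  rewrite bprod_center, Cmod_mult, Cmod_R, Rabs_pos_eq, Rpow_mult_distr in B
    by (apply pow_le; nra).
  rewrite Hf, Cmod_mult.
  2:{ apply DX; replace (X - X)%C with (RtoC 0) by ring; rewrite Cmod_0; lra. }
  assert (P1 : 0 < Rd ^ length l) by (apply pow_lt; lra).
  assert (B' : Cmod (g X) * Rd ^ length l <= M).
  { apply Rmult_le_reg_r with (Rd ^ length l); auto; lra. }
  assert (Z := zprod_center l X r0 H0 Hl).
  assert (0 < r0 ^ length l) by (apply pow_lt; lra).
  apply Rle_trans with (r0 ^ length l * Cmod (g X) * Rd ^ length l); [|nra].
  apply Rmult_le_compat_r; [lra|]; apply Rmult_le_compat_r; [apply Cmod_ge_0|auto].
Qed.

(** * The zeta function on the right half plane *)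

Lemma is_RInt_gen_of {V : NormedModule R_AbsRing} (f : R -> V) (a : R)
  (F : (R -> Prop) -> Prop) (I : R -> V) (l : V) : Filter F ->
  F (fun b => is_RInt f a b (I b)) -> filterlim I F (locally l) ->
  is_RInt_gen f (at_point a) F l.
Proof.
  intros HF HI Hl P HP.
  apply Filter_prod with (fun x => x = a) (fun b => is_RInt f a b (I b) /\ P (I b)).
  - reflexivity.
  - apply filter_and; auto; exact (Hl P HP).
  - intros x b -> [H1 H2]; exists (I b); auto.
Qed.

Lemma is_RInt_gen_inv (f : R -> R) (a : R) (F : (R -> Prop) -> Prop) (l : R) :
  Filter F -> is_RInt_gen f (at_point a) F l ->
  F (fun b => ex_RInt f a b) /\ filterlim (fun b => RInt f a b) F (locally l).
Proof.
  intros HF H.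
  assert (A : forall P : R -> Prop, locally l P ->
    F (fun b => ex_RInt f a b /\ P (RInt f a b))).
  { intros P HP; destruct (H P HP) as [Q S HQ HS HQS].
    apply filter_imp with (2 := HS); intros b Hb.
    destruct (HQS a b) as [y [Hy Py]]; auto; simpl in *.
    split; [exists y; auto|]. rewrite (is_RInt_unique _ _ _ _ Hy); auto. }
  split.
  - apply filter_imp with (2 := A (fun _ => True) (filter_true)); tauto.
  - intros P HP; unfold filtermap; apply filter_imp with (2 := A P HP); tauto.
Qed.

(** The power [x^(-1-d)], indexed so that its integral over [[1, oo)] is [1/d]; it is the common
    majorant for tails. *)
Definition powd (d x : R) : R := exp (- (1 + d) * ln x).

Lemma continuous_ln x : 0 < x -> continuous ln x.
Proof.
  intros H; apply (ex_derive_continuous (V := R_NormedModule)); auto_derive; auto.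
Qed.

Lemma is_RInt_powd d u v : 0 < d -> 1 <= u <= v ->
  is_RInt (powd d) u v (exp (- d * ln u) / d - exp (- d * ln v) / d).
Proof.
  intros Hd Huv.
  replace (exp (- d * ln u) / d - exp (- d * ln v) / d) with
    (minus ((fun x => - exp (- d * ln x) / d) v) ((fun x => - exp (- d * ln x) / d) u))
    by (unfold minus, plus, opp; simpl; field; lra).
  apply (is_RInt_derive (V := R_CompleteNormedModule) (fun x => - exp (- d * ln x) / d));
    rewrite Rmin_left, Rmax_right by lra; intros x Hx.
  - auto_derive; [lra|]. unfold powd.
    replace (- (1 + d) * ln x) with (- d * ln x + - ln x) by ring.
    rewrite exp_plus, exp_Ropp, exp_ln by lra; field; lra.
  - apply (ex_derive_continuous (V := R_NormedModule)); unfold powd; auto_derive; lra.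
Qed.

Lemma ln_ge_0 x : 1 <= x -> 0 <= ln x.
Proof. intros; rewrite <- ln_1; apply Rcomplements.ln_le; lra. Qed.

Lemma powd_tail d u v : 0 < d -> 1 <= u <= v ->
  RInt (powd d) u v <= exp (- d * ln u) / d.
Proof.
  intros Hd H; rewrite (is_RInt_unique _ _ _ _ (is_RInt_powd d u v Hd H)).
  assert (0 < exp (- d * ln v) / d) by (apply Rdiv_lt_0_compat; [apply exp_pos|lra]); lra.
Qed.

Lemma exp_ln_small d e : 0 < d -> 0 < e -> exists M, 1 <= M /\
  forall u, M < u -> exp (- d * ln u) < e.
Proof.
  intros Hd He; exists (Rmax 1 (exp (- ln e / d))); split; [apply Rmax_l|].
  intros u Hu.
  assert (H1 := Rmax_l 1 (exp (- ln e / d))); assert (H2 := Rmax_r 1 (exp (- ln e / d))).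
  rewrite <- (exp_ln e) at 1 by auto; apply exp_increasing.
  assert (- ln e / d < ln u).
  { rewrite <- (ln_exp (- ln e / d)); apply ln_increasing; [apply exp_pos|lra]. }
  assert (d * (- ln e / d) = - ln e) by (field; lra).
  assert (d * (- ln e / d) < d * ln u) by (apply Rmult_lt_compat_l; auto); lra.
Qed.

Lemma ex_RInt_sub (f : R -> R) a u v b :
  a <= u <= v -> v <= b -> ex_RInt f a b -> ex_RInt f u v.
Proof.
  intros H1 H2 H; apply (ex_RInt_Chasles_1 (V := R_CompleteNormedModule)) with b; [lra|].
  apply (ex_RInt_Chasles_2 (V := R_CompleteNormedModule)) with a; [lra|auto].
Qed.

Lemma RInt_Chasles_R (f : R -> R) a b c : ex_RInt f a b -> ex_RInt f b c ->
  RInt f a b + RInt f b c = RInt f a c.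
Proof. exact (RInt_Chasles (V := R_CompleteNormedModule) f a b c). Qed.

Lemma RInt_diff (f : R -> R) a b c : ex_RInt f a b -> ex_RInt f b c ->
  RInt f a c - RInt f a b = RInt f b c.
Proof.
  intros H1 H2; generalize (RInt_Chasles_R f a b c H1 H2).
  generalize (RInt f a b : R) (RInt f b c : R) (RInt f a c : R); simpl; intros; lra.
Qed.

Lemma improper_ex (f : R -> R) (K d : R) : 0 < d ->
  (forall b, 1 <= b -> ex_RInt f 1 b) ->
  (forall x, 1 <= x -> Rabs (f x) <= K * powd d x) ->
  exists l : R, is_lim (fun b => RInt f 1 b) p_infty l.
Proof.
  intros Hd He Hf.
  assert (HK : 0 <= K).
  { specialize (Hf 1 (Rle_refl _)); unfold powd in Hf.
    rewrite ln_1, Rmult_0_r, exp_0 in Hf; generalize (Rabs_pos (f 1)); lra. }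
  assert (B : forall u v, 1 <= u <= v ->
    Rabs (RInt f 1 v - RInt f 1 u) <= K * (exp (- d * ln u) / d)).
  { intros u v Huv.
    assert (E1 : ex_RInt f u v) by (apply ex_RInt_sub with 1 v; [auto|lra|apply He; lra]).
    rewrite RInt_diff by (auto; apply He; lra).
    eapply Rle_trans; [apply abs_RInt_le; [lra|auto]|].
    apply Rle_trans with (RInt (fun x => K * powd d x) u v).
    - apply RInt_le; [lra| | |intros; apply Hf; lra].
      + apply (ex_RInt_norm) in E1; exact E1.
      + apply ex_RInt_Rscal; eexists; apply is_RInt_powd; auto.
    - rewrite RInt_Rscal by (eexists; apply is_RInt_powd; auto).
      apply Rmult_le_compat_l; auto; apply powd_tail; auto. }
  assert (L : exists l : R, filterlim (fun b => RInt f 1 b) (Rbar_locally p_infty) (locally l)).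
  { apply (filterlim_locally_cauchy (U := R_CompleteSpace) (F := Rbar_locally p_infty)).
    intros e.
    destruct (exp_ln_small d (e * d / (K + 1))) as [M [HM HMu]]; auto.
    { apply Rdiv_lt_0_compat; [|lra]; apply Rmult_lt_0_compat; auto; apply cond_pos. }
    exists (fun u => M < u); split; [exists M; auto|].
    assert (W : forall u v, M < u -> u <= v -> Rabs (RInt f 1 v - RInt f 1 u) < e).
    { intros u v Hu Huv; eapply Rle_lt_trans; [apply B; lra|].
      specialize (HMu u Hu).
      assert (exp (- d * ln u) / d <= e / (K + 1)).
      { apply Rle_trans with (e * d / (K + 1) / d); [|right; field; lra].
        apply Rmult_le_compat_r; [|lra]; left; apply Rinv_0_lt_compat; auto. }
      apply Rle_lt_trans with (K * (e / (K + 1))); [apply Rmult_le_compat_l; auto|].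
      assert (0 < e / (K + 1)) by (apply Rdiv_lt_0_compat; [apply cond_pos|lra]).
      assert ((K + 1) * (e / (K + 1)) = e) by (field; lra). lra. }
    intros u v Hu Hv; unfold ball; simpl; unfold AbsRing_ball, abs, minus, plus, opp; simpl.
    destruct (Rle_or_lt u v); [apply W; auto|].
    change (Rabs (RInt f 1 v - RInt f 1 u) < e); rewrite Rabs_minus_sym; apply W; auto; lra. }
  destruct L as [l Hl]; exists l; exact Hl.
Qed.

Lemma is_lim_abs_le (g : R -> R) (l K : R) : is_lim g p_infty l ->
  (forall b, 1 <= b -> Rabs (g b) <= K) -> Rabs l <= K.
Proof.
  intros H HK.
  assert (A : l <= K).
  { apply (is_lim_le_loc g (fun _ => K) p_infty l K); auto; [|apply is_lim_const].
    exists 1; intros x Hx; specialize (HK x ltac:(lra)).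
    eapply Rle_trans; [apply Rle_abs|auto]. }
  assert (B : - K <= l).
  { apply (is_lim_le_loc (fun _ => - K) g p_infty (- K) l); auto; [|apply is_lim_const].
    exists 1; intros x Hx; specialize (HK x ltac:(lra)).
    generalize (Rle_abs (- g x)); rewrite Rabs_Ropp; lra. }
  apply Rabs_le; lra.
Qed.

Lemma abs_RInt_le_fun (f g : R -> R) a b : a <= b -> ex_RInt f a b -> ex_RInt g a b ->
  (forall x, a <= x <= b -> Rabs (f x) <= g x) -> Rabs (RInt f a b) <= RInt g a b.
Proof.
  intros Hab Hf Hg H; eapply Rle_trans; [apply abs_RInt_le; auto|].
  apply RInt_le; auto; [|intros; apply H; lra].
  apply (ex_RInt_norm) in Hf; exact Hf.
Qed.

Lemma frac_part_eq (n : nat) x : INR n <= x < INR n + 1 -> frac_part x = x - INR n.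
Proof.
  intros H; unfold frac_part; f_equal.
  rewrite <- (Int_part_spec x (Z.of_nat n)); rewrite <- INR_IZR_INZ; auto; lra.
Qed.

Lemma frac_part_bound x : 0 <= frac_part x <= 1.
Proof. destruct (base_fp x); lra. Qed.

Lemma frac_part_le_sub x : 1 <= x -> frac_part x <= x - 1.
Proof.
  intros H; unfold frac_part.
  destruct (base_Int_part x) as [A B].
  assert (IZR 0 < IZR (Int_part x)) by (simpl; lra).
  apply lt_IZR in H0. assert (1 <= Int_part x)%Z by lia.
  apply IZR_le in H1; lra.
Qed.

Lemma ex_RInt_frac_piece (p : R -> R) (n : nat) b :
  (forall x, 0 < x -> continuous p x) -> (1 <= n)%nat -> INR n <= b <= INR n + 1 ->
  ex_RInt (fun x => frac_part x * p x) (INR n) b.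
Proof.
  intros Hp Hn Hb; apply le_INR in Hn; simpl in Hn.
  apply (ex_RInt_ext (V := R_NormedModule) (fun x => (x - INR n) * p x)).
  - rewrite Rmin_left, Rmax_right by lra; intros x Hx.
    rewrite (frac_part_eq n) by lra; auto.
  - apply ex_RInt_cont; [lra|]; intros x Hx; apply continuous_Rmult; [|apply Hp; lra].
    apply continuous_Rminus; [apply continuous_id|apply continuous_const].
Qed.

Lemma ex_RInt_frac (p : R -> R) b :
  (forall x, 0 < x -> continuous p x) -> 1 <= b ->
  ex_RInt (fun x => frac_part x * p x) 1 b.
Proof.
  intros Hp Hb.
  assert (A : forall n, ex_RInt (fun x => frac_part x * p x) 1 (INR (S n))).
  { induction n; [apply (ex_RInt_point (V := R_NormedModule))|].
    apply (ex_RInt_Chasles (V := R_NormedModule)) with (INR (S n)); auto.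
    rewrite (S_INR (S n)); apply ex_RInt_frac_piece; auto; [lia|lra]. }
  destruct (nfloor_ex b) as [n Hn]; [lra|].
  destruct n; [simpl in Hn; lra|].
  apply (ex_RInt_Chasles (V := R_NormedModule)) with (INR (S n)); auto.
  apply ex_RInt_frac_piece; auto; [lia|lra].
Qed.

(** The [k]-th derivative in [s] of the integrand of [zeta_tail]; [tailk] is its integral, taken
    coordinatewise as a limit of proper integrals. *)
Definition tailf (k : nat) (s : C) (x : R) : C :=
  (RtoC (frac_part x * (- ln x) ^ k) * cpow x (- s - 1))%C.

Definition tailk (k : nat) (s : C) : C :=
  (real (Lim (fun b => RInt (fun x => Re (tailf k s x)) 1 b) p_infty),
   real (Lim (fun b => RInt (fun x => Im (tailf k s x)) 1 b) p_infty)).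

Lemma continuous_cpow_Re s x : 0 < x -> continuous (fun x => Re (cpow x s)) x.
Proof.
  intros; apply (ex_derive_continuous (V := R_NormedModule)); unfold cpow; simpl.
  auto_derive; auto.
Qed.

Lemma continuous_cpow_Im s x : 0 < x -> continuous (fun x => Im (cpow x s)) x.
Proof.
  intros; apply (ex_derive_continuous (V := R_NormedModule)); unfold cpow; simpl.
  auto_derive; auto.
Qed.

Lemma continuous_ln_pow k x : 0 < x -> continuous (fun x => (- ln x) ^ k) x.
Proof.
  intros; apply (ex_derive_continuous (V := R_NormedModule)); auto_derive; auto.
Qed.

Lemma ex_tailf_Re k s b : 1 <= b -> ex_RInt (fun x => Re (tailf k s x)) 1 b.
Proof.
  intros Hb.
  apply (ex_RInt_ext (V := R_NormedModule)
    (fun x => frac_part x * ((- ln x) ^ k * Re (cpow x (- s - 1))))).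
  - intros; unfold tailf, Re; simpl; rring.
  - apply ex_RInt_frac; auto; intros; apply continuous_Rmult;
      [apply continuous_ln_pow|apply continuous_cpow_Re]; auto.
Qed.

Lemma ex_tailf_Im k s b : 1 <= b -> ex_RInt (fun x => Im (tailf k s x)) 1 b.
Proof.
  intros Hb.
  apply (ex_RInt_ext (V := R_NormedModule)
    (fun x => frac_part x * ((- ln x) ^ k * Im (cpow x (- s - 1))))).
  - intros; unfold tailf, Im; simpl; rring.
  - apply ex_RInt_frac; auto; intros; apply continuous_Rmult;
      [apply continuous_ln_pow|apply continuous_cpow_Im]; auto.
Qed.

Lemma Cmod_cexp z : Cmod (cexp z) = exp (Re z).
Proof.
  assert (H := exp_pos (Re z)).
  replace (cexp z) with (RtoC (exp (Re z)) * (cos (Im z), sin (Im z)))%C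
    by (creal; ring).
  rewrite Cmod_mult, Cmod_R, Rabs_pos_eq by lra.
  replace (Cmod (cos (Im z), sin (Im z))) with 1; [ring|].
  unfold Cmod; simpl; rewrite !Rmult_1_r, sin2cos2, sqrt_1; auto.
Qed.

Lemma cpow_cexp x z : cpow x z = cexp (z * ln x).
Proof. unfold cpow, cexp; simpl; f_equal; do 2 f_equal; unfold Re, Im; simpl; ring. Qed.

Lemma Cmod_cpow x z : Cmod (cpow x z) = exp (Re z * ln x).
Proof. rewrite cpow_cexp, Cmod_cexp; f_equal; unfold Re; simpl; ring. Qed.

Lemma ln_pow_bound m d : 0 < d -> exists K, 0 <= K /\
  forall L, 0 <= L -> L ^ m <= K * exp (d * L).
Proof.
  intros Hd; destruct m as [|m].
  - exists 1; split; [lra|]; intros L HL; simpl.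
    generalize (exp_ineq1_le (d * L)); nra.
  - assert (Hm : 0 < INR (S m)) by (apply lt_0_INR; lia).
    (* With [n = S m], write [L = (n/d) * (d L/n)], use [x <= exp x] at [d L/n], and raise to the
       power [n]. *)
    exists ((INR (S m) / d) ^ S m).
    assert (0 < INR (S m) / d) by (apply Rdiv_lt_0_compat; auto).
    split; [apply pow_le; lra|]; intros L HL.
    replace (exp (d * L)) with (exp (d * L / INR (S m)) ^ S m).
    + rewrite <- Rpow_mult_distr; apply pow_incr; split; auto.
      apply Rle_trans with (INR (S m) / d * (d * L / INR (S m))).
      * right; field; lra.
      * apply Rmult_le_compat_l; [lra|].
        generalize (exp_ineq1_le (d * L / INR (S m))); lra.
    + rewrite <- Rpower_pow by apply exp_pos.
      unfold Rpower; rewrite ln_exp; f_equal; field; lra.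
Qed.

Lemma Cmod_tailf k s x : 1 <= x ->
  Cmod (tailf k s x) = frac_part x * (ln x ^ k) * powd (Re s) x.
Proof.
  intros Hx; unfold tailf; rewrite Cmod_mult, Cmod_cpow, Cmod_R.
  rewrite Rabs_mult, (Rabs_pos_eq (frac_part x)) by apply frac_part_bound.
  rewrite <- RPow_abs, Rabs_Ropp, Rabs_pos_eq by (apply ln_ge_0; auto).
  unfold powd; do 2 f_equal; simpl; unfold Re; ring.
Qed.

Lemma powd_split d e x : powd (d + e) x = powd d x * exp (- e * ln x).
Proof. unfold powd; rewrite <- exp_plus; f_equal; ring. Qed.

Lemma powd_pos d x : 0 < powd d x.
Proof. apply exp_pos. Qed.

(** Half of the exponent [Re s] is spent on absorbing the power of the logarithm; the other half
    keeps the majorant integrable. *)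
Lemma tailf_bound k s : 0 < Re s -> exists K, 0 <= K /\
  forall x, 1 <= x -> Cmod (tailf k s x) <= K * powd (Re s / 2) x.
Proof.
  intros Hs; destruct (ln_pow_bound k (Re s / 2)) as [K [HK H]]; [lra|].
  exists K; split; auto; intros x Hx; rewrite Cmod_tailf by auto.
  assert (L := ln_ge_0 x Hx).
  replace (powd (Re s) x) with (powd (Re s / 2 + Re s / 2) x) by (f_equal; lra).
  rewrite powd_split.
  specialize (H (ln x) L); destruct (frac_part_bound x) as [F0 F1].
  assert (P0 : 0 <= ln x ^ k) by (apply pow_le; auto).
  assert (P := powd_pos (Re s / 2) x).
  assert (E : exp (Re s / 2 * ln x) * exp (- (Re s / 2) * ln x) = 1)
    by (rewrite <- exp_plus; replace (_ + _) with 0 by ring; apply exp_0).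
  assert (0 < exp (- (Re s / 2) * ln x)) by apply exp_pos.
  apply Rle_trans with (1 * (K * exp (Re s / 2 * ln x)) *
     (powd (Re s / 2) x * exp (- (Re s / 2) * ln x))).
  - apply Rmult_le_compat_r; [apply Rmult_le_pos; lra|].
    apply Rmult_le_compat; auto.
  - right; transitivity (K * powd (Re s / 2) x *
      (exp (Re s / 2 * ln x) * exp (- (Re s / 2) * ln x))); [ring|rewrite E; ring].
Qed.

Lemma tailk_lim k s : 0 < Re s ->
  is_lim (fun b => RInt (fun x => Re (tailf k s x)) 1 b) p_infty (Re (tailk k s)) /\
  is_lim (fun b => RInt (fun x => Im (tailf k s x)) 1 b) p_infty (Im (tailk k s)).
Proof.
  intros Hs; destruct (tailf_bound k s Hs) as [K [HK H]].
  destruct (improper_ex (fun x => Re (tailf k s x)) K (Re s / 2)) as [l1 H1];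
    [lra|intros; apply ex_tailf_Re; auto| |].
  { intros x Hx; eapply Rle_trans; [apply Re_le_Cmod|auto]. }
  destruct (improper_ex (fun x => Im (tailf k s x)) K (Re s / 2)) as [l2 H2];
    [lra|intros; apply ex_tailf_Im; auto| |].
  { intros x Hx; eapply Rle_trans; [apply Im_le_Cmod|auto]. }
  unfold tailk; rewrite (is_lim_unique _ _ _ H1), (is_lim_unique _ _ _ H2); simpl; auto.
Qed.

Lemma zeta_tail_eq s : 0 < Re s -> zeta_tail s = tailk 0 s.
Proof.
  intros Hs; destruct (tailk_lim 0 s Hs) as [H1 H2].
  unfold zeta_tail; apply (is_RInt_gen_unique (V := C_R_CompleteNormedModule)).
  apply (is_RInt_gen_of (V := C_R_NormedModule)) with
    (fun b => (RInt (fun x => Re (tailf 0 s x)) 1 b, RInt (fun x => Im (tailf 0 s x)) 1 b)).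
  - apply Rbar_locally_filter.
  - exists 1; intros b Hb.
    apply (is_RInt_fct_extend_pair (U := R_NormedModule) (V := R_NormedModule)).
    + apply is_RInt_extR with (fun x => Re (tailf 0 s x)); [lra| |].
      * intros x _; unfold tailf, Re; simpl; unfold scal; simpl; unfold mult; simpl; ring.
      * apply (RInt_correct (V := R_CompleteNormedModule)); apply ex_tailf_Re; lra.
    + apply is_RInt_extR with (fun x => Im (tailf 0 s x)); [lra| |].
      * intros x _; unfold tailf, Im; simpl; unfold scal; simpl; unfold mult; simpl; ring.
      * apply (RInt_correct (V := R_CompleteNormedModule)); apply ex_tailf_Im; lra.
  - intros P [e HP]; unfold filtermap.
    assert (A1 := H1 _ (locally_ball (Re (tailk 0 s)) e)).
    assert (A2 := H2 _ (locally_ball (Im (tailk 0 s)) e)).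
    destruct A1 as [M1 A1], A2 as [M2 A2]; exists (Rmax M1 M2); intros b Hb.
    apply HP; split; [apply A1|apply A2]; eapply Rle_lt_trans; eauto;
      [apply Rmax_l|apply Rmax_r].
Qed.

Lemma MVT_bound_at (f df : R -> R) (M x : R) : 0 <= x <= 1 ->
  (forall y, 0 <= y <= 1 -> is_derive f y (df y)) ->
  (forall y, 0 <= y <= 1 -> Rabs (df y) <= M) -> Rabs (f x - f 0) <= M.
Proof.
  intros Hx H HM.
  destruct (MVT_gen f 0 x df) as [c [Hc E]]; rewrite ?Rmin_left, ?Rmax_right in * by lra.
  - intros; apply H; lra.
  - intros y Hy; apply continuous_continuity_pt.
    exact (is_derive_continuous _ _ _ (H y ltac:(lra))).
  - rewrite E, Rminus_0_r, Rabs_mult, (Rabs_pos_eq x) by lra.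
    specialize (HM c ltac:(lra)); generalize (Rabs_pos (df c)); nra.
Qed.

Lemma second_order_bound (p p' p'' : R -> R) (M : R) :
  (forall u, 0 <= u <= 1 -> is_derive p u (p' u)) ->
  (forall u, 0 <= u <= 1 -> is_derive p' u (p'' u)) ->
  (forall u, 0 <= u <= 1 -> Rabs (p'' u) <= M) ->
  Rabs (p 1 - p 0 - p' 0) <= M.
Proof.
  intros H1 H2 HM; set (q := fun u => p u - u * p' 0).
  replace (p 1 - p 0 - p' 0) with (q 1 - q 0) by (unfold q; ring).
  apply MVT_bound with (fun u => p' u - p' 0).
  - intros u Hu; unfold q; eapply is_derive_eq.
    + apply is_derive_Rminus; [eauto|].
      apply is_derive_Rmult; [apply is_derive_id|apply is_derive_Rconst].
    + unfold one; simpl; ring.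
  - intros u Hu; apply MVT_bound_at with p''; auto.
Qed.

Lemma exp_mono x y : x <= y -> exp x <= exp y.
Proof. intros [H| ->]; [left; apply exp_increasing; auto|lra]. Qed.

Lemma cexp_remainder (z : C) :
  Cmod (cexp z - 1 - z) <= 2 * (Cmod z * Cmod z * exp (Cmod z)).
Proof.
  destruct z as [a b]; set (z := (a, b) : C).
  assert (B : forall u : R, 0 <= u <= 1 -> Cmod (z * z * cexp (u * z)) <= Cmod z * Cmod z * exp (Cmod z)).
  { intros u Hu; rewrite !Cmod_mult, Cmod_cexp.
    apply Rmult_le_compat_l; [apply Rmult_le_pos; apply Cmod_ge_0|].
    apply exp_mono; eapply Rle_trans; [apply Rle_abs|]; eapply Rle_trans; [apply Re_le_Cmod|].
    rewrite Cmod_mult, Cmod_R, Rabs_pos_eq by lra.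
    generalize (Cmod_ge_0 z); nra. }
  assert (A1 := second_order_bound (fun u : R => exp (u * a) * cos (u * b))
    (fun u => exp (u * a) * (a * cos (u * b) - b * sin (u * b)))
    (fun u => Re (z * z * cexp (u * z))%C) (Cmod z * Cmod z * exp (Cmod z))).
  assert (A2 := second_order_bound (fun u : R => exp (u * a) * sin (u * b))
    (fun u => exp (u * a) * (a * sin (u * b) + b * cos (u * b)))
    (fun u => Im (z * z * cexp (u * z))%C) (Cmod z * Cmod z * exp (Cmod z))).
  assert (E1 : forall u : R, exp (Re (u * z)%C) = exp (u * a))
    by (intros; f_equal; unfold Re; simpl; ring).
  assert (E2 : forall u : R, Im (u * z)%C = u * b) by (intros; unfold Im; simpl; ring).
  eapply Rle_trans; [apply Cmod_le_abs|].
  replace (Re (cexp z - 1 - z)%C) with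
    (exp (1 * a) * cos (1 * b) - exp (0 * a) * cos (0 * b) - exp (0 * a) * (a * cos (0 * b) - b * sin (0 * b))).
  2:{ rewrite !Rmult_0_l, !Rmult_1_l, exp_0, cos_0, sin_0; unfold Re; simpl; unfold Re, Im; simpl; ring. }
  replace (Im (cexp z - 1 - z)%C) with
    (exp (1 * a) * sin (1 * b) - exp (0 * a) * sin (0 * b) - exp (0 * a) * (a * sin (0 * b) + b * cos (0 * b))).
  2:{ rewrite !Rmult_0_l, !Rmult_1_l, exp_0, cos_0, sin_0; unfold Im; simpl; unfold Re, Im; simpl; ring. }
  assert (Rabs (exp (1 * a) * cos (1 * b) - exp (0 * a) * cos (0 * b) - exp (0 * a) * (a * cos (0 * b) - b * sin (0 * b))) <= Cmod z * Cmod z * exp (Cmod z)).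
  { cbv beta in A1; apply A1.
    - intros; auto_derive; auto; ring.
    - intros; auto_derive; auto. unfold cexp; rewrite E1, E2; unfold Re; simpl; ring.
    - intros; eapply Rle_trans; [apply Re_le_Cmod|auto]. }
  assert (Rabs (exp (1 * a) * sin (1 * b) - exp (0 * a) * sin (0 * b) - exp (0 * a) * (a * sin (0 * b) + b * cos (0 * b))) <= Cmod z * Cmod z * exp (Cmod z)).
  { cbv beta in A2; apply A2.
    - intros; auto_derive; auto; ring.
    - intros; auto_derive; auto. unfold cexp; rewrite E1, E2; unfold Im; simpl; ring.
    - intros; eapply Rle_trans; [apply Im_le_Cmod|auto]. }
  lra.
Qed.

Lemma cexp_plus z w : cexp (z + w) = (cexp z * cexp w)%C.
Proof.
  unfold cexp; replace (Re (z + w)%C) with (Re z + Re w) by (unfold Re; simpl; ring).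
  replace (Im (z + w)%C) with (Im z + Im w) by (unfold Im; simpl; ring).
  rewrite exp_plus, cos_plus, sin_plus; creal; ring.
Qed.

Definition tailrem k s w x : C :=
  (tailf k w x - tailf k s x - (w - s) * tailf (S k) s x)%C.

(** The decay [x^(-Re s)] is shared out: a quarter of the exponent absorbs [(ln x)^(k+2)], a quarter
    the factor [exp (|w - s| ln x)], and half remains. Hence [K] is uniform in [w], and the
    remainder of the integral is quadratic in [w - s]. *)
Lemma tailrem_bound k s : 0 < Re s -> exists K, 0 <= K /\
  forall w x, 1 <= x -> Cmod (w - s) <= Re s / 4 ->
    Cmod (tailrem k s w x) <= Cmod (w - s) * Cmod (w - s) * K * powd (Re s / 2) x.
Proof.
  intros Hs; destruct (ln_pow_bound (S (S k)) (Re s / 4)) as [K [HK H]]; [lra|].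
  exists (2 * K); split; [lra|]; intros w x Hx Hw.
  assert (HL := ln_ge_0 x Hx); set (L := ln x) in *.
  set (h := Cmod (w - s)) in *; assert (Hh : 0 <= h) by apply Cmod_ge_0.
  set (eta := (- (w - s) * L)%C).
  (* The integrands at [w] and [s] differ by the factor [x^(-(w - s)) = cexp eta], so the remainder
     is that of the exponential series. *)
  replace (tailrem k s w x) with (tailf k s x * (cexp eta - 1 - eta))%C.
  2:{ unfold tailrem, tailf; rewrite !cpow_cexp; fold L.
      replace ((- w - 1) * L)%C with ((- s - 1) * L + eta)%C by (unfold eta; ring).
      rewrite cexp_plus; simpl pow; rewrite !RtoC_mult, RtoC_opp; unfold eta; ring. }
  assert (He : Cmod eta = h * L).
  { unfold eta; rewrite Cmod_mult, Cmod_opp, Cmod_R, Rabs_pos_eq; auto. }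
  rewrite Cmod_mult, Cmod_tailf by auto; fold L.
  assert (R1 := cexp_remainder eta); rewrite He in R1.
  destruct (frac_part_bound x) as [F0 F1].
  assert (P0 : 0 <= L ^ k) by (apply pow_le; auto).
  assert (P := powd_pos (Re s / 2) x).
  replace (powd (Re s) x) with (powd (Re s / 2 + Re s / 2) x) by (f_equal; lra).
  rewrite powd_split; fold L.
  assert (X1 : exp (h * L) <= exp (Re s / 4 * L)).
  { apply exp_mono; apply Rmult_le_compat_r; auto. }
  assert (X2 : L ^ S (S k) * exp (h * L) <= K * exp (Re s / 4 * L) * exp (Re s / 4 * L)).
  { apply Rmult_le_compat; auto; [apply pow_le; auto|left; apply exp_pos]. }
  assert (X3 : exp (Re s / 4 * L) * exp (Re s / 4 * L) * exp (- (Re s / 2) * L) = 1).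
  { rewrite <- !exp_plus; replace (_ + _) with 0 by lra; apply exp_0. }
  assert (X4 : 0 < exp (- (Re s / 2) * L)) by apply exp_pos.
  apply Rle_trans with (1 * L ^ k * (powd (Re s / 2) x * exp (- (Re s / 2) * L)) *
    (2 * (h * L * (h * L) * exp (h * L)))).
  - apply Rmult_le_compat; [|apply Cmod_ge_0| |exact R1].
    + apply Rmult_le_pos; [apply Rmult_le_pos; auto|]; apply Rmult_le_pos; lra.
    + apply Rmult_le_compat_r; [apply Rmult_le_pos; lra|].
      apply Rmult_le_compat_r; auto.
  - apply Rle_trans with (2 * (h * h * powd (Re s / 2) x) * exp (- (Re s / 2) * L) *
      (L ^ S (S k) * exp (h * L))); [right; simpl; ring|].
    apply Rle_trans with (2 * (h * h * powd (Re s / 2) x) * exp (- (Re s / 2) * L) *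
      (K * exp (Re s / 4 * L) * exp (Re s / 4 * L))).
    + apply Rmult_le_compat_l; auto.
      apply Rmult_le_pos; [|lra]; apply Rmult_le_pos; [lra|].
      apply Rmult_le_pos; [apply Rmult_le_pos; auto|lra].
    + right; transitivity (h * h * (2 * K) * powd (Re s / 2) x *
        (exp (Re s / 4 * L) * exp (Re s / 4 * L) * exp (- (Re s / 2) * L))); [ring|].
      rewrite X3; ring.
Qed.

Lemma RInt_powd_le d b : 0 < d -> 1 <= b -> RInt (powd d) 1 b <= / d.
Proof.
  intros Hd Hb; eapply Rle_trans; [apply powd_tail; auto; lra|].
  rewrite ln_1, Rmult_0_r, exp_0; lra.
Qed.

Lemma lim_bound_powd (f : R -> R) K d (l : R) : 0 < d -> 0 <= K ->
  (forall b, 1 <= b -> ex_RInt f 1 b) ->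
  (forall x, 1 <= x -> Rabs (f x) <= K * powd d x) ->
  is_lim (fun b => RInt f 1 b) p_infty l -> Rabs l <= K / d.
Proof.
  intros Hd HK He Hf Hl; apply (is_lim_abs_le _ _ _ Hl); intros b Hb.
  assert (Ep : ex_RInt (powd d) 1 b) by (eexists; apply is_RInt_powd; auto; lra).
  eapply Rle_trans; [apply (abs_RInt_le_fun f (fun x => K * powd d x)); auto|].
  - apply ex_RInt_Rscal; auto.
  - intros; apply Hf; lra.
  - rewrite RInt_Rscal by auto; apply Rmult_le_compat_l; auto; apply RInt_powd_le; auto.
Qed.

Lemma tailrem_lim k s w : 0 < Re s -> 0 < Re w ->
  (forall b, 1 <= b -> ex_RInt (fun x => Re (tailrem k s w x)) 1 b /\
      ex_RInt (fun x => Im (tailrem k s w x)) 1 b) /\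
  is_lim (fun b => RInt (fun x => Re (tailrem k s w x)) 1 b) p_infty
    (Re (tailk k w - tailk k s - (w - s) * tailk (S k) s)%C) /\
  is_lim (fun b => RInt (fun x => Im (tailrem k s w x)) 1 b) p_infty
    (Im (tailk k w - tailk k s - (w - s) * tailk (S k) s)%C).
Proof.
  intros Hs Hw.
  destruct (tailk_lim k s Hs) as [A1 A2]; destruct (tailk_lim k w Hw) as [B1 B2];
    destruct (tailk_lim (S k) s Hs) as [C1 C2].
  set (h := (w - s)%C).
  assert (I : forall b, 1 <= b ->
    is_RInt (fun x => Re (tailrem k s w x)) 1 b
      (RInt (fun x => Re (tailf k w x)) 1 b - RInt (fun x => Re (tailf k s x)) 1 b -
       (Re h * RInt (fun x => Re (tailf (S k) s x)) 1 b -
        Im h * RInt (fun x => Im (tailf (S k) s x)) 1 b)) /\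
    is_RInt (fun x => Im (tailrem k s w x)) 1 b
      (RInt (fun x => Im (tailf k w x)) 1 b - RInt (fun x => Im (tailf k s x)) 1 b -
       (Re h * RInt (fun x => Im (tailf (S k) s x)) 1 b +
        Im h * RInt (fun x => Re (tailf (S k) s x)) 1 b))).
  { intros b Hb.
    assert (R : forall k s, is_RInt (fun x => Re (tailf k s x)) 1 b (RInt (fun x => Re (tailf k s x)) 1 b))
      by (intros; apply (RInt_correct (V := R_CompleteNormedModule)); apply ex_tailf_Re; auto).
    assert (J : forall k s, is_RInt (fun x => Im (tailf k s x)) 1 b (RInt (fun x => Im (tailf k s x)) 1 b))
      by (intros; apply (RInt_correct (V := R_CompleteNormedModule)); apply ex_tailf_Im; auto).
    split.
    - apply is_RInt_extR with (fun x => Re (tailf k w x) - Re (tailf k s x) -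
        (Re h * Re (tailf (S k) s x) - Im h * Im (tailf (S k) s x))); [auto| |].
      + intros x _; unfold tailrem, Re; fold h; simpl; unfold Re, Im; ring.
      + apply is_RInt_Rminus; apply is_RInt_Rminus; auto using is_RInt_Rscal.
    - apply is_RInt_extR with (fun x => Im (tailf k w x) - Im (tailf k s x) -
        (Re h * Im (tailf (S k) s x) + Im h * Re (tailf (S k) s x))); [auto| |].
      + intros x _; unfold tailrem, Im; fold h; simpl; unfold Re, Im; ring.
      + apply is_RInt_Rminus; [apply is_RInt_Rminus|apply is_RInt_Rplus];
          auto using is_RInt_Rscal. }
  split; [intros b Hb; destruct (I b Hb); split; eexists; eauto|].
  assert (SL : forall (f : R -> R) (c l : R), is_lim f p_infty l ->
    is_lim (fun x => c * f x) p_infty (c * l)).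
  { intros f c l H; exact (is_lim_scal_l f c p_infty l H). }
  split.
  - apply (is_lim_ext_loc (fun b => RInt (fun x => Re (tailf k w x)) 1 b - RInt (fun x => Re (tailf k s x)) 1 b -
       (Re h * RInt (fun x => Re (tailf (S k) s x)) 1 b -
        Im h * RInt (fun x => Im (tailf (S k) s x)) 1 b))).
    + exists 1; intros b Hb; symmetry; exact (is_RInt_unique _ _ _ _ (proj1 (I b (Rlt_le _ _ Hb)))).
    + replace (Re (tailk k w - tailk k s - h * tailk (S k) s)%C) with
       (Re (tailk k w) - Re (tailk k s) - (Re h * Re (tailk (S k) s) - Im h * Im (tailk (S k) s))) by (simpl; ring).
      repeat apply is_lim_minus'; auto.
  - apply (is_lim_ext_loc (fun b => RInt (fun x => Im (tailf k w x)) 1 b - RInt (fun x => Im (tailf k s x)) 1 b -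
       (Re h * RInt (fun x => Im (tailf (S k) s x)) 1 b +
        Im h * RInt (fun x => Re (tailf (S k) s x)) 1 b))).
    + exists 1; intros b Hb; symmetry; exact (is_RInt_unique _ _ _ _ (proj2 (I b (Rlt_le _ _ Hb)))).
    + replace (Im (tailk k w - tailk k s - h * tailk (S k) s)%C) with
       (Im (tailk k w) - Im (tailk k s) - (Re h * Im (tailk (S k) s) + Im h * Re (tailk (S k) s))) by (simpl; ring).
      apply is_lim_minus'; [apply is_lim_minus'|apply is_lim_plus']; auto.
Qed.

Definition rhp (s : C) : Prop := 0 < Re s.

Lemma copen_rhp : copen rhp.
Proof.
  intros z Hz; exists (Re z); split; auto; intros w Hw; unfold rhp in *.
  assert (A := Re_le_Cmod (w - z)); unfold Re in *; simpl in A.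
  assert (B := Rle_abs (- (fst w + - fst z))); rewrite Rabs_Ropp in B; lra.
Qed.

Lemma cdiff_tailk k s : rhp s -> cdiff (tailk k) s (tailk (S k) s).
Proof.
  intros Hs; unfold rhp in Hs; destruct (tailrem_bound k s Hs) as [K [HK HB]].
  apply cdiff_eps; intros e He.
  set (Q := 4 * K / Re s + 1).
  assert (HQ : 0 < Q) by (unfold Q; assert (0 <= 4 * K / Re s) by (apply Rdiv_le_0_compat; lra); lra).
  exists (Rmin (Re s / 4) (e / Q)); split.
  { apply Rmin_glb_lt; [lra|apply Rdiv_lt_0_compat; auto]. }
  intros w Hw; set (h := Cmod (w - s)) in *; assert (Hh : 0 <= h) by apply Cmod_ge_0.
  assert (Hw1 : h <= Re s / 4) by (eapply Rle_trans; [left; exact Hw|apply Rmin_l]).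
  assert (Hw2 : h <= e / Q) by (eapply Rle_trans; [left; exact Hw|apply Rmin_r]).
  assert (Hrw : 0 < Re w).
  { assert (A := Re_le_Cmod (w - s)); fold h in A; unfold Re in *; simpl in A.
    assert (B := Rle_abs (- (fst w + - fst s))); rewrite Rabs_Ropp in B; lra. }
  destruct (tailrem_lim k s w Hs Hrw) as [E [L1 L2]].
  assert (HhK : 0 <= h * h * K) by (apply Rmult_le_pos; [apply Rmult_le_pos|]; auto).
  assert (B1 := lim_bound_powd _ (h * h * K) (Re s / 2) _ ltac:(lra) HhK (fun b Hb => proj1 (E b Hb))
    (fun x Hx => Rle_trans _ _ _ (Re_le_Cmod _) (HB w x Hx Hw1)) L1).
  assert (B2 := lim_bound_powd _ (h * h * K) (Re s / 2) _ ltac:(lra) HhK (fun b Hb => proj2 (E b Hb))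
    (fun x Hx => Rle_trans _ _ _ (Im_le_Cmod _) (HB w x Hx Hw1)) L2).
  replace (tailk (S k) s * (w - s))%C with ((w - s) * tailk (S k) s)%C by ring.
  eapply Rle_trans; [apply Cmod_le_abs|].
  apply Rle_trans with (h * (h * (4 * K / Re s))).
  - eapply Rle_trans; [apply Rplus_le_compat; [exact B1|exact B2]|right; field; lra].
  - rewrite (Rmult_comm e); apply Rmult_le_compat_l; auto.
    apply Rle_trans with (e / Q * Q); [|right; field; lra].
    apply Rmult_le_compat; auto; [apply Rdiv_le_0_compat; lra|unfold Q; lra].
Qed.

Lemma Cn_tailk n k : Cn n rhp (tailk k).
Proof.
  revert k; induction n; intros k.
  - intros s Hs; exact (cdiff_continuous _ _ _ (cdiff_tailk k s Hs)).
  - exists (tailk (S k)); split; auto; intros; apply cdiff_tailk; auto.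
Qed.

(** [zetaF] with its removable singularity at [1] filled in. *)
Definition Fz (s : C) : C := (s - s * (s - 1) * tailk 0 s)%C.

Lemma Cn_Fz n : Cn n rhp Fz.
Proof.
  apply Cn_minus; [apply Cn_id|]; apply Cn_mult; [|apply Cn_tailk].
  apply Cn_mult; [apply Cn_id|]; apply Cn_minus; [apply Cn_id|apply Cn_const].
Qed.

Lemma Csub_neq (s w : C) : s <> w -> (s - w)%C <> RtoC 0.
Proof. intros H E; apply H; replace s with (s - w + w)%C by ring; rewrite E; ring. Qed.

Lemma zetaF_Fz s : rhp s -> s <> RtoC 1 -> zetaF s = Fz s.
Proof.
  intros Hs H1; unfold zetaF, zeta, Fz; rewrite zeta_tail_eq by auto.
  field; apply Csub_neq; auto.
Qed.

Lemma Fz_1 : Fz 1 = RtoC 1.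
Proof. unfold Fz; ring. Qed.

Lemma tailk0_bound s : rhp s -> Cmod (tailk 0 s) <= 2 / Re s.
Proof.
  intros Hs; unfold rhp in Hs; destruct (tailk_lim 0 s Hs) as [H1 H2].
  assert (B : forall x, 1 <= x -> Cmod (tailf 0 s x) <= 1 * powd (Re s) x).
  { intros x Hx; rewrite Cmod_tailf by auto; simpl; rewrite Rmult_1_r.
    apply Rmult_le_compat_r; [left; apply powd_pos|apply frac_part_bound]. }
  assert (B1 := lim_bound_powd _ 1 (Re s) _ Hs Rle_0_1 (ex_tailf_Re 0 s)
    (fun x Hx => Rle_trans _ _ _ (Re_le_Cmod _) (B x Hx)) H1).
  assert (B2 := lim_bound_powd _ 1 (Re s) _ Hs Rle_0_1 (ex_tailf_Im 0 s)
    (fun x Hx => Rle_trans _ _ _ (Im_le_Cmod _) (B x Hx)) H2).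
  eapply Rle_trans; [apply Cmod_le_abs|]; lra.
Qed.

(** The bound [frac_part x <= x - 1] in place of 1 gains a second power of [Re s], which is what
    compensates the factor [s (s - 1)] in [Fz]. *)
Lemma tailk0_bound_far s : 1 < Re s -> Cmod (tailk 0 s) <= 2 / (Re s * (Re s - 1)).
Proof.
  intros Hs; destruct (tailk_lim 0 s ltac:(lra)) as [H1 H2]; set (d := Re s) in *.
  set (g := fun x => powd (d - 1) x - powd d x).
  assert (Ig : forall b, 1 <= b -> ex_RInt g 1 b /\ RInt g 1 b <= 1 / (d * (d - 1))).
  { intros b Hb.
    assert (J1 := is_RInt_powd (d - 1) 1 b ltac:(lra) ltac:(lra)).
    assert (J2 := is_RInt_powd d 1 b ltac:(lra) ltac:(lra)).
    assert (J := is_RInt_Rminus _ _ _ _ _ _ J1 J2).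
    split; [eexists; exact J|]; rewrite (is_RInt_unique g _ _ _ J).
    rewrite ln_1, !Rmult_0_r, exp_0.
    assert (exp (- d * ln b) <= exp (- (d - 1) * ln b)).
    { apply exp_mono; generalize (ln_ge_0 b Hb); nra. }
    set (A := exp (- d * ln b)) in *; set (B := exp (- (d - 1) * ln b)) in *.
    assert (0 < A) by apply exp_pos.
    assert (A / d <= B / (d - 1)).
    { apply Rmult_le_compat; try lra; [left; apply Rinv_0_lt_compat; lra|].
      apply Rinv_le_contravar; lra. }
    replace (1 / (d * (d - 1))) with (1 / (d - 1) - 1 / d) by (field; lra); lra. }
  assert (Bx : forall x, 1 <= x -> Cmod (tailf 0 s x) <= g x).
  { intros x Hx; rewrite Cmod_tailf by auto; simpl; rewrite Rmult_1_r; fold d.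
    replace (g x) with ((x - 1) * powd d x).
    - apply Rmult_le_compat_r; [left; apply powd_pos|apply frac_part_le_sub; auto].
    - unfold g, powd; replace (- (1 + (d - 1)) * ln x) with (- (1 + d) * ln x + ln x) by ring.
      rewrite exp_plus, exp_ln by lra; ring. }
  assert (B1 : Rabs (Re (tailk 0 s)) <= 1 / (d * (d - 1))).
  { apply (is_lim_abs_le _ _ _ H1); intros b Hb; destruct (Ig b Hb) as [E1 E2].
    eapply Rle_trans; [apply (abs_RInt_le_fun _ g); auto; [apply ex_tailf_Re; auto|]|exact E2].
    intros; eapply Rle_trans; [apply Re_le_Cmod|apply Bx; lra]. }
  assert (B2 : Rabs (Im (tailk 0 s)) <= 1 / (d * (d - 1))).
  { apply (is_lim_abs_le _ _ _ H2); intros b Hb; destruct (Ig b Hb) as [E1 E2].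
    eapply Rle_trans; [apply (abs_RInt_le_fun _ g); auto; [apply ex_tailf_Im; auto|]|exact E2].
    intros; eapply Rle_trans; [apply Im_le_Cmod|apply Bx; lra]. }
  eapply Rle_trans; [apply Cmod_le_abs|]; lra.
Qed.

Lemma Fz_bound s : rhp s ->
  Cmod (Fz s) <= Cmod s + Cmod s * (Cmod s + 1) * (2 / Re s).
Proof.
  intros Hs; unfold Fz, Cminus at 1; eapply Rle_trans; [apply Cmod_triangle|].
  apply Rplus_le_compat_l; rewrite Cmod_opp, !Cmod_mult.
  apply Rmult_le_compat; [apply Rmult_le_pos; apply Cmod_ge_0|apply Cmod_ge_0| |apply tailk0_bound; auto].
  apply Rmult_le_compat_l; [apply Cmod_ge_0|].
  unfold Cminus; eapply Rle_trans; [apply Cmod_triangle|rewrite Cmod_opp, Cmod_1; lra].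
Qed.

(** In this sector [|s|] and [|s - 1|] are at most [sqrt 2] times their real parts, so the
    correction term stays bounded and [Fz s = s + O(1)]. This anchors the argument near 0 far to the
    right. *)
Lemma Fz_far s : 1 < Re s -> Rabs (Im s) <= Re s - 1 -> Cmod (Fz s - s) <= 4.
Proof.
  intros Hs Ht; set (d := Re s) in *; set (t := Im s) in *.
  assert (Ht2 : t * t <= (d - 1) * (d - 1)).
  { rewrite <- (Rabs_pos_eq (t * t)) by nra; rewrite Rabs_mult.
    apply Rmult_le_compat; auto using Rabs_pos. }
  assert (A1 : Cmod s * Cmod (s - 1) <= 2 * (d * (d - 1))).
  { apply Rsqr_incr_0_var; [|nra]; unfold Rsqr.
    replace (Cmod s * Cmod (s - 1) * (Cmod s * Cmod (s - 1))) with
      ((Cmod s * Cmod s) * (Cmod (s - 1) * Cmod (s - 1))) by ring.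
    rewrite !Cmod_sqr; fold d t.
    replace (Re (s - 1)%C) with (d - 1) by (unfold d, Re; simpl; ring).
    replace (Im (s - 1)%C) with t by (unfold t, Im; simpl; ring).
    apply Rle_trans with ((2 * (d * d)) * (2 * ((d - 1) * (d - 1)))); [|right; ring].
    apply Rmult_le_compat; nra. }
  replace (Fz s - s)%C with (- (s * (s - 1) * tailk 0 s))%C by (unfold Fz; ring).
  rewrite Cmod_opp, !Cmod_mult.
  apply Rle_trans with (2 * (d * (d - 1)) * (2 / (d * (d - 1)))); [|right; field; lra].
  apply Rmult_le_compat; auto; [apply Rmult_le_pos; apply Cmod_ge_0|apply Cmod_ge_0|].
  apply tailk0_bound_far; auto.
Qed.

Lemma Fz_far_Re s : 1 < Re s -> Rabs (Im s) <= Re s - 1 -> Re s - 4 <= Re (Fz s).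
Proof.
  intros Hs Ht; assert (A := Rle_trans _ _ _ (Re_le_Cmod (Fz s - s)) (Fz_far s Hs Ht)).
  replace (Re (Fz s - s)%C) with (Re (Fz s) - Re s) in A by (unfold Re; simpl; ring).
  generalize (Rle_abs (- (Re (Fz s) - Re s))); rewrite Rabs_Ropp; lra.
Qed.

Lemma Fz_far_Im s : 1 < Re s -> Rabs (Im s) <= Re s - 1 ->
  Rabs (Im (Fz s)) <= Rabs (Im s) + 4.
Proof.
  intros Hs Ht; assert (A := Rle_trans _ _ _ (Im_le_Cmod (Fz s - s)) (Fz_far s Hs Ht)).
  replace (Im (Fz s - s)%C) with (Im (Fz s) - Im s) in A by (unfold Im; simpl; ring).
  generalize (Rabs_triang (Im (Fz s) - Im s) (Im s)).
  replace (Im (Fz s) - Im s + Im s) with (Im (Fz s)) by ring; lra.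
Qed.

Lemma tailf_conj k s x : tailf k (Cconj s) x = Cconj (tailf k s x).
Proof.
  unfold tailf, cpow.
  replace (Re (- Cconj s - 1)%C) with (Re (- s - 1)%C) by (unfold Re; simpl; ring).
  replace (Im (- Cconj s - 1)%C) with (- Im (- s - 1)%C) by (unfold Im; simpl; ring).
  rewrite Ropp_mult_distr_l_reverse, cos_neg, sin_neg; creal; ring.
Qed.

Lemma tailk_conj k s : rhp s -> tailk k (Cconj s) = Cconj (tailk k s).
Proof.
  intros Hs; destruct (tailk_lim k s Hs) as [A1 A2].
  assert (L1 : is_lim (fun b => RInt (fun x => Re (tailf k (Cconj s) x)) 1 b) p_infty (Re (tailk k s))).
  { apply is_lim_ext_loc with (2 := A1); exists 1; intros b Hb.
    apply RInt_extR; [lra|]; intros; rewrite tailf_conj; reflexivity. }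
  assert (L2 : is_lim (fun b => RInt (fun x => Im (tailf k (Cconj s) x)) 1 b) p_infty (- 1 * Im (tailk k s))).
  { apply (is_lim_ext_loc (fun b => - 1 * RInt (fun x => Im (tailf k s x)) 1 b)).
    - exists 1; intros b Hb; rewrite <- RInt_Rscal by (apply ex_tailf_Im; lra).
      apply RInt_extR; [lra|]; intros; rewrite tailf_conj; unfold Im; simpl; ring.
    - exact (is_lim_scal_l _ (- 1) p_infty _ A2). }
  unfold tailk at 1; rewrite (is_lim_unique _ _ _ L1), (is_lim_unique _ _ _ L2).
  creal; unfold Re, Im; ring.
Qed.

Lemma Fz_conj s : rhp s -> Fz (Cconj s) = Cconj (Fz s).
Proof. intros Hs; unfold Fz; rewrite tailk_conj by auto; creal; ring. Qed.

(** With [T] the real tail, [Fz x = x (1 - (x - 1) T)] and [0 <= T <= 1/x], so the bracket is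
    positive on either side of 1. In particular no zero is real. *)
Lemma Fz_real (x : R) : 0 < x -> 0 < Re (Fz x) /\ Im (Fz x) = 0.
Proof.
  intros Hx.
  assert (Hr : rhp x) by exact Hx.
  assert (E : Im (tailk 0 x) = 0).
  { assert (A := tailk_conj 0 x Hr).
    replace (Cconj x) with (RtoC x) in A by (creal; ring).
    apply (f_equal snd) in A; unfold Im; simpl in A; simpl; lra. }
  destruct (tailk_lim 0 x Hx) as [H1 _].
  assert (B : forall y, 1 <= y -> 0 <= Re (tailf 0 x y) <= powd x y).
  { intros y Hy; unfold tailf, cpow.
    replace (Im (- x - 1)%C) with 0 by (unfold Im; simpl; ring).
    replace (Re (- x - 1)%C) with (- (1 + x)) by (unfold Re; simpl; ring).
    rewrite Rmult_0_l, cos_0, sin_0; fold (powd x y).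
    replace (Re _) with (frac_part y * powd x y) by (unfold Re; simpl; ring).
    generalize (frac_part_bound y) (powd_pos x y); nra. }
  assert (P1 : 0 <= Re (tailk 0 x)).
  { apply (is_lim_le_loc (fun _ => 0) _ p_infty 0 _) with (2 := is_lim_const 0 p_infty) (3 := H1).
    exists 1; intros b Hb; apply RInt_ge_0; [lra|apply ex_tailf_Re; lra|].
    intros; apply B; lra. }
  assert (P2 : Rabs (Re (tailk 0 x)) <= 1 / x).
  { apply (lim_bound_powd _ 1 x _ Hx Rle_0_1 (ex_tailf_Re 0 x)) with (2 := H1).
    intros y Hy; destruct (B y Hy); rewrite Rabs_pos_eq; lra. }
  rewrite Rabs_pos_eq in P2 by auto.
  assert (E2 : Fz x = RtoC (x * (1 - (x - 1) * Re (tailk 0 x)))).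
  { unfold Fz; rewrite (RtoC_Im0 _ E); creal; ring. }
  rewrite E2; split; [|reflexivity]; change (0 < x * (1 - (x - 1) * Re (tailk 0 x))).
  apply Rmult_lt_0_compat; auto; set (T := Re (tailk 0 x)) in *.
  destruct (Rle_or_lt x 1); [nra|].
  assert ((x - 1) * T <= (x - 1) * (1 / x)) by (apply Rmult_le_compat_l; lra).
  assert ((x - 1) * (1 / x) = 1 - / x) by (field; lra).
  assert (0 < / x) by (apply Rinv_0_lt_compat; auto); lra.
Qed.

(** * Arguments *)

Lemma IVT_le (f : R -> R) a b v : a <= b ->
  (forall x, a <= x <= b -> continuous f x) ->
  f a <= v <= f b \/ f b <= v <= f a -> exists c, a <= c <= b /\ f c = v.
Proof.
  intros Hab Hc Hv.
  destruct (Req_dec (f a) v) as [E|Na]; [exists a; split; [lra|auto]|].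
  destruct (Req_dec (f b) v) as [E|Nb]; [exists b; split; [lra|auto]|].
  destruct (Req_dec a b) as [->|Hn]; [exfalso; lra|].
  destruct Hv as [Hv|Hv].
  - destruct (IVT_interv (fun x => f x - v) a b) as [c [Hc1 Hc2]]; try lra.
    + intros x Hx; apply continuous_continuity_pt; apply continuous_Rminus;
        [auto|apply continuous_const].
    + exists c; split; auto; lra.
  - destruct (IVT_interv (fun x => v - f x) a b) as [c [Hc1 Hc2]]; try lra.
    + intros x Hx; apply continuous_continuity_pt; apply continuous_Rminus;
        [apply continuous_const|auto].
    + exists c; split; auto; lra.
Qed.

Lemma int_valued_const (f : R -> R) a b : 
  (forall x, a <= x <= b -> continuous f x) ->
  (forall x, a <= x <= b -> exists k : Z, f x = IZR k) ->
  forall x y, a <= x <= y -> y <= b -> f x = f y.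
Proof.
  intros Hc Hz x y Hx Hy.
  destruct (Hz x ltac:(lra)) as [k Hk]; destruct (Hz y ltac:(lra)) as [m Hm].
  destruct (Z.eq_dec k m) as [->|Hn]; [congruence|exfalso].
  assert (E : (k + 1 <= m \/ m + 1 <= k)%Z) by lia.
  assert (HI : exists c, x <= c <= y /\ f c = IZR (Z.min k m) + / 2).
  { apply IVT_le; [lra|intros; apply Hc; lra|].
    rewrite Hk, Hm; destruct E as [E|E].
    - rewrite Z.min_l by lia; apply IZR_le in E; rewrite plus_IZR in E; left; lra.
    - rewrite Z.min_r by lia; apply IZR_le in E; rewrite plus_IZR in E; right; lra. }
  destruct HI as [c [Hc1 Hc2]]; destruct (Hz c ltac:(lra)) as [j Hj].
  rewrite Hj in Hc2.
  assert (A1 : IZR (Z.min k m) < IZR j) by lra.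
  assert (A2 : IZR j < IZR (Z.min k m + 1)) by (rewrite plus_IZR; lra).
  apply lt_IZR in A1; apply lt_IZR in A2; lia.
Qed.

(** Every [t] qualifies at [z = 0], so products need no side condition; the uniqueness lemmas assume
    [z] nonzero instead. *)
Definition isarg (z : C) (t : R) : Prop := z = (Cmod z * cos t, Cmod z * sin t).

Lemma isarg_polar (r t : R) : 0 <= r -> isarg (r * cos t, r * sin t) t.
Proof.
  intros Hr; unfold isarg; replace (Cmod _) with r; auto.
  symmetry; replace ((r * cos t)%R, (r * sin t)%R) with (RtoC r * (cos t, sin t))%C by (creal; ring).
  rewrite Cmod_mult, Cmod_R, Rabs_pos_eq by auto.
  replace (Cmod (cos t, sin t)) with 1; [ring|].
  unfold Cmod; simpl; rewrite !Rmult_1_r, sin2cos2, sqrt_1; auto.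
Qed.

Lemma isarg_intro z r t : 0 <= r -> z = (r * cos t, r * sin t) -> isarg z t.
Proof. intros Hr ->; apply isarg_polar; auto. Qed.

Lemma isarg_mult z w a b : isarg z a -> isarg w b -> isarg (z * w) (a + b).
Proof.
  intros Hz Hw; apply isarg_intro with (Cmod z * Cmod w).
  { apply Rmult_le_pos; apply Cmod_ge_0. }
  rewrite Hz at 1; rewrite Hw at 1; rewrite cos_plus, sin_plus; creal; ring.
Qed.

Lemma isarg_conj z a : isarg z a -> isarg (Cconj z) (- a).
Proof.
  intros Hz; apply isarg_intro with (Cmod z); [apply Cmod_ge_0|].
  rewrite Hz at 1; rewrite cos_neg, sin_neg; creal; ring.
Qed.

Lemma isarg_inv z a : isarg z a -> isarg (/ z) (- a).
Proof.
  intros Hz; destruct (Ceq_dec z 0) as [E|H0].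
  - apply isarg_intro with 0; [lra|]; rewrite E; creal; unfold Rdiv; simpl; ring.
  - assert (P := Cmod_pos _ H0); apply isarg_intro with (/ Cmod z).
    { left; apply Rinv_0_lt_compat; auto. }
    assert (Q := sin2cos2 a); rewrite cos_neg, sin_neg.
    assert (E : z = (RtoC (Cmod z) * (cos a, sin a))%C) by (rewrite Hz at 1; creal; ring).
    rewrite E at 1; unfold Cinv; simpl.
    replace ((Cmod z * cos a - 0 * sin a) * ((Cmod z * cos a - 0 * sin a) * 1) +
      (Cmod z * sin a + 0 * cos a) * ((Cmod z * sin a + 0 * cos a) * 1)) with (Cmod z * Cmod z).
    + creal; field; lra.
    + transitivity (Cmod z * Cmod z * (cos a * cos a + sin a * sin a)); [rewrite Q; ring|ring].
Qed.

Lemma isarg_div z w a b : isarg z a -> isarg w b -> isarg (z / w) (a - b).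
Proof. intros; apply isarg_mult; auto; apply isarg_inv; auto. Qed.

Lemma isarg_pos (r : R) : 0 <= r -> isarg r 0.
Proof.
  intros; apply isarg_intro with r; auto; rewrite cos_0, sin_0; creal; ring.
Qed.

Lemma isarg_cexp z : isarg (cexp z) (Im z).
Proof. apply isarg_polar; left; apply exp_pos. Qed.

Lemma isarg_mod z a b : z <> RtoC 0 -> isarg z a -> isarg z b ->
  exists k : Z, a - b = 2 * PI * IZR k.
Proof.
  intros H0 Ha Hb; assert (P := Cmod_pos _ H0).
  unfold isarg in Ha; rewrite Hb in Ha at 1; injection Ha; intros Es Ec.
  apply Rmult_eq_reg_l in Es; [|lra]; apply Rmult_eq_reg_l in Ec; [|lra].
  assert (S : sin ((a - b) / 2) = 0).
  { assert (E : cos (a - b) = 1).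
    { rewrite cos_minus, <- Es, <- Ec; apply sin2cos2. }
    replace (a - b) with (2 * ((a - b) / 2)) in E by field.
    rewrite cos_2a_sin in E; nra. }
  destruct (sin_eq_0_0 _ S) as [k Hk]; exists k; lra.
Qed.

Lemma isarg_eq z a b : z <> RtoC 0 -> isarg z a -> isarg z b ->
  Rabs (a - b) < 2 * PI -> a = b.
Proof.
  intros H0 Ha Hb H; destruct (isarg_mod z a b H0 Ha Hb) as [k Hk].
  generalize PI_RGT_0; intros HP.
  rewrite Hk, Rabs_mult, Rabs_pos_eq in H by lra.
  assert (K : Rabs (IZR k) < 1).
  { apply Rmult_lt_reg_l with (2 * PI); lra. }
  rewrite <- abs_IZR in K; apply lt_IZR in K.
  assert (k = 0%Z) by lia; subst k; rewrite Rmult_0_r in Hk; lra.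
Qed.

(** The difference divided by [2 PI] is continuous and integer-valued, hence constant. *)
Lemma isarg_unique_cont (zz : R -> C) (f g : R -> R) a b c :
  (forall x, a <= x <= b -> zz x <> RtoC 0) ->
  (forall x, a <= x <= b -> isarg (zz x) (f x)) ->
  (forall x, a <= x <= b -> isarg (zz x) (g x)) ->
  (forall x, a <= x <= b -> continuous f x) ->
  (forall x, a <= x <= b -> continuous g x) ->
  a <= c <= b -> f c = g c -> forall x, a <= x <= b -> f x = g x.
Proof.
  intros HZ Hf Hg Cf Cg Hc E x Hx; generalize PI_RGT_0; intros HP.
  set (h := fun x => (f x - g x) * / (2 * PI)).
  assert (Ch : forall x, a <= x <= b -> continuous h x).
  { intros; apply continuous_Rmult; [apply continuous_Rminus; auto|apply continuous_const]. }
  assert (Ih : forall x, a <= x <= b -> exists k : Z, h x = IZR k).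
  { intros y Hy; destruct (isarg_mod _ _ _ (HZ y Hy) (Hf y Hy) (Hg y Hy)) as [k Hk].
    exists k; unfold h; rewrite Hk; field; lra. }
  assert (h x = h c).
  { destruct (Rle_or_lt x c);
      [|symmetry]; apply (int_valued_const h a b); auto; lra. }
  unfold h in H; apply Rmult_eq_reg_r in H; [|apply Rinv_neq_0_compat; lra]; lra.
Qed.

(** Principal argument, in [(-PI, PI]]; the value [PI] is also given at [0]. *)
Definition Arg (z : C) : R :=
  if excluded_middle_informative (Re z <= 0 /\ Im z = 0) then PI
  else 2 * atan (Im z / (Cmod z + Re z)).

Lemma Cmod_plus_Re_pos z : ~ (Re z <= 0 /\ Im z = 0) -> 0 < Cmod z + Re z.
Proof.
  intros H; assert (A := Cmod_sqr z); assert (B := Re_le_Cmod z).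
  assert (P := Cmod_ge_0 z); assert (Q := Rle_abs (- Re z)); rewrite Rabs_Ropp in Q.
  destruct (Req_dec (Cmod z + Re z) 0) as [E|]; [|lra].
  exfalso; apply H; split; [lra|].
  replace (Cmod z) with (- Re z) in A by lra; nra.
Qed.

(** The quotient [Im z / (|z| + Re z)] is the tangent of half the argument, so the double-angle
    formulas recover cosine and sine without a split into quadrants. *)
Lemma isarg_Arg z : isarg z (Arg z).
Proof.
  assert (A := Cmod_sqr z); assert (P := Cmod_ge_0 z).
  unfold isarg, Arg; destruct excluded_middle_informative as [[H1 H2]|H].
  - rewrite cos_PI, sin_PI; creal; [|unfold Im in H2; lra].
    rewrite H2 in A; unfold Re in *; nra.
  - assert (Q := Cmod_plus_Re_pos z H).
    set (q := Im z / (Cmod z + Re z)).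
    assert (Cq : 0 < 1 + q * q) by (generalize (Rle_0_sqr q); unfold Rsqr; lra).
    assert (E1 : cos (2 * atan q) = (1 - q * q) / (1 + q * q)).
    { rewrite cos_2a_cos, cos_atan; unfold Rsqr.
      assert (S := sqrt_sqrt (1 + q * q) ltac:(lra)).
      assert (0 < sqrt (1 + q * q)) by (apply sqrt_lt_R0; auto).
      replace (2 * (1 / sqrt (1 + q * q)) * (1 / sqrt (1 + q * q)) - 1) with
        (2 / (sqrt (1 + q * q) * sqrt (1 + q * q)) - 1) by (field; lra).
      rewrite S; field; lra. }
    assert (E2 : sin (2 * atan q) = 2 * q / (1 + q * q)).
    { rewrite sin_2a, cos_atan, sin_atan; unfold Rsqr.
      assert (S := sqrt_sqrt (1 + q * q) ltac:(lra)).
      assert (0 < sqrt (1 + q * q)) by (apply sqrt_lt_R0; auto).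
      replace (2 * (q / sqrt (1 + q * q)) * (1 / sqrt (1 + q * q))) with
        (2 * q / (sqrt (1 + q * q) * sqrt (1 + q * q))) by (field; lra).
      rewrite S; field; lra. }
    rewrite E1, E2; unfold q in *.
    set (x := Re z) in *; set (y := Im z) in *; set (m := Cmod z) in *.
    assert (N : 0 < (m + x) * (m + x) + y * y) by nra.
    assert (M0 : m <> 0) by (intros M0; rewrite M0 in A; nra).
    assert (Y : y * y = (m - x) * (m + x)) by lra.
    replace z with ((x, y) : C) by (destruct z; reflexivity).
    assert (Y2 : (m + x) * (m + x) + y * y = 2 * m * (m + x)) by (rewrite Y; ring).
    assert (W : 1 + y / (m + x) * (y / (m + x)) = 2 * m / (m + x)).
    { replace (1 + y / (m + x) * (y / (m + x))) with (((m + x) * (m + x) + y * y) / ((m + x) * (m + x))) by (field; lra).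
      rewrite Y2; field; lra. }
    rewrite W; apply injective_projections; cbv [fst snd].
    + replace (1 - y / (m + x) * (y / (m + x))) with (2 * x / (m + x)).
      * field; lra.
      * replace (1 - y / (m + x) * (y / (m + x))) with (((m + x) * (m + x) - y * y) / ((m + x) * (m + x))) by (field; lra).
        rewrite Y; field; lra.
    + field; lra.
Qed.

Lemma Arg_bound z : - PI < Arg z <= PI.
Proof.
  generalize PI_RGT_0; intros HP.
  unfold Arg; destruct excluded_middle_informative; [lra|].
  generalize (atan_bound (Im z / (Cmod z + Re z))); lra.
Qed.

Lemma Arg_pos_real z : 0 < Re z -> Im z = 0 -> Arg z = 0.
Proof.
  intros H1 H2; unfold Arg; destruct excluded_middle_informative; [lra|].
  rewrite H2; unfold Rdiv; rewrite Rmult_0_l, atan_0; ring.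
Qed.

Lemma Arg_Im_pos z : 0 < Im z -> 0 < Arg z < PI.
Proof.
  intros H; unfold Arg; destruct excluded_middle_informative as [|N]; [lra|].
  assert (Q := Cmod_plus_Re_pos z N).
  generalize (atan_bound (Im z / (Cmod z + Re z))).
  assert (0 < atan (Im z / (Cmod z + Re z))); [|lra].
  rewrite <- atan_0; apply atan_increasing; apply Rdiv_lt_0_compat; auto.
Qed.

Lemma Arg_Im_neg z : Im z < 0 -> - PI < Arg z < 0.
Proof.
  intros H; unfold Arg; destruct excluded_middle_informative as [|N]; [lra|].
  assert (Q := Cmod_plus_Re_pos z N).
  generalize (atan_bound (Im z / (Cmod z + Re z))).
  assert (atan (Im z / (Cmod z + Re z)) < 0); [|lra].
  rewrite <- atan_0; apply atan_increasing.
  assert (0 < - Im z / (Cmod z + Re z)) by (apply Rdiv_lt_0_compat; lra).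
  replace (- Im z / (Cmod z + Re z)) with (- (Im z / (Cmod z + Re z))) in * by (field; lra); lra.
Qed.

Lemma Arg_Im_nonneg z : 0 <= Im z -> 0 <= Arg z <= PI.
Proof.
  generalize PI_RGT_0; intros HP [H|H].
  - generalize (Arg_Im_pos z H); lra.
  - destruct (Rle_or_lt (Re z) 0) as [Hr|Hr].
    + unfold Arg; destruct excluded_middle_informative; [lra|]; exfalso; auto.
    + rewrite Arg_pos_real; auto; lra.
Qed.

Lemma Arg_Re_pos z : 0 < Re z -> - (PI / 2) < Arg z < PI / 2.
Proof.
  intros H; generalize PI_RGT_0 (Arg_bound z); intros HP B.
  assert (Hc : 0 < cos (Arg z)).
  { assert (A := isarg_Arg z); unfold isarg in A; apply (f_equal fst) in A; simpl in A.
    unfold Re in H; generalize (Cmod_ge_0 z); intros.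
    destruct (Rle_or_lt (cos (Arg z)) 0); auto; nra. }
  split.
  - destruct (Rlt_or_le (- (PI / 2)) (Arg z)) as [|N]; auto; exfalso.
    assert (cos (- Arg z) <= 0) by (apply cos_le_0; lra).
    rewrite cos_neg in *; lra.
  - destruct (Rlt_or_le (Arg z) (PI / 2)) as [|N]; auto; exfalso.
    assert (cos (Arg z) <= 0) by (apply cos_le_0; lra); lra.
Qed.

Lemma continuous_Cmod z : continuous Cmod z.
Proof.
  intros P [e HP].
  assert (He := cond_pos e).
  destruct (proj1 (continuous_C_eps (fun w => w) z) (continuous_id z) e He) as [d [Hd H]].
  assert (Hd' : 0 < Rmin (d / 2) (e / 2)) by (apply Rmin_glb_lt; lra).
  exists (mkposreal _ Hd'); intros w [B1 B2]; apply HP.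
  unfold ball in B1, B2; simpl in B1, B2;
    unfold AbsRing_ball, abs, minus, plus, opp in B1, B2; simpl in B1, B2.
  unfold ball; simpl; unfold AbsRing_ball, abs, minus, plus, opp; simpl.
  generalize (Rmin_r (d / 2) (e / 2)); intros M.
  assert (Hw : Cmod (w - z) < e).
  { eapply Rle_lt_trans; [apply Cmod_le_abs|]; unfold Re, Im; simpl; lra. }
  apply Rabs_def1.
  - generalize (Cmod_sub_ge w z); lra.
  - generalize (Cmod_sub_ge z w); rewrite Cmod_sub_sym; lra.
Qed.

Lemma continuous_Arg z : ~ (Re z <= 0 /\ Im z = 0) -> continuous Arg z.
Proof.
  intros N.
  assert (Q := Cmod_plus_Re_pos z N).
  apply continuous_ext_loc with (fun z => 2 * atan (Im z / (Cmod z + Re z))).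
  - assert (Cn : continuous (fun w : C => Cmod w + Re w) z).
    { apply continuous_Rplus; [apply continuous_Cmod|].
      apply (continuous_ReC (fun w => w)); apply continuous_id. }
    assert (He : 0 < Cmod z + Re z) by auto.
    destruct (Cn _ (locally_ball _ (mkposreal _ He))) as [d Hd].
    exists d; intros w Hw; specialize (Hd w Hw).
    unfold ball in Hd; simpl in Hd; unfold AbsRing_ball, abs, minus, plus, opp in Hd; simpl in Hd.
    apply Rabs_def2 in Hd.
    unfold Arg; destruct excluded_middle_informative as [[H1 H2]|]; auto.
    assert (A := Cmod_sqr w); rewrite H2 in A; assert (P := Cmod_ge_0 w).
    assert (Cmod w = - Re w) by nra. lra.
  - apply continuous_Rmult; [apply continuous_const|].
    apply (continuous_comp (fun z : C => Im z / (Cmod z + Re z)) atan).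
    + apply continuous_Rdiv; [| |lra].
      * apply (continuous_ImC (fun w => w)); apply continuous_id.
      * apply continuous_Rplus; [apply continuous_Cmod|].
        apply (continuous_ReC (fun w => w)); apply continuous_id.
    + apply continuity_pt_filterlim; apply derivable_continuous_pt.
      eexists; apply derivable_pt_lim_atan.
Qed.

Lemma Arg_Im_pos_atan z : 0 < Im z -> Arg z = PI / 2 - atan (Re z / Im z).
Proof.
  intros H; generalize PI_RGT_0 (Arg_Im_pos z H) (atan_bound (Re z / Im z)); intros HP B A.
  assert (N : z <> RtoC 0) by (intros E; rewrite E in H; simpl in H; lra).
  apply isarg_eq with z; auto; [apply isarg_Arg| |apply Rabs_def1; lra].
  set (q := Re z / Im z).
  assert (0 < sqrt (1 + q * q)).
  { apply sqrt_lt_R0; generalize (Rle_0_sqr q); unfold Rsqr; lra. }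
  apply isarg_intro with (Im z * sqrt (1 + q * q)); [nra|].
  rewrite cos_shift, sin_shift, sin_atan, cos_atan; unfold Rsqr.
  creal; unfold q, Re, Im in *; field; try split; lra.
Qed.

Lemma Arg_conj z : ~ (Re z <= 0 /\ Im z = 0) -> Arg (Cconj z) = - Arg z.
Proof.
  intros N; unfold Arg; simpl.
  destruct excluded_middle_informative as [[H1 H2]|].
  { exfalso; apply N; unfold Re, Im in *; simpl in *; split; lra. }
  destruct excluded_middle_informative as [[H1 H2]|]; [tauto|].
  rewrite Cmod_conj; unfold Im, Re; simpl.
  rewrite Ropp_mult_distr_r, <- atan_opp; do 2 f_equal.
  unfold Rdiv; ring.
Qed.

(** The value [PI] on the cut is the limit from the upper half plane, the same convention as for the
    argument in the theorem. The proof turns [z] to the positive axis, where [Arg] is continuous. *)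
Lemma continuous_Arg_above z : Re z < 0 -> Im z = 0 ->
  forall e, 0 < e -> exists d, 0 < d /\
    forall h, 0 < h < d -> Rabs (Arg (z + (0, h)) - Arg z) < e.
Proof.
  intros H1 H2 e He; generalize PI_RGT_0; intros HP.
  assert (E : Arg z = PI).
  { unfold Arg; destruct excluded_middle_informative; auto; exfalso; lra. }
  assert (C1 : continuous Arg (- z)%C).
  { apply continuous_Arg; unfold Re, Im in *; simpl; lra. }
  assert (E0 : Arg (- z)%C = 0) by (apply Arg_pos_real; unfold Re, Im in *; simpl; lra).
  destruct (C1 _ (locally_ball _ (mkposreal e He))) as [d Hd].
  exists d; split; [apply cond_pos|]; intros h Hh.
  assert (B : ball (M := C_UniformSpace) (- z)%C d (- z - (0, h))%C).
  { split; unfold ball; simpl; unfold AbsRing_ball, abs, minus, plus, opp; simpl.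
    - match goal with |- Rabs ?x < _ => replace x with 0 by ring end.
      rewrite Rabs_R0; apply cond_pos.
    - match goal with |- Rabs ?x < _ => replace x with (- h) by ring end.
      rewrite Rabs_Ropp, Rabs_pos_eq; lra. }
  specialize (Hd _ B); unfold ball in Hd; simpl in Hd;
    unfold AbsRing_ball, abs, minus, plus, opp in Hd; simpl in Hd; rewrite E0 in Hd.
  set (w := (z + (0, h))%C) in *.
  replace (- z - (0, h))%C with (- w)%C in Hd by (unfold w; ring).
  assert (Hw : 0 < Im w) by (unfold w, Im in *; simpl; lra).
  assert (Hw' : Im (- w)%C < 0) by (unfold Im in *; simpl; lra).
  replace (Arg w) with (Arg (- w)%C + PI).
  - rewrite E; replace (Arg (- w)%C + PI - PI) with (Arg (- w)%C + - 0) by ring; auto.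
  - assert (A1 := Arg_Im_pos w Hw); assert (A2 := Arg_Im_neg _ Hw').
    assert (N : w <> RtoC 0) by (intros E1; rewrite E1 in Hw; simpl in Hw; lra).
    apply isarg_eq with w; auto; [|apply isarg_Arg|apply Rabs_def1; lra].
    replace w with ((- w) * (- RtoC 1))%C at 1 by ring.
    apply isarg_mult; [apply isarg_Arg|].
    apply isarg_intro with 1; [lra|]; rewrite cos_PI, sin_PI; creal; ring.
Qed.

(** * Division by linear factors *)

Lemma continuous_eq_off_point (f g : C -> C) z d : 0 < d ->
  continuous f z -> continuous g z ->
  (forall w, w <> z -> Cmod (w - z) < d -> f w = g w) -> f z = g z.
Proof.
  intros Hd Hf Hg H.
  destruct (Ceq_dec (f z) (g z)) as [|N]; auto; exfalso.
  assert (P := Cmod_pos _ (Csub_neq _ _ N)).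
  set (e := Cmod (f z - g z) / 2) in *; assert (He : 0 < e) by (unfold e; lra).
  destruct (proj1 (continuous_C_eps f z) Hf e He) as [d1 [Hd1 H1]].
  destruct (proj1 (continuous_C_eps g z) Hg e He) as [d2 [Hd2 H2]].
  set (r := Rmin d (Rmin d1 d2) / 2).
  assert (Hr : 0 < Rmin d (Rmin d1 d2)) by (repeat apply Rmin_glb_lt; auto).
  assert (M1 := Rmin_l d (Rmin d1 d2)); assert (M2 := Rmin_r d (Rmin d1 d2)).
  assert (M3 := Rmin_l d1 d2); assert (M4 := Rmin_r d1 d2).
  set (w := (z + RtoC r)%C).
  assert (E : Cmod (w - z) = r).
  { unfold w; replace (z + r - z)%C with (RtoC r) by ring.
    rewrite Cmod_R, Rabs_pos_eq; unfold r; lra. }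
  assert (Nw : w <> z).
  { intros E'; rewrite E' in E; replace (z - z)%C with (RtoC 0) in E by ring.
    rewrite Cmod_0 in E; unfold r in E; lra. }
  assert (A := H w Nw ltac:(unfold r in *; lra)).
  specialize (H1 w ltac:(unfold r in *; lra)); specialize (H2 w ltac:(unfold r in *; lra)).
  rewrite A, Cmod_sub_sym in H1.
  assert (T := Cmod_triangle (f z - g w) (g w - g z)).
  replace (f z - g w + (g w - g z))%C with (f z - g z)%C in T by ring.
  unfold e in *; lra.
Qed.

Lemma cdiff_unique f z l m : cdiff f z l -> cdiff f z m -> l = m.
Proof.
  intros [p [Hp [<- Cp]]] [q [Hq [<- Cq]]].
  apply continuous_eq_off_point with 1; auto; [lra|].
  intros w Nw _; assert (E := Hq w); rewrite (Hp w) in E.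
  assert (N := Csub_neq _ _ Nw).
  assert (E' : (p w * (w - z) = q w * (w - z))%C).
  { replace (p w * (w - z))%C with (f z + p w * (w - z) - f z)%C by ring.
    rewrite E; ring. }
  replace (p w) with (p w * (w - z) / (w - z))%C by (field; auto).
  rewrite E'; field; auto.
Qed.

Definition Cinf (D : C -> Prop) (f : C -> C) : Prop := forall n, Cn n D f.

(** Hadamard's lemma: the quotient is the integral of [f'] over the segment from [c] to [s], so it
    inherits smoothness and is defined at [c] as well. *)
Lemma Cinf_quotient D f c :
  copen D -> star D c -> Cinf D f -> f c = RtoC 0 ->
  exists g, Cinf D g /\ forall s, D s -> f s = ((s - c) * g s)%C.
Proof.
  intros HO HD Hf H0.
  destruct (Hf 1%nat) as [f' [Hd Cf']].
  (* Each order supplies its own first derivative; uniqueness of derivatives identifies them all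
     with [f']. *)
  assert (Hf' : Cinf D f').
  { intros n; destruct (Hf (S n)) as [f1 [Hd1 H1]].
    apply Cn_ext with f1; auto; intros z Hz; eapply cdiff_unique; eauto. }
  exists (segint 0 f' c); split; [intros n; apply segint_Cn; auto|].
  intros s Hs.
  assert (Cc : forall z, D z -> continuous f' z) by exact Cf'.
  unfold segint; rewrite <- Cint_scal by (apply cont01_segint with D; auto).
  rewrite (Cint_derive (fun u => f (seg c s u))).
  - rewrite seg_1, seg_0, H0; ring.
  - intros u Hu.
    replace ((s - c) * (RtoC (u ^ 0) * f' (seg c s u)))%C with
      (f' (seg c s u) * (s - c))%C by (simpl; ring).
    apply cdiff_seg; auto.
  - intros u Hu; apply continuous_Cmult; [apply continuous_const|].
    apply (cont01_segint 0 D f' c s); auto.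
Qed.

Lemma star_rhp c : rhp c -> star rhp c.
Proof.
  intros Hc s u Hs Hu; unfold rhp, seg, Re in *; simpl.
  replace (fst c + (u * (fst s + - fst c) - 0 * (snd s + - snd c)))
    with ((1 - u) * fst c + u * fst s) by ring.
  destruct (Req_dec u 0) as [->|]; [lra|].
  assert (0 < u * fst s) by (apply Rmult_lt_0_compat; lra).
  assert (0 <= (1 - u) * fst c) by (apply Rmult_le_pos; lra); lra.
Qed.

Lemma zeros_factor f l : Cinf rhp f -> NoDup l ->
  (forall rho, In rho l -> rhp rho /\ f rho = RtoC 0) ->
  exists g, Cinf rhp g /\ forall s, rhp s -> f s = (zprod l s * g s)%C.
Proof.
  revert f; induction l as [|c l IH]; intros f Hf Hl H0.
  - exists f; split; auto; intros; unfold zprod; simpl; ring.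
  - destruct (H0 c (or_introl eq_refl)) as [Hc Hc0].
    destruct (Cinf_quotient rhp f c copen_rhp (star_rhp c Hc) Hf Hc0) as [g [Hg E]].
    inversion Hl as [|c' l' Nc Nl]; subst.
    destruct (IH g Hg Nl) as [k [Hk E']].
    { intros rho Hr; destruct (H0 rho (or_intror Hr)) as [A B]; split; auto.
      assert (N : (rho - c)%C <> RtoC 0) by (apply Csub_neq; intros ->; auto).
      rewrite (E rho A) in B.
      replace (g rho) with ((rho - c) * g rho / (rho - c))%C by (field; auto).
      rewrite B; field; auto. }
    exists k; split; auto; intros s Hs.
    rewrite (E s Hs), (E' s Hs); simpl; ring.
Qed.

(** * Factoring out the zeros *)

(** Pairing with the conjugate keeps the factor real on the real axis. The denominator normalises it
    to 1 at [s = 1], the point sent to the centre of the disc. *)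
Definition pfac (rho s : C) : C :=
  ((s - rho) * (s - Cconj rho) / RtoC (Cmod (1 - rho) * Cmod (1 - rho)))%C.

Definition pprod (l : list C) (s : C) : C :=
  fold_right (fun rho acc => (pfac rho s * acc)%C) (RtoC 1) l.

(** The bound [1/4] leaves room on both sides: it is inside [Re s > 0], where [Fz] is smooth, and
    strictly left of the line [Re s = 1 - a >= 1/2]. *)
Definition strip (T : R) (s : C) : Prop := 1 / 4 < Re s /\ Rabs (Im s) < T.

(** [Fz] with finitely many conjugate pairs of zeros divided out. *)
Definition partial_fact (T : R) (l : list C) (G : C -> C) : Prop :=
  (forall rho, In rho l -> 1 / 4 < Re rho /\ 0 < Im rho < T) /\
  (forall s, rhp s -> Fz s = (pprod l s * G s)%C) /\
  Cinf rhp G /\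
  (forall s, rhp s -> G (Cconj s) = Cconj (G s)).

Lemma Cmod_1_sub_pos rho : 0 < Im rho -> 0 < Cmod (1 - rho).
Proof.
  intros H; apply Cmod_pos; intros E; apply (f_equal snd) in E.
  unfold Im in H; simpl in E; lra.
Qed.

Lemma pfac_1 rho : 0 < Im rho -> pfac rho 1 = RtoC 1.
Proof.
  intros H; assert (P := Cmod_1_sub_pos rho H); unfold pfac.
  replace ((1 - rho) * (1 - Cconj rho))%C with (RtoC (Cmod (1 - rho) * Cmod (1 - rho))).
  - assert (Q : 0 < Cmod (1 - rho) * Cmod (1 - rho)) by (apply Rmult_lt_0_compat; auto).
    unfold Cdiv; apply Cinv_r; intros E; apply (f_equal fst) in E; simpl in E; lra.
  - rewrite Cmod_sqr; creal; unfold Re, Im; simpl; ring.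
Qed.

Lemma pprod_zprod l : exists c : C, forall s,
  pprod l s = (zprod (flat_map (fun r => r :: Cconj r :: nil) l) s * c)%C.
Proof.
  induction l as [|r l [c H]].
  - exists (RtoC 1); intros; unfold pprod, zprod; simpl; ring.
  - exists (/ RtoC (Cmod (1 - r) * Cmod (1 - r)) * c)%C; intros s.
    change (pfac r s * pprod l s = (s - r) * ((s - Cconj r) *
      zprod (flat_map (fun r => r :: Cconj r :: nil) l) s) *
      (/ RtoC (Cmod (1 - r) * Cmod (1 - r)) * c))%C.
    rewrite H; unfold pfac, Cdiv; ring.
Qed.

Lemma Fz_nonzero_far s : 4 < Re s -> Rabs (Im s) <= Re s - 1 -> Fz s <> RtoC 0.
Proof.
  intros H1 H2 E; assert (A := Fz_far_Re s ltac:(lra) H2).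
  rewrite E in A; simpl in A; lra.
Qed.

Lemma pprod_zero l rho : In rho l -> pprod l rho = RtoC 0.
Proof.
  induction l as [|r l IH]; [intros []|]; intros [->|H].
  - change (pfac rho rho * pprod l rho = 0)%C; unfold pfac, Cdiv; ring.
  - change (pfac r rho * pprod l rho = 0)%C; rewrite IH; auto; ring.
Qed.

(** A circle with centre [X] and radius [X - K] stays in [Re s >= K], away from the imaginary axis.
    The vertical shifts by [y] serve the symmetrised function [Fsym]; [y = 0] serves the count of
    zeros. *)
Lemma Fz_bound_circle (X y K R0 : R) z : 0 < K -> 1 <= X -> 0 <= y <= X -> R0 = X - K ->
  Cmod (z - X) = R0 -> forall w, w = (z + (0, y))%C \/ w = (z + (0, (- y)%R))%C ->
  rhp w /\ Cmod (Fz w) <= 3 * X + 3 * X * (3 * X + 1) * (2 / K).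
Proof.
  intros HK HX Hy HR Hz w Hw.
  assert (A := Re_le_Cmod (z - X)); rewrite Hz, HR in A.
  assert (Hre : Re w = Re z) by (destruct Hw; subst w; unfold Re; simpl; ring).
  assert (Hk : K <= Re w).
  { rewrite Hre; unfold Re in *; simpl in A.
    generalize (Rle_abs (- (fst z + - X))); rewrite Rabs_Ropp; lra. }
  assert (Hc : Cmod w <= 3 * X).
  { assert (Cz : Cmod z <= Cmod (z - X) + X).
    { replace z with (z - X + X)%C at 1 by ring.
      eapply Rle_trans; [apply Cmod_triangle|]; rewrite Cmod_R, (Rabs_pos_eq X); lra. }
    assert (Cy : Cmod w <= Cmod z + y).
    { destruct Hw; subst w; (eapply Rle_trans; [apply Cmod_triangle|]); apply Rplus_le_compat_l;
        (eapply Rle_trans; [apply Cmod_le_abs|]); unfold Re, Im; simpl;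
        rewrite Rabs_R0, ?Rabs_Ropp, Rabs_pos_eq; lra. }
    lra. }
  split; [unfold rhp; lra|].
  assert (P := Cmod_ge_0 w).
  assert (2 / Re w <= 2 / K).
  { apply Rmult_le_compat_l; [lra|]; apply Rinv_le_contravar; lra. }
  assert (0 <= 2 / Re w) by (apply Rdiv_le_0_compat; lra).
  eapply Rle_trans; [apply Fz_bound; unfold rhp; lra|].
  apply Rplus_le_compat; auto; apply Rmult_le_compat; auto.
  - apply Rmult_le_pos; lra.
  - apply Rmult_le_compat; lra.
Qed.

(** Jensen's inequality on one large disc covering the relevant part of the strip. Repetitions in
    [l] are allowed, so multiplicities are bounded too. *)
Lemma partial_fact_bound T : 0 < T -> exists N, forall l G,
  partial_fact T l G -> (length l <= N)%nat.
Proof.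
  (* The zeros lie in [1/4 < Re s <= T + 5], [|Im s| < T]. They are within [X - 3/16] of [X] once
     [T^2] is at most [(X - 3/16)^2 - (X - 1/4)^2], which is close to [X/8]. *)
  intros HT; set (X := 8 * (T * T) + T + 20).
  assert (HX : 20 <= X) by (unfold X; nra).
  set (r0 := X - 3 / 16); set (Rd := X - 1 / 8).
  set (M := 3 * X + 3 * X * (3 * X + 1) * (2 / (1 / 8))).
  destruct (nfloor_ex (16 * r0 * M)) as [N HN].
  { unfold r0, M; apply Rmult_le_pos; [lra|]; nra. }
  exists N; intros l G [Hl [HF [HG _]]].
  destruct (pprod_zprod l) as [c Hc].
  set (l2 := flat_map (fun r => r :: Cconj r :: nil) l) in *.
  assert (J : Cmod (Fz X) * Rd ^ length l2 <= M * r0 ^ length l2).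
  { apply (jensen rhp Fz (fun s => c * G s)%C); try (unfold Rd, r0; lra).
    - apply Cn_mult; [apply Cn_const|apply HG].
    - exists (1 / 8); split; [lra|]; intros z Hz.
      assert (A := Re_le_Cmod (z - X)); unfold rhp, Re, Rd in *; simpl in A.
      generalize (Rle_abs (- (fst z + - X))); rewrite Rabs_Ropp; lra.
    - intros z Hz; rewrite (HF z Hz), Hc; ring.
    - intros rho Hr; unfold l2 in Hr; apply in_flat_map in Hr.
      destruct Hr as [r [Hr Hr2]]; destruct (Hl r Hr) as [A1 A2].
      assert (Z : Fz r = RtoC 0).
      { rewrite HF by (unfold rhp; lra); rewrite pprod_zero by auto; ring. }
      assert (B : Re r <= T + 5).
      { destruct (Rle_or_lt (Re r) (T + 5)); auto; exfalso.
        apply (Fz_nonzero_far r); auto; [lra|]; rewrite Rabs_pos_eq; lra. }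
      assert (Q : Cmod (rho - X) = Cmod (r - X)).
      { destruct Hr2 as [<-|[<-|[]]]; auto.
        rewrite <- (Cmod_conj (r - X)); f_equal; creal; ring. }
      rewrite Q; apply Rsqr_incr_0_var; [|unfold r0; lra].
      unfold Rsqr; rewrite Cmod_sqr; unfold r0.
      replace (Re (r - X)%C) with (Re r - X) by (unfold Re; simpl; ring).
      replace (Im (r - X)%C) with (Im r) by (unfold Im; simpl; ring).
      assert (Im r * Im r <= T * T) by nra.
      assert ((Re r - X) * (Re r - X) <= (X - 1 / 4) * (X - 1 / 4)).
      { assert (Re r <= X) by (unfold X in *; nra). nra. }
      assert (T * T <= (X - 3 / 16) * (X - 3 / 16) - (X - 1 / 4) * (X - 1 / 4)) by (unfold X; nra).
      lra.
    - intros z Hz; apply (Fz_bound_circle X 0 (1 / 8) Rd z); auto; try lra.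
      left; creal; ring. }
  assert (HFX : 1 <= Cmod (Fz X)).
  { eapply Rle_trans; [|apply Re_le_Cmod]; eapply Rle_trans; [|apply Rle_abs].
    eapply Rle_trans; [|apply Fz_far_Re]; simpl; rewrite ?Rabs_R0; lra. }
  assert (P0 : 0 < r0 ^ length l2) by (apply pow_lt; unfold r0; lra).
  assert (B : (1 + / (16 * r0)) ^ length l2 <= M).
  { apply Rmult_le_reg_r with (r0 ^ length l2); auto.
    rewrite <- Rpow_mult_distr.
    replace ((1 + / (16 * r0)) * r0) with Rd by (unfold Rd, r0 in *; field; unfold r0; lra).
    assert (0 <= Rd ^ length l2) by (apply pow_le; unfold Rd; lra). nra. }
  (* Bernoulli's inequality turns the exponential bound into a bound on the length, as
     [Rd / r0 = 1 + 1/(16 r0)]. *)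
  assert (Br := poly (length l2) (/ (16 * r0)) ltac:(apply Rinv_0_lt_compat; unfold r0; lra)).
  assert (L2 : length l2 = (2 * length l)%nat).
  { unfold l2; clear; induction l; simpl; auto; simpl in IHl; rewrite IHl; lia. }
  assert (K1 : INR (length l2) <= 16 * r0 * M).
  { assert (0 < 16 * r0) by (unfold r0; lra).
    replace (INR (length l2)) with (16 * r0 * (INR (length l2) * / (16 * r0))) by (field; lra).
    apply Rmult_le_compat_l; lra. }
  assert (K2 : INR (length l2) < INR (S N)) by (rewrite S_INR; lra).
  apply INR_lt in K2; lia.
Qed.

(** A zero of the cofactor is not real by [Fz_real], and its conjugate is a zero too, so a whole
    pair can be divided out. What needs care is that the new cofactor again commutes with
    conjugation. *)
Lemma partial_fact_step T l G rho : partial_fact T l G ->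
  strip T rho -> G rho = RtoC 0 ->
  exists r G', partial_fact T (r :: l) G'.
Proof.
  intros [Hl [HF [HG HC]]] Hr H0.
  assert (Hrp : forall s, strip T s -> rhp s) by (unfold strip, rhp; intros; lra).
  assert (Hi : Im rho <> 0).
  { intros E; assert (Z : Fz rho = RtoC 0) by (rewrite HF, H0 by auto; ring).
    rewrite (RtoC_Im0 _ E) in Z.
    destruct (Fz_real (Re rho)) as [A _]; [apply Hrp; auto|].
    rewrite Z in A; simpl in A; lra. }
  assert (W : exists r, 0 < Im r /\ strip T r /\ G r = RtoC 0).
  { destruct (Rlt_or_le 0 (Im rho)) as [Hp|Hn]; [exists rho; auto|].
    exists (Cconj rho); split; [simpl; unfold Im in *; lra|split].
    - destruct Hr; split; simpl; auto; rewrite Rabs_Ropp; auto.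
    - rewrite HC, H0 by auto; creal; ring. }
  clear rho Hr H0 Hi; destruct W as [r [Hi [Hr H0]]].
  assert (Rr : rhp r) by auto.
  assert (Rc : rhp (Cconj r)) by (unfold rhp in *; auto).
  assert (Nc : Cconj r <> r) by (intros E; apply (f_equal snd) in E; unfold Im in Hi; simpl in E; lra).
  destruct (zeros_factor G (r :: Cconj r :: nil)) as [g [Hg E]]; auto.
  { constructor; [intros [|[]]; congruence|]; constructor; [intros []|constructor]. }
  { intros x [<-|[<-|[]]]; split; auto; rewrite HC, H0 by auto; creal; ring. }
  set (c := RtoC (Cmod (1 - r) * Cmod (1 - r))).
  assert (Hc : c <> RtoC 0).
  { assert (P := Cmod_1_sub_pos r Hi).
    assert (Q : 0 < Cmod (1 - r) * Cmod (1 - r)) by (apply Rmult_lt_0_compat; auto).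
    intros E1; apply (f_equal fst) in E1; simpl in E1; lra. }
  exists r, (fun s => c * g s)%C; split; [|split; [|split]].
  - intros x [<-|Hx]; auto; destruct Hr as [A B]; split; auto.
    rewrite Rabs_pos_eq in B; lra.
  - intros s Hs; rewrite (HF s Hs), (E s Hs).
    change (pprod (r :: l) s) with (pfac r s * pprod l s)%C; unfold pfac; fold c.
    simpl; field; auto.
  - intros n; apply Cn_mult; [apply Cn_const|auto].
  (* Away from the pair the symmetry follows by division; at the two zeros themselves it is obtained
     by continuity. *)
  - assert (Q : forall s, rhp s -> s <> r -> s <> Cconj r -> g (Cconj s) = Cconj (g s)).
    { intros s Hs N1 N2.
      assert (Hs' : rhp (Cconj s)) by (unfold rhp in *; auto).
      assert (E1 := E s Hs); assert (E2 := E _ Hs'); rewrite HC in E2 by auto; rewrite E1 in E2.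
      simpl in E2.
      assert (M1 := Csub_neq _ _ N1); assert (M2 := Csub_neq _ _ N2).
      assert (M3 : (Cconj s - r)%C <> RtoC 0).
      { apply Csub_neq; intros E3; apply N2; rewrite <- E3, Cconj_conj; auto. }
      assert (M4 : (Cconj s - Cconj r)%C <> RtoC 0).
      { apply Csub_neq; intros E3; apply N1; rewrite <- (Cconj_conj r), <- E3, Cconj_conj; auto. }
      rewrite !Cmult_conj, !Cminus_conj, Cconj_conj in E2.
      replace (g (Cconj s)) with
        ((Cconj s - r) * ((Cconj s - Cconj r) * 1) * g (Cconj s) / ((Cconj s - r) * (Cconj s - Cconj r)))%C
        by (field; auto).
      rewrite <- E2; replace (Cconj 1) with (RtoC 1) by (creal; ring); field; auto. }
    assert (Cconjc : forall z, continuous Cconj z).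
    { intros z; apply continuous_pairC.
      - apply (continuous_ReC (fun w => w)); apply continuous_id.
      - apply (continuous_opp (V := R_NormedModule)).
        apply (continuous_ImC (fun w => w)); apply continuous_id. }
    assert (Cg : forall z, rhp z -> continuous g z) by (intros; apply (Cn_continuous 0 rhp); auto).
    assert (Qr : g (Cconj r) = Cconj (g r)).
    { destruct (copen_rhp r Rr) as [d [Hd Hdw]].
      apply (continuous_eq_off_point (fun s => g (Cconj s)) (fun s => Cconj (g s)) r (Rmin d (Im r))).
      - apply Rmin_glb_lt; auto.
      - apply (continuous_comp Cconj g); auto.
      - apply (continuous_comp g Cconj); auto.
      - intros w Nw Hw; apply Q; auto.
        + apply Hdw; eapply Rlt_le_trans; [exact Hw|apply Rmin_l].
        + intros E1; assert (A := Im_le_Cmod (w - r)); generalize (Rmin_r d (Im r)); intros.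
          rewrite E1 in A at 1; unfold Im in *; simpl in A.
          generalize (Rle_abs (- (- snd r + - snd r))); rewrite Rabs_Ropp; lra. }
    intros s Hs; rewrite !Cmult_conj; f_equal; [unfold c; creal; ring|].
    destruct (Ceq_dec s r) as [->|N1]; auto.
    destruct (Ceq_dec s (Cconj r)) as [->|N2]; auto.
    rewrite Qr, !Cconj_conj; auto.
Qed.

Lemma max_length_ex (P : nat -> Prop) N : P O -> (forall n, P n -> (n <= N)%nat) ->
  exists n, P n /\ ~ P (S n).
Proof.
  intros H0 HN; destruct (excluded_middle_informative (exists n, P n /\ ~ P (S n))) as [|H]; auto.
  exfalso; assert (A : forall n, P n).
  { induction n; auto.
    destruct (excluded_middle_informative (P (S n))); auto.
    exfalso; apply H; exists n; auto. }
  specialize (HN _ (A (S N))); lia.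
Qed.

(** [L] is the logarithm of the zero-free factor, normalised to be real on the
    real axis. *)
Definition full_fact (T : R) (l : list C) (L : C -> C) : Prop :=
  exists G, partial_fact T l G /\
  (forall s, strip T s -> G s = cexp (L s)) /\
  Cn 1 (strip T) L /\ L 1 = RtoC 0 /\
  (forall x : R, strip T x -> Im (L x) = 0).

Lemma copen_strip T : copen (strip T).
Proof.
  intros z [H1 H2].
  exists (Rmin (Re z - 1 / 4) (T - Rabs (Im z))); split; [apply Rmin_glb_lt; lra|].
  intros w Hw.
  assert (A := Re_le_Cmod (w - z)); assert (B := Im_le_Cmod (w - z)).
  generalize (Rmin_l (Re z - 1 / 4) (T - Rabs (Im z))) (Rmin_r (Re z - 1 / 4) (T - Rabs (Im z))); intros.
  split.
  - unfold Re in *; simpl in A.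
    generalize (Rle_abs (- (fst w + - fst z))); rewrite Rabs_Ropp; lra.
  - replace (Im w) with (Im (w - z)%C + Im z) by (unfold Im; simpl; ring).
    eapply Rle_lt_trans; [apply Rabs_triang|lra].
Qed.

Lemma star_strip T : star (strip T) 1.
Proof.
  intros s u [H1 H2] Hu; split; unfold seg, Re, Im in *; simpl.
  - replace (1 + (u * (fst s + - (1)) - 0 * (snd s + - 0))) with (1 - u + u * fst s) by ring.
    destruct (Req_dec u 0) as [->|]; [lra|].
    assert (0 < u * (fst s - 1 / 4)) by (apply Rmult_lt_0_compat; lra); lra.
  - replace (0 + (u * (snd s + - 0) + 0 * (fst s + - (1)))) with (u * snd s) by ring.
    rewrite Rabs_mult, (Rabs_pos_eq u) by lra.
    generalize (Rabs_pos (snd s)); nra.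
Qed.

Lemma strip_rhp T s : strip T s -> rhp s.
Proof. unfold strip, rhp; lra. Qed.

Lemma strip_real T (x : R) : 0 < T -> 1 / 4 < x -> strip T x.
Proof. intros; split; simpl; [auto|rewrite Rabs_R0; auto]. Qed.

Lemma pprod_1 l : (forall rho, In rho l -> 0 < Im rho) -> pprod l 1 = RtoC 1.
Proof.
  induction l as [|r l IH]; intros H; [reflexivity|].
  change (pfac r 1 * pprod l 1 = 1)%C; rewrite pfac_1, IH; [ring| |]; auto with datatypes.
Qed.

Lemma partial_fact_1 T l G : partial_fact T l G -> G 1 = RtoC 1.
Proof.
  intros [Hl [HF _]].
  assert (E := HF 1%C ltac:(unfold rhp; simpl; lra)).
  rewrite Fz_1, pprod_1 in E; [rewrite E at 2; ring|].
  intros r Hr; destruct (Hl r Hr); lra.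
Qed.

(** A list of maximal length leaves a cofactor without zeros in the strip, for otherwise one more
    pair could be added. The strip is starlike about 1, so the cofactor has a logarithm there. *)
Lemma full_fact_ex T : 0 < T -> exists l L, full_fact T l L.
Proof.
  intros HT; destruct (partial_fact_bound T HT) as [N HN].
  destruct (max_length_ex (fun n => exists l G, length l = n /\ partial_fact T l G) N)
    as [n [[l [G [Hn HP]]] Hmax]].
  - exists nil, Fz; split; auto; split; [intros ? []|split; [|split]].
    + intros; simpl; ring.
    + intros n; apply Cn_Fz.
    + exact Fz_conj.
  - intros n [l [G [<- HP]]]; eauto.
  - assert (NZ : forall s, strip T s -> G s <> RtoC 0).
    { intros s Hs E; destruct (partial_fact_step T l G s HP Hs E) as [r [G' H']].
      apply Hmax; exists (r :: l), G'; split; auto; simpl; congruence. }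
    assert (G1 := partial_fact_1 T l G HP).
    assert (HP' := HP); destruct HP' as [Hl [HF [HG HC]]].
    destruct (log_exists 0 (strip T) G 1) as [k [Ck [Ek Ik]]]; auto.
    + apply copen_strip.
    + apply star_strip.
    + apply Cn_sub with rhp; auto; apply strip_rhp.
    + apply strip_real; lra.
    + intros t Ht; assert (E := HC t (strip_rhp _ _ Ht)).
      replace (Cconj t) with (RtoC t) in E by (creal; ring).
      apply (f_equal snd) in E; unfold Im; simpl in E; lra.
    + exists l, (fun s => (s - 1) * k s)%C, G; split; auto; split; [exact Ek|split; [|split]].
      * apply Cn_mult; auto; apply Cn_minus; [apply Cn_id|apply Cn_const].
      * ring.
      * intros x Hx; assert (I := Ik x Hx); unfold Im in *; simpl; rewrite I; ring.
Qed.

(** The candidate for [arg Fz], continued from the right along horizontal lines. *)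
Definition argE (l : list C) (L : C -> C) (s : C) : R :=
  fold_right (fun rho acc => Arg (s - rho) + Arg (s - Cconj rho) + acc) (Im (L s)) l.

Lemma isarg_pfac rho s t : 0 < Im rho ->
  isarg (s - rho) t -> isarg (pfac rho s) (t + Arg (s - Cconj rho)).
Proof.
  intros Hi Ht; unfold pfac.
  replace (t + Arg (s - Cconj rho)) with (t + Arg (s - Cconj rho) - 0) by ring.
  apply isarg_div; [apply isarg_mult; auto; apply isarg_Arg|].
  apply isarg_pos; apply Rmult_le_pos; apply Cmod_ge_0.
Qed.

Lemma isarg_argE T l L s : full_fact T l L -> strip T s -> isarg (Fz s) (argE l L s).
Proof.
  intros [G [[Hl [HF _]] [HL _]]] Hs; rewrite HF by (eapply strip_rhp; eauto).
  rewrite HL by auto; clear HF HL; induction l as [|r l IH]; simpl.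
  - replace (1 * cexp (L s))%C with (cexp (L s)) by ring; apply isarg_cexp.
  - rewrite <- Cmult_assoc; apply isarg_mult; [|apply IH; auto with datatypes].
    apply isarg_pfac; [destruct (Hl r); auto with datatypes; lra|apply isarg_Arg].
Qed.

Lemma continuous_Arg_sub rho s : Im s <> Im rho \/ Re rho < Re s ->
  continuous (fun s => Arg (s - rho)) s.
Proof.
  intros H; apply (continuous_comp (fun s : C => (s - rho)%C) Arg).
  - apply continuous_Cminus; [apply continuous_id|apply continuous_const].
  - apply continuous_Arg; unfold Re, Im in *; simpl; lra.
Qed.

Lemma continuous_argE T l L s : full_fact T l L -> strip T s -> 0 <= Im s ->
  (forall rho, In rho l -> Im s <> Im rho \/ Re rho < Re s) ->
  continuous (argE l L) s.
Proof.
  intros [G [[Hl _] [_ [HL _]]]] Hs Hi H.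
  apply (Cn_continuous 1 (strip T) L s) in HL; auto.
  induction l as [|r l IH]; simpl.
  - apply continuous_ImC; auto.
  - destruct (Hl r (or_introl eq_refl)) as [A1 A2].
    apply continuous_Rplus; [apply continuous_Rplus|apply IH; auto with datatypes].
    + apply continuous_Arg_sub; auto with datatypes.
    + apply continuous_Arg_sub; left; unfold Im in *; simpl; lra.
Qed.

Lemma argE_real T l L (x : R) : full_fact T l L -> 1 / 4 < x -> 0 < T -> argE l L x = 0.
Proof.
  intros [G [[Hl _] [_ [_ [_ HL]]]]] Hx HT; specialize (HL x (strip_real T x HT Hx)).
  induction l as [|r l IH]; simpl; auto.
  rewrite IH by auto with datatypes.
  destruct (Hl r (or_introl eq_refl)) as [A1 A2].
  replace (x - Cconj r)%C with (Cconj (x - r)) by (creal; ring).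
  rewrite Arg_conj; [ring|unfold Im in *; simpl; lra].
Qed.

Lemma zero_in_list T l L rho : full_fact T l L -> In rho l -> Fz rho = RtoC 0.
Proof.
  intros [G [[Hl [HF _]] _]] H; destruct (Hl rho H) as [A1 A2].
  rewrite HF by (unfold rhp; lra); rewrite pprod_zero by auto; ring.
Qed.

Lemma zero_Re_bound T l L rho : full_fact T l L -> In rho l -> Re rho < Im rho + 5.
Proof.
  intros HF H; assert (Z := zero_in_list T l L rho HF H).
  destruct HF as [G [[Hl _] _]]; destruct (Hl rho H) as [A1 A2].
  destruct (Rlt_or_le (Re rho) (Im rho + 5)); auto; exfalso.
  apply (Fz_nonzero_far rho); auto; [lra|]; rewrite Rabs_pos_eq; lra.
Qed.

Lemma list_zero T l L s : full_fact T l L -> strip T s -> 0 <= Im s -> Fz s = RtoC 0 -> In s l.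
Proof.
  intros [G [[Hl [HF _]] [HL _]]] Hs Hi HZ.
  rewrite HF, HL in HZ by (try eapply strip_rhp; eauto); clear HF HL.
  assert (P := Cmod_cexp (L s)); assert (P2 := exp_pos (Re (L s))).
  assert (N : pprod l s = RtoC 0).
  { apply Cmod_eq_0; apply (f_equal Cmod) in HZ; rewrite Cmod_mult, Cmod_0 in HZ.
    apply Rmult_integral in HZ; destruct HZ; auto; lra. }
  clear HZ; induction l as [|r l IH].
  - exfalso; apply (f_equal fst) in N; simpl in N; lra.
  - destruct (Hl r (or_introl eq_refl)) as [A1 A2].
    apply (f_equal Cmod) in N.
    change (Cmod (pfac r s * pprod l s) = Cmod 0) in N.
    rewrite Cmod_mult, Cmod_0 in N; apply Rmult_integral in N; destruct N as [N|N].
    + left; assert (Q := Cmod_1_sub_pos r ltac:(lra)).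
      assert (Qs : Cmod (1 - r) * Cmod (1 - r) <> 0) by nra.
      unfold pfac in N; rewrite Cmod_div, !Cmod_mult, Cmod_R in N.
      2:{ intros E; apply (f_equal fst) in E; simpl in E; auto. }
      apply Rmult_integral in N; destruct N as [N|N].
      * apply Rmult_integral in N; destruct N as [N|N]; apply Cmod_eq_0 in N.
        -- replace s with (s - r + r)%C by ring; rewrite N; ring.
        -- apply (f_equal snd) in N; unfold Im in *; simpl in N; lra.
      * exfalso; revert N; apply Rinv_neq_0_compat; apply Rabs_no_R0; auto.
    + right; apply IH; auto with datatypes. apply Cmod_eq_0; auto.
Qed.

Lemma isarg_Re_pos z t : isarg z t -> 0 < Re z -> cos t <> 0.
Proof.
  intros H P E; unfold isarg in H; rewrite E in H; apply (f_equal fst) in H.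
  unfold Re in P; simpl in H; lra.
Qed.

(** A continuous angle whose cosine never vanishes cannot cross [PI/2] or [-PI/2]. *)
Lemma cos_ivt_bound (g : R -> R) a b :
  (forall x, Rmin a b <= x <= Rmax a b -> continuous g x) ->
  (forall x, Rmin a b <= x <= Rmax a b -> cos (g x) <> 0) ->
  Rabs (g a) < PI / 2 -> Rabs (g b) < PI / 2.
Proof.
  intros Hc Hn Ha; generalize PI_RGT_0; intros HP.
  destruct (Rlt_or_le (Rabs (g b)) (PI / 2)) as [|Hb]; auto; exfalso.
  apply Rabs_def2 in Ha.
  assert (V : exists v, cos v = 0 /\ (g a <= v <= g b \/ g b <= v <= g a)).
  { destruct (Rle_or_lt 0 (g b)) as [P|P].
    - rewrite Rabs_pos_eq in Hb by auto; exists (PI / 2); split; [apply cos_PI2|lra].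
    - rewrite Rabs_left in Hb by auto; exists (- (PI / 2)); split; [rewrite cos_neg; apply cos_PI2|lra]. }
  destruct V as [v [V0 V]].
  assert (W : exists c, Rmin a b <= c <= Rmax a b /\ g c = v).
  { destruct (Rle_or_lt a b).
    - rewrite Rmin_left, Rmax_right in * by lra; apply IVT_le; auto.
    - rewrite Rmin_right, Rmax_left in * by lra; apply IVT_le; auto; [lra|tauto]. }
  destruct W as [c [Hc1 Hc2]]; apply (Hn c Hc1); rewrite Hc2; auto.
Qed.

Lemma continuous_hor (y x : R) : continuous (fun u : R => (u, y) : C) x.
Proof. apply continuous_pairC; [apply continuous_id|apply continuous_const]. Qed.

Lemma continuous_ver (y x : R) : continuous (fun u : R => (x, u) : C) y.
Proof. apply continuous_pairC; [apply continuous_const|apply continuous_id]. Qed.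

(** The value 0 on the real axis is carried up at an abscissa [X] to the right of all zeros of the
    list, then left at height [y]. On this path [Re Fz > 0], so the angle stays within [PI/2] of
    0. *)
Lemma argE_far T l L (x y : R) : full_fact T l L -> 0 <= y < T -> y + 6 <= x ->
  Rabs (argE l L (x, y)) < PI / 2.
Proof.
  intros HF Hy Hx; generalize PI_RGT_0; intros HP.
  set (X := Rmax x (T + 6)).
  assert (X1 := Rmax_l x (T + 6)); assert (X2 := Rmax_r x (T + 6)); fold X in X1, X2.
  assert (Hst : forall u v, 1 <= u -> 0 <= v <= y -> strip T (u, v)).
  { intros u v Hu Hv; split; simpl; [lra|rewrite Rabs_pos_eq; lra]. }
  assert (Hre : forall u v, v + 6 <= u -> 0 <= v <= y -> 0 < Re (Fz (u, v))).
  { intros u v Hu Hv; eapply Rlt_le_trans; [|apply Fz_far_Re]; simpl;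
      rewrite ?(Rabs_pos_eq v); lra. }
  assert (HL : forall rho, In rho l -> Im rho < T).
  { intros rho Hr; destruct HF as [G [[Hl _] _]]; destruct (Hl rho Hr); lra. }
  apply (cos_ivt_bound (fun u => argE l L (u, y)) X x).
  - rewrite Rmin_right, Rmax_left by lra; intros u Hu.
    apply (continuous_comp (fun u => (u, y) : C) (argE l L)); [apply continuous_hor|].
    apply (continuous_argE T); auto; [apply Hst; lra|simpl; lra|].
    intros rho Hr; simpl; destruct (Req_dec y (Im rho)) as [E|]; auto; right.
    assert (A := zero_Re_bound T l L rho HF Hr); lra.
  - rewrite Rmin_right, Rmax_left by lra; intros u Hu.
    apply (isarg_Re_pos (Fz (u, y))); [apply (isarg_argE T); auto; apply Hst; lra|].
    apply Hre; lra.
  - apply (cos_ivt_bound (fun v => argE l L (X, v)) 0 y).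
    + rewrite Rmin_left, Rmax_right by lra; intros v Hv.
      apply (continuous_comp (fun v => (X, v) : C) (argE l L)); [apply continuous_ver|].
      apply (continuous_argE T); auto; [apply Hst; lra|simpl; lra|].
      intros rho Hr; right; simpl.
      assert (A := zero_Re_bound T l L rho HF Hr); specialize (HL rho Hr); lra.
    + rewrite Rmin_left, Rmax_right by lra; intros v Hv.
      apply (isarg_Re_pos (Fz (X, v))); [apply (isarg_argE T); auto; apply Hst; lra|].
      apply Hre; lra.
    + change (X, 0) with (RtoC X); rewrite (argE_real T); auto; [rewrite Rabs_R0; lra|lra|lra].
Qed.

Lemma atan_abs_le v : Rabs (atan v) <= Rabs v.
Proof.
  destruct (MVT_gen atan 0 v (fun x => / (1 + x * x))) as [c [_ E]].
  - intros x _; eapply is_derive_eq; [apply is_derive_Reals; apply derivable_pt_lim_atan|].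
    f_equal; ring.
  - intros x _; apply derivable_continuous_pt; eexists; apply derivable_pt_lim_atan.
  - rewrite atan_0, !Rminus_0_r in E; rewrite E, Rabs_mult.
    assert (P : 0 < 1 + c * c) by nra.
    rewrite (Rabs_pos_eq (/ (1 + c * c))) by (left; apply Rinv_0_lt_compat; auto).
    assert (/ (1 + c * c) <= 1).
    { rewrite <- Rinv_1; apply Rinv_le_contravar; [lra|nra]. }
    generalize (Rabs_pos v); nra.
Qed.

Lemma isarg_atan z t : isarg z t -> Rabs t < PI / 2 -> 0 < Re z -> t = atan (Im z / Re z).
Proof.
  intros H Ht Hz; apply Rabs_def2 in Ht; rewrite <- (atan_tan t) by lra; f_equal.
  assert (C0 : 0 < cos t) by (apply cos_gt_0; lra).
  unfold isarg in H; assert (H1 := f_equal fst H); assert (H2 := f_equal snd H).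
  simpl in H1, H2; unfold Re, Im in *; rewrite H1, H2; unfold tan; field.
  split; [lra|]; intros E; rewrite E in H1; lra.
Qed.

Lemma argE_lim T l L y : full_fact T l L -> 0 < y < T ->
  forall e, 0 < e -> exists M, forall x, M < x -> Rabs (argE l L (x, y)) < e.
Proof.
  intros HF Hy e He; exists (y + 6 + (y + 4) / e); intros x Hx.
  assert (Q : 0 < (y + 4) / e) by (apply Rdiv_lt_0_compat; lra).
  assert (R1 : x - 4 <= Re (Fz (x, y))).
  { apply (Fz_far_Re (x, y)); simpl; [lra|rewrite Rabs_pos_eq; lra]. }
  assert (I1 : Rabs (Im (Fz (x, y))) <= y + 4).
  { eapply Rle_trans; [apply Fz_far_Im|]; simpl; rewrite ?Rabs_pos_eq; lra. }
  rewrite (isarg_atan (Fz (x, y)) (argE l L (x, y))).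
  - eapply Rle_lt_trans; [apply atan_abs_le|].
    unfold Rdiv; rewrite Rabs_mult, Rabs_inv, (Rabs_pos_eq (Re _)) by lra.
    apply Rle_lt_trans with ((y + 4) / (x - 4)).
    + apply Rmult_le_compat; auto using Rabs_pos; [left; apply Rinv_0_lt_compat; lra|].
      apply Rinv_le_contravar; lra.
    + apply Rmult_lt_reg_r with (x - 4); [lra|].
      replace ((y + 4) / (x - 4) * (x - 4)) with ((y + 4) / e * e) by (field; lra).
      rewrite (Rmult_comm e); apply Rmult_lt_compat_r; auto; lra.
  - apply (isarg_argE T); auto; split; simpl; [lra|rewrite Rabs_pos_eq; lra].
  - apply (argE_far T); auto; lra.
  - lra.
Qed.

Definition not_height (l : list C) (y : R) : Prop := forall rho, In rho l -> y <> Im rho.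

Lemma arg_branch_argE T l L x y : full_fact T l L -> 1 / 4 < x -> 0 < y < T ->
  not_height l y -> arg_branch x y (argE l L (x, y)).
Proof.
  intros HF Hx Hy Hn.
  assert (Hst : forall u, x <= u -> strip T (u, y)).
  { intros u Hu; split; simpl; [lra|rewrite Rabs_pos_eq; lra]. }
  (* The branch must be continuous on all of [R]; it is frozen to the left of [x], where nothing is
     required of it. *)
  exists (fun u => argE l L (Rmax u x, y)); split; [|split; [|split]].
  - intros u.
    apply (continuous_comp (fun u => (Rmax u x, y) : C) (argE l L)).
    + apply continuous_pairC; [|apply continuous_const].
      apply continuous_extC with (fun u => (u + x + Rabs (u - x)) * / 2).
      * intros v; unfold Rmax, Rabs; destruct Rle_dec; destruct Rcase_abs; lra.
      * apply continuous_Rmult; [|apply continuous_const].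
        apply continuous_Rplus.
        -- apply continuous_Rplus; [apply (continuous_id (U := R_UniformSpace))|apply continuous_const].
        -- apply (continuous_comp (fun u => u - x) Rabs); [|apply continuous_Rabs].
           apply continuous_Rminus; [apply (continuous_id (U := R_UniformSpace))|apply continuous_const].
    + apply (continuous_argE T); [auto|apply Hst; apply Rmax_r|simpl; lra|].
      intros rho Hr; left; simpl; apply Hn; auto.
  - intros u Hu; rewrite Rmax_left by auto.
    rewrite zetaF_Fz.
    + apply (isarg_argE T); auto.
    + unfold rhp; simpl; lra.
    + intros E; apply (f_equal snd) in E; simpl in E; lra.
  - apply is_lim_spec; intros e.
    destruct (argE_lim T l L y HF Hy e (cond_pos e)) as [M HM].
    exists (Rmax M x); intros u Hu; rewrite Rminus_0_r.
    rewrite Rmax_left; [apply HM|];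
      generalize (Rmax_l M x) (Rmax_r M x); lra.
  - rewrite Rmax_left; auto; lra.
Qed.

(** Two branches tending to 0 differ by less than [2 PI] at some far point, so they agree there and,
    by continuity, back to [x]. *)
Lemma arg_branch_unique x y a b :
  (forall u, x <= u -> zetaF (u, y) <> RtoC 0) ->
  arg_branch x y a -> arg_branch x y b -> a = b.
Proof.
  intros NZ [f [Cf [Af [Lf <-]]]] [g [Cg [Ag [Lg <-]]]].
  apply is_lim_spec in Lf; apply is_lim_spec in Lg.
  destruct (Lf (mkposreal 1 Rlt_0_1)) as [M1 H1]; destruct (Lg (mkposreal 1 Rlt_0_1)) as [M2 H2].
  simpl in H1, H2.
  set (X := Rmax x (Rmax M1 M2 + 1)).
  assert (X1 := Rmax_l x (Rmax M1 M2 + 1)); assert (X2 := Rmax_r x (Rmax M1 M2 + 1)); fold X in X1, X2.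
  assert (X3 := Rmax_l M1 M2); assert (X4 := Rmax_r M1 M2).
  apply (isarg_unique_cont (fun u => zetaF (u, y)) f g x X X); try lra; auto.
  - intros; apply NZ; lra.
  - intros u Hu; apply Af; lra.
  - intros u Hu; apply Ag; lra.
  - apply isarg_eq with (zetaF (X, y)); [apply NZ; auto|apply Af; auto|apply Ag; auto|].
    specialize (H1 X ltac:(lra)); specialize (H2 X ltac:(lra)).
    rewrite Rminus_0_r in H1, H2; apply Rabs_def2 in H1; apply Rabs_def2 in H2.
    generalize PI2_3_2; intros; apply Rabs_def1; lra.
Qed.

Lemma zetaF_nonzero T l L u y : full_fact T l L -> 1 / 4 < u -> 0 < y < T ->
  not_height l y -> zetaF (u, y) <> RtoC 0.
Proof.
  intros HF Hu Hy Hn E; rewrite zetaF_Fz in E.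
  - assert (A := list_zero T l L (u, y) HF); apply (Hn (u, y)); [|reflexivity].
    apply A; auto; [split; simpl; [lra|rewrite Rabs_pos_eq; lra]|simpl; lra].
  - unfold rhp; simpl; lra.
  - intros E'; apply (f_equal snd) in E'; simpl in E'; lra.
Qed.

(** The heights of zeros are left out. Below [T] they are finitely many, so integrals do not see
    them; [is_RInt_off_finite] makes this precise. *)
Lemma arg_zetaF_argE T l L x y : full_fact T l L -> 1 / 4 < x -> 0 < y < T ->
  not_height l y -> arg_zetaF x y = argE l L (x, y).
Proof.
  intros HF Hx Hy Hn.
  assert (B := arg_branch_argE T l L x y HF Hx Hy Hn).
  unfold arg_zetaF; destruct excluded_middle_informative as [H|H]; [|exfalso; eauto].
  assert (E : arg_branch x y (arg_nz x y)) by (exact (epsilon_spec (inhabits 0) (arg_branch x y) H)).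
  apply (arg_branch_unique x y); auto.
  intros u Hu; apply (zetaF_nonzero T l L); auto; lra.
Qed.

(** * Growth of the argument *)

Lemma avoid_finite (l : list R) a b : a < b ->
  exists a' b', a <= a' < b' /\ b' <= b /\ forall x, a' < x < b' -> ~ In x l.
Proof.
  intros Hab; induction l as [|c l [a' [b' [H1 [H2 H3]]]]].
  - exists a, b; repeat split; try lra; intros x _ [].
  - destruct (Rle_or_lt c a') as [Hc|Hc].
    + exists a', b'; repeat split; try lra; intros x Hx [->|H]; [lra|apply (H3 x); auto].
    + exists a', (Rmin c b').
      generalize (Rmin_l c b') (Rmin_r c b'); intros M1 M2.
      assert (a' < Rmin c b') by (apply Rmin_glb_lt; lra).
      repeat split; try lra; intros x Hx [->|H']; [lra|apply (H3 x); auto; lra].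
Qed.

(** One-sided continuity in the height: [argE] jumps across the horizontal cuts to the left of the
    zeros but is continuous from above there. *)
Definition right_cont (f : C -> R) (s : C) : Prop :=
  forall e, 0 < e -> exists d, 0 < d /\
    forall h, 0 < h < d -> Rabs (f (s + (0, h))%C - f s) < e.

Lemma right_cont_continuous f s : continuous f s -> right_cont f s.
Proof.
  intros H e He; destruct (H _ (locally_ball _ (mkposreal e He))) as [d Hd].
  exists d; split; [apply cond_pos|]; intros h Hh.
  apply (Hd (s + (0, h))%C); split; unfold ball; simpl; unfold AbsRing_ball, abs, minus, plus, opp; simpl.
  - match goal with |- Rabs ?x < _ => replace x with 0 by ring end.
    rewrite Rabs_R0; apply cond_pos.
  - match goal with |- Rabs ?x < _ => replace x with h by ring end.
    rewrite Rabs_pos_eq; lra.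
Qed.

Lemma right_cont_plus f g s : right_cont f s -> right_cont g s ->
  right_cont (fun s => f s + g s) s.
Proof.
  intros Hf Hg e He.
  destruct (Hf (e / 2)) as [d1 [D1 H1]]; [lra|]; destruct (Hg (e / 2)) as [d2 [D2 H2]]; [lra|].
  exists (Rmin d1 d2); split; [apply Rmin_glb_lt; auto|]; intros h Hh.
  generalize (Rmin_l d1 d2) (Rmin_r d1 d2); intros.
  specialize (H1 h ltac:(lra)); specialize (H2 h ltac:(lra)).
  apply Rabs_def2 in H1; apply Rabs_def2 in H2; apply Rabs_def1; lra.
Qed.

Lemma right_cont_Arg rho s : s <> rho -> right_cont (fun s => Arg (s - rho)) s.
Proof.
  intros N.
  destruct (Req_dec (Im s) (Im rho)) as [E|E];
    [|apply right_cont_continuous; apply continuous_Arg_sub; auto].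
  destruct (Rlt_or_le (Re rho) (Re s)) as [H|H];
    [apply right_cont_continuous; apply continuous_Arg_sub; auto|].
  assert (H1 : Re (s - rho)%C < 0).
  { destruct H as [H|H]; [unfold Re in *; simpl; lra|].
    exfalso; apply N; destruct s, rho; unfold Re, Im in *; simpl in *; subst; auto. }
  assert (H2 : Im (s - rho)%C = 0) by (unfold Im in *; simpl; lra).
  intros e He; destruct (continuous_Arg_above _ H1 H2 e He) as [d [Hd Hh]].
  exists d; split; auto; intros h Hh0.
  replace (s + (0, h) - rho)%C with (s - rho + (0, h))%C by ring; auto.
Qed.

Lemma right_cont_argE T l L s : full_fact T l L -> strip T s -> 0 < Im s ->
  ~ In s l -> right_cont (argE l L) s.
Proof.
  intros [G [[Hl _] [_ [HL _]]]] Hs Hi Hn.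
  apply (Cn_continuous 1 (strip T) L s) in HL; auto.
  induction l as [|r l IH].
  - apply right_cont_continuous; simpl; apply continuous_ImC; auto.
  - destruct (Hl r (or_introl eq_refl)) as [A1 A2].
    apply (right_cont_plus (fun s => Arg (s - r) + Arg (s - Cconj r)) (argE l L)).
    + apply right_cont_plus; apply right_cont_Arg.
      * intros ->; apply Hn; left; auto.
      * intros ->; unfold Im in *; simpl in *; lra.
    + apply IH; auto with datatypes.
Qed.

(** Slightly above [s] there are heights free of zeros, where both sides are the unique branch;
    continuity from above brings the equality down to [s]. Factorisations on different strips thus
    become interchangeable. *)
Lemma argE_eq T1 l1 L1 T2 l2 L2 s : full_fact T1 l1 L1 -> full_fact T2 l2 L2 ->
  1 / 4 < Re s -> 0 < Im s -> Im s < T1 -> Im s < T2 -> Fz s <> RtoC 0 ->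
  argE l1 L1 s = argE l2 L2 s.
Proof.
  intros F1 F2 Hr Hi H1 H2 HZ.
  destruct (Req_dec (argE l1 L1 s) (argE l2 L2 s)) as [|N]; auto; exfalso.
  set (e := Rabs (argE l1 L1 s - argE l2 L2 s)).
  assert (He : 0 < e) by (apply Rabs_pos_lt; lra).
  assert (St : forall T, Im s < T -> strip T s) by (intros; split; auto; rewrite Rabs_pos_eq; lra).
  assert (N1 : ~ In s l1) by (intros H; apply HZ; exact (zero_in_list _ _ _ _ F1 H)).
  destruct (right_cont_argE T1 l1 L1 s F1 (St _ H1) Hi N1 (e / 2)) as [d1 [D1 C1]]; [lra|].
  assert (N2 : ~ In s l2) by (intros H; apply HZ; exact (zero_in_list _ _ _ _ F2 H)).
  destruct (right_cont_argE T2 l2 L2 s F2 (St _ H2) Hi N2 (e / 2)) as [d2 [D2 C2]]; [lra|].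
  set (d := Rmin (Rmin d1 d2) (Rmin (T1 - Im s) (T2 - Im s))).
  assert (Hd : 0 < d) by (unfold d; repeat apply Rmin_glb_lt; lra).
  assert (M : d <= d1 /\ d <= d2 /\ d <= T1 - Im s /\ d <= T2 - Im s).
  { unfold d; generalize (Rmin_l (Rmin d1 d2) (Rmin (T1 - Im s) (T2 - Im s)))
      (Rmin_r (Rmin d1 d2) (Rmin (T1 - Im s) (T2 - Im s))) (Rmin_l d1 d2) (Rmin_r d1 d2)
      (Rmin_l (T1 - Im s) (T2 - Im s)) (Rmin_r (T1 - Im s) (T2 - Im s)); lra. }
  destruct (avoid_finite (map (fun r => Im r) (l1 ++ l2)) (Im s) (Im s + d)) as [a [b [Ha [Hb Hab]]]]; [lra|].
  set (y := (a + b) / 2); set (h := y - Im s).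
  assert (Hy : a < y < b) by (unfold y; lra).
  assert (NH : forall rho, In rho (l1 ++ l2) -> y <> Im rho).
  { intros rho Hr' E; apply (Hab y Hy); rewrite E; apply (in_map (fun r => Im r)); auto. }
  specialize (C1 h ltac:(unfold h; lra)); specialize (C2 h ltac:(unfold h; lra)).
  replace (s + (0, h))%C with ((Re s, y) : C) in C1, C2
    by (unfold h; destruct s; unfold Im; creal; ring).
  rewrite <- (arg_zetaF_argE T1 l1 L1) in C1; auto; try lra.
  2:{ intros rho Hr'; apply NH; apply in_or_app; auto. }
  rewrite <- (arg_zetaF_argE T2 l2 L2) in C2; auto; try lra.
  2:{ intros rho Hr'; apply NH; apply in_or_app; auto. }
  unfold e in *; clear - C1 C2 He.
  set (A := arg_zetaF (Re s) y) in *.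
  assert (Q := Rabs_triang (argE l1 L1 s - A) (A - argE l2 L2 s)).
  replace (argE l1 L1 s - A + (A - argE l2 L2 s)) with (argE l1 L1 s - argE l2 L2 s) in Q by ring.
  rewrite (Rabs_minus_sym (argE l1 L1 s) A) in Q; lra.
Qed.

Lemma distinct_list {A : Type} (P : nat -> A -> Prop) n :
  (forall j, (j < n)%nat -> exists u, P j u) ->
  (forall j k u, P j u -> P k u -> j = k) ->
  exists l, length l = n /\ NoDup l /\ forall u, In u l -> exists j, (j < n)%nat /\ P j u.
Proof.
  intros HE HU; induction n as [|n IH].
  - exists nil; split; auto; split; [constructor|intros u []].
  - destruct IH as [l [Hl [Hd Hi]]]; [intros; apply HE; lia|].
    destruct (HE n) as [u Hu]; [lia|].
    exists (u :: l); split; [simpl; lia|split].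
    + constructor; auto; intros Hin; destruct (Hi u Hin) as [j [Hj Pj]].
      assert (j = n) by (eapply HU; eauto); lia.
    + intros v [<-|Hv]; [exists n; auto|].
      destruct (Hi v Hv) as [j [Hj Pj]]; exists j; auto.
Qed.

(** Backlund's device: an analytic function whose values at real [u] are [Re (Fz (u, y))], so that
    zeros of this real part can be counted by Jensen. *)
Definition Fsym (y : R) (z : C) : C :=
  (RtoC (/ 2) * (Fz (z + (0, y)) + Fz (z + (0, (- y)%R))))%C.

Lemma Fsym_real y (u : R) : 0 < u -> Fsym y u = RtoC (Re (Fz (u, y))).
Proof.
  intros Hu; unfold Fsym.
  replace (u + (0, y))%C with ((u, y) : C) by (creal; ring).
  replace (u + (0, (- y)%R))%C with (Cconj (u, y)) by (creal; ring).
  rewrite Fz_conj by (unfold rhp; simpl; auto).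
  creal; unfold Re; field.
Qed.

Lemma Cinf_Fsym y : Cinf rhp (Fsym y).
Proof.
  intros n; apply Cn_mult; [apply Cn_const|].
  assert (A : forall y, Cn n rhp (fun z => Fz (z + (0, y)))).
  { intros v; apply (Cn_comp n rhp rhp Fz (fun z => z + (0, v))%C).
    - unfold rhp, Re; intros z Hz; simpl; lra.
    - apply Cn_Fz.
    - apply Cn_plus; [apply Cn_id|apply Cn_const]. }
  apply Cn_plus; apply A.
Qed.

(** Jensen gives [(1 + h)^(4 m) <= 100 X^2] with [h = 1/(4 X)]. Bernoulli is applied to [(1 + h)^m]
    and the result raised to the fourth power, so [(m h)^4 <= 100 X^2] and [m = O(X^(3/2))]. Applied
    directly to the power [4 m], it would only give [O(X^3)], too weak for the integral near
    [p = 0]. *)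
Lemma sign_changes_bound (y : R) (l : list C) :
  0 <= y -> NoDup l ->
  (forall z, In z l -> exists u : R, z = RtoC u /\ 1 / 2 <= u <= y + 10 /\ Re (Fz (u, y)) = 0) ->
  forall m, length l = (4 * m)%nat -> INR m * INR m <= 160 * (y + 10) ^ 3.
Proof.
  intros Hy Hd Hl m Hm; set (X := y + 10).
  destruct (zeros_factor (Fsym y) l (Cinf_Fsym y) Hd) as [g [Hg E]].
  { intros z Hz; destruct (Hl z Hz) as [u [-> [Hu H0]]]; split.
    - unfold rhp; simpl; lra.
    - rewrite Fsym_real by lra; rewrite H0; auto. }
  set (Rd := X - 1 / 4); set (r0 := X - 1 / 2).
  assert (HX : 10 <= X) by (unfold X; lra).
  assert (J : Cmod (Fsym y X) * Rd ^ length l <= 100 * (X * X) * r0 ^ length l).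
  { apply (jensen rhp (Fsym y) g); try (unfold Rd, r0; lra).
    - exact (Hg 1%nat).
    - exists (1 / 8); split; [lra|]; intros z Hz.
      assert (A := Re_le_Cmod (z - X)); unfold rhp, Re, Rd in *; simpl in A.
      generalize (Rle_abs (- (fst z + - X))); rewrite Rabs_Ropp; lra.
    - exact E.
    - intros z Hz; destruct (Hl z Hz) as [u [-> [Hu _]]].
      rewrite <- RtoC_minus, Cmod_R, Rabs_left1; unfold r0, X in *; lra.
    - intros z Hz.
      assert (B : forall w, w = (z + (0, y))%C \/ w = (z + (0, (- y)%R))%C ->
         Cmod (Fz w) <= 100 * (X * X)).
      { intros w Hw; destruct (Fz_bound_circle X y (1 / 4) Rd z ltac:(lra) ltac:(lra)
          ltac:(unfold X; lra) eq_refl Hz w Hw) as [_ B].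
        eapply Rle_trans; [exact B|]; nra. }
      unfold Fsym; rewrite Cmod_mult, Cmod_R, (Rabs_pos_eq (/ 2)) by lra.
      assert (T := Cmod_triangle (Fz (z + (0, y))) (Fz (z + (0, (- y)%R)))).
      generalize (B _ (or_introl eq_refl)) (B _ (or_intror eq_refl)); lra. }
  assert (H1 : 1 <= Cmod (Fsym y X)).
  { rewrite Fsym_real by lra; rewrite Cmod_R; eapply Rle_trans; [|apply Rle_abs].
    eapply Rle_trans; [|apply Fz_far_Re]; simpl; rewrite ?Rabs_pos_eq; unfold X; lra. }
  assert (P0 : 0 < r0 ^ length l) by (apply pow_lt; unfold r0; lra).
  set (h := / (4 * X)).
  assert (Hh : 0 < h) by (apply Rinv_0_lt_compat; lra).
  assert (B : (1 + h) ^ length l <= 100 * (X * X)).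
  { apply Rmult_le_reg_r with (r0 ^ length l); auto.
    rewrite <- Rpow_mult_distr.
    assert (((1 + h) * r0) ^ length l <= Rd ^ length l).
    { apply pow_incr; split; [unfold r0; nra|].
      assert (h * r0 <= / 4).
      { apply Rle_trans with (h * X); [apply Rmult_le_compat_l; unfold r0; lra|].
        unfold h; right; field; lra. }
      unfold Rd, r0 in *; lra. }
    assert (0 <= Rd ^ length l) by (apply pow_le; unfold Rd; lra). nra. }
  rewrite Hm, Nat.mul_comm, pow_mult in B.
  assert (Br := poly m h Hh); set (q := (1 + h) ^ m) in *.
  assert (M0 := pos_INR m); set (w := INR m) in *.
  assert (Q : w * h <= q) by lra.
  assert (Q0 : 0 <= w * h) by (apply Rmult_le_pos; lra).
  assert (Q2 : (w * h) * (w * h) <= q * q) by (apply Rmult_le_compat; auto).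
  assert (B2 : (q * q) * (q * q) <= (10 * X) * (10 * X)) by (simpl in B; lra).
  assert (B3 : q * q <= 10 * X).
  { apply Rsqr_incr_0_var; [exact B2|lra]. }
  assert (W : w = (w * h) * (4 * X)) by (unfold h; field; lra).
  rewrite W.
  replace (w * h * (4 * X) * (w * h * (4 * X))) with ((w * h) * (w * h) * (16 * (X * X))) by ring.
  apply Rle_trans with (10 * X * (16 * (X * X))); [|right; simpl; ring].
  apply Rmult_le_compat_r; [nra|lra].
Qed.

(** Between [x] and the far point [X] the argument crosses every level [PI/2 + j PI] below its final
    size, and at each crossing [Re Fz] vanishes. *)
Lemma argE_bound_aux T l L x y : full_fact T l L -> 1 / 2 <= x -> 0 < y < T ->
  not_height l y -> argE l L (x, y) * argE l L (x, y) <= 100000 * (y + 10) ^ 3.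
Proof.
  intros HF Hx Hy Hn; generalize PI_RGT_0 PI_4; intros HP HP4.
  set (E := fun u => argE l L (u, y)); fold (E x); set (X := y + 10).
  assert (X3 : 1000 <= X ^ 3).
  { replace 1000 with (10 ^ 3) by (simpl; ring); apply pow_incr; unfold X; lra. }
  assert (EX : forall u, X <= u -> Rabs (E u) < PI / 2) by (intros; apply (argE_far T); unfold X in *; auto; lra).
  destruct (Rle_or_lt X x) as [Hc|Hc].
  { assert (A := EX x Hc); apply Rabs_def2 in A; nra. }
  (* Dividing by [4 PI] produces [4 m] crossings, the shape that [sign_changes_bound] asks for. *)
  destruct (nfloor_ex (Rabs (E x) / (4 * PI))) as [m Hm].
  { apply Rdiv_le_0_compat; [apply Rabs_pos|lra]. }
  assert (Em : 4 * PI * INR m <= Rabs (E x) < 4 * PI * (INR m + 1)).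
  { replace (Rabs (E x)) with (4 * PI * (Rabs (E x) / (4 * PI))) by (field; lra).
    split; [apply Rmult_le_compat_l; lra|apply Rmult_lt_compat_l; lra]. }
  assert (CE : forall u, x <= u <= X -> continuous E u).
  { intros u Hu; apply (continuous_comp (fun u => (u, y) : C) (argE l L)); [apply continuous_hor|].
    apply (continuous_argE T); [auto| | |].
    - split; simpl; [lra|rewrite Rabs_pos_eq; lra].
    - simpl; lra.
    - intros rho Hr; left; simpl; apply Hn; auto. }
  assert (BX := EX X (Rle_refl _)); apply Rabs_def2 in BX.
  (* The sign of [E x] is factored out so that only positive levels have to be crossed. *)
  set (sg := if Rle_dec 0 (E x) then 1 else -1).
  assert (Esg : Rabs (E x) = sg * E x).
  { unfold sg; destruct Rle_dec; [rewrite Rabs_pos_eq; lra|rewrite Rabs_left; lra]. }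
  assert (Sg : sg = 1 \/ sg = -1) by (unfold sg; destruct Rle_dec; auto).
  set (Q := fun (j : nat) (z : C) => exists u : R, z = RtoC u /\ x <= u <= X /\
     sg * E u = PI / 2 + INR j * PI).
  destruct (distinct_list Q (4 * m)) as [zl [Z1 [Z2 Z3]]].
  - intros j Hj.
    assert (Hj' : INR j + 1 <= 4 * INR m).
    { rewrite <- S_INR. replace (4 * INR m) with (INR (4 * m)) by (rewrite mult_INR; simpl; ring).
      apply le_INR; lia. }
    assert (J0 := pos_INR j).
    destruct (IVT_le (fun u => sg * E u) x X (PI / 2 + INR j * PI)) as [u [Hu1 Hu2]].
    + lra.
    + intros; apply continuous_Rmult; [apply continuous_const|auto].
    + right; rewrite <- Esg; split; [destruct Sg as [-> | ->]; nra|nra].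
    + exists (RtoC u), u; auto.
  - intros j k z [u [-> [_ H1]]] [v [Huv [_ H2]]].
    apply (f_equal fst) in Huv; simpl in Huv; subst v.
    apply INR_eq; apply Rmult_eq_reg_r with PI; lra.
  - assert (B := sign_changes_bound y zl ltac:(lra) Z2).
    assert (BM : INR m * INR m <= 160 * (y + 10) ^ 3).
    { apply B; auto; intros z Hz; destruct (Z3 z Hz) as [j [_ [u [-> [Hu Hv]]]]].
      exists u; split; auto; split; [unfold X in *; lra|].
      assert (A : isarg (Fz (u, y)) (E u)).
      { apply (isarg_argE T); auto; split; simpl; [lra|rewrite Rabs_pos_eq; lra]. }
      assert (C0 : cos (E u) = 0).
      { assert (C1 : cos (sg * E u) = 0).
        { rewrite Hv; replace (PI / 2 + INR j * PI) with (INR j * PI + PI / 2) by ring.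
          rewrite cos_plus, cos_PI2, sin_PI2.
          assert (S : sin (INR j * PI) = 0) by (apply sin_eq_0_1; exists (Z.of_nat j); rewrite <- INR_IZR_INZ; auto).
          rewrite S; ring. }
        destruct Sg as [E1|E1]; rewrite E1 in C1; [rewrite Rmult_1_l in C1; auto|].
        replace (-1 * E u) with (- E u) in C1 by ring; rewrite cos_neg in C1; auto. }
      unfold isarg in A; rewrite C0 in A; apply (f_equal fst) in A.
      change (Re (Fz (u, y)) = Cmod (Fz (u, y)) * 0) in A; rewrite A; ring. }
    fold X in BM; assert (M0 := pos_INR m); set (w := INR m) in *.
    replace (E x * E x) with (Rabs (E x) * Rabs (E x)) by (rewrite <- Rabs_mult; apply Rabs_pos_eq; generalize (Rle_0_sqr (E x)); unfold Rsqr; lra).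
    assert (A0 := Rabs_pos (E x)).
    assert (PI * (w + 1) <= 4 * (w + 1)) by (apply Rmult_le_compat_r; lra).
    assert (Rabs (E x) <= 16 * (w + 1)) by lra.
    apply Rle_trans with ((16 * (w + 1)) * (16 * (w + 1))); [apply Rmult_le_compat; auto|].
    apply Rle_trans with (512 * (w * w) + 512); [generalize (Rle_0_sqr (w - 1)); unfold Rsqr; lra|lra].
Qed.

Lemma argE_bound : exists K, 0 < K /\ forall T l L x y,
  full_fact T l L -> 1 / 2 <= x -> 0 < y < T -> Fz (x, y) <> RtoC 0 ->
  argE l L (x, y) * argE l L (x, y) <= K * (1 + y) ^ 3.
Proof.
  (* The bound is taken at a height [v] in [(y, y + 1)] free of zeros, where the argument differs by
     less than 1. There [v + 10 <= 11 (1 + y)] gives [1331 = 11^3], and [p^2 <= 2 q^2 + 2] the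
     rest. *)
  exists (2 * (100000 * 1331) + 2); split; [lra|]; intros T l L x y HF Hx Hy HZ.
  assert (Hs : strip T (x, y)) by (split; simpl; [lra|rewrite Rabs_pos_eq; lra]).
  assert (Nl : ~ In ((x, y) : C) l) by (intros H; apply HZ; exact (zero_in_list _ _ _ _ HF H)).
  assert (Hi : 0 < Im (x, y)) by (simpl; lra).
  destruct (right_cont_argE T l L (x, y) HF Hs Hi Nl 1 Rlt_0_1) as [d [Hd C1]].
  set (d' := Rmin d (Rmin 1 (T - y))).
  assert (Hd' : 0 < d') by (unfold d'; repeat apply Rmin_glb_lt; lra).
  assert (M : d' <= d /\ d' <= 1 /\ d' <= T - y).
  { unfold d'; generalize (Rmin_l d (Rmin 1 (T - y))) (Rmin_r d (Rmin 1 (T - y)))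
      (Rmin_l 1 (T - y)) (Rmin_r 1 (T - y)); lra. }
  destruct (avoid_finite (map (fun r => Im r) l) y (y + d')) as [a [b [Ha [Hb Hab]]]]; [lra|].
  set (v := (a + b) / 2); assert (Hv : a < v < b) by (unfold v; lra).
  specialize (C1 (v - y) ltac:(lra)).
  replace ((x, y) + (0, (v - y)%R))%C with ((x, v) : C) in C1 by (creal; ring).
  assert (B := argE_bound_aux T l L x v HF Hx ltac:(lra)).
  assert (NH : not_height l v).
  { intros rho Hr E; apply (Hab v Hv); rewrite E; apply (in_map (fun r => Im r)); auto. }
  specialize (B NH).
  assert (B2 : (v + 10) ^ 3 <= 1331 * (1 + y) ^ 3).
  { replace (1331 * (1 + y) ^ 3) with ((11 * (1 + y)) ^ 3) by (simpl; ring).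
    apply pow_incr; lra. }
  assert (B3 : 1 <= (1 + y) ^ 3).
  { replace 1 with (1 ^ 3) at 1 by (simpl; ring); apply pow_incr; lra. }
  apply Rabs_def2 in C1.
  set (p := argE l L (x, y)) in *; set (q := argE l L (x, v)) in *.
  assert ((q - p) * (q - p) <= 1) by nra.
  assert (p * p <= 2 * (q * q) + 2) by (generalize (Rle_0_sqr (2 * q - p)); unfold Rsqr; lra).
  lra.
Qed.

(** * The identity on an arc *)

Definition cdisc (Rd : R) (z : C) : Prop := Cmod z < Rd.

Lemma copen_cdisc Rd : copen (cdisc Rd).
Proof.
  intros z Hz; exists (Rd - Cmod z); unfold cdisc in *; split; [lra|]; intros w Hw.
  replace w with (w - z + z)%C by ring; eapply Rle_lt_trans; [apply Cmod_triangle|lra].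
Qed.

Lemma star_cdisc Rd : star (cdisc Rd) 0.
Proof.
  intros z u Hz Hu; unfold cdisc, seg in *.
  replace (0 + u * (z - 0))%C with (u * z)%C by ring.
  rewrite Cmod_mult, Cmod_R, Rabs_pos_eq by lra; generalize (Cmod_ge_0 z); nra.
Qed.

Lemma circ_mul2 q t : (circ 0 q t * circ 0 q t)%C = circ 0 (q * q) (2 * t).
Proof. unfold circ; rewrite cos_2a, sin_2a; creal; ring. Qed.

Lemma Cmod_circ0 y t : Cmod (circ 0 y t) = Rabs y.
Proof. rewrite <- (circ_dist 0 y t); f_equal; ring. Qed.

Lemma continuous_circ_t c y t : continuous (circ c y) t.
Proof. exact (continuous_2d_fix _ _ _ (continuous_circ c y t)). Qed.

Lemma is_derive_Im_mul_cis (f : C -> C) y t l : cdiff f (circ 0 y t) l ->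
  is_derive (fun u => Im ((cos u, sin u) * f (circ 0 y u))%C) t
    (Im ((cos t, sin t) * (Ci * (f (circ 0 y t) + circ 0 y t * l)))%C).
Proof.
  intros H; destruct (circ_derive_t f 0 y t l H) as [D1 D2].
  apply is_derive_extR with
    (fun u => cos u * Im (f (circ 0 y u)) + sin u * Re (f (circ 0 y u))).
  { intros u; unfold Re, Im; simpl; ring. }
  eapply is_derive_eq.
  - apply is_derive_Rplus; apply is_derive_Rmult;
      [apply is_derive_Reals; apply derivable_pt_lim_cos|exact D2
      |apply is_derive_Reals; apply derivable_pt_lim_sin|exact D1].
  - unfold circ, Re, Im; simpl; ring.
Qed.

(** The kernel [(tau^2 - q^2) / tau] is chosen so that on the arc [|tau| = q] only the
    argument of [g] contributes and on the imaginary axis only its modulus; the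
    quarter cdisc in [tau] is a half cdisc in [tau^2]. *)
Lemma arc_identity (g : C -> C) (Rd q : R) (phi : R -> R) :
  0 < q -> q * q < Rd -> Cn 2 (cdisc Rd) g ->
  (forall z, cdisc Rd z -> g z <> RtoC 0) -> g 0 = RtoC 1 ->
  (forall t : R, cdisc Rd t -> Im (g t) = 0) ->
  (forall p, 0 <= p <= PI / 2 -> continuous phi p) -> phi 0 = 0 ->
  (forall p, 0 <= p <= PI / 2 -> isarg (g (circ 0 (q * q) (2 * p))) (phi p)) ->
  exists M, is_RInt (fun p => phi p * sin p) 0 (PI / 2) M /\
    is_RInt (fun y => (1 + q * q / (y * y)) * ln (Cmod (g (RtoC (- (y * y)))))) 0 q (- 2 * q * M).
Proof.
  intros Hq HR Hg H0 H1 Hr Hphi P0 Hphi2; generalize PI_RGT_0; intros HPI.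
  destruct (log_exists 0 (cdisc Rd) g 0) as [k [Ck [Ek Ik]]]; auto.
  { apply copen_cdisc. } { apply star_cdisc. }
  { unfold cdisc; rewrite Cmod_0; nra. }
  assert (Ek' : forall s, cdisc Rd s -> g s = cexp (s * k s)).
  { intros s Hs; rewrite Ek by auto; f_equal; ring. }
  clear Ek; set (r := q * q) in *.
  assert (Hr0 : 0 < r) by (apply Rmult_lt_0_compat; auto).
  assert (HRr : q * q < Rd) by exact HR.
  assert (Hqq : 0 <= q * q) by (apply Rmult_le_pos; lra).
  set (D := fun tau : C => cdisc Rd (tau * tau)%C).
  set (sR := sqrt Rd).
  assert (HsR : q < sR).
  { unfold sR; rewrite <- (sqrt_square q) by lra; apply sqrt_lt_1; auto; lra. }
  assert (Dc : forall y t, Rabs y < sR -> D (circ 0 y t)).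
  { intros y t Hy; unfold D, cdisc; rewrite Cmod_mult, Cmod_circ0.
    rewrite <- (sqrt_sqrt Rd) by lra; fold sR; generalize (Rabs_pos y); intros; apply Rmult_le_0_lt_compat; auto. }
  (* Since [log g(tau^2) = tau^2 k(tau^2)], this is [2 log g(tau^2) (tau^2 - r) / tau^2] with its
     singularity at 0 removed; [F] is [f] times [i tau], the velocity along a circle. *)
  set (f := fun tau : C => (RtoC 2 * k (tau * tau) * (tau * tau - RtoC r))%C).
  assert (Cf : Cn 1 D f).
  { apply Cn_mult; [apply Cn_mult; [apply Cn_const|]|].
    - apply (Cn_comp 1 D (cdisc Rd) k (fun t => t * t)%C); auto.
      apply Cn_mult; apply Cn_id.
    - apply Cn_minus; [apply Cn_mult; apply Cn_id|apply Cn_const]. }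
  assert (Cf0 : forall z, D z -> continuous f z) by (intros; eapply Cn_continuous; eauto).
  destruct Cf as [f' [Hf' Cf']]; simpl in Cf'.
  set (F := fun tau : C => (f tau * (Ci * tau))%C).
  set (F' := fun tau : C => (Ci * (f tau + tau * f' tau))%C).
  assert (HF : forall z, D z -> cdiff F z (F' z)).
  { intros z Hz; eapply cdiff_eq.
    - apply cdiff_mult; [apply Hf'; auto|].
      apply cdiff_mult; [apply cdiff_const|apply cdiff_id].
    - unfold F'; ring. }
  (* Cauchy's theorem on the quarter disc is obtained by varying the radius. The derivative of [P]
     is the integral of a derivative in the angle, so only its end values remain: the one at angle 0
     vanishes because [k] is real on the real axis, and the one at [PI/2] is [v]. *)
  set (P := fun y => RInt (fun t => Im (F (circ 0 y t))) 0 (PI / 2)).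
  set (dP := fun y t => Im (F' (circ 0 y t) * (cos t, sin t))%C).
  assert (Cc : forall t, continuous (fun t : R => (cos t, sin t) : C) t).
  { intros t; apply continuous_pairC; [apply continuous_cos|apply continuous_sin]. }
  assert (CF' : forall z, D z -> continuous F' z).
  { intros z Hz; apply continuous_Cmult; [apply continuous_const|].
    apply continuous_Cplus; auto; apply continuous_Cmult; auto; apply continuous_id. }
  assert (DP : forall y, 0 <= y <= q -> is_derive P y (RInt (dP y) 0 (PI / 2))).
  { intros x Hx.
    assert (Sh : forall y, Rabs (y - x) < sR - q -> Rabs y < sR).
    { intros y Hy; replace y with ((y - x) + x) by ring.
      eapply Rle_lt_trans; [apply Rabs_triang|]; rewrite (Rabs_pos_eq x) by lra; lra. }
    apply (param_derive (fun y t => Im (F (circ 0 y t))) dP) with (sR - q); try lra.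
    - intros y t Hy; apply circ_derive_y; apply HF; apply Dc; auto.
    - intros t; apply continuous_ImC; apply continuous_Cmult.
      + apply (continuous_comp (fun p => circ 0 (fst p) (snd p)) F');
          [apply continuous_circ|apply CF'; apply Dc; simpl; apply Sh].
        rewrite Rminus_diag, Rabs_R0; lra.
      + apply (continuous_comp snd (fun t : R => (cos t, sin t) : C)); [apply continuous_snd|apply Cc].
    - intros y t Hy; apply continuous_ImC.
      apply (continuous_comp (fun t => circ 0 y t) F); [apply continuous_circ_t|].
      apply (cdiff_continuous F _ (F' (circ 0 y t))); apply HF; apply Dc; auto. }
  set (v := fun y => Re (f (0, y))).
  assert (EP : forall y, 0 <= y <= q -> RInt (dP y) 0 (PI / 2) = v y).
  { intros y Hy; apply is_RInt_unique.
    assert (Dy : forall t, D (circ 0 y t)) by (intros; apply Dc; rewrite Rabs_pos_eq; lra).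
    apply is_RInt_extR with (fun t => Im ((cos t, sin t) * (Ci * (f (circ 0 y t) + circ 0 y t * f' (circ 0 y t))))%C).
    { lra. } { intros t _; unfold dP, F'; f_equal; ring. }
    replace (v y) with (Im ((cos (PI / 2), sin (PI / 2)) * f (circ 0 y (PI / 2)))%C -
       Im ((cos 0, sin 0) * f (circ 0 y 0))%C).
    - apply (is_RInt_derive (V := R_CompleteNormedModule) (fun t => Im ((cos t, sin t) * f (circ 0 y t))%C)).
      + intros t _; apply is_derive_Im_mul_cis; auto.
      + intros t _; apply continuous_ImC; apply continuous_Cmult; [apply Cc|].
        apply (continuous_comp (fun t => circ 0 y t) F'); [apply continuous_circ_t|auto].
    - unfold v; rewrite cos_PI2, sin_PI2, cos_0, sin_0; unfold circ.
      rewrite cos_PI2, sin_PI2, cos_0, sin_0.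
      replace (0 + ((y * 0)%R, (y * 1)%R))%C with ((0, y) : C) by (creal; ring).
      replace (0 + ((y * 1)%R, (y * 0)%R))%C with (RtoC y) by (creal; ring).
      assert (Ky : Im (k (RtoC (y * y))) = 0).
      { apply Ik; unfold cdisc; rewrite Cmod_R, Rabs_pos_eq by nra; nra. }
      unfold f; rewrite <- RtoC_mult, (RtoC_Im0 _ Ky).
      unfold Im, Re; simpl; ring. }
  assert (Cv : forall y, 0 <= y <= q -> continuous v y).
  { intros y Hy; apply continuous_ReC; apply (continuous_comp (fun y : R => (0, y) : C) f).
    - apply continuous_ver.
    - apply Cf0; replace ((0, y) : C) with (circ 0 y (PI / 2)).
      + apply Dc; rewrite Rabs_pos_eq; lra.
      + unfold circ; rewrite cos_PI2, sin_PI2; creal; ring. }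
  assert (IV : is_RInt v 0 q (P q - P 0)).
  { apply (is_RInt_derive (V := R_CompleteNormedModule) P v); rewrite Rmin_left, Rmax_right by lra; auto.
    intros y Hy; rewrite <- EP by auto; auto. }
  assert (P00 : P 0 = 0).
  { unfold P; rewrite (RInt_extR _ (fun _ => 0)) by
      (try lra; intros; unfold F, circ, Im; simpl; ring).
    rewrite RInt_const; unfold scal; simpl; unfold mult; simpl; ring. }
  assert (CIm : forall p, continuous (fun p => Im (circ 0 r (2 * p) * k (circ 0 r (2 * p)))%C) p).
  { intros p; apply continuous_ImC.
    assert (C1 : continuous (fun p => circ 0 r (2 * p)) p).
    { apply (continuous_comp (fun p => 2 * p) (circ 0 r)); [|apply continuous_circ_t].
      apply continuous_Rmult; [apply continuous_const|apply continuous_id]. }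
    apply continuous_Cmult; auto.
    apply (continuous_comp (fun p => circ 0 r (2 * p)) k); auto.
    apply (Cn_continuous 1 (cdisc Rd)); auto.
    unfold cdisc; rewrite Cmod_circ0, Rabs_pos_eq; lra. }
  assert (Dr : forall p, cdisc Rd (circ 0 r p)).
  { intros p; unfold cdisc; rewrite Cmod_circ0, Rabs_pos_eq; lra. }
  (* Both sides are continuous arguments of [g] along the arc and both vanish at [p = 0]. *)
  assert (Ephi : forall p, 0 <= p <= PI / 2 -> phi p = Im (circ 0 r (2 * p) * k (circ 0 r (2 * p)))%C).
  { apply (isarg_unique_cont (fun p => g (circ 0 r (2 * p)))) with 0; auto; try lra.
    - intros p Hp; rewrite Ek' by auto; apply isarg_cexp.
    - rewrite P0, Rmult_0_r; replace (circ 0 r 0) with (RtoC r)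
        by (unfold circ; rewrite cos_0, sin_0; creal; ring).
      assert (Kr : Im (k r) = 0) by (apply Ik; unfold cdisc; rewrite Cmod_R, Rabs_pos_eq; lra).
      rewrite (RtoC_Im0 _ Kr); unfold Im; simpl; ring. }
  assert (EM : ex_RInt (fun p => phi p * sin p) 0 (PI / 2)).
  { apply ex_RInt_cont; [lra|]; intros; apply continuous_Rmult; auto; apply continuous_sin. }
  exists (RInt (fun p => phi p * sin p) 0 (PI / 2)); split.
  { apply (RInt_correct (V := R_CompleteNormedModule)); auto. }
  assert (EPq : P q = - 4 * q * RInt (fun p => phi p * sin p) 0 (PI / 2)).
  { unfold P; rewrite <- RInt_Rscal by auto; apply RInt_extR; [lra|]; intros p Hp.
    rewrite Ephi by lra; unfold F, f; rewrite circ_mul2; fold r.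
    set (K := k (circ 0 r (2 * p))).
    replace (RtoC 2 * K * (circ 0 r (2 * p) - r) * (Ci * circ 0 q p))%C
      with (RtoC (-4 * q * sin p) * (circ 0 r (2 * p) * K))%C.
    - unfold Im; simpl; ring.
    - assert (S := sin2cos2 p).
      replace (circ 0 r (2 * p) - r)%C with (RtoC (2 * r * sin p) * (Ci * (cos p, sin p)))%C.
      + unfold circ; rewrite cos_2a, sin_2a; destruct K as [k1 k2]; unfold r; creal; ring.
      + unfold circ; rewrite cos_2a, sin_2a; creal; [|ring].
        replace (cos p * cos p) with (1 - sin p * sin p) by lra; ring. }
  rewrite EPq, P00, Rminus_0_r in IV; apply (is_RInt_Rscal _ (/ 2)) in IV.
  replace (-2 * q * RInt (fun p => phi p * sin p) 0 (PI / 2)) with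
    (/ 2 * (- 4 * q * RInt (fun p => phi p * sin p) 0 (PI / 2))) by field.
  apply is_RInt_extR with (3 := IV); [lra|].
  intros y Hy.
  assert (Dy : cdisc Rd (RtoC (- (y * y)))).
  { unfold cdisc; rewrite Cmod_R, Rabs_Ropp, Rabs_pos_eq by nra; nra. }
  assert (Ky := Ik _ Dy).
  rewrite Ek', Cmod_cexp, ln_exp by auto.
  unfold v, f; replace ((0, y) * (0, y))%C with (RtoC (- (y * y))) by (creal; ring).
  rewrite (RtoC_Im0 _ Ky); unfold Re; simpl; unfold r; field; lra.
Qed.

(** * An explicit logarithmic integral *)

Definition clamp (a b x : R) : R := Rmax a (Rmin b x).

Lemma clamp_in a b x : a <= x <= b -> clamp a b x = x.
Proof. intros H; unfold clamp; rewrite Rmin_right, Rmax_right; lra. Qed.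

Lemma clamp_bound a b x : a <= b -> a <= clamp a b x <= b.
Proof.
  intros H; unfold clamp; split; [apply Rmax_l|].
  apply Rmax_lub; auto; apply Rmin_l.
Qed.

Lemma continuous_clamp a b x : continuous (clamp a b) x.
Proof.
  apply continuous_extC with
    (fun x => (a + (b + x - Rabs (b - x)) * / 2 + Rabs (a - (b + x - Rabs (b - x)) * / 2)) * / 2).
  - intros u; unfold clamp, Rmax, Rmin, Rabs; destruct Rle_dec; destruct (Rcase_abs (b - u));
      destruct Rle_dec; destruct Rcase_abs; lra.
  - assert (C1 : continuous (fun x => (b + x - Rabs (b - x)) * / 2) x).
    { apply continuous_Rmult; [|apply continuous_const].
      apply continuous_Rminus.
      - apply continuous_Rplus; [apply continuous_const|apply (continuous_id (U := R_UniformSpace))].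
      - apply (continuous_comp (fun x => b - x) Rabs); [|apply continuous_Rabs].
        apply continuous_Rminus; [apply continuous_const|apply (continuous_id (U := R_UniformSpace))]. }
    apply continuous_Rmult; [|apply continuous_const].
    apply continuous_Rplus; [apply continuous_Rplus; [apply continuous_const|auto]|].
    apply (continuous_comp (fun x => a - (b + x - Rabs (b - x)) * / 2) Rabs); [|apply continuous_Rabs].
    apply continuous_Rminus; [apply continuous_const|auto].
Qed.

(** The primitive used in [log_integral] is differentiated only on the open interval, where its
    singular-looking terms are explicit. Clamping extends [f] continuously to the whole line. *)
Lemma FTC_open (f F : R -> R) a b : a <= b ->
  (forall x, a <= x <= b -> continuous f x) ->
  (forall x, a <= x <= b -> continuous F x) ->
  (forall x, a < x < b -> is_derive F x (f x)) ->
  is_RInt f a b (F b - F a).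
Proof.
  intros Hab Cf CF HD.
  set (g := fun x => f (clamp a b x)).
  assert (Cg : forall x, continuous g x).
  { intros x; apply (continuous_comp (clamp a b) f); [apply continuous_clamp|].
    apply Cf; apply clamp_bound; auto. }
  assert (Ig : forall x, is_RInt g a x (RInt g a x)).
  { intros x; apply (RInt_correct (V := R_CompleteNormedModule)).
    apply (ex_RInt_continuous (V := R_CompleteNormedModule)); auto. }
  assert (DG : forall x, is_derive (fun x => RInt g a x) x (g x)).
  { intros x; apply (is_derive_RInt (V := R_NormedModule) g _ a); auto.
    exists (mkposreal 1 Rlt_0_1); auto. }
  destruct (MVT_gen (fun x => RInt g a x - F x) a b (fun _ => 0)) as [c [_ E]];
    rewrite ?Rmin_left, ?Rmax_right by lra.
  - intros x Hx; eapply is_derive_eq; [apply is_derive_Rminus; [apply DG|apply HD; lra]|].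
    unfold g; rewrite clamp_in by lra; ring.
  - intros x Hx; apply continuous_continuity_pt; apply continuous_Rminus; auto.
    exact (is_derive_continuous _ _ _ (DG x)).
  - rewrite RInt_point in E; unfold zero in E; simpl in E.
    apply is_RInt_extR with g; auto.
    + intros x Hx; unfold g; rewrite clamp_in; auto; lra.
    + replace (F b - F a) with (RInt g a b) by lra; apply Ig.
Qed.

(** The continuous extension of [ln (1 + x) / x]; with it, a logarithm of size [y^2] divided by
    [y^2] is visibly continuous at [y = 0]. *)
Definition lnslope (x : R) : R := if Req_EM_T x 0 then 1 else ln (1 + x) / x.

Lemma lnslope_mul x : lnslope x * x = ln (1 + x).
Proof.
  unfold lnslope; destruct Req_EM_T as [->|]; [rewrite Rplus_0_r, ln_1; ring|field; auto].
Qed.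

Lemma continuous_lnslope x : -1 < x -> continuous lnslope x.
Proof.
  intros Hx; destruct (Req_dec x 0) as [->|N].
  - assert (D : derivable_pt_lim (fun x => ln (1 + x)) 0 1).
    { apply is_derive_Reals; auto_derive; lra. }
    intros P [e HP].
    destruct (D e (cond_pos e)) as [d Hd].
    exists d; intros y Hy; apply HP; unfold ball; simpl.
    unfold ball in Hy; simpl in Hy; unfold AbsRing_ball, abs, minus, plus, opp in *; simpl in *.
    rewrite Ropp_0, Rplus_0_r in Hy; unfold lnslope.
    destruct (Req_EM_T 0 0) as [_|]; [|tauto].
    destruct (Req_EM_T y 0) as [->|Ny].
    + rewrite Rplus_opp_r, Rabs_R0; apply cond_pos.
    + specialize (Hd y Ny Hy); rewrite Rplus_0_l, Rplus_0_r, ln_1, Rminus_0_r in Hd; exact Hd.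
  - apply continuous_ext_loc with (fun x => ln (1 + x) / x).
    + exists (mkposreal (Rabs x) (Rabs_pos_lt x N)); intros y Hy.
      unfold lnslope; destruct Req_EM_T as [->|]; auto; exfalso.
      unfold ball in Hy; simpl in Hy; unfold AbsRing_ball, abs, minus, plus, opp in Hy; simpl in Hy.
      rewrite Rplus_0_l, Rabs_Ropp in Hy; lra.
    + apply (ex_derive_continuous (V := R_NormedModule)); auto_derive; lra.
Qed.

Lemma is_derive_comp_R (f g : R -> R) x l m :
  is_derive f (g x) l -> is_derive g x m -> is_derive (fun u => f (g u)) x (m * l).
Proof. exact (is_derive_comp (V := R_NormedModule) f g x l m). Qed.

Lemma is_derive_atan x : is_derive atan x (/ (1 + x ^ 2)).
Proof. apply is_derive_Reals; apply derivable_pt_lim_atan. Qed.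

(** Put [c = c1 + i c2] and [k = c^2]. The two logarithms are those of [|k + y^2|^2 / |k|^2],
    belonging to a zero in the disc, and of [|1 + k y^2|^2], belonging to its reflection in the
    circle. Their sum has an elementary integral whose value depends only on [c1] and [n = |k|]. *)
Lemma log_integral (c1 c2 : R) : 0 < c1 ->
  let n := c1 * c1 + c2 * c2 in
  let k1 := c1 * c1 - c2 * c2 in let k2 := 2 * c1 * c2 in
  is_RInt (fun y => (1 + 1 / (y * y)) *
    (ln (((k1 + y * y) ^ 2 + k2 ^ 2) / (n * n)) + ln ((1 + k1 * (y * y)) ^ 2 + (k2 * (y * y)) ^ 2)))
    0 1 (-8 + 2 * PI * (c1 * (1 + / n))).
Proof.
  intros Hc n k1 k2.
  assert (Hcc : 0 < c1 * c1) by (apply Rmult_lt_0_compat; auto).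
  assert (Hn : 0 < n) by (unfold n; generalize (Rle_0_sqr c2); unfold Rsqr; lra).
  assert (Hkn : k1 * k1 + k2 * k2 = n * n) by (unfold k1, k2, n; ring).
  set (m1 := fun y => (2 * k1 + y * y) / (n * n)).
  set (m2 := fun y => 2 * k1 + n * n * (y * y)).
  set (N1 := fun y => ((k1 + y * y) ^ 2 + k2 ^ 2) / (n * n)).
  set (N2 := fun y => (1 + k1 * (y * y)) ^ 2 + (k2 * (y * y)) ^ 2).
  assert (E1 : forall y, N1 y = 1 + y * y * m1 y).
  { intros y; unfold N1, m1.
    replace ((k1 + y * y) ^ 2 + k2 ^ 2) with (n * n + y * y * (2 * k1 + y * y)) by (rewrite <- Hkn; ring).
    field; lra. }
  assert (E2 : forall y, N2 y = 1 + y * y * m2 y).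
  { intros y; unfold N2, m2.
    replace (1 + y * y * (2 * k1 + n * n * (y * y))) with
      (1 + y * y * (2 * k1 + (k1 * k1 + k2 * k2) * (y * y))) by (rewrite Hkn; auto); ring. }
  (* Having the square root [c] of [k] splits both quartics: [Ap] and [Am] are the squared moduli of
     [c + i y] and [c - i y], [Bm] and [Bp] those of [1 + i c y] and [1 - i c y]. *)
  set (Ap := fun y => c1 * c1 + (c2 + y) * (c2 + y)); set (Am := fun y => c1 * c1 + (c2 - y) * (c2 - y)).
  set (Bp := fun y => c1 * y * (c1 * y) + (c2 * y + 1) * (c2 * y + 1)).
  set (Bm := fun y => c1 * y * (c1 * y) + (1 - c2 * y) * (1 - c2 * y)).
  assert (P1 : forall y, 0 < Ap y) by (intros y; unfold Ap; generalize (Rle_0_sqr (c2 + y)); unfold Rsqr; lra).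
  assert (P2 : forall y, 0 < Am y) by (intros y; unfold Am; generalize (Rle_0_sqr (c2 - y)); unfold Rsqr; lra).
  assert (PB : forall u v, 0 <= u -> (u = 0 -> v <> 0) -> 0 < c1 * u * (c1 * u) + v * v).
  { intros u v Hu Hv; destruct (Req_dec u 0) as [E|N].
    - specialize (Hv E); rewrite E; generalize (Rsqr_pos_lt v Hv); unfold Rsqr; nra.
    - assert (0 < c1 * u) by (apply Rmult_lt_0_compat; lra).
      generalize (Rle_0_sqr v); unfold Rsqr; nra. }
  assert (P3 : forall y, 0 <= y -> 0 < Bp y).
  { intros; apply PB; auto; intros ->; lra. }
  assert (P4 : forall y, 0 <= y -> 0 < Bm y).
  { intros; apply PB; auto; intros ->; lra. }
  assert (F1 : forall y, (k1 + y * y) ^ 2 + k2 ^ 2 = Ap y * Am y)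
    by (intros; unfold k1, k2, Ap, Am; ring).
  assert (F2 : forall y, N2 y = Bp y * Bm y) by (intros; unfold N2, k1, k2, Bp, Bm; ring).
  assert (Q1 : forall y, 0 < N1 y).
  { intros; unfold N1; rewrite F1; apply Rdiv_lt_0_compat; apply Rmult_lt_0_compat; auto. }
  assert (Q2 : forall y, 0 <= y -> 0 < N2 y).
  { intros; rewrite F2; apply Rmult_lt_0_compat; auto. }
  set (w := fun y => lnslope (y * y * m1 y) * m1 y + lnslope (y * y * m2 y) * m2 y).
  assert (Ew : forall y, y * y * w y = ln (N1 y) + ln (N2 y)).
  { intros y; rewrite E1, E2, <- !lnslope_mul; unfold w; ring. }
  assert (Cm1 : forall y, continuous m1 y).
  { intros; apply (ex_derive_continuous (V := R_NormedModule)); unfold m1; auto_derive; auto. }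
  assert (Cm2 : forall y, continuous m2 y).
  { intros; apply (ex_derive_continuous (V := R_NormedModule)); unfold m2; auto_derive; auto. }
  assert (Cy : forall y : R, continuous (fun y : R => y) y) by (intros; apply continuous_id).
  assert (Cw : forall y, 0 <= y -> continuous w y).
  { intros y Hy; apply continuous_Rplus; apply continuous_Rmult; auto.
    - apply (continuous_comp (fun y => y * y * m1 y) lnslope).
      + apply continuous_Rmult; auto; apply continuous_Rmult; auto.
      + apply continuous_lnslope; specialize (Q1 y); rewrite E1 in Q1; lra.
    - apply (continuous_comp (fun y => y * y * m2 y) lnslope).
      + apply continuous_Rmult; auto; apply continuous_Rmult; auto.
      + apply continuous_lnslope; specialize (Q2 y Hy); rewrite E2 in Q2; lra. }
  set (d1 := c1 * (1 + / n)); set (d2 := c2 * (1 - / n)).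
  (* The part of the primitive left after integration by parts. The angles of the [B] factors are
     written with [Arg] because the corresponding arctangents have [c1 * y] in the denominator,
     which vanishes at [y = 0]. *)
  set (S := fun y => / 2 * (d1 * (atan ((c2 + y) / c1) - atan ((c2 - y) / c1) +
     Arg (1 - c2 * y, c1 * y) + Arg (1 + c2 * y, c1 * y)) +
     d2 * / 2 * (ln (Ap y) - ln (Am y) + ln (Bm y) - ln (Bp y)))).
  (* Integration by parts with [y - 1/y] as primitive of [1 + 1/y^2]; the sum of logarithms is
     [y^2 * w y], which cancels the pole. *)
  set (Psi := fun y => (y * y - 1) * y * w y - 8 * y + 4 * S y).
  assert (Cln : forall (f : R -> R) y, continuous f y -> 0 < f y -> continuous (fun y => ln (f y)) y).
  { intros f y Hf Hp; apply (continuous_comp f ln); auto; apply continuous_ln; auto. }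
  assert (Cat : forall (f : R -> R) y, continuous f y -> continuous (fun y => atan (f y)) y).
  { intros f y Hf; apply (continuous_comp f atan); auto.
    exact (is_derive_continuous _ _ _ (is_derive_atan _)). }
  assert (Cpoly : forall (f : R -> R) y, ex_derive f y -> continuous f y).
  { intros; apply (ex_derive_continuous (V := R_NormedModule)); auto. }
  assert (CArg : forall u y, 0 <= y -> continuous (fun y => Arg (1 + u * y, c1 * y)) y).
  { intros u y Hy; apply (continuous_comp (fun y => (1 + u * y, c1 * y) : C) Arg).
    - apply continuous_pairC; apply Cpoly; auto_derive; auto.
    - apply continuous_Arg; simpl; intros [H1 H2].
      apply Rmult_integral in H2; destruct H2 as [H2|H2]; [lra|rewrite H2 in H1; lra]. }
  assert (CS : forall y, 0 <= y -> continuous S y).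
  { intros y Hy; apply continuous_Rmult; [apply continuous_const|].
    apply continuous_Rplus; apply continuous_Rmult; try apply continuous_const.
    - apply continuous_Rplus; [apply continuous_Rplus; [apply continuous_Rminus|]|apply CArg; auto].
      + apply Cat; apply Cpoly; auto_derive; lra.
      + apply Cat; apply Cpoly; auto_derive; lra.
      + apply continuous_extC with (fun y => Arg (1 + (- c2) * y, c1 * y)); [|apply CArg; auto].
        intros u; do 2 f_equal; ring.
    - apply continuous_Rminus; [apply continuous_Rplus; [apply continuous_Rminus|]|];
        apply Cln; auto; apply Cpoly; unfold Ap, Am, Bp, Bm; auto_derive; auto. }
  assert (CPsi : forall y, 0 <= y <= 1 -> continuous Psi y).
  { intros y Hy; apply continuous_Rplus.
    - apply continuous_Rminus; [apply continuous_Rmult; [|apply Cw; lra]|]; apply Cpoly; auto_derive; auto.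
    - apply continuous_Rmult; [apply continuous_const|apply CS; lra]. }
  assert (DArg : forall u y, 0 < y -> is_derive (fun y => Arg (1 + u * y, c1 * y)) y
      (c1 / (c1 * y * (c1 * y) + (1 + u * y) * (1 + u * y)))).
  { intros u y Hy.
    apply (is_derive_ext_loc (V := R_NormedModule) (fun y => PI / 2 - atan ((1 + u * y) / (c1 * y)))).
    - exists (mkposreal y Hy); intros v Hv.
      unfold ball in Hv; simpl in Hv; unfold AbsRing_ball, abs, minus, plus, opp in Hv; simpl in Hv.
      apply Rabs_def2 in Hv; symmetry; apply (Arg_Im_pos_atan (1 + u * v, c1 * v)); simpl.
      apply Rmult_lt_0_compat; lra.
    - assert (0 < c1 * y) by (apply Rmult_lt_0_compat; auto).
      assert (0 < c1 * y * (c1 * y) + (1 + u * y) * (1 + u * y)).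
      { generalize (Rle_0_sqr (1 + u * y)); unfold Rsqr; nra. }
      eapply is_derive_eq.
      + apply is_derive_Rminus; [apply is_derive_Rconst|].
        apply (is_derive_comp_R atan (fun y => (1 + u * y) / (c1 * y))); [apply is_derive_atan|].
        auto_derive; [lra|reflexivity].
      + field; repeat split; lra. }
  set (f := fun y => (y * y + 1) * w y).
  assert (DS : forall y, 0 < y < 1 -> is_derive S y
     ((/ 2) * (d1 * (c1 / Ap y + c1 / Am y + c1 / Bm y + c1 / Bp y) +
       d2 * ((c2 + y) / Ap y + (c2 - y) / Am y +
         (c1 * c1 * y - c2 * (1 - c2 * y)) / Bm y - (c1 * c1 * y + c2 * (c2 * y + 1)) / Bp y)))).
  { intros y Hy.
    assert (X1 := P1 y); assert (X2 := P2 y); assert (X3 := P3 y ltac:(lra)); assert (X4 := P4 y ltac:(lra)).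
    eapply is_derive_eq.
    - apply is_derive_Rmult; [apply is_derive_Rconst|].
      apply is_derive_Rplus; (apply is_derive_Rmult; [apply is_derive_Rconst|]).
      + apply is_derive_Rplus; [apply is_derive_Rplus; [apply is_derive_Rminus|]|].
        * apply (is_derive_comp_R atan (fun y => (c2 + y) / c1)); [apply is_derive_atan|].
          auto_derive; [lra|reflexivity].
        * apply (is_derive_comp_R atan (fun y => (c2 - y) / c1)); [apply is_derive_atan|].
          auto_derive; [lra|reflexivity].
        * apply is_derive_extR with (fun y => Arg (1 + (- c2) * y, c1 * y)); [|apply DArg; lra].
          intros u; do 2 f_equal; ring.
        * apply DArg; lra.
      + apply is_derive_Rminus; [apply is_derive_Rplus; [apply is_derive_Rminus|]|];
          [instantiate (1 := 2 * (c2 + y) / Ap y)|instantiate (1 := - (2 * (c2 - y) / Am y))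
          |instantiate (1 := 2 * (c1 * c1 * y - c2 * (1 - c2 * y)) / Bm y)
          |instantiate (1 := 2 * (c1 * c1 * y + c2 * (c2 * y + 1)) / Bp y)];
          unfold Ap, Am, Bp, Bm in *; auto_derive; auto; field; lra.
    - replace (c1 * y * (c1 * y) + (1 + - c2 * y) * (1 + - c2 * y)) with (Bm y) by (unfold Bm; ring).
      replace (c1 * y * (c1 * y) + (1 + c2 * y) * (1 + c2 * y)) with (Bp y) by (unfold Bp; ring).
      replace (/ (1 + ((c2 + y) / c1) ^ 2)) with (c1 * c1 / Ap y).
      2:{ unfold Ap in *; field; split; [|lra]; intros E; revert X1; rewrite <- E; intros; nra. }
      replace (/ (1 + ((c2 - y) / c1) ^ 2)) with (c1 * c1 / Am y).
      2:{ unfold Am in *; field; split; [|lra]; intros E; revert X2; rewrite <- E; intros; nra. }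
      field; repeat split; lra. }
  assert (DPsi : forall y, 0 < y < 1 -> is_derive Psi y (f y)).
  { intros y Hy.
    assert (X1 := P1 y); assert (X2 := P2 y); assert (X3 := P3 y ltac:(lra)); assert (X4 := P4 y ltac:(lra)).
    apply (is_derive_ext_loc (V := R_NormedModule) (fun y => (y - / y) *
       (ln (Ap y) + ln (Am y) - ln (n * n) + (ln (Bp y) + ln (Bm y))) - 8 * y + 4 * S y)).
    - exists (mkposreal y (proj1 Hy)); intros v Hv.
      unfold ball in Hv; simpl in Hv; unfold AbsRing_ball, abs, minus, plus, opp in Hv; simpl in Hv.
      apply Rabs_def2 in Hv.
      unfold Psi; do 2 f_equal.
      transitivity ((v - / v) * (v * v * w v)); [|field; lra].
      rewrite Ew, F2; unfold N1; rewrite F1; f_equal.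
      unfold Rdiv; rewrite !ln_mult, ln_Rinv by
        (first [apply Rmult_lt_0_compat; auto|apply Rinv_0_lt_compat; apply Rmult_lt_0_compat; auto
               |apply P3; lra|apply P4; lra|auto]); rewrite ?(ln_mult n n) by auto; ring.
    - eapply is_derive_eq.
      + apply is_derive_Rplus; [apply is_derive_Rminus|].
        * apply is_derive_Rmult.
          -- instantiate (1 := 1 + / (y * y)); auto_derive; [lra|field; lra].
          -- instantiate (1 := 2 * (c2 + y) / Ap y - 2 * (c2 - y) / Am y +
               (2 * (c1 * c1 * y + c2 * (c2 * y + 1)) / Bp y + 2 * (c1 * c1 * y - c2 * (1 - c2 * y)) / Bm y)).
             unfold Ap, Am, Bp, Bm in *; auto_derive; [repeat split; auto|].
             field; lra.
        * instantiate (1 := 8); auto_derive; auto; ring.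
        * apply is_derive_Rmult; [apply is_derive_Rconst|apply DS; auto].
      + assert (EL : ln (Ap y) + ln (Am y) - ln (n * n) + (ln (Bp y) + ln (Bm y)) = y * y * w y).
        { rewrite Ew, F2; unfold N1; rewrite F1.
          unfold Rdiv; rewrite !ln_mult, ln_Rinv by
            (first [apply Rmult_lt_0_compat; auto|apply Rinv_0_lt_compat; apply Rmult_lt_0_compat; auto
               |auto]); rewrite ?(ln_mult n n) by auto; ring. }
        cbv beta; rewrite EL; unfold f, d1, d2.
        clear - Hc Hn Hy X1 X2 X3 X4.
        replace ((1 + / (y * y)) * (y * y * w y)) with ((y * y + 1) * w y) by (field; lra).
        apply Rminus_diag_uniq; unfold Ap, Am, Bp, Bm, n in *; field.
        repeat split; lra. }
  assert (ES1 : S 1 = / 2 * (d1 * PI)).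
  { unfold S; rewrite !(Arg_Im_pos_atan (_, _)) by (simpl; lra); simpl.
    replace ((1 - c2 * 1) / (c1 * 1)) with (- ((c2 - 1) / c1)) by (field; lra).
    replace ((1 + c2 * 1) / (c1 * 1)) with ((c2 + 1) / c1) by (field; lra).
    rewrite atan_opp.
    replace (Bm 1) with (Am 1) by (unfold Am, Bm; ring).
    replace (Bp 1) with (Ap 1) by (unfold Ap, Bp; ring). field. }
  assert (ES0 : S 0 = 0).
  { unfold S; rewrite !Arg_pos_real by (simpl; lra).
    replace (Am 0) with (Ap 0) by (unfold Am, Ap; ring).
    replace (Bm 0) with (Bp 0) by (unfold Bm, Bp; ring).
    replace (c2 + 0) with c2 by ring; replace (c2 - 0) with c2 by ring; ring. }
  replace (-8 + 2 * PI * d1) with (Psi 1 - Psi 0)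
    by (unfold Psi; rewrite ES1, ES0; field).
  apply is_RInt_extR with f; [lra| |].
  - intros y Hy; unfold f; fold (N1 y); fold (N2 y); rewrite <- Ew; field; lra.
  - apply FTC_open; auto; [lra|].
    intros y Hy; apply continuous_Rmult; [|apply Cw; lra].
    apply Cpoly; auto_derive; auto.
Qed.

Lemma Re_Cminus z w : Re (z - w)%C = Re z - Re w.
Proof. unfold Re; simpl; ring. Qed.

Lemma Im_Cminus z w : Im (z - w)%C = Im z - Im w.
Proof. unfold Im; simpl; ring. Qed.

(** * Contribution of a pair of zeros *)

(** Cayley parametrisation of the half plane [Re s > 1 - a] by the unit disc, with
    [0] sent to [1]. *)
Definition sz (a : R) (w : C) : C := (1 + RtoC (2 * a) * w / (1 - w))%C.

Lemma one_sub_neq w : Cmod w < 1 -> (1 - w)%C <> RtoC 0.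
Proof.
  intros H; apply Csub_neq; intros <-; rewrite Cmod_1 in H; lra.
Qed.

(** The squared modulus of [1 - w] at [w = r e^(i t)]. *)
Definition circ_den (r t : R) : R := 1 - 2 * r * cos t + r * r.

Lemma circ_den_pos r t : 0 <= r < 1 -> 0 < circ_den r t.
Proof.
  intros H; unfold circ_den; generalize (COS_bound t); intros B.
  assert (r * cos t <= r) by nra. nra.
Qed.

Lemma sz_circ a r t : 0 <= r < 1 ->
  sz a (circ 0 r t) = (1 - a + a * (1 - r * r) / circ_den r t, 2 * a * r * sin t / circ_den r t).
Proof.
  intros H; assert (D := circ_den_pos r t H); assert (S := sin2cos2 t).
  assert (N : (1 - circ 0 r t)%C <> RtoC 0) by (apply one_sub_neq; rewrite Cmod_circ0, Rabs_pos_eq; lra).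
  assert (E : (1 - r * cos t) * (1 - r * cos t) + r * sin t * (r * sin t) = circ_den r t).
  { unfold circ_den; replace (r * sin t * (r * sin t)) with (r * r * (sin t * sin t)) by ring.
    replace (sin t * sin t) with (1 - cos t * cos t) by lra; ring. }
  unfold sz, Cdiv; replace (/ (1 - circ 0 r t))%C with
    ((((1 - r * cos t) / circ_den r t)%R, (r * sin t / circ_den r t)%R) : C).
  - unfold circ; creal; [|field; lra].
    apply Rmult_eq_reg_r with (circ_den r t); [|lra]; field_simplify; try lra.
    replace (cos t ^ 2) with (1 - sin t ^ 2) by (simpl; lra); unfold circ_den; ring.
  - symmetry; replace (/ (1 - circ 0 r t))%C with (/ (1 - circ 0 r t) * ((1 - circ 0 r t) *
      (((1 - r * cos t) / circ_den r t)%R, (r * sin t / circ_den r t)%R)))%C.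
    + rewrite Cmult_assoc, Cinv_l, Cmult_1_l; auto.
    + replace ((1 - circ 0 r t) * (((1 - r * cos t) / circ_den r t)%R, (r * sin t / circ_den r t)%R))%C
        with (RtoC 1); [ring|].
      unfold circ; creal; [|field; lra].
      rewrite <- E; field; rewrite E; lra.
Qed.

Lemma sz_Re_pos a w : 0 < a -> Cmod w < 1 -> 1 - a < Re (sz a w).
Proof.
  intros Ha Hw; assert (N := one_sub_neq w Hw).
  assert (M := Cnormsq_pos _ N); assert (Q := Cmod_sqr w).
  assert (Cmod w * Cmod w < 1) by (generalize (Cmod_ge_0 w); nra).
  replace (Re (sz a w)) with (1 - a + a * ((1 - (Re w * Re w + Im w * Im w)) /
    (Re (1 - w)%C * Re (1 - w)%C + Im (1 - w)%C * Im (1 - w)%C))).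
  - assert (0 < a * ((1 - (Re w * Re w + Im w * Im w)) /
    (Re (1 - w)%C * Re (1 - w)%C + Im (1 - w)%C * Im (1 - w)%C))); [|lra].
    apply Rmult_lt_0_compat; auto; apply Rdiv_lt_0_compat; lra.
  - unfold sz, Re, Im in *; simpl in *; field; lra.
Qed.

Lemma sz_0 a : sz a 0 = RtoC 1.
Proof. unfold sz; field; apply Csub_neq; intros E; apply (f_equal fst) in E; simpl in E; lra. Qed.

Lemma Cn_sz n a : Cn n (cdisc 1) (sz a).
Proof.
  apply Cn_plus; [apply Cn_const|]; apply Cn_div.
  - intros w Hw; apply one_sub_neq; exact Hw.
  - apply Cn_mult; [apply Cn_const|apply Cn_id].
  - apply Cn_minus; [apply Cn_const|apply Cn_id].
Qed.

Lemma sz_real a (t : R) : Rabs t < 1 -> sz a t = RtoC (1 + 2 * a * t / (1 - t)).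
Proof.
  intros H; apply Rabs_def2 in H; unfold sz; creal; field; nra.
Qed.

(** Cleared of its denominator, [sz a w - rho] is affine in [w], with root
    [(rho - 1) / (rho - 1 + 2 a)]. The later comparisons of [q * q * Cmod (rho - 1 + RtoC (2 * a))]
    with [Cmod (rho - 1)] say on which side of the arc this preimage lies. *)
Lemma sz_sub a w rho : Cmod w < 1 ->
  ((sz a w - rho) * (1 - w))%C = ((1 - rho) - w * (1 - rho - RtoC (2 * a)))%C.
Proof. intros H; unfold sz; field; apply one_sub_neq; auto. Qed.

Lemma Cn_pfac n D rho : Cn n D (pfac rho).
Proof.
  apply Cn_mult; [|apply Cn_const].
  apply Cn_mult; apply Cn_minus; try apply Cn_id; apply Cn_const.
Qed.

Lemma pfac_real rho (x : R) : Im (pfac rho x) = 0.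
Proof.
  unfold pfac, Cdiv.
  replace ((x - rho) * (x - Cconj rho))%C with
    (RtoC ((x - Re rho) * (x - Re rho) + Im rho * Im rho))
    by (unfold Re, Im; creal; ring).
  set (c := Cmod (1 - rho) * Cmod (1 - rho)).
  unfold Im; simpl; unfold Rdiv; ring.
Qed.

Lemma pfac_nonzero rho s : 0 < Im rho -> s <> rho -> s <> Cconj rho -> pfac rho s <> RtoC 0.
Proof.
  intros H N1 N2; unfold pfac.
  assert (P := Cmod_1_sub_pos rho H).
  assert (Q : 0 < Cmod (1 - rho) * Cmod (1 - rho)) by (apply Rmult_lt_0_compat; auto).
  apply Cmult_neq_0; [apply Cmult_neq_0; apply Csub_neq; auto|].
  intros E; apply (f_equal Cmod) in E; rewrite Cmod_0, Cmod_inv, Cmod_R, Rabs_pos_eq in E.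
  - apply Rinv_neq_0_compat in E; auto; lra.
  - lra.
  - intros E'; apply (f_equal fst) in E'; simpl in E'; lra.
Qed.

(** Centre and radius of the circle onto which [sz a] maps [|w| = r]. *)
Definition ctr (a r : R) : R := 1 + 2 * a * (r * r) / (1 - r * r).
Definition rad (a r : R) : R := 2 * a * r / (1 - r * r).

Lemma sz_circ_ctr a r t : 0 < r < 1 ->
  (sz a (circ 0 r t) - RtoC (ctr a r))%C =
  (RtoC (rad a r) * (cos t, sin t) * ((1 - Cconj (circ 0 r t)) / (1 - circ 0 r t)))%C.
Proof.
  intros H; assert (S := sin2cos2 t).
  assert (Hr : 1 - r * r <> 0) by nra.
  assert (N : (1 - circ 0 r t)%C <> RtoC 0) by (apply one_sub_neq; rewrite Cmod_circ0, Rabs_pos_eq; lra).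
  assert (Hr2 : (1 - RtoC r * RtoC r)%C <> RtoC 0).
  { rewrite <- RtoC_mult, <- RtoC_minus; intros E; apply (f_equal fst) in E; simpl in E; lra. }
  assert (E : (RtoC r * (cos t, sin t) * (1 - Cconj (circ 0 r t)))%C = (circ 0 r t - RtoC (r * r))%C).
  { unfold circ; creal; [|ring].
    replace (r * r) with (r * r * (cos t * cos t + sin t * sin t)) by (rewrite S; ring); ring. }
  unfold rad, ctr.
  replace (RtoC (2 * a * r / (1 - r * r)) * (cos t, sin t) * ((1 - Cconj (circ 0 r t)) / (1 - circ 0 r t)))%C
    with (RtoC (2 * a / (1 - r * r)) * (RtoC r * (cos t, sin t) * (1 - Cconj (circ 0 r t))) / (1 - circ 0 r t))%C.
  - rewrite E; unfold sz.
    rewrite !RtoC_plus, !RtoC_div, !RtoC_minus, !RtoC_mult by auto; field; auto.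
  - replace (2 * a * r / (1 - r * r)) with (2 * a / (1 - r * r) * r) by (field; auto).
    rewrite (RtoC_mult (2 * a / (1 - r * r)) r); field; auto.
Qed.

Lemma Cmod_cis t : Cmod (cos t, sin t) = 1.
Proof. unfold Cmod; simpl; rewrite !Rmult_1_r, sin2cos2, sqrt_1; auto. Qed.

Lemma rad_pos a r : 0 < a -> 0 < r < 1 -> 0 < rad a r.
Proof. intros; unfold rad; apply Rdiv_lt_0_compat; nra. Qed.

Lemma sz_circ_dist a r t : 0 < a -> 0 < r < 1 ->
  Cmod (sz a (circ 0 r t) - RtoC (ctr a r)) = rad a r.
Proof.
  intros Ha H; assert (N : (1 - circ 0 r t)%C <> RtoC 0)
    by (apply one_sub_neq; rewrite Cmod_circ0, Rabs_pos_eq; lra).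
  assert (P := rad_pos a r Ha H); assert (Q := Cmod_pos _ N).
  rewrite sz_circ_ctr, !Cmod_mult, Cmod_R, Cmod_cis, Rabs_pos_eq, Cmod_div by (auto; lra).
  replace (1 - Cconj (circ 0 r t))%C with (Cconj (1 - circ 0 r t)) by (creal; ring).
  rewrite Cmod_conj; field; lra.
Qed.

(** Links the two descriptions of inside and outside: by the image circle in the [s] plane, and by
    the modulus of the preimage in the disc. *)
Lemma ctr_dist a r rho : 0 < r < 1 ->
  Cmod (rho - RtoC (ctr a r)) * Cmod (rho - RtoC (ctr a r)) - rad a r * rad a r =
  (Cmod (rho - 1) * Cmod (rho - 1) - r * r * (Cmod (rho - 1 + RtoC (2 * a)) * Cmod (rho - 1 + RtoC (2 * a)))) / (1 - r * r).
Proof.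
  intros H; rewrite !Cmod_sqr; unfold ctr, rad, Re, Im; simpl; field; nra.
Qed.

Lemma continuous_sz_circ a r t : 0 <= r < 1 -> continuous (fun t => sz a (circ 0 r t)) t.
Proof.
  intros H; apply (continuous_comp (circ 0 r) (sz a)); [apply continuous_circ_t|].
  apply (Cn_continuous 0 (cdisc 1)); [apply Cn_sz|].
  unfold cdisc; rewrite Cmod_circ0, Rabs_pos_eq; lra.
Qed.

Lemma continuous_double (f : R -> C) p : (forall t, continuous f t) -> continuous (fun p => f (2 * p)) p.
Proof.
  intros H; apply (continuous_comp (fun p => 2 * p) f); auto.
  apply continuous_Rmult; [apply continuous_const|apply continuous_id].
Qed.

Definition arcpt (a q p : R) : C := sz a (circ 0 (q * q) (2 * p)).

(** [Lam] is an argument along the arc [|w| = q^2], and [c] its total contribution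
    together with that of the modulus of [g] on [(-q^2, 0)]. *)
Definition contrib (a q : R) (g : C -> C) (Lam : R -> R) (c : R) : Prop :=
  exists M V, is_RInt (fun p => Lam p * sin p) 0 (PI / 2) M /\
    is_RInt (fun y => (1 + q * q / (y * y)) * ln (Cmod (g (sz a (RtoC (- (y * y))))))) 0 q V /\
    2 * q * M + V = c.

Lemma contrib_zero_free a q g phi Rd : 0 < a -> 0 < q < 1 -> q * q < Rd <= 1 ->
  (forall n, Cn n rhp g) -> a <= 1 -> g 1 = RtoC 1 ->
  (forall w, cdisc Rd w -> g (sz a w) <> RtoC 0) ->
  (forall x : R, 0 < x -> Im (g x) = 0) ->
  (forall p, 0 <= p <= PI / 2 -> continuous phi p) -> phi 0 = 0 ->
  (forall p, 0 <= p <= PI / 2 -> isarg (g (arcpt a q p)) (phi p)) ->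
  contrib a q g phi 0.
Proof.
  intros Ha Hq HR Hg Ha1 H1 H0 Hr Hphi P0 Hphi2.
  destruct (arc_identity (fun w => g (sz a w)) Rd q phi) as [M [IM IV]]; auto; try lra.
  - apply (Cn_comp 2 (cdisc Rd) rhp g (sz a)); auto.
    + intros w Hw; unfold rhp; assert (A := sz_Re_pos a w Ha); unfold cdisc in Hw; specialize (A ltac:(lra)); lra.
    + apply Cn_sub with (cdisc 1); [unfold cdisc; intros; lra|apply Cn_sz].
  - rewrite sz_0; auto.
  - intros t Ht; unfold cdisc in Ht; rewrite Cmod_R in Ht.
    assert (A := sz_Re_pos a t Ha ltac:(rewrite Cmod_R; lra)).
    rewrite sz_real in * by lra; apply Hr; simpl in A; lra.
  - exists M, (-2 * q * M); split; auto; split; auto; ring.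
Qed.

Lemma Arg_mod_cases z t : z <> RtoC 0 -> isarg z t ->
  - (5 / 2 * PI) < Arg z - t < 5 / 2 * PI ->
  Arg z - t = 0 \/ Arg z - t = 2 * PI \/ Arg z - t = - (2 * PI).
Proof.
  intros H0 Ht HB; generalize PI_RGT_0; intros HP.
  destruct (isarg_mod z (Arg z) t H0 (isarg_Arg z) Ht) as [k Hk]; rewrite Hk in *.
  assert (K1 : IZR k < 2) by (apply Rmult_lt_reg_l with (2 * PI); lra).
  assert (K2 : -2 < IZR k) by (apply Rmult_lt_reg_l with (2 * PI); lra).
  apply lt_IZR in K1; apply lt_IZR in K2.
  assert (E : (k = 0 \/ k = 1 \/ k = -1)%Z) by lia.
  destruct E as [-> | [-> | ->]]; [left|right; left|right; right]; ring.
Qed.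

Lemma arcpt_Re_pos a q p : 0 < a -> 0 < q < 1 -> 1 - a < Re (arcpt a q p).
Proof.
  intros Ha Hq; apply sz_Re_pos; auto; rewrite Cmod_circ0, Rabs_pos_eq; nra.
Qed.

Lemma arcpt_Im a q p : 0 < a -> 0 < q < 1 -> 0 <= p <= PI / 2 ->
  0 <= Im (arcpt a q p) /\ (0 < p < PI / 2 -> 0 < Im (arcpt a q p)).
Proof.
  intros Ha Hq Hp; unfold arcpt; rewrite sz_circ by nra; simpl.
  assert (D := circ_den_pos (q * q) (2 * p) ltac:(nra)).
  assert (0 < 2 * a * (q * q)) by (apply Rmult_lt_0_compat; [lra|apply Rmult_lt_0_compat; lra]).
  split.
  - apply Rdiv_le_0_compat; auto; apply Rmult_le_pos; [lra|apply sin_ge_0; lra].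
  - intros Hp'; apply Rdiv_lt_0_compat; auto; apply Rmult_lt_0_compat; auto; apply sin_gt_0; lra.
Qed.

Lemma arcpt_0 a q : 0 < q < 1 -> exists x : R, arcpt a q 0 = RtoC x.
Proof.
  intros Hq; unfold arcpt; rewrite Rmult_0_r.
  exists (1 + 2 * a * (q * q) / (1 - q * q)); rewrite <- sz_real by (rewrite Rabs_pos_eq; nra).
  f_equal; unfold circ; rewrite cos_0, sin_0; creal; ring.
Qed.

(** With [b] the vector from [rho] to the centre of the image circle, [(s - rho) / b] stays in the
    right half plane on the arc. So [Arg b] plus the principal argument of this quotient is
    continuous, and [pfac rho] is zero-free in a disc containing the arc: the contribution is 0. If
    [Re rho <= 1 - a], the arc does not meet the cut of [Arg (s - rho)] and the two arguments
    coincide. *)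
Lemma zero_outside a q rho : 0 < a <= 1 / 2 -> 0 < q < 1 -> 0 < Im rho -> 0 < Re rho ->
  q * q * Cmod (rho - 1 + RtoC (2 * a)) < Cmod (rho - 1) ->
  exists Lam, contrib a q (pfac rho) Lam 0 /\
    (forall p, 0 < p < PI / 2 -> Lam p <= Arg (arcpt a q p - rho) + Arg (arcpt a q p - Cconj rho)) /\
    (Re rho <= 1 - a -> forall p, 0 < p < PI / 2 ->
       Lam p = Arg (arcpt a q p - rho) + Arg (arcpt a q p - Cconj rho)).
Proof.
  intros Ha Hq Hi Hre Hout; generalize PI_RGT_0; intros HPI.
  set (r := q * q) in *; assert (Hr : 0 < r < 1) by (unfold r; nra).
  set (c0 := ctr a r); set (b := (RtoC c0 - rho)%C).
  assert (Hb : rad a r < Cmod b).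
  { apply Rsqr_incrst_0; [|left; apply rad_pos; lra|apply Cmod_ge_0]; unfold Rsqr.
    assert (E := ctr_dist a r rho Hr); fold c0 in E.
    unfold b; rewrite Cmod_sub_sym.
    assert (0 < (Cmod (rho - 1) * Cmod (rho - 1) - r * r * (Cmod (rho - 1 + RtoC (2 * a)) * Cmod (rho - 1 + RtoC (2 * a)))) / (1 - r * r)); [|lra].
    apply Rdiv_lt_0_compat; [|nra].
    assert (P := Cmod_ge_0 (rho - 1 + RtoC (2 * a))).
    assert (Q : 0 <= r * Cmod (rho - 1 + RtoC (2 * a))) by (apply Rmult_le_pos; lra).
    assert (W := Rmult_le_0_lt_compat _ _ _ _ Q Q Hout Hout); lra. }
  assert (Rp := rad_pos a r (proj1 Ha) Hr).
  assert (Nb : b <> RtoC 0) by (intros E; rewrite E, Cmod_0 in Hb; lra).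
  assert (Imb : Im b < 0) by (unfold b, Im in *; simpl; lra).
  assert (Nbc : Cconj b <> RtoC 0).
  { intros E; assert (E' : Im (Cconj b) = 0) by (rewrite E; auto).
    rewrite im_conj in E'; lra. }
  set (s := arcpt a q).
  assert (Rq : forall p, 0 < Re ((s p - rho) / b)%C).
  { intros p; replace ((s p - rho) / b)%C with (1 + (s p - c0) / b)%C by (unfold b; field; auto).
    assert (A : Cmod ((s p - c0) / b) < 1).
    { rewrite Cmod_div by auto; unfold s, arcpt, c0; fold r; rewrite sz_circ_dist by (auto; lra).
      apply Rmult_lt_reg_r with (Cmod b); [lra|]; unfold Rdiv; rewrite Rmult_assoc, Rinv_l; lra. }
    assert (B := Re_le_Cmod ((s p - c0) / b)); set (w := ((s p - c0) / b)%C) in *.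
    replace (Re (1 + w)%C) with (1 + Re w) by (unfold Re; simpl; ring).
    generalize (Rle_abs (- Re w)); rewrite Rabs_Ropp; lra. }
  assert (Rqc : forall p, 0 < Re ((s p - Cconj rho) / Cconj b)%C).
  { intros p; replace ((s p - Cconj rho) / Cconj b)%C with (1 + (s p - c0) / Cconj b)%C.
    2:{ replace (Cconj b) with (RtoC c0 - Cconj rho)%C by (unfold b; creal; ring); field.
        replace (RtoC c0 - Cconj rho)%C with (Cconj b) by (unfold b; creal; ring); auto. }
    assert (A : Cmod ((s p - c0) / Cconj b) < 1).
    { rewrite Cmod_div, Cmod_conj by auto; unfold s, arcpt, c0; fold r; rewrite sz_circ_dist by (auto; lra).
      apply Rmult_lt_reg_r with (Cmod b); [lra|]; unfold Rdiv; rewrite Rmult_assoc, Rinv_l; lra. }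
    assert (B := Re_le_Cmod ((s p - c0) / Cconj b)); set (w := ((s p - c0) / Cconj b)%C) in *.
    replace (Re (1 + w)%C) with (1 + Re w) by (unfold Re; simpl; ring).
    generalize (Rle_abs (- Re w)); rewrite Rabs_Ropp; lra. }
  set (L1 := fun p => Arg b + Arg ((s p - rho) / b)%C).
  set (L2 := fun p => Arg (Cconj b) + Arg ((s p - Cconj rho) / Cconj b)%C).
  assert (I1 : forall p, isarg (s p - rho) (L1 p)).
  { intros p; replace (s p - rho)%C with (b * ((s p - rho) / b))%C by (field; auto).
    apply isarg_mult; apply isarg_Arg. }
  assert (I2 : forall p, isarg (s p - Cconj rho) (L2 p)).
  { intros p; replace (s p - Cconj rho)%C with (Cconj b * ((s p - Cconj rho) / Cconj b))%C by (field; auto).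
    apply isarg_mult; apply isarg_Arg. }
  assert (Cs : forall p, continuous s p).
  { intros p; unfold s, arcpt; apply (continuous_double (fun t => sz a (circ 0 (q * q) t))).
    intros; apply continuous_sz_circ; fold r; lra. }
  assert (CA : forall d e p, 0 < Re ((s p - d) / e)%C -> continuous (fun p => Arg ((s p - d) / e)%C) p).
  { intros d e p Hp; apply (continuous_comp (fun p => ((s p - d) / e)%C) Arg).
    - apply continuous_Cmult; [|apply continuous_const].
      apply continuous_Cminus; [auto|apply continuous_const].
    - apply continuous_Arg; lra. }
  exists (fun p => L1 p + L2 p); split; [|split].
  (* The modulus of the preimages of [rho] and its conjugate; below it the composed factor has no
     zero. *)
  - set (kk := Cmod (rho - 1) / Cmod (rho - 1 + RtoC (2 * a))).
    assert (Nd : 0 < Cmod (rho - 1 + RtoC (2 * a))).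
    { apply Cmod_pos; intros E; apply (f_equal snd) in E; unfold Im in Hi; simpl in E; lra. }
    assert (Hk : r < kk).
    { unfold kk; apply Rmult_lt_reg_r with (Cmod (rho - 1 + RtoC (2 * a))); auto.
      unfold Rdiv; rewrite Rmult_assoc, Rinv_l; lra. }
    assert (Key : forall w rh, Cmod w < 1 -> Cmod (rh - 1) = Cmod (rho - 1) ->
       Cmod (rh - 1 + RtoC (2 * a)) = Cmod (rho - 1 + RtoC (2 * a)) -> sz a w = rh -> Cmod w = kk).
    { intros w rh Hw E1 E2 E; assert (A := sz_sub a w rh Hw); rewrite E in A.
      assert (B : (rh - 1)%C = (w * (rh - 1 + RtoC (2 * a)))%C).
      { transitivity ((rh - rh) * (1 - w) - (1 - rh))%C; [ring|rewrite A; ring]. }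
      apply (f_equal Cmod) in B; rewrite Cmod_mult, E1, E2 in B.
      unfold kk; rewrite B; field; lra. }
    apply (contrib_zero_free a q (pfac rho) _ (Rmin kk 1)); auto; try lra.
    + split; [apply Rmin_glb_lt; [exact Hk|exact (proj2 Hr)]|apply Rmin_r].
    + intros n; apply Cn_pfac.
    + apply pfac_1; auto.
    + intros w Hw; unfold cdisc in Hw.
      assert (Hw1 : Cmod w < 1) by (eapply Rlt_le_trans; [exact Hw|apply Rmin_r]).
      assert (Hw2 : Cmod w < kk) by (eapply Rlt_le_trans; [exact Hw|apply Rmin_l]).
      apply pfac_nonzero; auto; intros E.
      * assert (A := Key w rho Hw1 eq_refl eq_refl E); lra.
      * assert (A := Key w (Cconj rho) Hw1).
        rewrite <- (Cmod_conj (rho - 1)), <- (Cmod_conj (rho - 1 + RtoC (2 * a))) in A.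
        replace (Cconj (rho - 1)) with (Cconj rho - 1)%C in A by (creal; ring).
        replace (Cconj (rho - 1 + RtoC (2 * a))) with (Cconj rho - 1 + RtoC (2 * a))%C in A by (creal; ring).
        specialize (A eq_refl eq_refl E); lra.
    + intros; apply pfac_real.
    + intros p _; apply continuous_Rplus; apply continuous_Rplus; try apply continuous_const; apply CA; auto.
    + destruct (arcpt_0 a q Hq) as [x Hx]; unfold L1, L2, s; rewrite Hx.
      rewrite Arg_conj by lra.
      replace ((x - Cconj rho) / Cconj b)%C with (Cconj ((x - rho) / b)).
      * specialize (Rq 0); unfold s in Rq; rewrite Hx in Rq.
        rewrite (Arg_conj ((x - rho) / b)) by lra.
        cbv beta; generalize (Arg b) (Arg ((x - rho) / b)); intros r0 r1; change (r0 + r1 + (- r0 + - r1) = 0 :> R); ring.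
      * rewrite Cdiv_conj, Cminus_conj by auto.
        replace (Cconj x) with (RtoC x) by (creal; ring); auto.
    + intros p _; unfold pfac; replace (L1 p + L2 p) with (L1 p + L2 p - 0) by ring.
      apply isarg_div; [apply isarg_mult; [apply I1|apply I2]|].
      apply isarg_pos; apply Rmult_le_pos; apply Cmod_ge_0.
  (* The principal and the continuous argument differ by 0 or [2 PI] up to sign. Since [Im b < 0],
     [L1] is less than [PI/2], which excludes a principal value smaller by [2 PI]; for the conjugate
     zero the ranges force equality. *)
  - intros p Hp; destruct (arcpt_Im a q p (proj1 Ha) Hq ltac:(lra)) as [_ HI]; specialize (HI Hp); fold (s p) in *.
    assert (N1 : (s p - rho)%C <> RtoC 0).
    { intros E; specialize (Rq p); rewrite E in Rq; unfold Cdiv in Rq; rewrite Cmult_0_l in Rq; simpl in Rq; lra. }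
    assert (Im2 : 0 < Im (s p - Cconj rho)%C) by (rewrite Im_Cminus, im_conj; lra).
    assert (N2 : (s p - Cconj rho)%C <> RtoC 0) by (intros E; rewrite E in Im2; simpl in Im2; lra).
    assert (B1 := Arg_Im_neg b Imb); assert (B2 := Arg_Im_pos (Cconj b) ltac:(rewrite im_conj; lra)).
    assert (B3 := Arg_Re_pos _ (Rq p)); assert (B4 := Arg_Re_pos _ (Rqc p)).
    assert (B5 := Arg_bound (s p - rho)); assert (B6 := Arg_Im_pos _ Im2).
    destruct (Arg_mod_cases _ _ N1 (I1 p)) as [E1|[E1|E1]]; [unfold L1; lra| | |];
      (destruct (Arg_mod_cases _ _ N2 (I2 p)) as [E2|[E2|E2]]; [unfold L2; lra| | |]);
      unfold L1, L2 in *; lra.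
  - intros Hl p Hp; destruct (arcpt_Im a q p (proj1 Ha) Hq ltac:(lra)) as [_ HI]; specialize (HI Hp); fold (s p) in *.
    assert (HR := arcpt_Re_pos a q p (proj1 Ha) Hq); fold (s p) in HR.
    assert (Re1 : 0 < Re (s p - rho)%C) by (rewrite Re_Cminus; lra).
    assert (Re2 : 0 < Re b).
    { unfold b, c0, ctr, Re in *; simpl.
      assert (0 < 2 * a * (r * r) / (1 - r * r)); [|lra].
      apply Rdiv_lt_0_compat; [|nra]; apply Rmult_lt_0_compat; [lra|nra]. }
    assert (N1 : (s p - rho)%C <> RtoC 0) by (intros E; rewrite E in Re1; simpl in Re1; lra).
    assert (Im2 : 0 < Im (s p - Cconj rho)%C) by (rewrite Im_Cminus, im_conj; lra).
    assert (N2 : (s p - Cconj rho)%C <> RtoC 0) by (intros E; rewrite E in Im2; simpl in Im2; lra).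
    assert (B1 := Arg_Re_pos b Re2); assert (B2 := Arg_Im_pos (Cconj b) ltac:(rewrite im_conj; lra)).
    assert (B3 := Arg_Re_pos _ (Rq p)); assert (B4 := Arg_Re_pos _ (Rqc p)).
    assert (B5 := Arg_Re_pos _ Re1); assert (B6 := Arg_Im_pos _ Im2).
    destruct (Arg_mod_cases _ _ N1 (I1 p)) as [E1|[E1|E1]]; [unfold L1; lra| | |];
      (destruct (Arg_mod_cases _ _ N2 (I2 p)) as [E2|[E2|E2]]; [unfold L2; lra| | |]);
      unfold L1, L2 in *; lra.
Qed.

Lemma Arg_antitone x x' h : 0 < h -> x <= x' -> Arg (x', h) <= Arg (x, h).
Proof.
  intros Hh Hx; rewrite !Arg_Im_pos_atan by (simpl; auto); simpl.
  assert (x / h <= x' / h) by (apply Rmult_le_compat_r; auto; left; apply Rinv_0_lt_compat; auto).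
  destruct (Req_dec (x / h) (x' / h)) as [->|]; [lra|].
  assert (atan (x / h) < atan (x' / h)) by (apply atan_increasing; lra); lra.
Qed.

(** Half the angle under which [[-a, a]] is seen from [(x, h)]. *)
Definition psi (a x h : R) : R := / 2 * Arg (x * x + h * h - a * a, 2 * a * h).

Lemma psi_bound a x h : 0 < a -> 0 < h -> 0 < psi a x h < PI / 2.
Proof.
  intros Ha Hh; assert (B := Arg_Im_pos (x * x + h * h - a * a, 2 * a * h)).
  simpl in B; assert (0 < 2 * a * h) by (apply Rmult_lt_0_compat; lra).
  specialize (B H); unfold psi; lra.
Qed.

Lemma psi_antitone a x x' h : 0 < a -> 0 < h -> 0 <= x <= x' -> psi a x' h <= psi a x h.
Proof.
  intros Ha Hh Hx; unfold psi; apply Rmult_le_compat_l; [lra|].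
  apply Arg_antitone; [apply Rmult_lt_0_compat; lra|nra].
Qed.

(** With [z = s - (1 - a) = x + i h], the disc variable is [w = (z - a)/(z + a)], and [(z - a)]
    times the conjugate of [z + a] has coordinates [|z|^2 - a^2] and [2 a h]. So [psi] is half the
    argument of [w]. *)
Lemma psi_arcpt a q p : 0 < a -> 0 < q < 1 -> 0 < p < PI / 2 ->
  psi a (Re (arcpt a q p) - (1 - a)) (Im (arcpt a q p)) = p.
Proof.
  intros Ha Hq Hp; unfold arcpt, psi.
  set (r := q * q); assert (Hr : 0 < r < 1) by (unfold r; nra).
  rewrite sz_circ by lra; simpl; set (t := 2 * p).
  assert (D := circ_den_pos r t ltac:(lra)); set (m := circ_den r t) in *.
  assert (S := sin2cos2 t).
  assert (Hs : 0 < sin t) by (apply sin_gt_0; unfold t; lra).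
  assert (E : Arg ((1 - a + a * (1 - r * r) / m - (1 - a)) * (1 - a + a * (1 - r * r) / m - (1 - a)) +
     2 * a * r * sin t / m * (2 * a * r * sin t / m) - a * a, 2 * a * (2 * a * r * sin t / m)) = t).
  2:{ rewrite E; unfold t; field. }
  assert (F : (1 - a + a * (1 - r * r) / m - (1 - a)) * (1 - a + a * (1 - r * r) / m - (1 - a)) +
     2 * a * r * sin t / m * (2 * a * r * sin t / m) - a * a = 4 * a * a * r / m * cos t).
  { apply Rmult_eq_reg_r with (m * m); [|nra]; field_simplify; try lra.
    replace (sin t ^ 2) with (1 - cos t ^ 2) by (simpl; lra).
    unfold m, circ_den; ring. }
  rewrite F; replace (2 * a * (2 * a * r * sin t / m)) with (4 * a * a * r / m * sin t) by (field; lra).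
  assert (Q : 0 < 4 * a * a * r / m).
  { apply Rdiv_lt_0_compat; auto; apply Rmult_lt_0_compat; [nra|lra]. }
  assert (IA := isarg_polar (4 * a * a * r / m) t ltac:(lra)).
  set (z := ((4 * a * a * r / m * cos t)%R, (4 * a * a * r / m * sin t)%R) : C) in *.
  assert (Iz : 0 < Im z) by (simpl; apply Rmult_lt_0_compat; auto).
  apply isarg_eq with z; auto.
  - intros Ez; rewrite Ez in Iz; simpl in Iz; lra.
  - apply isarg_Arg.
  - assert (B := Arg_Im_pos z Iz); apply Rabs_def1; unfold t; lra.
Qed.

Lemma is_RInt_cont_FTC (f F : R -> R) a b : a <= b ->
  (forall x, a <= x <= b -> is_derive F x (f x)) ->
  (forall x, a <= x <= b -> continuous f x) -> is_RInt f a b (F b - F a).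
Proof.
  intros Hab HD Hc; apply (is_RInt_derive (V := R_CompleteNormedModule) F f);
    rewrite Rmin_left, Rmax_right by lra; auto.
Qed.

(** The weight of a jump by [2 PI] at the parameter [c], as occurs when the arc crosses a cut. *)
Lemma step_sin c : 0 <= c <= PI / 2 ->
  is_RInt (fun p => (if Rlt_dec p c then 0 else 2 * PI) * sin p) 0 (PI / 2) (2 * PI * cos c).
Proof.
  intros Hc.
  replace (2 * PI * cos c) with (0 + 2 * PI * cos c) by ring.
  apply (is_RInt_Chasles (V := R_NormedModule)) with c.
  - apply is_RInt_extR with (fun _ => 0); [lra| |].
    + intros x Hx; destruct Rlt_dec; [ring|lra].
    + replace 0 with ((c - 0) * 0) at 2 by ring.
      apply (is_RInt_const (V := R_NormedModule)).
  - apply is_RInt_extR with (fun p => 2 * PI * sin p); [lra| |].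
    + intros x Hx; destruct Rlt_dec; [lra|ring].
    + apply is_RInt_Rscal.
      replace (cos c) with (- cos (PI / 2) - - cos c) by (rewrite cos_PI2; ring).
      apply (is_RInt_cont_FTC sin (fun p => - cos p)); [lra| |].
      * intros x _; auto_derive; auto; ring.
      * intros x _; apply continuous_sin.
Qed.

Lemma RInt_psin : is_RInt (fun p => 4 * p * sin p) 0 (PI / 2) 4.
Proof.
  generalize PI_RGT_0; intros HP.
  assert (I := is_RInt_cont_FTC (fun p => 4 * p * sin p) (fun p => 4 * (sin p - p * cos p)) 0 (PI / 2)
    ltac:(lra)); cbv beta in I.
  replace (4 * (sin (PI / 2) - PI / 2 * cos (PI / 2)) - 4 * (sin 0 - 0 * cos 0)) with 4 in I
    by (rewrite sin_PI2, cos_PI2, sin_0; ring).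
  apply I.
  - intros x _; auto_derive; auto; ring.
  - intros x _; apply continuous_Rmult; [|apply continuous_sin].
    apply continuous_Rmult; [apply continuous_const|apply continuous_id].
Qed.

Lemma Cmod_circ_mul_conj r t : (circ 0 r t * Cconj (circ 0 r t))%C = RtoC (r * r).
Proof.
  assert (S := sin2cos2 t); unfold circ; creal; [|ring].
  replace (r * r) with (r * r * (cos t * cos t + sin t * sin t)) by (rewrite S; ring); ring.
Qed.

(** The reflection [g] of the pair in the circle is zero-free, so [arc_identity] applies to it. On
    the arc its argument is [4 p] minus that of the pair, and [log_integral] gives the sum of the
    two modulus integrals, so the contribution of the pair is explicit. The principal argument may
    drop by [2 PI] when the arc crosses the cut to the left of [rho]; subtracting this drop from the
    parameter [psi a xs (Im rho)] on yields [Lam]. The number [xs] bounds the abscissa of any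
    crossing measured from the line, hence its parameter from below. *)
Lemma zero_inside a q rho xs : 0 < a <= 1 / 2 -> 0 < q < 1 -> 0 < Im rho -> 1 - a < Re rho ->
  Cmod (rho - 1) < q * q * Cmod (rho - 1 + RtoC (2 * a)) -> rho <> RtoC 1 -> 0 <= xs ->
  (forall p, 0 <= p <= PI / 2 -> Im (arcpt a q p) = Im rho -> Re (arcpt a q p) <= Re rho ->
     Re (arcpt a q p) - (1 - a) <= xs) ->
  exists Lam c, contrib a q (pfac rho) Lam c /\
    (forall p, 0 < p < PI / 2 -> Lam p <= Arg (arcpt a q p - rho) + Arg (arcpt a q p - Cconj rho)) /\
    4 * PI * q * (cos (psi a (Re rho - (1 - a)) (Im rho)) - cos (psi a xs (Im rho))) <= c.
Proof.
  intros Ha Hq Hi Hre Hin Hn1 Hxs Hcut; generalize PI_RGT_0; intros HPI.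
  set (r := q * q) in *; assert (Hr : 0 < r < 1) by (unfold r; nra).
  set (c0 := RtoC (ctr a r)).
  assert (Rp := rad_pos a r (proj1 Ha) Hr); set (R0 := rad a r) in *.
  assert (Nd : 0 < Cmod (rho - 1 + RtoC (2 * a))).
  { apply Cmod_pos; intros E; apply (f_equal snd) in E; unfold Im in Hi; simpl in E; lra. }
  assert (Nd' : (rho - 1 + RtoC (2 * a))%C <> RtoC 0) by (intros E; rewrite E, Cmod_0 in Nd; lra).
  assert (N1 : 0 < Cmod (rho - 1)) by (apply Cmod_pos; apply Csub_neq; auto).
  assert (Hb : Cmod (rho - c0) < R0).
  { apply Rsqr_incrst_0; [|apply Cmod_ge_0|lra]; unfold Rsqr.
    assert (E := ctr_dist a r rho Hr); fold c0 R0 in E.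
    assert (0 < (r * r * (Cmod (rho - 1 + RtoC (2 * a)) * Cmod (rho - 1 + RtoC (2 * a))) - Cmod (rho - 1) * Cmod (rho - 1)) / (1 - r * r)).
    { apply Rdiv_lt_0_compat; [|nra].
      assert (W := Rmult_le_0_lt_compat _ _ _ _ (Rlt_le _ _ N1) (Rlt_le _ _ N1) Hin Hin); lra. }
    unfold Rdiv in *; lra. }
  assert (Hbc : Cmod (Cconj rho - c0) < R0).
  { replace (Cconj rho - c0)%C with (Cconj (rho - c0)) by (unfold c0; creal; ring).
    rewrite Cmod_conj; auto. }
  set (s := arcpt a q); set (zt := fun p => circ 0 r (2 * p)).
  assert (Hzt : forall p, Cmod (zt p) = r) by (intros; unfold zt; rewrite Cmod_circ0, Rabs_pos_eq; lra).
  assert (N1z : forall p, (1 - zt p)%C <> RtoC 0) by (intros; apply one_sub_neq; rewrite Hzt; lra).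
  assert (Rz : forall p, 0 < Re (1 - zt p)%C).
  { intros p; assert (B := Re_le_Cmod (zt p)); rewrite Hzt in B; rewrite Re_Cminus; simpl (Re 1).
    generalize (Rle_abs (Re (zt p))); lra. }
  (* A continuous argument of [s - c0] read off from [sz_circ_ctr]; [1 - zt p] stays in the right
     half plane, so its [Arg] is continuous. *)
  set (gam := fun p => 2 * p - 2 * Arg (1 - zt p)).
  assert (Isc : forall p, (s p - c0)%C = (RtoC R0 * (cos (2 * p), sin (2 * p)) *
      (Cconj (1 - zt p) / (1 - zt p)))%C).
  { intros p; unfold s, arcpt, c0; fold r; rewrite sz_circ_ctr by auto; fold (zt p) R0.
    do 2 f_equal; creal; ring. }
  assert (Igam : forall p, isarg (s p - c0) (gam p)).
  { intros p; rewrite Isc; unfold gam.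
    replace (2 * p - 2 * Arg (1 - zt p)) with (0 + 2 * p + (- Arg (1 - zt p) - Arg (1 - zt p))) by ring.
    apply isarg_mult; [apply isarg_mult; [apply isarg_pos; lra|]|].
    - apply isarg_intro with 1; [lra|creal; ring].
    - apply isarg_div; [apply isarg_conj|]; apply isarg_Arg. }
  assert (Ms : forall p, Cmod (s p - c0) = R0).
  { intros p; unfold s, arcpt, c0; fold r; apply sz_circ_dist; auto; lra. }
  assert (Nsc : forall p, (s p - c0)%C <> RtoC 0).
  { intros p E; assert (A := Ms p); rewrite E, Cmod_0 in A; lra. }
  assert (Rgam : forall p, 0 <= p <= PI / 2 -> 0 <= gam p <= PI).
  { intros p Hp; destruct (arcpt_Im a q p (proj1 Ha) Hq Hp) as [HI _]; fold (s p) in HI.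
    assert (B := Arg_Im_nonneg (s p - c0)); rewrite Im_Cminus in B; change (Im c0) with 0 in B.
    specialize (B ltac:(lra)).
    replace (gam p) with (Arg (s p - c0)); auto.
    assert (A := Arg_Re_pos _ (Rz p)).
    apply isarg_eq with (s p - c0)%C; auto; [apply isarg_Arg|unfold gam; apply Rabs_def1; lra]. }
  assert (Cs : forall p, continuous s p).
  { intros p; unfold s, arcpt; apply (continuous_double (fun t => sz a (circ 0 (q * q) t))).
    intros; apply continuous_sz_circ; fold r; lra. }
  assert (Cz : forall p, continuous zt p).
  { intros p; apply (continuous_double (circ 0 r)); intros; apply continuous_circ_t. }
  set (uf := fun d p => (1 - (d - c0) / (s p - c0))%C).
  assert (Ru : forall d p, Cmod (d - c0) < R0 -> 0 < Re (uf d p)).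
  { intros d p Hd; assert (A : Cmod ((d - c0) / (s p - c0)) < 1).
    { rewrite Cmod_div, Ms by auto.
      apply Rmult_lt_reg_r with R0; auto; unfold Rdiv; rewrite Rmult_assoc, Rinv_l; lra. }
    assert (B := Re_le_Cmod ((d - c0) / (s p - c0))); unfold uf; rewrite Re_Cminus; simpl (Re 1).
    generalize (Rle_abs (Re ((d - c0) / (s p - c0))%C)); lra. }
  assert (Cu : forall d p, Cmod (d - c0) < R0 -> continuous (fun p => Arg (uf d p)) p).
  { intros d p Hd; apply (continuous_comp (uf d) Arg).
    - apply continuous_Cminus; [apply continuous_const|].
      apply continuous_Cmult; [apply continuous_const|].
      apply continuous_Cinv; auto; apply continuous_Cminus; [auto|apply continuous_const].
    - apply continuous_Arg; assert (A := Ru d p Hd); lra. }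
  assert (Cg : forall p, continuous gam p).
  { intros p; apply continuous_Rminus; apply continuous_Rmult; try apply continuous_const.
    - apply continuous_id.
    - apply (continuous_comp (fun p => (1 - zt p)%C) Arg).
      + apply continuous_Cminus; [apply continuous_const|auto].
      + apply continuous_Arg; assert (A := Rz p); lra. }
  set (L1 := fun p => gam p + Arg (uf rho p)); set (L2 := fun p => gam p + Arg (uf (Cconj rho) p)).
  assert (IL : forall d p, isarg (s p - d) (gam p + Arg (uf d p))).
  { intros d p; replace (s p - d)%C with ((s p - c0) * uf d p)%C by (unfold uf; field; auto).
    apply isarg_mult; [apply Igam|apply isarg_Arg]. }
  set (kap := ((rho - 1) / (rho - 1 + RtoC (2 * a)))%C).
  assert (Mk : Cmod kap < r).
  { unfold kap; rewrite Cmod_div by auto.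
    apply Rmult_lt_reg_r with (Cmod (rho - 1 + RtoC (2 * a))); auto.
    unfold Rdiv; rewrite Rmult_assoc, Rinv_l; lra. }
  assert (Nk : kap <> RtoC 0).
  { unfold kap; apply Cmult_neq_0; [apply Csub_neq; auto|].
    intros E; apply (f_equal Cmod) in E; rewrite Cmod_inv, Cmod_0 in E by auto.
    revert E; apply Rinv_neq_0_compat; lra. }
  assert (Pk := Cmod_pos _ Nk).
  (* The factors [e1] and [e2] vanish at the mirror images of [kap] and its conjugate in [|w| = r],
     outside the arc. The square of [1 - z] in [g] cancels the denominators of [sz]. *)
  set (e1 := fun z => (1 - Cconj kap * z * RtoC (/ (r * r)))%C).
  set (e2 := fun z => (1 - kap * z * RtoC (/ (r * r)))%C).
  set (g := fun z => (e1 z * e2 z * ((1 - z) * (1 - z)))%C).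
  (* On the circle the conjugate of [w] is [r^2 / w], so [w - kap] equals [w] times the conjugate of
     [e1 w]: each factor of the pair has argument [2 p] minus that of its mirror. *)
  set (phi := fun p => 4 * p - (L1 p + L2 p)).
  assert (Hrr : 0 < r * r) by (apply Rmult_lt_0_compat; lra).
  assert (Nrr : RtoC (r * r) <> RtoC 0).
  { intros E; apply (f_equal fst) in E; simpl in E; lra. }
  assert (Nz : forall p, zt p <> RtoC 0).
  { intros p E; assert (A := Hzt p); rewrite E, Cmod_0 in A; lra. }
  assert (Fac : forall d kd p, kd = ((d - 1) / (d - 1 + RtoC (2 * a)))%C -> (d - 1 + RtoC (2 * a))%C <> RtoC 0 ->
     ((s p - d) * (1 - zt p))%C = ((d - 1 + RtoC (2 * a)) * zt p * Cconj (1 - Cconj kd * zt p * RtoC (/ (r * r))))%C).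
  { intros d kd p -> Hd; unfold s, arcpt; fold r; fold (zt p).
    rewrite sz_sub by (rewrite Hzt; lra).
    rewrite Cminus_conj, !Cmult_conj, Cconj_conj.
    replace (Cconj 1) with (RtoC 1) by (creal; ring).
    replace (Cconj (RtoC (/ (r * r)))) with (RtoC (/ (r * r))) by (creal; ring).
    assert (Q := Cmod_circ_mul_conj r (2 * p)); fold (zt p) in Q.
    replace (Cconj (zt p)) with (RtoC (r * r) / zt p)%C by (rewrite <- Q; field; auto).
    rewrite RtoC_inv by lra; field; auto. }
  assert (Ie : forall d kd A L p, kd = ((d - 1) / (d - 1 + RtoC (2 * a)))%C -> (d - 1 + RtoC (2 * a))%C <> RtoC 0 ->
     isarg (d - 1 + RtoC (2 * a)) A -> isarg (s p - d) L ->
     isarg (1 - Cconj kd * zt p * RtoC (/ (r * r))) (- (L + Arg (1 - zt p) - (A + 2 * p)))).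
  { intros d kd A L p Hk Hd HA HL.
    rewrite <- (Cconj_conj (1 - Cconj kd * zt p * RtoC (/ (r * r)))).
    apply isarg_conj; assert (Fp := Fac d kd p Hk Hd).
    replace (Cconj (1 - Cconj kd * zt p * RtoC (/ (r * r)))) with
      (((s p - d) * (1 - zt p)) / ((d - 1 + RtoC (2 * a)) * zt p))%C.
    - apply isarg_div; apply isarg_mult; auto; [apply isarg_Arg|].
      apply isarg_intro with r; [lra|]; unfold zt, circ; creal; ring.
    - rewrite Fp; field; auto. }
  assert (Ndc : (Cconj rho - 1 + RtoC (2 * a))%C <> RtoC 0).
  { intros E; apply (f_equal snd) in E; unfold Im in Hi; simpl in E; lra. }
  assert (Kc : Cconj kap = ((Cconj rho - 1) / (Cconj rho - 1 + RtoC (2 * a)))%C).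
  { unfold kap; rewrite Cdiv_conj, Cplus_conj, Cminus_conj by auto.
    replace (Cconj 1) with (RtoC 1) by (creal; ring).
    replace (Cconj (RtoC (2 * a))) with (RtoC (2 * a)) by (creal; ring); auto. }
  assert (Iphi : forall p, isarg (g (zt p)) (phi p)).
  { intros p; set (A := Arg (rho - 1 + RtoC (2 * a))).
    assert (J1 := Ie rho kap A (L1 p) p eq_refl Nd' (isarg_Arg _) (IL rho p)).
    assert (J2 := Ie (Cconj rho) (Cconj kap) (- A) (L2 p) p Kc Ndc).
    rewrite Cconj_conj in J2.
    assert (IA : isarg (Cconj rho - 1 + RtoC (2 * a)) (- A)).
    { replace (Cconj rho - 1 + RtoC (2 * a))%C with (Cconj (rho - 1 + RtoC (2 * a))) by (creal; ring).
      apply isarg_conj; apply isarg_Arg. }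
    specialize (J2 IA (IL (Cconj rho) p)).
    unfold g, e1, e2, phi.
    replace (4 * p - (L1 p + L2 p)) with (- (L1 p + Arg (1 - zt p) - (A + 2 * p)) +
      - (L2 p + Arg (1 - zt p) - (- A + 2 * p)) + (Arg (1 - zt p) + Arg (1 - zt p))) by ring.
    apply isarg_mult; [apply isarg_mult; auto|apply isarg_mult; apply isarg_Arg]. }
  assert (s0 : exists x : R, s 0 = RtoC x) by (apply arcpt_0; auto).
  assert (gam0 : gam 0 = 0).
  { unfold gam; rewrite Arg_pos_real; [ring|apply Rz|].
    unfold zt; rewrite Rmult_0_r; unfold circ; rewrite sin_0; unfold Im; simpl; ring. }
  assert (phi0 : phi 0 = 0).
  { destruct s0 as [x Hx]; unfold phi, L1, L2; rewrite gam0.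
    replace (uf (Cconj rho) 0) with (Cconj (uf rho 0)).
    - rewrite Arg_conj; [ring|]; assert (A := Ru rho 0 Hb); lra.
    - assert (A := Nsc 0); unfold uf; rewrite Hx in *.
      rewrite Cminus_conj, Cdiv_conj, !Cminus_conj by auto.
      replace (Cconj x) with (RtoC x) by (creal; ring).
      replace (Cconj c0) with c0 by (unfold c0; creal; ring).
      replace (Cconj 1) with (RtoC 1) by (creal; ring); auto. }
  assert (Rk : r < r * r / Cmod kap).
  { apply Rmult_lt_reg_r with (Cmod kap); auto.
    replace (r * r / Cmod kap * Cmod kap) with (r * r) by (field; lra).
    apply Rmult_lt_compat_l; lra. }
  set (Rd := Rmin (r * r / Cmod kap) 1).
  assert (HRd : r < Rd) by (unfold Rd; apply Rmin_glb_lt; lra).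
  assert (Ne : forall k z, Cmod k = Cmod kap -> cdisc Rd z -> (1 - k * z * RtoC (/ (r * r)))%C <> RtoC 0).
  { intros k z Hk Hz E; unfold cdisc in Hz.
    assert (Hz2 : Cmod z < r * r / Cmod kap) by (eapply Rlt_le_trans; [exact Hz|apply Rmin_l]).
    assert (E1 : (k * z * RtoC (/ (r * r)))%C = RtoC 1).
    { replace (k * z * RtoC (/ (r * r)))%C with (1 - (1 - k * z * RtoC (/ (r * r))))%C by ring.
      rewrite E; ring. }
    apply (f_equal Cmod) in E1; rewrite !Cmod_mult, Cmod_R, Cmod_1, Hk, Rabs_pos_eq in E1
      by (left; apply Rinv_0_lt_compat; auto).
    assert (Cmod kap * Cmod z * / (r * r) < 1); [|lra].
    apply Rmult_lt_reg_r with (r * r); auto; rewrite Rmult_assoc, Rinv_l, Rmult_1_l, Rmult_1_r by lra.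
    apply Rlt_le_trans with (Cmod kap * (r * r / Cmod kap)); [apply Rmult_lt_compat_l; auto|].
    right; field; lra. }
  assert (Hgr : forall t : R, g t = RtoC (((1 - Re kap * t / (r * r)) * (1 - Re kap * t / (r * r)) +
      (Im kap * t / (r * r)) * (Im kap * t / (r * r))) * ((1 - t) * (1 - t)))).
  { intros t; unfold g, e1, e2; generalize kap; intros k; unfold Re, Im; creal; field; lra. }
  destruct (arc_identity g Rd q phi) as [Mg [IMg IVg]];
    [lra|exact HRd| | | | | |exact phi0|intros; apply Iphi|].
  { apply Cn_mult; [apply Cn_mult|apply Cn_mult]; (apply Cn_minus; [apply Cn_const|]);
      try apply Cn_id; apply Cn_mult; try apply Cn_const; apply Cn_mult; try apply Cn_const; apply Cn_id. }
  { intros z Hz; unfold g; apply Cmult_neq_0; [apply Cmult_neq_0; apply Ne; auto; apply Cmod_conj|].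
    unfold cdisc in Hz; assert (Hz2 : Cmod z < 1) by (eapply Rlt_le_trans; [exact Hz|apply Rmin_r]).
    apply Cmult_neq_0; apply one_sub_neq; auto. }
  { unfold g, e1, e2; ring. }
  { intros t _; rewrite Hgr; reflexivity. }
  { intros p _; unfold phi, L1, L2; apply continuous_Rminus.
    - apply continuous_Rmult; [apply continuous_const|apply continuous_id].
    - apply continuous_Rplus; apply continuous_Rplus; auto. }
  set (pr := psi a (Re rho - (1 - a)) (Im rho)).
  assert (Hpr := psi_bound a (Re rho - (1 - a)) (Im rho) (proj1 Ha) Hi); fold pr in Hpr.
  (* As [2 pr] is an argument of [kap], [lam * e^(i pr)] is a square root of [kap / r], the number
     [c] of [log_integral]. *)
  set (n := Cmod kap / r); assert (Hn : 0 < n) by (unfold n; apply Rdiv_lt_0_compat; lra).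
  set (lam := sqrt n); assert (Hlam : 0 < lam) by (apply sqrt_lt_R0; auto).
  assert (Ell : lam * lam = n) by (apply sqrt_sqrt; lra).
  assert (Ekap : kap = (RtoC (Cmod kap) * (cos (2 * pr), sin (2 * pr)))%C).
  { assert (IK : isarg kap (2 * pr)).
    { unfold pr, psi; replace (2 * (/ 2 * Arg ((Re rho - (1 - a)) * (Re rho - (1 - a)) + Im rho * Im rho - a * a, 2 * a * Im rho)))
        with (0 + Arg ((Re rho - (1 - a)) * (Re rho - (1 - a)) + Im rho * Im rho - a * a, 2 * a * Im rho)) by field.
      set (M2 := Cmod (rho - 1 + RtoC (2 * a)) * Cmod (rho - 1 + RtoC (2 * a))).
      assert (HM2 : 0 < M2) by (apply Rmult_lt_0_compat; auto).
      replace kap with (RtoC (/ M2) * (((Re rho - (1 - a)) * (Re rho - (1 - a)) + Im rho * Im rho - a * a)%R, (2 * a * Im rho)%R))%C.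
      - apply isarg_mult; [apply isarg_pos; left; apply Rinv_0_lt_compat; auto|apply isarg_Arg].
      - assert (E2 : ((rho - 1) * Cconj (rho - 1 + RtoC (2 * a)))%C = (((Re rho - (1 - a)) * (Re rho - (1 - a)) + Im rho * Im rho - a * a)%R, (2 * a * Im rho)%R))
          by (unfold Re, Im; creal; ring).
        rewrite <- E2; unfold kap.
        assert (E3 : RtoC M2 = ((rho - 1 + RtoC (2 * a)) * Cconj (rho - 1 + RtoC (2 * a)))%C)
          by (unfold M2; rewrite Cmod_sqr; unfold Re, Im; creal; ring).
        assert (NM2 : RtoC M2 <> RtoC 0) by (intros E; apply (f_equal fst) in E; simpl in E; lra).
        rewrite RtoC_inv, E3 by lra; field; split; auto.
        intros E; apply NM2; rewrite E3, E; ring. }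
    unfold isarg in IK; rewrite IK at 1; creal; ring. }
  assert (Hc1 : 0 < lam * cos pr) by (apply Rmult_lt_0_compat; auto; apply cos_gt_0; lra).
  assert (LI := log_integral (lam * cos pr) (lam * sin pr) Hc1); cbv zeta in LI.
  assert (Sp := sin2cos2 pr).
  replace (lam * cos pr * (lam * cos pr) + lam * sin pr * (lam * sin pr)) with n in LI.
  2:{ rewrite <- Ell; transitivity (lam * lam * (cos pr * cos pr + sin pr * sin pr)); [rewrite Sp; ring|ring]. }
  replace (lam * cos pr * (lam * cos pr) - lam * sin pr * (lam * sin pr)) with (Re kap / r) in LI.
  2:{ rewrite Ekap; unfold Re; simpl; rewrite cos_2a.
      transitivity (n * (cos pr * cos pr - sin pr * sin pr)); [unfold n; field; lra|rewrite <- Ell; ring]. }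
  replace (2 * (lam * cos pr) * (lam * sin pr)) with (Im kap / r) in LI.
  2:{ rewrite Ekap; unfold Im; simpl; rewrite sin_2a.
      transitivity (n * (2 * (sin pr * cos pr))); [unfold n; field; lra|rewrite <- Ell; ring]. }
  set (W := fun y => (1 + 1 / (y * y)) * (ln (((Re kap / r + y * y) ^ 2 + (Im kap / r) ^ 2) / (n * n)) +
     ln ((1 + Re kap / r * (y * y)) ^ 2 + (Im kap / r * (y * y)) ^ 2))).
  set (val := -8 + 2 * PI * (lam * cos pr * (1 + / n))).
  change (is_RInt W 0 1 val) in LI.
  (* Rescaling [y] by [q] carries the integral over [[0, 1]] to [[0, q]] and the weight to
     [1 + q^2/y^2]. *)
  assert (LS : is_RInt (fun y => q * (/ q * W (/ q * y + 0))) 0 q (q * val)).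
  { apply is_RInt_Rscal.
    apply (is_RInt_comp_lin (V := R_NormedModule) W (/ q) 0 0 q val).
    replace (/ q * 0 + 0) with 0 by ring; replace (/ q * q + 0) with 1 by (field; lra); auto. }
  assert (Q2 : q * q = r) by reflexivity.
  (* At [w = -t] the modulus of the pair is [B1 / (1 + t)^2] and that of [g] is [B2 (1 + t)^2], so
     the logarithm of the pair is the integrand of [log_integral] minus that of [g]. *)
  assert (IVp : is_RInt (fun y => (1 + q * q / (y * y)) * ln (Cmod (pfac rho (sz a (RtoC (- (y * y))))))) 0 q
     (q * val - (-2 * q * Mg))).
  { apply is_RInt_extR with (3 := is_RInt_Rminus _ _ _ _ _ _ LS IVg); [lra|].
    intros y Hy.
    assert (Hyy : 0 < y * y < 1) by nra.
    set (t := y * y) in *.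
    assert (KK : Re kap * Re kap + Im kap * Im kap = Cmod kap * Cmod kap) by (symmetry; apply Cmod_sqr).
    assert (Ikap : Im kap <> 0).
    { rewrite Ekap; unfold Im; simpl.
      assert (0 < sin (2 * pr)) by (apply sin_gt_0; lra).
      assert (0 < Cmod kap * sin (2 * pr)) by (apply Rmult_lt_0_compat; auto); lra. }
    assert (SQ : forall u, 0 < u * u + t * t * (Im kap * Im kap)).
    { intros u; assert (0 < t * t * (Im kap * Im kap)).
      { apply Rmult_lt_0_compat; [apply Rmult_lt_0_compat; lra|apply Rsqr_pos_lt; auto]. }
      generalize (Rle_0_sqr u); unfold Rsqr; lra. }
    assert (EW : W (/ q * y + 0) = (1 + r / t) *
      (ln (((Re kap + t) * (Re kap + t) + Im kap * Im kap) / (Cmod kap * Cmod kap)) +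
       ln ((1 + Re kap * t / (r * r)) * (1 + Re kap * t / (r * r)) + (Im kap * t / (r * r)) * (Im kap * t / (r * r))))).
    { unfold W; replace ((/ q * y + 0) * (/ q * y + 0)) with (t / r) by (unfold t; rewrite <- Q2; field; lra).
      f_equal; [field; lra|]; f_equal; f_equal.
      - unfold n; field; lra.
      - field; lra. }
    rewrite EW, Hgr, Cmod_R; fold r; clear EW.
    replace (1 - Re kap * - t / (r * r)) with (1 + Re kap * t / (r * r)) by (field; lra).
    replace (Im kap * - t / (r * r) * (Im kap * - t / (r * r))) with
      (Im kap * t / (r * r) * (Im kap * t / (r * r))) by (field; lra).
    replace (1 - - t) with (1 + t) by ring.
    set (B2 := (1 + Re kap * t / (r * r)) * (1 + Re kap * t / (r * r)) + Im kap * t / (r * r) * (Im kap * t / (r * r))).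
    assert (HB2 : 0 < B2).
    { unfold B2; assert (A := SQ ((1 + Re kap * t / (r * r)) * (r * r))).
      apply Rmult_lt_reg_r with (r * r * (r * r)); [apply Rmult_lt_0_compat; auto|].
      rewrite Rmult_0_l.
      replace (((1 + Re kap * t / (r * r)) * (1 + Re kap * t / (r * r)) + Im kap * t / (r * r) * (Im kap * t / (r * r))) * (r * r * (r * r)))
        with ((1 + Re kap * t / (r * r)) * (r * r) * ((1 + Re kap * t / (r * r)) * (r * r)) + t * t * (Im kap * Im kap)) by (field; lra).
      auto. }
    rewrite Rabs_pos_eq by (apply Rmult_le_pos; [lra|nra]).
    set (B1 := ((Re kap + t) * (Re kap + t) + Im kap * Im kap) / (Cmod kap * Cmod kap)).
    assert (HB1 : 0 < B1).
    { unfold B1; apply Rdiv_lt_0_compat; [|apply Rmult_lt_0_compat; auto].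
      generalize (Rle_0_sqr (Re kap + t)) (Rsqr_pos_lt _ Ikap); unfold Rsqr; lra. }
    assert (EP : Cmod (pfac rho (sz a (RtoC (- t)))) = B1 / ((1 + t) * (1 + t))).
    { assert (Ht1 : Cmod (RtoC (- t)) < 1) by (rewrite Cmod_R, Rabs_Ropp, Rabs_pos_eq; lra).
      assert (SS : forall d kd, Cmod kd = Cmod kap -> kd = ((d - 1) / (d - 1 + RtoC (2 * a)))%C -> (d - 1 + RtoC (2 * a))%C <> RtoC 0 ->
         Re kd = Re kap -> Im kd * Im kd = Im kap * Im kap ->
         Cmod (sz a (RtoC (- t)) - d) * Cmod (sz a (RtoC (- t)) - d) * ((1 + t) * (1 + t)) =
         Cmod (d - 1) * Cmod (d - 1) * B1).
      { intros d kd Hkd Ekd Nd0 Er Ei.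
        assert (A := sz_sub a (RtoC (- t)) d Ht1).
        assert (A2 : ((sz a (RtoC (- t)) - d) * RtoC (1 + t))%C = ((d - 1 + RtoC (2 * a)) * (RtoC (- t) - kd))%C).
        { replace (RtoC (1 + t)) with (1 - RtoC (- t))%C by (creal; ring).
          rewrite A, Ekd; field; auto. }
        apply (f_equal Cmod) in A2; rewrite !Cmod_mult, Cmod_R, (Rabs_pos_eq (1 + t)) in A2 by lra.
        assert (A3 : Cmod (RtoC (- t) - kd) * Cmod (RtoC (- t) - kd) = B1 * (Cmod kap * Cmod kap)).
        { rewrite Cmod_sqr, Re_Cminus, Im_Cminus; simpl (Re (RtoC (- t))); simpl (Im (RtoC (- t))).
          rewrite Er; unfold B1; replace ((0 - Im kd) * (0 - Im kd)) with (Im kap * Im kap) by (rewrite <- Ei; ring).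
          field; lra. }
        assert (A4 : Cmod (d - 1) = Cmod kap * Cmod (d - 1 + RtoC (2 * a))).
        { rewrite <- Hkd, Ekd, Cmod_div by auto; field.
          assert (P := Cmod_pos _ Nd0); lra. }
        set (X := Cmod (sz a (RtoC (- t)) - d)) in *.
        transitivity ((X * (1 + t)) * (X * (1 + t))); [ring|].
        rewrite A2, A4.
        transitivity (Cmod (d - 1 + RtoC (2 * a)) * Cmod (d - 1 + RtoC (2 * a)) * (Cmod (RtoC (- t) - kd) * Cmod (RtoC (- t) - kd))); [ring|].
        rewrite A3; ring. }
      assert (S1 := SS rho kap eq_refl eq_refl Nd' eq_refl eq_refl).
      assert (S2 := SS (Cconj rho) (Cconj kap) (Cmod_conj kap) Kc Ndc (re_conj kap) ltac:(rewrite im_conj; ring)).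
      replace (Cmod (Cconj rho - 1)) with (Cmod (rho - 1)) in S2
        by (rewrite <- (Cmod_conj (rho - 1)); f_equal; creal; ring).
      unfold pfac; rewrite Cmod_div, Cmod_mult, Cmod_R, (Cmod_sub_sym 1 rho).
      2:{ intros E; apply (f_equal fst) in E; simpl in E; rewrite Cmod_sub_sym in E; nra. }
      rewrite Rabs_pos_eq by nra.
      set (X1 := Cmod (sz a (RtoC (- t)) - rho)) in *; set (X2 := Cmod (sz a (RtoC (- t)) - Cconj rho)) in *.
      assert (P1 : 0 <= X1) by apply Cmod_ge_0; assert (P2 : 0 <= X2) by apply Cmod_ge_0.
      assert (E12 : X1 = X2).
      { apply Rsqr_inj; auto; unfold Rsqr; apply Rmult_eq_reg_r with ((1 + t) * (1 + t)); [|nra].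
        rewrite S1, S2; auto. }
      rewrite <- E12; apply Rmult_eq_reg_r with ((1 + t) * (1 + t) * (Cmod (rho - 1) * Cmod (rho - 1))); [|nra].
      transitivity (X1 * X1 * ((1 + t) * (1 + t))); [field; lra|].
      rewrite S1; field; nra. }
    rewrite EP.
    assert (T2 : 0 < (1 + t) * (1 + t)) by nra.
    change (B1 / ((1 + t) * (1 + t))) with (B1 * / ((1 + t) * (1 + t))).
    rewrite (ln_mult B2), (ln_mult B1 (/ _)), ln_Rinv by (try apply Rinv_0_lt_compat; auto).
    field; lra. }
  set (ps := psi a xs (Im rho)).
  assert (Hps := psi_bound a xs (Im rho) (proj1 Ha) Hi); fold ps in Hps.
  set (st := fun p => if Rlt_dec p ps then 0 else 2 * PI).
  exists (fun p => L1 p + L2 p - st p), (2 * q * (4 - Mg - 2 * PI * cos ps) + (q * val - (-2 * q * Mg))).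
  split; [|split].
  - exists (4 - Mg - 2 * PI * cos ps), (q * val - (-2 * q * Mg)); split; [|auto].
    apply is_RInt_extR with (3 := is_RInt_Rminus _ _ _ _ _ _
      (is_RInt_Rminus _ _ _ _ _ _ RInt_psin IMg) (step_sin ps ltac:(lra))); [lra|].
    intros p _; unfold phi, st; ring.
  - intros p Hp; destruct (arcpt_Im a q p (proj1 Ha) Hq ltac:(lra)) as [_ HI]; specialize (HI Hp); fold (s p) in *.
    assert (Nin : forall p, (s p - rho)%C <> RtoC 0).
    { intros p' E; assert (E1 : s p' = rho) by (replace (s p') with (s p' - rho + rho)%C by ring; rewrite E; ring).
      assert (A := Ms p'); rewrite E1 in A; lra. }
    assert (Im2 : 0 < Im (s p - Cconj rho)%C) by (rewrite Im_Cminus, im_conj; lra).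
    assert (N2 : (s p - Cconj rho)%C <> RtoC 0) by (intros E; rewrite E in Im2; simpl in Im2; lra).
    assert (G := Rgam p ltac:(lra)).
    assert (B3 := Arg_Re_pos _ (Ru rho p Hb)); assert (B4 := Arg_Re_pos _ (Ru (Cconj rho) p Hbc)).
    assert (B5 := Arg_bound (s p - rho)); assert (B6 := Arg_Im_pos _ Im2).
    assert (F2 : Arg (s p - Cconj rho) = L2 p).
    { apply isarg_eq with (s p - Cconj rho)%C; [exact N2|apply isarg_Arg|apply IL|].
      unfold L2; apply Rabs_def1; lra. }
    unfold st; destruct (Rlt_dec p ps) as [Hlt|Hge].
    (* Any crossing of the cut has abscissa at most [xs] from the line, hence parameter at least
       [ps] as [psi] is antitone. Before [ps] the principal argument is therefore continuous, and it
       agrees with [L1] at 0. *)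
    + assert (F1 : Arg (s p - rho) = L1 p).
      { apply (isarg_unique_cont (fun p => (s p - rho)%C) (fun p => Arg (s p - rho)) L1 0 p 0); try lra.
        - intros; apply Nin.
        - intros; apply isarg_Arg.
        - intros; apply IL.
        - intros p' Hp'; apply (continuous_comp (fun p => (s p - rho)%C) Arg).
          + apply continuous_Cminus; [auto|apply continuous_const].
          + apply continuous_Arg; intros [X1 X2].
            rewrite Re_Cminus in X1; rewrite Im_Cminus in X2.
            assert (Xc := Hcut p' ltac:(lra)); fold (s p') in Xc; specialize (Xc ltac:(lra) ltac:(lra)).
            assert (P' : 0 < p').
            { destruct (Req_dec p' 0) as [->|]; [|lra]; exfalso.
              destruct s0 as [x Hx]; rewrite Hx in X2; simpl in X2; lra. }
            assert (PA := psi_arcpt a q p' (proj1 Ha) Hq ltac:(lra)); fold (s p') in PA.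
            replace (Im (s p')) with (Im rho) in PA by lra.
            assert (HR := arcpt_Re_pos a q p' (proj1 Ha) Hq); fold (s p') in HR.
            assert (M := psi_antitone a (Re (s p') - (1 - a)) xs (Im rho) (proj1 Ha) Hi ltac:(lra)).
            fold ps in M; lra.
        - intros; unfold L1; apply continuous_Rplus; [apply Cg|apply Cu; exact Hb].
        - apply isarg_eq with (s 0 - rho)%C; [apply Nin|apply isarg_Arg|apply IL|].
          unfold L1; rewrite gam0; assert (A0 := Arg_Re_pos _ (Ru rho 0 Hb)).
          assert (I0 : Im (s 0 - rho)%C < 0).
          { destruct s0 as [x Hx]; rewrite Im_Cminus, Hx; simpl; lra. }
          assert (B0 := Arg_Im_neg _ I0); apply Rabs_def1; lra. }
      rewrite F1, F2; lra.
    (* Past [ps] only a loss of at most [2 PI] has to be excluded from [Lam], which is what [st]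
       subtracts. *)
    + destruct (Arg_mod_cases _ _ (Nin p) (IL rho p)) as [E1|[E1|E1]]; unfold L1 in *; lra.
  - fold pr; unfold val.
    (* In the total the terms [8 q] and those in [Mg] cancel; what remains is bounded below by
       [lam + 1/lam >= 2]. *)
    assert (D1 : 2 * cos pr <= lam * cos pr * (1 + / n)).
    { assert (C0 : 0 < cos pr) by (apply cos_gt_0; lra).
      assert (2 <= lam * (1 + / n)).
      { rewrite <- Ell; apply Rmult_le_reg_r with lam; auto.
        replace (lam * (1 + / (lam * lam)) * lam) with (lam * lam + 1) by (field; lra).
        generalize (Rle_0_sqr (lam - 1)); unfold Rsqr; lra. }
      replace (lam * cos pr * (1 + / n)) with (lam * (1 + / n) * cos pr) by ring.
      apply Rmult_le_compat_r; lra. }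
    assert (0 < PI * q) by (apply Rmult_lt_0_compat; lra).
    assert (PI * q * (2 * cos pr) <= PI * q * (lam * cos pr * (1 + / n))) by (apply Rmult_le_compat_l; lra).
    set (dd := lam * cos pr * (1 + / n)) in *.
    lra.
Qed.

Lemma contrib_ext a q f g Lam Lam' c : 0 < a <= 1 / 2 -> 0 < q < 1 ->
  (forall s, rhp s -> f s = g s) -> (forall p, 0 < p < PI / 2 -> Lam p = Lam' p) ->
  contrib a q f Lam c -> contrib a q g Lam' c.
Proof.
  intros Ha Hq Hfg HL [M [V [IM [IV E]]]]; exists M, V; generalize PI_RGT_0; intros HP.
  split; [|split; auto].
  - apply is_RInt_extR with (3 := IM); [lra|]; intros p Hp; rewrite HL; auto.
  - apply is_RInt_extR with (3 := IV); [lra|]; intros y Hy; rewrite Hfg; auto.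
    unfold rhp; assert (A := sz_Re_pos a (RtoC (- (y * y))) (proj1 Ha)).
    rewrite Cmod_R, Rabs_Ropp, Rabs_pos_eq in A by nra; specialize (A ltac:(nra)); lra.
Qed.

Lemma contrib_mult a q f g Lf Lg c d : 0 < a -> 0 < q < 1 ->
  (forall y, 0 < y < q -> f (sz a (RtoC (- (y * y)))) <> RtoC 0) ->
  (forall y, 0 < y < q -> g (sz a (RtoC (- (y * y)))) <> RtoC 0) ->
  contrib a q f Lf c -> contrib a q g Lg d ->
  contrib a q (fun s => f s * g s)%C (fun p => Lf p + Lg p) (c + d).
Proof.
  intros Ha Hq Nf Ng [M [V [IM [IV E]]]] [M' [V' [IM' [IV' E']]]].
  exists (M + M'), (V + V'); generalize PI_RGT_0; intros HP; split; [|split].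
  - apply is_RInt_extR with (3 := is_RInt_Rplus _ _ _ _ _ _ IM IM'); [lra|].
    intros p _; ring.
  - apply is_RInt_extR with (3 := is_RInt_Rplus _ _ _ _ _ _ IV IV'); [lra|].
    intros y Hy; rewrite Cmod_mult, ln_mult by (apply Cmod_pos; auto); ring.
  - lra.
Qed.

(** * Contribution of all zeros *)

(** The proposition [E] is a switch for the exact form: [True] when no zero lies to the right of the
    line, [False] when one may. One induction over the zeros then serves both implications. *)
Definition zero_contrib (a q : R) (rho : C) (d : R) (E : Prop) : Prop :=
  exists Lam c, contrib a q (pfac rho) Lam c /\ d <= c /\
    (forall p, 0 < p < PI / 2 -> Lam p <= Arg (arcpt a q p - rho) + Arg (arcpt a q p - Cconj rho)) /\
    (E -> c = 0 /\ forall p, 0 < p < PI / 2 ->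
       Lam p = Arg (arcpt a q p - rho) + Arg (arcpt a q p - Cconj rho)).

(** The line [Re s = 1 - a] is the perpendicular bisector of the points [1] and [1 - 2 a]. *)
Lemma Re_gt_of_dist a rho : 0 < a ->
  Cmod (rho - 1) < Cmod (rho - 1 + RtoC (2 * a)) -> 1 - a < Re rho.
Proof.
  intros Ha H; assert (A := Cmod_sqr (rho - 1)); assert (B := Cmod_sqr (rho - 1 + RtoC (2 * a))).
  assert (P := Cmod_ge_0 (rho - 1)).
  assert (Q : Cmod (rho - 1) * Cmod (rho - 1) < Cmod (rho - 1 + RtoC (2 * a)) * Cmod (rho - 1 + RtoC (2 * a))) by nra.
  rewrite A, B in Q; unfold Re, Im in *; simpl in Q; nra.
Qed.

Lemma zero_contrib_nonneg a q rho (E : Prop) : 0 < a <= 1 / 2 -> 0 < q < 1 ->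
  0 < Im rho -> 0 < Re rho -> (E -> Re rho <= 1 - a) ->
  q * q * Cmod (rho - 1 + RtoC (2 * a)) <> Cmod (rho - 1) -> zero_contrib a q rho 0 E.
Proof.
  intros Ha Hq Hi Hre HE Hne; unfold zero_contrib.
  destruct (Rle_dec (q * q * Cmod (rho - 1 + RtoC (2 * a))) (Cmod (rho - 1))) as [H|H].
  - destruct (zero_outside a q rho) as [Lam [H1 [H2 H3]]]; auto; [lra|].
    exists Lam, 0; split; [|split; [lra|split]]; auto.
  - assert (P := Cmod_ge_0 (rho - 1 + RtoC (2 * a))).
    assert (Hq2 : q * q < 1) by nra.
    assert (W := Re_gt_of_dist a rho (proj1 Ha) ltac:(nra)).
    destruct (zero_inside a q rho (Re rho - (1 - a))) as [Lam [c [H1 [H2 H3]]]]; auto; try lra.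
    + intros ->; simpl in Hi; lra.
    + intros; lra.
    + exists Lam, c; split; [|split; [lra|split]]; auto.
      intros HE'; specialize (HE HE'); lra.
Qed.

Lemma arcpt_circle a q p : 0 < q < 1 ->
  (Re (arcpt a q p) - (1 - a)) * (Re (arcpt a q p) - (1 - a)) + Im (arcpt a q p) * Im (arcpt a q p) + a * a =
  2 * (a * (1 + q * q * (q * q)) / (1 - q * q * (q * q))) * (Re (arcpt a q p) - (1 - a)).
Proof.
  intros Hq; unfold arcpt; set (r := q * q); assert (Hr : 0 < r < 1) by (unfold r; nra).
  rewrite sz_circ by lra; simpl Re; simpl Im; set (t := 2 * p).
  assert (D := circ_den_pos r t ltac:(lra)); assert (S := sin2cos2 t).
  apply Rmult_eq_reg_r with (circ_den r t * circ_den r t); [|nra].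
  field_simplify; try nra.
  replace (sin t ^ 2) with (1 - cos t ^ 2) by (simpl; lra); unfold circ_den; field; nra.
Qed.

(** The last hypothesis holds for [q] near 1. By [arcpt_circle] a crossing at height [Im rho] and
    distance [x <= xi] from the line satisfies [2 k x <= xi^2 + h^2 + a^2 <= k xi], so
    [x <= xi / 2]. The gap between [xi] and [xi / 2] does not shrink as [q] tends to 1. *)
Lemma zero_contrib_pos a q rho : 0 < a <= 1 / 2 -> 0 < q < 1 ->
  0 < Im rho -> 1 - a < Re rho ->
  Cmod (rho - 1) < q * q * Cmod (rho - 1 + RtoC (2 * a)) ->
  (Re rho - (1 - a)) * (Re rho - (1 - a)) + Im rho * Im rho + a * a <=
    a * (1 + q * q * (q * q)) / (1 - q * q * (q * q)) * (Re rho - (1 - a)) ->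
  zero_contrib a q rho (4 * PI * q * (cos (psi a (Re rho - (1 - a)) (Im rho)) -
    cos (psi a ((Re rho - (1 - a)) / 2) (Im rho)))) False.
Proof.
  intros Ha Hq Hi Hre Hin Hc.
  destruct (zero_inside a q rho ((Re rho - (1 - a)) / 2)) as [Lam [c [H1 [H2 H3]]]]; auto; try lra.
  - intros ->; simpl in Hi; lra.
  - intros p Hp EI HR; assert (A := arcpt_circle a q p Hq); rewrite EI in A.
    assert (P := arcpt_Re_pos a q p (proj1 Ha) Hq).
    set (x := Re (arcpt a q p) - (1 - a)) in *; set (xi := Re rho - (1 - a)) in *.
    set (k := a * (1 + q * q * (q * q)) / (1 - q * q * (q * q))) in *.
    assert (Hk : 0 < k).
    { assert (xi * xi + Im rho * Im rho + a * a > 0) by (unfold xi in *; nra).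
      assert (0 < xi) by (unfold xi; lra); destruct (Rle_dec k 0); [nra|lra]. }
    assert (x <= xi) by (unfold x, xi; lra).
    assert (x * x <= xi * xi) by (unfold x, xi in *; nra).
    apply Rmult_le_reg_l with (2 * k); [lra|]; lra.
  - exists Lam, c; tauto.
Qed.

Lemma sz_neg_sqr_real a y : 0 < a <= 1 / 2 -> 0 < y < 1 ->
  exists x : R, sz a (RtoC (- (y * y))) = RtoC x /\ 0 < x.
Proof.
  intros Ha Hy; assert (A := sz_Re_pos a (RtoC (- (y * y))) (proj1 Ha)).
  rewrite Cmod_R, Rabs_Ropp, Rabs_pos_eq in A by nra; specialize (A ltac:(nra)).
  rewrite sz_real in * by (rewrite Rabs_Ropp, Rabs_pos_eq; nra); simpl in A.
  eexists; split; [reflexivity|]; simpl; lra.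
Qed.

Lemma sz_strip a R1 T w : 0 < a <= 1 / 2 -> R1 < 1 -> / (1 - R1) <= T -> cdisc R1 w -> strip T (sz a w).
Proof.
  intros Ha HR HT Hw; unfold cdisc in Hw.
  assert (A := sz_Re_pos a w (proj1 Ha) ltac:(lra)); split; [lra|].
  assert (N := one_sub_neq w ltac:(lra)).
  assert (B : Cmod (1 - w) >= 1 - Cmod w).
  { generalize (Cmod_sub_ge 1 w); rewrite Cmod_1; lra. }
  replace (Im (sz a w)) with (Im (RtoC (2 * a) * w / (1 - w))%C) by (unfold sz, Im; simpl; ring).
  eapply Rle_lt_trans; [apply Im_le_Cmod|].
  rewrite Cmod_div, Cmod_mult, Cmod_R, Rabs_pos_eq by (auto; lra).
  assert (P := Cmod_ge_0 w).
  apply Rlt_le_trans with (/ (1 - Cmod w)).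
  - apply Rle_lt_trans with (Cmod w * / (1 - Cmod w)).
    + apply Rmult_le_compat; [nra|left; apply Rinv_0_lt_compat; lra|nra|apply Rinv_le_contravar; lra].
    + rewrite <- (Rmult_1_l (/ (1 - Cmod w))) at 2; apply Rmult_lt_compat_r; [apply Rinv_0_lt_compat|]; lra.
  - apply Rle_trans with (2 := HT); apply Rinv_le_contravar; lra.
Qed.

(** The height comes from the disc of radius [R1 = (1 + q^2)/2], strictly larger than the arc, for
    which [1/(1 - R1) = 2/(1 - q^2)]. The zero-free factor is controlled on this whole disc. *)
Lemma arcpt_strip a q T p : 0 < a <= 1 / 2 -> 0 < q < 1 -> 2 / (1 - q * q) <= T ->
  strip T (arcpt a q p).
Proof.
  intros Ha Hq HT; assert (Hr : 0 < q * q < 1) by nra.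
  apply (sz_strip a ((1 + q * q) / 2)); try lra.
  - apply Rle_trans with (2 := HT); right; field; lra.
  - unfold cdisc; rewrite Cmod_circ0, Rabs_pos_eq; lra.
Qed.

Lemma cexp_neq_0 z : cexp z <> RtoC 0.
Proof. intros E; assert (A := Cmod_cexp z); rewrite E, Cmod_0 in A; generalize (exp_pos (Re z)); lra. Qed.

(** The zero-free factor contributes 0 and the pairs add up by [contrib_mult]; its nonvanishing
    conditions hold because the zeros of the list are not real. *)
Lemma contrib_argE a q T l L (d : C -> R) (E : Prop) : 0 < a <= 1 / 2 -> 0 < q < 1 ->
  2 / (1 - q * q) <= T -> full_fact T l L ->
  (forall rho, In rho l -> zero_contrib a q rho (d rho) E) ->
  exists Lam c, contrib a q Fz Lam c /\ fold_right (fun rho acc => d rho + acc) 0 l <= c /\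
    (forall p, 0 < p < PI / 2 -> Lam p <= argE l L (arcpt a q p)) /\
    (E -> c = 0 /\ forall p, 0 < p < PI / 2 -> Lam p = argE l L (arcpt a q p)).
Proof.
  intros Ha Hq HT [G [HG [EG [CL [L1 LR]]]]] Hz.
  assert (Hr : 0 < q * q < 1) by nra.
  assert (HT0 : 0 < T).
  { apply Rlt_le_trans with (2 := HT); apply Rdiv_lt_0_compat; lra. }
  assert (Hst := fun p => arcpt_strip a q T p Ha Hq HT).
  assert (NG : forall s, strip T s -> G s <> RtoC 0) by (intros s Hs; rewrite EG by auto; apply cexp_neq_0).
  assert (G1 := partial_fact_1 T l G HG); destruct HG as [Hl [HF [CG SG]]].
  assert (CB : contrib a q G (fun p => Im (L (arcpt a q p))) 0).
  { apply contrib_zero_free with ((1 + q * q) / 2); auto; try lra.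
    - intros w Hw; apply NG; apply (sz_strip a ((1 + q * q) / 2)); auto; try lra.
      apply Rle_trans with (2 := HT); right; field; lra.
    - intros x Hx; assert (A := SG (RtoC x) Hx).
      replace (Cconj x) with (RtoC x) in A by (creal; ring).
      apply (f_equal Im) in A; rewrite im_conj in A; lra.
    - intros p _; apply (continuous_ImC (fun p => L (arcpt a q p))).
      apply (continuous_comp (arcpt a q) L).
      + unfold arcpt; apply (continuous_double (fun t => sz a (circ 0 (q * q) t))).
        intros; apply continuous_sz_circ; lra.
      + apply (Cn_continuous 1 (strip T)); auto.
    - destruct (arcpt_0 a q Hq) as [x Hx]; assert (S0 := Hst 0); rewrite Hx in *; auto.
    - intros p _; rewrite EG by auto; apply isarg_cexp. }
  assert (Ny : forall y, 0 < y < q -> strip T (sz a (RtoC (- (y * y))))).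
  { intros y Hy; apply (sz_strip a ((1 + q * q) / 2)); auto; try lra.
    - apply Rle_trans with (2 := HT); right; field; lra.
    - unfold cdisc; rewrite Cmod_R, Rabs_Ropp, Rabs_pos_eq; nra. }
  assert (Np : forall y rho, 0 < y < q -> 0 < Im rho -> pfac rho (sz a (RtoC (- (y * y)))) <> RtoC 0).
  { intros y rho Hy Hi; destruct (sz_neg_sqr_real a y Ha ltac:(lra)) as [x [-> Hx]].
    apply pfac_nonzero; auto; intros A; apply (f_equal Im) in A; [|rewrite im_conj in A]; simpl in A; lra. }
  assert (K : exists Lam c, contrib a q (fun s => pprod l s * G s)%C Lam c /\
    fold_right (fun rho acc => d rho + acc) 0 l <= c /\
    (forall p, 0 < p < PI / 2 -> Lam p <= argE l L (arcpt a q p)) /\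
    (E -> c = 0 /\ forall p, 0 < p < PI / 2 -> Lam p = argE l L (arcpt a q p)) /\
    forall y, 0 < y < q -> (pprod l (sz a (RtoC (- (y * y)))) * G (sz a (RtoC (- (y * y)))))%C <> RtoC 0).
  { clear HF; induction l as [|rho l IH].
    - exists (fun p => Im (L (arcpt a q p))), 0; simpl; split; [|split; [lra|split; [intros; lra|split]]].
      + apply contrib_ext with (5 := CB); auto; intros; ring.
      + intros _; auto.
      + intros y Hy; rewrite Cmult_1_l; auto.
    - destruct IH as [Lam [c [H1 [H2 [H3 [H4 H5]]]]]].
      { intros; apply Hl; right; auto. }
      { intros; apply Hz; right; auto. }
      destruct (Hz rho (or_introl eq_refl)) as [Lr [cr [K1 [K2 [K3 K4]]]]].
      destruct (Hl rho (or_introl eq_refl)) as [_ Hi].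
      exists (fun p => Lr p + Lam p), (cr + c); split; [|split; [simpl; lra|split; [|split]]].
      + apply contrib_ext with (fun s => pfac rho s * (pprod l s * G s))%C (fun p => Lr p + Lam p); auto.
        * intros s _; simpl; ring.
        * apply contrib_mult; auto; try lra; intros y Hy; apply Np; auto; lra.
      + intros p Hp; simpl; specialize (K3 p Hp); specialize (H3 p Hp); lra.
      + intros HE; destruct (H4 HE) as [-> A]; destruct (K4 HE) as [-> B]; split; [ring|].
        intros p Hp; simpl; rewrite A, B by auto; ring.
      + intros y Hy; simpl.
        rewrite <- Cmult_assoc; apply Cmult_neq_0; [apply Np; auto; lra|auto]. }
  destruct K as [Lam [c [H1 [H2 [H3 [H4 _]]]]]]; exists Lam, c; split; auto.
  apply contrib_ext with (5 := H1); auto.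
  intros s Hs; rewrite HF; auto.
Qed.

Lemma sum_ge (d : C -> R) l rho : (forall r, In r l -> 0 <= d r) -> In rho l ->
  d rho <= fold_right (fun r acc => d r + acc) 0 l.
Proof.
  assert (N : forall l, (forall r, In r l -> 0 <= d r) -> 0 <= fold_right (fun r acc => d r + acc) 0 l).
  { induction l0 as [|r l0 IH]; intros H; simpl; [lra|].
    specialize (IH (fun r Hr => H r (or_intror Hr))); specialize (H r (or_introl eq_refl)); lra. }
  induction l as [|r l IH]; intros H; [intros []|intros [->|Hin]]; simpl.
  - specialize (N l (fun r Hr => H r (or_intror Hr))); lra.
  - specialize (IH (fun r Hr => H r (or_intror Hr)) Hin); specialize (H r (or_introl eq_refl)); lra.
Qed.

Lemma psi_gap a xi h : 0 < a -> 0 < h -> 0 < xi ->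
  cos (psi a (xi / 2) h) < cos (psi a xi h).
Proof.
  intros Ha Hh Hx; generalize PI_RGT_0; intros HP.
  assert (B1 := psi_bound a xi h Ha Hh); assert (B2 := psi_bound a (xi / 2) h Ha Hh).
  apply cos_decreasing_1; try lra.
  assert (Hah : 0 < 2 * a * h) by (apply Rmult_lt_0_compat; lra).
  unfold psi; rewrite !Arg_Im_pos_atan by (simpl; auto); simpl.
  apply Rmult_lt_compat_l; [lra|].
  assert (atan ((xi / 2 * (xi / 2) + h * h - a * a) / (2 * a * h)) < atan ((xi * xi + h * h - a * a) / (2 * a * h))); [|lra].
  apply atan_increasing, Rmult_lt_compat_r; [apply Rinv_0_lt_compat; auto|nra].
Qed.

(** * The integral along the real axis *)

Definition xpt (a y : R) : R := 1 - 2 * a * (y * y) / (1 + y * y).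

Lemma one_plus_sqr_pos y : 0 < 1 + y * y.
Proof. generalize (Rle_0_sqr y); unfold Rsqr; lra. Qed.

Lemma xpt_pos a y : 0 < a <= 1 / 2 -> 0 < xpt a y.
Proof.
  intros Ha; assert (P := one_plus_sqr_pos y); unfold xpt.
  replace (1 - 2 * a * (y * y) / (1 + y * y)) with ((1 + (1 - 2 * a) * (y * y)) / (1 + y * y)) by (field; lra).
  apply Rdiv_lt_0_compat; auto.
  assert (0 <= (1 - 2 * a) * (y * y)) by (apply Rmult_le_pos; [lra|apply Rle_0_sqr]); lra.
Qed.

Lemma sz_xpt a y : 0 <= y < 1 -> sz a (RtoC (- (y * y))) = RtoC (xpt a y).
Proof.
  intros Hy; rewrite sz_real by (rewrite Rabs_Ropp, Rabs_pos_eq; nra).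
  assert (P := one_plus_sqr_pos y); unfold xpt; f_equal; field; lra.
Qed.

Lemma continuous_sqr y : continuous (fun y => y * y) y.
Proof. apply continuous_Rmult; apply continuous_id. Qed.

Lemma continuous_xpt a y : continuous (xpt a) y.
Proof.
  assert (P := one_plus_sqr_pos y).
  apply continuous_Rminus; [apply continuous_const|]; apply continuous_Rdiv; [| |lra].
  - apply continuous_Rmult; [apply continuous_const|apply continuous_sqr].
  - apply continuous_Rplus; [apply continuous_const|apply continuous_sqr].
Qed.

(** As [Fz 1 = 1] and [xpt a y - 1] is of order [y^2], the logarithm is divisible by [y^2]. This
    removes the singularity of the weight [1 + q^2/y^2] at [y = 0]. *)
Lemma ln_Fz_slope a : 0 < a <= 1 / 2 -> exists H : R -> R,
  (forall y, continuous H y) /\ forall y, ln (Re (Fz (xpt a y))) = y * y * H y.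
Proof.
  intros Ha.
  destruct (Cinf_quotient rhp (fun s => Fz s - 1)%C 1) as [g [Cg Eg]].
  - apply copen_rhp.
  - apply star_rhp; unfold rhp; simpl; lra.
  - intros n; apply Cn_minus; [apply Cn_Fz|apply Cn_const].
  - rewrite Fz_1; ring.
  - set (kk := fun y => Re (g (xpt a y)) * (- (2 * a) / (1 + y * y))).
    assert (Ek : forall y, Re (Fz (xpt a y)) = 1 + y * y * kk y).
    { intros y; assert (X := xpt_pos a y Ha); assert (A := Eg (RtoC (xpt a y)) X).
      replace (Fz (xpt a y)) with (1 + (Fz (xpt a y) - 1))%C by ring; rewrite A.
      unfold kk; set (G := g (xpt a y)).
      replace (Re (1 + (xpt a y - 1) * G)%C) with (1 + (xpt a y - 1) * Re G) by (unfold Re; simpl; ring).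
      assert (P := one_plus_sqr_pos y); unfold xpt; field; lra. }
    exists (fun y => kk y * lnslope (y * y * kk y)); split.
    + intros y; assert (Ck : continuous kk y).
      { apply continuous_Rmult.
        - apply (continuous_ReC (fun y => g (xpt a y))); apply (continuous_comp (fun y => RtoC (xpt a y)) g).
          + apply (continuous_comp (xpt a) RtoC); [apply continuous_xpt|apply continuous_RtoC].
          + apply (Cn_continuous 0 rhp); [apply Cg|apply xpt_pos; auto].
        - assert (P := one_plus_sqr_pos y); apply continuous_Rdiv; [apply continuous_const| |lra].
          apply continuous_Rplus; [apply continuous_const|apply continuous_sqr]. }
      apply continuous_Rmult; auto.
      apply (continuous_comp (fun y => y * y * kk y) lnslope).
      * apply continuous_Rmult; auto; apply continuous_sqr.
      * apply continuous_lnslope; assert (F := Fz_real (xpt a y) (xpt_pos a y Ha)); rewrite Ek in F; lra.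
    + intros y; rewrite Ek, <- lnslope_mul; ring.
Qed.

Lemma ex_RInt_continuous_R (f : R -> R) a b : (forall x, continuous f x) -> ex_RInt f a b.
Proof. intros H; apply (ex_RInt_continuous (V := R_CompleteNormedModule)); auto. Qed.

Lemma is_RInt_RInt (f : R -> R) a b : ex_RInt f a b -> is_RInt f a b (RInt f a b).
Proof. apply (RInt_correct (V := R_CompleteNormedModule)). Qed.

Lemma continuous_RInt_upper (f : R -> R) (a b : R) : (forall x, continuous f x) ->
  continuous (fun x => RInt f a x) b.
Proof.
  intros H; apply (continuous_RInt_1 (V := R_NormedModule) f a b (fun x => RInt f a x)).
  apply filter_forall; intros x; apply is_RInt_RInt, ex_RInt_continuous_R; auto.
Qed.

Lemma continuous_R_eps (f : R -> R) x e : continuous f x -> 0 < e ->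
  exists d, 0 < d /\ forall y, Rabs (y - x) < d -> Rabs (f y - f x) < e.
Proof.
  intros H He.
  destruct (H (fun z => Rabs (z - f x) < e)) as [d Hd].
  { exists (mkposreal e He); intros z Hz; exact Hz. }
  exists d; split; [apply cond_pos|]; intros y Hy; apply Hd; exact Hy.
Qed.

(** With [H] the integrand becomes [(y^2 + q^2) H y], so the modulus integral is a continuous
    function of [q] up to [q = 1]. *)
Lemma modulus_limit a (H : R -> R) e : 0 < a <= 1 / 2 -> (forall y, continuous H y) ->
  (forall y, ln (Re (Fz (xpt a y))) = y * y * H y) -> 0 < e ->
  exists d, 0 < d /\ forall q V, 0 < q < 1 -> 1 - d < q ->
    is_RInt (fun y => (1 + q * q / (y * y)) * ln (Cmod (Fz (sz a (RtoC (- (y * y))))))) 0 q V ->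
    Rabs (V - RInt (fun y => (y * y + 1) * H y) 0 1) < e.
Proof.
  intros Ha CH EH He.
  set (f1 := fun y => y * y * H y).
  assert (C1 : forall y, continuous f1 y) by (intros; apply continuous_Rmult; auto; apply continuous_sqr).
  set (P := fun q => RInt f1 0 q + q * q * RInt H 0 q).
  assert (CP : continuous P 1).
  { apply continuous_Rplus; [apply continuous_RInt_upper; auto|].
    apply continuous_Rmult; [apply continuous_sqr|apply continuous_RInt_upper; auto]. }
  destruct (continuous_R_eps P 1 e CP He) as [d [Hd0 Hd]].
  exists d; split; auto; intros q V Hq Hqd IV.
  assert (E : forall q, is_RInt (fun y => (y * y + q * q) * H y) 0 q (P q)).
  { intros q'; apply is_RInt_ext with (fun y => f1 y + q' * q' * H y).
    - intros y _; unfold f1; rring.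
    - apply is_RInt_Rplus; [|apply is_RInt_Rscal]; apply is_RInt_RInt, ex_RInt_continuous_R; auto. }
  assert (E1 := E 1); replace (RInt (fun y => (y * y + 1) * H y) 0 1) with (P 1).
  2:{ symmetry; apply is_RInt_unique; rewrite Rmult_1_r in E1; exact E1. }
  replace V with (P q); [apply Hd; apply Rabs_def1; lra|].
  transitivity (RInt (fun y => (y * y + q * q) * H y) 0 q); [symmetry; apply is_RInt_unique; auto|].
  apply is_RInt_unique; apply is_RInt_extR with (3 := IV); [lra|].
  intros y Hy; rewrite sz_xpt by lra.
  destruct (Fz_real (xpt a y) (xpt_pos a y Ha)) as [F1 F2].
  replace (Cmod (Fz (xpt a y))) with (Re (Fz (xpt a y))).
  - rewrite EH; field; lra.
  - replace (Fz (xpt a y)) with (RtoC (Re (Fz (xpt a y)))) at 2.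
    + rewrite Cmod_R, Rabs_pos_eq; lra.
    + destruct (Fz (xpt a y)); simpl in *; rewrite F2; auto.
Qed.

Lemma Rpower_3_2 u : 0 < u -> Rpower (u * u) (3 / 2) = u * u * u.
Proof.
  intros Hu; assert (0 < u * u) by (apply Rmult_lt_0_compat; auto).
  replace (u * u) with (Rpower u 2) at 1.
  - rewrite Rpower_mult; replace (2 * (3 / 2)) with (INR 3) by (simpl; lra).
    rewrite Rpower_pow by auto; simpl; ring.
  - replace 2 with (INR 2) by (simpl; lra); rewrite Rpower_pow by auto; simpl; ring.
Qed.

Lemma is_derive_xpt a y : is_derive (xpt a) y (- (4 * a * y) / ((1 + y * y) * (1 + y * y))).
Proof.
  assert (P := one_plus_sqr_pos y); unfold xpt; auto_derive; [lra|field; lra].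
Qed.

(** Under [s = xpt a y] the product [(1 - s)(s - 1 + 2 a)] is the square of [2 a y/(1 + y^2)], so
    the power [3/2] is rational in [y] and the integrand becomes [(1 + y^2) H y / (2 a^2)]. The
    improper end [s = 1] is the regular point [y = 0]. *)
Lemma real_axis_integral a (H : R -> R) : 0 < a <= 1 / 2 -> (forall y, continuous H y) ->
  (forall y, ln (Re (Fz (xpt a y))) = y * y * H y) ->
  is_RInt_gen (fun s => ln (Re (zetaF (RtoC s))) / (Rpower (1 - s) (3 / 2) * Rpower (s - 1 + 2 * a) (3 / 2)))
    (at_point (1 - a)) (at_left 1) (RInt (fun y => (y * y + 1) * H y) 0 1 / (2 * (a * a))).
Proof.
  intros Ha CH EH.
  set (f := fun s => ln (Re (Fz (RtoC s))) / (Rpower (1 - s) (3 / 2) * Rpower (s - 1 + 2 * a) (3 / 2))).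
  set (w := fun y => (y * y + 1) * H y).
  assert (Cw : forall y, continuous w y).
  { intros y; apply continuous_Rmult; auto; apply continuous_Rplus; [apply continuous_sqr|apply continuous_const]. }
  set (yb := fun s => sqrt ((1 - s) / (s - 1 + 2 * a))).
  assert (X1 : xpt a 1 = 1 - a) by (unfold xpt; field).
  assert (Haa : 0 < a * a) by nra.
  assert (Main : forall b, 1 - a < b < 1 ->
    is_RInt (fun s => ln (Re (zetaF (RtoC s))) / (Rpower (1 - s) (3 / 2) * Rpower (s - 1 + 2 * a) (3 / 2)))
      (1 - a) b ((RInt w 0 1 - RInt w 0 (yb b)) / (2 * (a * a)))).
  { intros b Hb.
    assert (Q : 0 < (1 - b) / (b - 1 + 2 * a)) by (apply Rdiv_lt_0_compat; lra).
    assert (Hy : 0 < yb b) by (apply sqrt_lt_R0; auto).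
    assert (Hyy : yb b * yb b = (1 - b) / (b - 1 + 2 * a)) by (apply sqrt_sqrt; lra).
    assert (Xb : xpt a (yb b) = b) by (unfold xpt; rewrite Hyy; field; lra).
    assert (Hy1 : yb b < 1).
    { apply Rlt_le_trans with (sqrt 1); [|rewrite sqrt_1; lra]; apply sqrt_lt_1_alt; split; [lra|].
      apply Rmult_lt_reg_r with (b - 1 + 2 * a); [lra|].
      unfold Rdiv; rewrite Rmult_assoc, Rinv_l; lra. }
    assert (HP : forall u, 0 < u -> 0 < Rpower u (3 / 2)) by (intros; apply exp_pos).
    assert (Xin : forall y, yb b <= y <= 1 -> 1 - a <= xpt a y < 1).
    { intros y Hyr; assert (P := one_plus_sqr_pos y); unfold xpt.
      assert (0 < y * y <= 1) by nra.
      split.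
      - replace (1 - 2 * a * (y * y) / (1 + y * y)) with (1 - a + a * ((1 - y * y) / (1 + y * y))) by (field; lra).
        assert (0 <= a * ((1 - y * y) / (1 + y * y))); [|lra].
        apply Rmult_le_pos; [lra|apply Rdiv_le_0_compat; lra].
      - assert (0 < 2 * a * (y * y) / (1 + y * y)); [|lra].
        apply Rdiv_lt_0_compat; auto; apply Rmult_lt_0_compat; lra. }
    assert (Cf : forall s, 1 - a <= s < 1 -> continuous f s).
    { intros s Hs; apply continuous_Rdiv.
      - apply (continuous_comp (fun s => Re (Fz (RtoC s))) ln).
        + apply (continuous_ReC (fun s => Fz (RtoC s))); apply (continuous_comp RtoC Fz); [apply continuous_RtoC|].
          apply (Cn_continuous 0 rhp); [apply Cn_Fz|unfold rhp; simpl; lra].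
        + apply continuous_ln; apply Fz_real; lra.
      - assert (CR : forall g : R -> R, continuous g s -> 0 < g s -> continuous (fun s => Rpower (g s) (3 / 2)) s).
        { intros g Cg Pg; unfold Rpower.
          apply (continuous_comp (fun s => 3 / 2 * ln (g s)) exp); [|apply continuous_exp].
          apply continuous_Rmult; [apply continuous_const|].
          apply (continuous_comp g ln); auto; apply continuous_ln; auto. }
        apply continuous_Rmult; apply CR; try lra.
        + apply continuous_Rminus; [apply continuous_const|apply continuous_id].
        + apply continuous_Rplus; [apply continuous_Rminus; [apply continuous_id|]|]; apply continuous_const.
      - apply Rmult_integral_contrapositive; split; apply Rgt_not_eq, HP; lra. }
    assert (IS : is_RInt f (1 - a) b (RInt f (1 - a) b)).
    { apply is_RInt_RInt, ex_RInt_cont; [lra|]; intros; apply Cf.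
      lra. }
    assert (IC := is_RInt_comp (V := R_CompleteNormedModule) f (xpt a)
      (fun y => - (4 * a * y) / ((1 + y * y) * (1 + y * y))) 1 (yb b)).
    rewrite X1, Xb in IC; rewrite Rmin_right, Rmax_left in IC by lra.
    assert (IC' : is_RInt (fun y => scal (- (4 * a * y) / ((1 + y * y) * (1 + y * y))) (f (xpt a y))) 1 (yb b)
       (RInt f (1 - a) b)).
    { apply IC; [intros y Hyr; apply Cf, Xin; auto|].
      intros y Hyr; split; [apply is_derive_xpt|].
      assert (P := one_plus_sqr_pos y); apply continuous_Rdiv.
      - apply (continuous_opp (fun y => 4 * a * y)).
        apply continuous_Rmult; [apply continuous_const|apply continuous_id].
      - apply continuous_Rmult; (apply continuous_Rplus; [apply continuous_const|apply continuous_sqr]).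
      - nra. }
    apply is_RInt_swap in IC'.
    assert (E : RInt f (1 - a) b = (RInt w 0 1 - RInt w 0 (yb b)) / (2 * (a * a))).
    { assert (J : is_RInt (fun y => / (2 * (a * a)) * w y) (yb b) 1 (- RInt f (1 - a) b * -1)).
      { apply is_RInt_extR with (fun y => -1 * scal (- (4 * a * y) / ((1 + y * y) * (1 + y * y))) (f (xpt a y))); [lra| |].
        - intros y Hyr; assert (Xy := Xin y ltac:(lra)); unfold f.
          rewrite EH; assert (P := one_plus_sqr_pos y).
          rewrite Rpower_mult_distr by lra.
          replace ((1 - xpt a y) * (xpt a y - 1 + 2 * a)) with
            ((2 * a * y / (1 + y * y)) * (2 * a * y / (1 + y * y))) by (unfold xpt; field; lra).
          rewrite Rpower_3_2 by (apply Rdiv_lt_0_compat; nra).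
          change scal with Rmult; unfold w; field; lra.
        - replace (- RInt f (1 - a) b * -1) with (-1 * - RInt f (1 - a) b) by ring; apply is_RInt_Rscal; exact IC'. }
      assert (K := is_RInt_unique _ _ _ _ J).
      rewrite RInt_Rscal in K by (apply ex_RInt_continuous_R; auto).
      rewrite <- (RInt_diff w 0 (yb b) 1) in K by (apply ex_RInt_continuous_R; auto).
      revert K; generalize (RInt f (1 - a) b) (RInt w 0 1) (RInt w 0 (yb b)); intros u v z K.
      change (/ (2 * (a * a)) * (v - z) = - u * -1 :> R) in K; change (u = (v - z) / (2 * (a * a)) :> R).
      replace u with (- u * -1) by (change (- u * -1 = u :> R); ring).
      rewrite <- K; change (/ (2 * (a * a)) * (v - z) = (v - z) / (2 * (a * a)) :> R); field; nra. }
    rewrite <- E; apply is_RInt_extR with (3 := IS); [lra|].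
    intros s Hs; unfold f; rewrite zetaF_Fz; auto; [unfold rhp; simpl; lra|].
    intros A; apply (f_equal fst) in A; simpl in A; lra. }
  apply is_RInt_gen_of with (fun b => (RInt w 0 1 - RInt w 0 (yb b)) / (2 * (a * a))).
  - apply within_filter, locally_filter.
  - exists (mkposreal a (proj1 Ha)); intros b Hb Hb1; apply Main.
    change (Rabs (b - 1) < a) in Hb; apply Rabs_def2 in Hb; lra.
  - eapply filterlim_filter_le_1; [apply filter_le_within|].
    replace (RInt w 0 1 / (2 * (a * a))) with ((RInt w 0 1 - RInt w 0 (yb 1)) / (2 * (a * a))).
    + apply (continuous_Rdiv (fun b => RInt w 0 1 - RInt w 0 (yb b)) (fun _ => 2 * (a * a)) (1 : R));
        [|apply continuous_const|nra].
      apply continuous_Rminus; [apply continuous_const|].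
      apply (continuous_comp yb (fun y => RInt w 0 y)); [|apply continuous_RInt_upper; auto].
      apply (continuous_comp (fun s => (1 - s) / (s - 1 + 2 * a)) sqrt); [|apply continuous_sqrt].
      apply continuous_Rdiv; [| |lra].
      * apply continuous_Rminus; [apply continuous_const|apply continuous_id].
      * apply continuous_Rplus; [apply continuous_Rminus; [apply continuous_id|]|]; apply continuous_const.
    + unfold yb; replace ((1 - 1) / (1 - 1 + 2 * a)) with 0 by (field; lra).
      rewrite sqrt_0, RInt_point; f_equal; change (RInt w 0 1 - 0 = RInt w 0 1 :> R); ring.
Qed.

(** * From the arc to the line *)

Definition hgt (a p : R) : R := a * cos p / sin p.
Definition pc (a t : R) : R := PI / 2 - atan (t / a).

Lemma pc_bound a t : 0 < a -> 0 <= t -> 0 < pc a t <= PI / 2.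
Proof.
  intros Ha Ht; assert (B := atan_bound (t / a)); unfold pc; split; [lra|].
  assert (0 <= t / a) by (apply Rdiv_le_0_compat; lra).
  destruct (Req_dec (t / a) 0) as [->|]; [rewrite atan_0; lra|].
  assert (A := atan_increasing 0 (t / a) ltac:(lra)); rewrite atan_0 in A; lra.
Qed.

Lemma pc_0 a : 0 < a -> pc a 0 = PI / 2.
Proof. intros Ha; unfold pc; replace (0 / a) with 0 by (field; lra); rewrite atan_0; ring. Qed.

Lemma pc_hgt a p : 0 < a -> 0 < p <= PI / 2 -> pc a (hgt a p) = p.
Proof.
  intros Ha Hp; unfold pc, hgt; assert (S := sin_gt_0 p ltac:(lra) ltac:(lra)).
  replace (a * cos p / sin p / a) with (tan (PI / 2 - p)).
  - rewrite atan_tan by lra; ring.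
  - unfold tan; rewrite sin_shift, cos_shift; field; lra.
Qed.

Lemma hgt_pc a t : 0 < a -> 0 <= t -> hgt a (pc a t) = t.
Proof.
  intros Ha Ht; unfold hgt, pc; rewrite cos_shift, sin_shift.
  assert (Q : 0 < sqrt (1 + Rsqr (t / a))).
  { apply sqrt_lt_R0; unfold Rsqr; generalize (one_plus_sqr_pos (t / a)); lra. }
  rewrite sin_atan, cos_atan; revert Q; generalize (sqrt (1 + Rsqr (t / a))); intros x Q; field; lra.
Qed.

Lemma pc_lt a u v : 0 < a -> u < v -> pc a v < pc a u.
Proof.
  intros Ha H; unfold pc.
  assert (atan (u / a) < atan (v / a)); [|lra].
  apply atan_increasing, Rmult_lt_compat_r; auto; apply Rinv_0_lt_compat; auto.
Qed.

Lemma hgt_le a u v p : 0 < a -> 0 <= u -> u <= v -> pc a v <= p <= pc a u -> u <= hgt a p <= v.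
Proof.
  intros Ha Hu Hv Hp.
  assert (B1 := pc_bound a u Ha Hu); assert (B2 := pc_bound a v Ha ltac:(lra)).
  assert (E := pc_hgt a p Ha ltac:(lra)).
  split; apply Rnot_lt_le; intros H; apply (pc_lt a _ _ Ha) in H; lra.
Qed.

Lemma hgt_lt a u v p : 0 < a -> 0 <= u -> u <= v -> pc a v < p < pc a u -> u < hgt a p < v.
Proof.
  intros Ha Hu Hv Hp.
  assert (B1 := pc_bound a u Ha Hu); assert (B2 := pc_bound a v Ha ltac:(lra)).
  assert (E := pc_hgt a p Ha ltac:(lra)).
  assert (H := hgt_le a u v p Ha Hu Hv ltac:(lra)).
  split; apply Rnot_le_lt; intros H'; [replace (hgt a p) with u in E by lra|replace (hgt a p) with v in E by lra]; lra.
Qed.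

Lemma is_derive_hgt a p : sin p <> 0 -> is_derive (hgt a) p (- a / (sin p * sin p)).
Proof.
  intros S; unfold hgt; auto_derive; auto.
  assert (E := sin2cos2 p); field_simplify; auto.
  apply Rmult_eq_reg_r with (sin p ^ 2); [|apply pow_nonzero; auto].
  field_simplify; auto; replace (cos p ^ 2) with (1 - sin p ^ 2) by (simpl; lra); ring.
Qed.

Definition wt (a t : R) : R := Rpower (a ^ 2 + t ^ 2) (3 / 2).

Lemma wt_pos a t : 0 < wt a t.
Proof. apply exp_pos. Qed.

Lemma sqr_sum_pos a t : 0 < a -> 0 < a ^ 2 + t ^ 2.
Proof. intros Ha; simpl; generalize (Rle_0_sqr t); unfold Rsqr; nra. Qed.

Lemma continuous_wt a t : 0 < a -> continuous (wt a) t.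
Proof.
  intros Ha; unfold wt, Rpower; assert (P := sqr_sum_pos a t Ha).
  apply (continuous_comp (fun t => 3 / 2 * ln (a ^ 2 + t ^ 2)) exp); [|apply continuous_exp].
  apply continuous_Rmult; [apply continuous_const|].
  apply (continuous_comp (fun t => a ^ 2 + t ^ 2) ln); [|apply continuous_ln; auto].
  apply continuous_extC with (fun t => a ^ 2 + t * t); [intros; simpl; rring|].
  apply continuous_Rplus; [apply continuous_const|apply continuous_sqr].
Qed.

Lemma wt_hgt a p : 0 < a -> 0 < sin p -> wt a (hgt a p) = a / sin p * (a / sin p) * (a / sin p).
Proof.
  intros Ha S; unfold wt; rewrite <- Rpower_3_2 by (apply Rdiv_lt_0_compat; auto).
  f_equal; unfold hgt; assert (E := sin2cos2 p).
  apply Rmult_eq_reg_r with (sin p * sin p); [|nra]; field_simplify; try lra.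
  replace (cos p ^ 2) with (1 - sin p ^ 2) by (simpl; lra); ring.
Qed.

Lemma wt_ge a t : 0 < a -> a * a * a <= wt a t.
Proof.
  intros Ha; unfold wt; rewrite <- Rpower_3_2 by auto.
  apply Rle_Rpower_l; [lra|]; split; [nra|].
  simpl; generalize (Rle_0_sqr t); unfold Rsqr; nra.
Qed.

(** The substitution [t = a cot p] is legitimate for [f] on [[u, v]]. *)
Definition subst_ok (a : R) (f : R -> R) (u v V : R) : Prop :=
  is_RInt (fun t => f t / wt a t) u v V /\
  is_RInt (fun p => f (hgt a p) * sin p) (pc a v) (pc a u) (a * a * V).

(** With [t = a cot p], [dt = - a / sin^2 p] and the weight is [(a / sin p)^3], which leaves
    [- sin p / a^2]; the sign is absorbed by the reversed order of the endpoints. *)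
Lemma subst_ok_cont a f u v : 0 < a -> 0 <= u <= v ->
  (forall t, u <= t <= v -> continuous f t) -> exists V, subst_ok a f u v V.
Proof.
  intros Ha Hu Cf; generalize PI_RGT_0; intros HP.
  assert (Hpc : pc a v <= pc a u).
  { destruct (Req_dec u v) as [->|]; [lra|left; apply pc_lt; lra]. }
  assert (B1 := pc_bound a u Ha ltac:(lra)); assert (B2 := pc_bound a v Ha ltac:(lra)).
  set (F := fun t => f t / wt a t).
  assert (CF : forall t, u <= t <= v -> continuous F t).
  { intros t Ht; apply continuous_Rdiv; [auto|apply continuous_wt; auto|apply Rgt_not_eq, wt_pos]. }
  assert (Hs : forall p, pc a v <= p <= pc a u -> 0 < sin p) by (intros; apply sin_gt_0; lra).
  exists (RInt F u v); split; [apply is_RInt_RInt, ex_RInt_cont; auto; lra|].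
  assert (IC := is_RInt_comp (V := R_CompleteNormedModule) F (hgt a) (fun p => - a / (sin p * sin p)) (pc a v) (pc a u)).
  rewrite Rmin_left, Rmax_right in IC by auto.
  rewrite !hgt_pc in IC by lra.
  assert (IC' : is_RInt (fun p => scal (- a / (sin p * sin p)) (F (hgt a p))) (pc a v) (pc a u) (RInt F v u)).
  { apply IC; intros p Hp; specialize (Hs p Hp).
    - apply CF, hgt_le; auto; lra.
    - split; [apply is_derive_hgt; lra|].
      apply continuous_Rdiv; [apply continuous_const| |nra].
      apply continuous_Rmult; apply continuous_sin. }
  replace (a * a * RInt F u v) with (- (a * a) * RInt F v u).
  - apply is_RInt_extR with (3 := is_RInt_Rscal _ _ _ _ _ IC'); [auto|].
    intros p Hp; assert (S := Hs p ltac:(lra)); unfold F; change scal with Rmult.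
    rewrite wt_hgt by auto; field; lra.
  - rewrite <- (opp_RInt_swap F u v).
    + change (- (a * a) * - RInt F u v = a * a * RInt F u v); rring.
    + apply ex_RInt_cont; auto; lra.
Qed.

Lemma subst_ok_ext a f g u v V : 0 < a -> 0 <= u <= v ->
  (forall t, u < t < v -> f t = g t) -> subst_ok a f u v V -> subst_ok a g u v V.
Proof.
  intros Ha Hu E [I1 I2].
  assert (Hpc : pc a v <= pc a u).
  { destruct (Req_dec u v) as [->|]; [lra|left; apply pc_lt; lra]. }
  split.
  - apply is_RInt_extR with (3 := I1); [lra|]; intros t Ht; rewrite E; auto.
  - apply is_RInt_extR with (3 := I2); [lra|]; intros p Hp; rewrite E; auto.
    apply hgt_lt; auto; lra.
Qed.

Lemma subst_ok_Chasles a f u v w V W :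
  subst_ok a f u v V -> subst_ok a f v w W -> subst_ok a f u w (V + W).
Proof.
  intros [I1 I2] [J1 J2]; split.
  - apply (is_RInt_Chasles (V := R_NormedModule)) with v; auto.
  - rewrite Rmult_plus_distr_l, Rplus_comm.
    apply (is_RInt_Chasles (V := R_NormedModule)) with (pc a v); auto.
Qed.

Lemma subst_ok_plus a f g u v V W : subst_ok a f u v V -> subst_ok a g u v W ->
  subst_ok a (fun t => f t + g t) u v (V + W).
Proof.
  intros [I1 I2] [J1 J2]; split.
  - apply is_RInt_ext with (fun t => f t / wt a t + g t / wt a t).
    + intros t _; unfold Rdiv; rring.
    + apply is_RInt_Rplus; auto.
  - rewrite Rmult_plus_distr_l.
    apply is_RInt_ext with (fun p => f (hgt a p) * sin p + g (hgt a p) * sin p).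
    + intros t _; rring.
    + apply is_RInt_Rplus; auto.
Qed.

(** On each side of the height [e] the argument is the restriction of a function continuous on all
    of [R], which makes it integrable across its jump. For [x < 0] these functions come from turning
    by [PI] or [-PI]. *)
Lemma Arg_sides (x e : R) : exists g1 g2 : R -> R,
  (forall t, continuous g1 t) /\ (forall t, continuous g2 t) /\
  (forall t, t < e -> Arg (x, t - e) = g1 t) /\ (forall t, e < t -> Arg (x, t - e) = g2 t).
Proof.
  generalize PI_RGT_0; intros HP.
  assert (Cv : forall t : R, continuous (fun t => t - e) t).
  { intros t; apply continuous_Rminus; [apply continuous_id|apply continuous_const]. }
  destruct (Rtotal_order x 0) as [Hx|[->|Hx]].
  - set (g := fun t => Arg (- x, - (t - e))).
    assert (Cg : forall t, continuous g t).
    { intros t; apply (continuous_comp (fun t => (- x, - (t - e)) : C) Arg).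
      - apply continuous_pairC; [apply continuous_const|apply (continuous_opp (fun t => t - e)); apply Cv].
      - apply continuous_Arg; simpl; lra. }
    assert (Key : forall t s, s * s = 1 -> - PI < g t + s * PI < PI -> t <> e ->
      Arg (x, t - e) = g t + s * PI).
    { intros t s Hs Hb Ht; apply isarg_eq with (x, t - e).
      - intros E; apply (f_equal snd) in E; simpl in E; lra.
      - apply isarg_Arg.
      - assert (I := isarg_Arg (- x, - (t - e))); fold (g t) in I.
        replace ((x, t - e) : C) with (RtoC (-1) * (((- x)%R, (- (t - e))%R) : C))%C by (creal; ring).
        rewrite (Rplus_comm (g t)); apply isarg_mult; auto.
        apply isarg_intro with 1; [lra|].
        assert (Hs' : s = 1 \/ s = -1).
        { destruct (Req_dec s 1); auto; right; apply Rmult_eq_reg_l with (s - 1); lra. }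
        destruct Hs' as [-> | ->].
        + rewrite !Rmult_1_l, cos_PI, sin_PI; creal; ring.
        + replace (-1 * PI) with (- PI) by ring; rewrite cos_neg, sin_neg, cos_PI, sin_PI; creal; ring.
      - assert (B := Arg_bound (x, t - e)); apply Rabs_def1; lra. }
    exists (fun t => g t + -1 * PI), (fun t => g t + 1 * PI).
    split; [intros; apply continuous_Rplus; [auto|apply continuous_const]|].
    split; [intros; apply continuous_Rplus; [auto|apply continuous_const]|].
    split; intros t Ht; apply Key; try lra.
    + assert (B := Arg_Im_pos (- x, - (t - e)) ltac:(simpl; lra)); fold (g t) in B; lra.
    + assert (B := Arg_Im_neg (- x, - (t - e)) ltac:(simpl; lra)); fold (g t) in B; lra.
  - exists (fun _ => - (PI / 2)), (fun _ => PI / 2).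
    split; [intros; apply continuous_const|split; [intros; apply continuous_const|]].
    assert (Q : forall h, 0 < h -> Arg (0, h) = PI / 2).
    { intros h Hh; rewrite Arg_Im_pos_atan by auto; simpl.
      replace (0 / h) with 0 by (field; lra); rewrite atan_0; ring. }
    split; intros t Ht; [|apply Q; lra].
    replace ((0, t - e) : C) with (Cconj (0, - (t - e))) by (creal; ring).
    rewrite Arg_conj by (simpl; lra); rewrite Q; lra.
  - set (g := fun t => Arg (x, t - e)).
    assert (Cg : forall t, continuous g t).
    { intros t; apply (continuous_comp (fun t => (x, t - e) : C) Arg).
      - apply continuous_pairC; [apply continuous_const|apply Cv].
      - apply continuous_Arg; simpl; lra. }
    exists g, g; auto.
Qed.

Lemma subst_ok_Arg a S x e : 0 < a -> 0 < S -> 0 < e ->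
  exists V, subst_ok a (fun t => Arg (x, t - e)) 0 S V.
Proof.
  intros Ha HS He; destruct (Arg_sides x e) as [g1 [g2 [C1 [C2 [E1 E2]]]]].
  destruct (Rle_dec S e) as [H|H].
  - destruct (subst_ok_cont a g1 0 S) as [V HV]; auto; [lra|].
    exists V; apply subst_ok_ext with g1; auto; [lra|]; intros; symmetry; apply E1; lra.
  - destruct (subst_ok_cont a g1 0 e) as [V HV]; auto; [lra|].
    destruct (subst_ok_cont a g2 e S) as [W HW]; auto; [lra|].
    exists (V + W); apply subst_ok_Chasles with e.
    + apply subst_ok_ext with g1; auto; [lra|]; intros; symmetry; apply E1; lra.
    + apply subst_ok_ext with g2; auto; [lra|]; intros; symmetry; apply E2; lra.
Qed.

Lemma continuous_line f a t : continuous f ((1 - a, t) : C) -> continuous (fun t : R => (f ((1 - a, t) : C) : R)) t.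
Proof.
  intros H; apply (continuous_comp (fun t : R => (1 - a, t) : C) f); auto; apply continuous_ver.
Qed.

Lemma subst_ok_argE a T l L S : 0 < a <= 1 / 2 -> 0 < S < T -> full_fact T l L ->
  exists V, subst_ok a (fun t => argE l L (1 - a, t)) 0 S V.
Proof.
  intros Ha HS HF; assert (HL : forall rho, In rho l -> 0 < Im rho).
  { intros rho Hr; destruct HF as [G [[Hl _] _]]; apply Hl; auto. }
  destruct HF as [G [_ [_ [CL _]]]].
  induction l as [|rho l IH].
  - apply subst_ok_cont; [lra|lra|]; intros t Ht; simpl.
    apply (continuous_ImC (fun t : R => L (1 - a, t))).
    apply (continuous_comp (fun t : R => (1 - a, t) : C) L); [apply continuous_ver|].
    apply (Cn_continuous 1 (strip T)); auto.
    split; simpl; [lra|rewrite Rabs_pos_eq; lra].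
  - assert (Hi := HL rho (or_introl eq_refl)).
    destruct IH as [V HV]; [intros r Hr; apply HL; right; auto|].
    destruct (subst_ok_Arg a S (1 - a - Re rho) (Im rho)) as [V1 H1]; [lra|lra|auto|].
    destruct (subst_ok_cont a (fun t => Arg ((1 - a, t) - Cconj rho)) 0 S) as [V2 H2]; [lra|lra| |].
    { intros t Ht; apply (continuous_line (fun s => Arg (s - Cconj rho))).
      apply continuous_Arg_sub; left; rewrite im_conj; simpl; lra. }
    exists (V1 + V2 + V); simpl.
    apply subst_ok_plus; [apply subst_ok_plus; [|exact H2]|exact HV].
    apply subst_ok_ext with (4 := H1); [lra|lra|].
    intros t _; f_equal; unfold Re, Im; creal; ring.
Qed.

(** [f] near the segment [Re s = 1 - a, 0 <= Im s <= S] differs from its value on the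
    segment by at most a function of arbitrarily small weighted integral. *)
Definition near_line (a S : R) (f : C -> R) : Prop :=
  forall e, 0 < e -> exists h V d, 0 < d /\
    (forall t, 0 <= t <= S -> continuous h t) /\
    is_RInt (fun t => h t / wt a t) 0 S V /\ V <= e /\
    forall t s, 0 <= t <= S -> Cmod (s - (1 - a, t)) < d -> Rabs (f s - f (1 - a, t)) <= h t.

Lemma near_line_plus a S f g : near_line a S f -> near_line a S g ->
  near_line a S (fun s => f s + g s).
Proof.
  intros Hf Hg e He.
  destruct (Hf (e / 2) ltac:(lra)) as [h1 [V1 [d1 [D1 [C1 [I1 [L1 B1]]]]]]].
  destruct (Hg (e / 2) ltac:(lra)) as [h2 [V2 [d2 [D2 [C2 [I2 [L2 B2]]]]]]].
  exists (fun t => h1 t + h2 t), (V1 + V2), (Rmin d1 d2).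
  split; [apply Rmin_glb_lt; auto|split; [|split; [|split; [lra|]]]].
  - intros; apply continuous_Rplus; auto.
  - apply is_RInt_ext with (fun t => h1 t / wt a t + h2 t / wt a t).
    + intros t _; unfold Rdiv; rring.
    + apply is_RInt_Rplus; auto.
  - intros t s Ht Hs.
    assert (A1 := B1 t s Ht (Rlt_le_trans _ _ _ Hs (Rmin_l _ _))).
    assert (A2 := B2 t s Ht (Rlt_le_trans _ _ _ Hs (Rmin_r _ _))).
    replace (f s + g s - (f (1 - a, t) + g (1 - a, t))) with
      ((f s - f (1 - a, t)) + (g s - g (1 - a, t))) by ring.
    eapply Rle_trans; [apply Rabs_triang|lra].
Qed.

Lemma wt_integral_const a S c : 0 < a -> 0 < S -> 0 <= c -> exists V,
  is_RInt (fun t => c / wt a t) 0 S V /\ V <= c * S / (a * a * a).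
Proof.
  intros Ha HS Hc; assert (P : 0 < a * a * a) by (repeat apply Rmult_lt_0_compat; auto).
  assert (I : ex_RInt (fun t => c / wt a t) 0 S).
  { apply ex_RInt_cont; [lra|]; intros; apply continuous_Rdiv;
      [apply continuous_const|apply continuous_wt; auto|apply Rgt_not_eq, wt_pos]. }
  exists (RInt (fun t => c / wt a t) 0 S); split; [apply is_RInt_RInt; auto|].
  replace (c * S / (a * a * a)) with (RInt (fun _ => c / (a * a * a)) 0 S).
  - apply RInt_le; auto; [lra|apply ex_RInt_const|].
    intros t _; apply Rmult_le_compat_l; auto; apply Rinv_le_contravar; auto; apply wt_ge; auto.
  - rewrite RInt_const; change ((S - 0) * (c / (a * a * a)) = c * S / (a * a * a)); field; lra.
Qed.

Lemma tube_line (f : C -> R) a u v : (forall t, u <= t <= v -> continuous f ((1 - a, t) : C)) ->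
  forall e, 0 < e -> exists d, 0 < d /\
    forall t s, u <= t <= v -> Cmod (s - (1 - a, t)) < d -> Rabs (f s - f (1 - a, t)) < e.
Proof.
  intros Cf e He.
  destruct (tube (fun s => RtoC (f s)) (fun t => (1 - a, t)) u v) with (e := e) as [d [Hd H]]; auto.
  - intros; apply continuous_ver.
  - intros t Ht; apply (continuous_comp f RtoC); [auto|apply continuous_RtoC].
  - exists d; split; auto; intros t s Ht Hs.
    specialize (H t s Ht Hs); rewrite <- RtoC_minus, Cmod_R in H; auto.
Qed.

Lemma near_line_cont a S f : 0 < a -> 0 < S ->
  (forall t, 0 <= t <= S -> continuous f ((1 - a, t) : C)) -> near_line a S f.
Proof.
  intros Ha HS Cf e He; assert (P : 0 < a * a * a) by (repeat apply Rmult_lt_0_compat; auto).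
  set (c := e * (a * a * a) / S).
  assert (Hc : 0 < c) by (apply Rdiv_lt_0_compat; auto; apply Rmult_lt_0_compat; auto).
  destruct (wt_integral_const a S c) as [V [IV HV]]; auto; [lra|].
  destruct (tube_line f a 0 S Cf c Hc) as [d [Hd H]].
  exists (fun _ => c), V, d; split; [auto|split; [intros; apply continuous_const|split; [auto|split]]].
  - apply Rle_trans with (1 := HV); right; unfold c; field; lra.
  - intros; left; auto.
Qed.

(** The bump is at least [2 PI] for [|t - e| <= k], enough to dominate any jump of [Arg]. It has an
    arctangent as primitive, and its integral is at most [4 PI^2 k]. *)
Lemma bump_integral a S e k : 0 < a -> 0 < S -> 0 < k -> exists V,
  is_RInt (fun t => 4 * PI * (k * k) / (k * k + (t - e) * (t - e)) / wt a t) 0 S V /\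
  V <= 4 * PI * PI * k / (a * a * a).
Proof.
  intros Ha HS Hk; assert (P : 0 < a * a * a) by (repeat apply Rmult_lt_0_compat; auto).
  generalize PI_RGT_0; intros HP.
  assert (Hkk : 0 < k * k) by nra.
  assert (D : forall t, 0 < k * k + (t - e) * (t - e)).
  { intros t; generalize (Rle_0_sqr (t - e)); unfold Rsqr; lra. }
  set (b := fun t => 4 * PI * (k * k) / (k * k + (t - e) * (t - e))).
  assert (Cb : forall t, continuous b t).
  { intros t; apply continuous_Rdiv; [apply continuous_const| |specialize (D t); lra].
    apply continuous_Rplus; [apply continuous_const|].
    apply continuous_Rmult; apply continuous_Rminus; try apply continuous_id; apply continuous_const. }
  assert (Pb : forall t, 0 < b t).
  { intros t; apply Rdiv_lt_0_compat; auto; apply Rmult_lt_0_compat; lra. }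
  assert (I : ex_RInt (fun t => b t / wt a t) 0 S).
  { apply ex_RInt_cont; [lra|]; intros; apply continuous_Rdiv;
      [apply Cb|apply continuous_wt; auto|apply Rgt_not_eq, wt_pos]. }
  exists (RInt (fun t => b t / wt a t) 0 S); split; [apply is_RInt_RInt; auto|].
  assert (J : is_RInt b 0 S (4 * PI * k * atan ((S - e) / k) - 4 * PI * k * atan ((0 - e) / k))).
  { apply (is_RInt_cont_FTC b (fun t => 4 * PI * k * atan ((t - e) / k))); [lra| |auto].
    intros t _; specialize (D t); unfold b; auto_derive; auto.
    field; repeat split; try lra. }
  apply Rle_trans with (RInt (fun t => / (a * a * a) * b t) 0 S).
  - apply RInt_le; auto; [lra| |].
    + apply ex_RInt_Rscal; eexists; exact J.
    + intros t _; rewrite (Rmult_comm (/ (a * a * a))); apply Rmult_le_compat_l; [left; auto|].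
      apply Rinv_le_contravar; auto; apply wt_ge; auto.
  - rewrite RInt_Rscal by (eexists; exact J).
    rewrite (is_RInt_unique _ _ _ _ J), Rmult_comm.
    apply Rmult_le_compat_r; [left; apply Rinv_0_lt_compat; auto|].
    assert (B1 := atan_bound ((S - e) / k)); assert (B2 := atan_bound ((0 - e) / k)).
    replace (4 * PI * PI * k) with (4 * PI * k * PI) by ring.
    rewrite <- Rmult_minus_distr_l; apply Rmult_le_compat_l; [|lra].
    apply Rmult_le_pos; lra.
Qed.

(** Outside a band of half-width [k] around the height of [rho] uniform continuity applies. Inside,
    two principal arguments differ by less than [2 PI], which the bump covers. *)
Lemma near_line_Arg a S rho : 0 < a -> 0 < S ->
  near_line a S (fun s => Arg (s - rho)).
Proof.
  intros Ha HS e He; assert (P : 0 < a * a * a) by (repeat apply Rmult_lt_0_compat; auto).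
  generalize PI_RGT_0; intros HP.
  (* The width for which the bound of [bump_integral] is exactly [e / 2]; [c] shares out the other
     half. *)
  set (k := e / 2 * (a * a * a) / (4 * PI * PI)).
  assert (HPP : 0 < 4 * PI * PI) by (apply Rmult_lt_0_compat; lra).
  assert (Hk : 0 < k) by (apply Rdiv_lt_0_compat; auto; apply Rmult_lt_0_compat; lra).
  set (c := e / 2 * (a * a * a) / S).
  assert (Hc : 0 < c) by (apply Rdiv_lt_0_compat; auto; apply Rmult_lt_0_compat; lra).
  destruct (wt_integral_const a S c) as [V1 [I1 L1]]; auto; [lra|].
  destruct (bump_integral a S (Im rho) k) as [V2 [I2 L2]]; auto.
  set (b := fun t => 4 * PI * (k * k) / (k * k + (t - Im rho) * (t - Im rho))).
  assert (Hkk : 0 < k * k) by nra.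
  assert (D : forall t, 0 < k * k + (t - Im rho) * (t - Im rho)).
  { intros t; generalize (Rle_0_sqr (t - Im rho)); unfold Rsqr; lra. }
  destruct (tube_line (fun s => Arg (s - rho)) a 0 (Im rho - k)) with (e := c) as [d1 [Hd1 H1]]; auto.
  { intros t Ht; apply continuous_Arg_sub; left; simpl; lra. }
  destruct (tube_line (fun s => Arg (s - rho)) a (Im rho + k) S) with (e := c) as [d2 [Hd2 H2]]; auto.
  { intros t Ht; apply continuous_Arg_sub; left; simpl; lra. }
  exists (fun t => c + b t), (V1 + V2), (Rmin d1 d2).
  assert (Pb : forall t, 0 < b t).
  { intros t; apply Rdiv_lt_0_compat; auto; apply Rmult_lt_0_compat; lra. }
  split; [apply Rmin_glb_lt; auto|split; [|split; [|split]]].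
  - intros t _; apply continuous_Rplus; [apply continuous_const|].
    apply continuous_Rdiv; [apply continuous_const| |specialize (D t); lra].
    apply continuous_Rplus; [apply continuous_const|].
    apply continuous_Rmult; apply continuous_Rminus; try apply continuous_id; apply continuous_const.
  - apply is_RInt_ext with (fun t => c / wt a t + b t / wt a t).
    + intros t _; unfold Rdiv; rring.
    + apply is_RInt_Rplus; auto.
  - assert (c * S / (a * a * a) = e / 2) by (unfold c; field; lra).
    assert (4 * PI * PI * k / (a * a * a) = e / 2) by (unfold k; field; lra).
    lra.
  - intros t s Ht Hs; specialize (Pb t).
    destruct (Rle_dec t (Im rho - k)) as [A|A].
    { assert (Q := H1 t s ltac:(lra) (Rlt_le_trans _ _ _ Hs (Rmin_l _ _))); lra. }
    destruct (Rle_dec (Im rho + k) t) as [B|B].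
    { assert (Q := H2 t s ltac:(lra) (Rlt_le_trans _ _ _ Hs (Rmin_r _ _))); lra. }
    assert (B1 := Arg_bound (s - rho)); assert (B2 := Arg_bound ((1 - a, t) - rho)).
    apply Rle_trans with (2 * PI); [left; apply Rabs_def1; lra|].
    assert (2 * PI <= b t); [|lra].
    unfold b; specialize (D t); apply Rmult_le_reg_r with (k * k + (t - Im rho) * (t - Im rho)); auto.
    unfold Rdiv; rewrite (Rmult_assoc (4 * PI * (k * k))), Rinv_l by lra.
    assert ((t - Im rho) * (t - Im rho) <= k * k) by nra.
    rewrite Rmult_1_r; replace (4 * PI * (k * k)) with (2 * PI * (k * k + k * k)) by ring.
    apply Rmult_le_compat_l; lra.
Qed.

Lemma near_line_argE a T l L S : 0 < a <= 1 / 2 -> 0 < S < T -> full_fact T l L ->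
  near_line a S (argE l L).
Proof.
  intros Ha HS HF; assert (HL : forall rho, In rho l -> 0 < Im rho).
  { intros rho Hr; destruct HF as [G [[Hl _] _]]; apply Hl; auto. }
  destruct HF as [G [_ [_ [CL _]]]].
  induction l as [|rho l IH].
  - apply near_line_cont; [lra|lra|]; intros t Ht; simpl.
    apply (continuous_ImC L).
    apply (Cn_continuous 1 (strip T)); auto.
    split; simpl; [lra|rewrite Rabs_pos_eq; lra].
  - assert (Hi := HL rho (or_introl eq_refl)); simpl.
    apply (near_line_plus a S (fun s => Arg (s - rho) + Arg (s - Cconj rho)) (argE l L)).
    + apply (near_line_plus a S (fun s => Arg (s - rho)) (fun s => Arg (s - Cconj rho)));
        apply near_line_Arg; lra.
    + apply IH; intros r Hr; apply HL; right; auto.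
Qed.

Lemma circ_den_double r p : circ_den r (2 * p) = (1 - r) * (1 - r) + 4 * r * (sin p * sin p).
Proof. unfold circ_den; rewrite cos_2a_sin; ring. Qed.

(** The arc point is compared with the line point of the same parameter. That it lies lower lets a
    factorisation valid up to height [S] be used at it too; the distance bound degenerates only as
    [p] tends to 0. *)
Lemma arcpt_Im_hgt a q p : 0 < a -> 0 < q < 1 -> 0 < p <= PI / 2 ->
  Im (arcpt a q p) <= hgt a p /\
  Cmod (arcpt a q p - (1 - a, hgt a p)) * (q * q * (sin p * sin p)) <= (a + hgt a p) * (1 - q).
Proof.
  intros Ha Hq Hp; generalize PI_RGT_0; intros HP.
  assert (S := sin_gt_0 p ltac:(lra) ltac:(lra)); assert (Cp := cos_ge_0 p ltac:(lra) ltac:(lra)).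
  unfold arcpt; set (r := q * q); assert (Hr : 0 < r < 1) by (unfold r; nra).
  assert (Hrq : 1 - r <= 2 * (1 - q)) by (unfold r; nra).
  rewrite sz_circ by lra; rewrite circ_den_double, sin_2a.
  assert (SS : 0 < sin p * sin p) by nra; set (s2 := sin p * sin p) in *.
  set (m := (1 - r) * (1 - r) + 4 * r * s2).
  assert (Hm : 0 < 4 * r * s2) by (apply Rmult_lt_0_compat; lra).
  assert (H1 : 0 <= (1 - r) * (1 - r)) by nra.
  assert (Hh : 0 <= hgt a p).
  { unfold hgt; apply Rdiv_le_0_compat; auto; apply Rmult_le_pos; lra. }
  assert (Dif : hgt a p - 2 * a * r * (2 * sin p * cos p) / m = hgt a p * ((1 - r) * (1 - r) / m)).
  { unfold hgt, m, s2; field; fold s2; fold m; unfold m; split; lra. }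
  assert (Q : 0 <= hgt a p * ((1 - r) * (1 - r) / m)).
  { apply Rmult_le_pos; auto; apply Rdiv_le_0_compat; unfold m; lra. }
  split; [simpl; lra|].
  assert (R1 : Cmod ((1 - a + a * (1 - r * r) / m, 2 * a * r * (2 * sin p * cos p) / m) - (1 - a, hgt a p)) <=
    a * (1 - r * r) / m + hgt a p * ((1 - r) * (1 - r) / m)).
  { eapply Rle_trans; [apply Cmod_le_abs|]; rewrite Re_Cminus, Im_Cminus; simpl Re; simpl Im.
    rewrite <- Dif; apply Rplus_le_compat.
    - replace (1 - a + a * (1 - r * r) / m - (1 - a)) with (a * (1 - r * r) / m) by ring.
      rewrite Rabs_pos_eq; [lra|apply Rdiv_le_0_compat; [|unfold m; lra]; apply Rmult_le_pos; nra].
    - rewrite Rabs_left1; lra. }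
  assert (Hrs : 0 < r * s2) by (apply Rmult_lt_0_compat; lra).
  apply Rle_trans with ((a * (1 - r * r) / m + hgt a p * ((1 - r) * (1 - r) / m)) * (r * s2)).
  - apply Rmult_le_compat_r; [lra|exact R1].
  - replace ((a * (1 - r * r) / m + hgt a p * ((1 - r) * (1 - r) / m)) * (r * s2)) with
      ((a * (1 + r) + hgt a p * (1 - r)) * (1 - r) * ((r * s2) / m)) by (field; unfold m; lra).
    assert (F : r * s2 / m <= 1 / 4).
    { apply Rmult_le_reg_r with m; [unfold m; lra|]; unfold Rdiv at 1.
      rewrite Rmult_assoc, Rinv_l; unfold m; lra. }
    assert (F0 : 0 <= r * s2 / m) by (apply Rdiv_le_0_compat; unfold m; lra).
    assert (E1 : a * (1 + r) + hgt a p * (1 - r) <= 2 * (a + hgt a p)) by nra.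
    assert (E2 : 0 <= a * (1 + r) + hgt a p * (1 - r)) by nra.
    apply Rle_trans with (2 * (a + hgt a p) * (2 * (1 - q)) * (1 / 4)); [|right; field].
    apply Rmult_le_compat; auto; [apply Rmult_le_pos; lra|].
    apply Rmult_le_compat; lra.
Qed.

Lemma arc_line a S d : 0 < a -> 0 < S -> 0 < d -> exists e, 0 < e < 1 /\
  forall q p, 1 - e < q < 1 -> pc a S <= p <= PI / 2 -> Cmod (arcpt a q p - (1 - a, hgt a p)) < d.
Proof.
  intros Ha HS Hd; generalize PI_RGT_0; intros HP.
  assert (B := pc_bound a S Ha ltac:(lra)).
  assert (K := sin_gt_0 (pc a S) ltac:(lra) ltac:(lra)); set (k := sin (pc a S)) in *.
  assert (Kk : 0 < k * k) by nra.
  set (e := d * (k * k) / 4 / (a + S)).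
  assert (He : 0 < e) by (unfold e; apply Rdiv_lt_0_compat; [nra|lra]).
  exists (Rmin (1 / 2) e); split; [split; [apply Rmin_glb_lt; lra|]|].
  { eapply Rle_lt_trans; [apply Rmin_l|lra]. }
  intros q p Hq Hp.
  assert (Q1 : 1 / 2 < q) by (generalize (Rmin_l (1 / 2) e); lra).
  assert (Q2 : 1 - q < e) by (generalize (Rmin_r (1 / 2) e); lra).
  destruct (arcpt_Im_hgt a q p Ha ltac:(lra) ltac:(lra)) as [_ H].
  assert (Hh := hgt_le a 0 S p Ha ltac:(lra) ltac:(lra)); rewrite pc_0 in Hh by auto; specialize (Hh Hp).
  assert (Sp : k <= sin p) by (apply sin_incr_1; lra).
  assert (k * k <= sin p * sin p) by (apply Rmult_le_compat; lra).
  assert (1 / 4 <= q * q) by nra.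
  assert (L : 1 / 4 * (k * k) <= q * q * (sin p * sin p)) by (apply Rmult_le_compat; lra).
  assert (P := Cmod_ge_0 (arcpt a q p - (1 - a, hgt a p))).
  set (X := Cmod (arcpt a q p - (1 - a, hgt a p))) in *.
  apply Rmult_lt_reg_r with (1 / 4 * (k * k)); [lra|].
  apply Rle_lt_trans with (X * (q * q * (sin p * sin p))); [apply Rmult_le_compat_l; auto|].
  apply Rle_lt_trans with (1 := H).
  apply Rle_lt_trans with ((a + S) * (1 - q)); [apply Rmult_le_compat_r; lra|].
  apply Rlt_le_trans with ((a + S) * e); [apply Rmult_lt_compat_l; lra|].
  unfold e; right; field; lra.
Qed.

(** From [E^2 <= K (1 + y)^3] and [(1 + y) sin p <= 2] one gets [(E sin p)^2 sin p <= 8 K]: an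
    integrable majorant independent of [q]. *)
Lemma argE_arc_bound : exists K, 0 < K /\ forall a q p T l L,
  0 < a <= 1 / 2 -> 0 < q < 1 -> 0 < p < PI / 2 -> 2 / (1 - q * q) <= T -> full_fact T l L ->
  Fz (arcpt a q p) <> RtoC 0 -> Rabs (argE l L (arcpt a q p) * sin p) <= K / sqrt (sin p).
Proof.
  destruct argE_bound as [K [HK Hb]]; exists (sqrt (8 * K)).
  split; [apply sqrt_lt_R0; lra|].
  intros a q p T l L Ha Hq Hp HT HF HN; generalize PI_RGT_0; intros HP.
  assert (S := sin_gt_0 p ltac:(lra) ltac:(lra)); assert (Cp := cos_gt_0 p ltac:(lra) ltac:(lra)).
  assert (Hs := arcpt_strip a q T p Ha Hq HT); assert (Hx := arcpt_Re_pos a q p (proj1 Ha) Hq).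
  destruct (arcpt_Im a q p (proj1 Ha) Hq ltac:(lra)) as [_ Hy]; specialize (Hy Hp).
  destruct (arcpt_Im_hgt a q p (proj1 Ha) Hq ltac:(lra)) as [Hh _].
  destruct Hs as [_ Hs]; rewrite Rabs_pos_eq in Hs by lra.
  specialize (Hb T l L (Re (arcpt a q p)) (Im (arcpt a q p)) HF ltac:(lra) ltac:(lra)).
  unfold Re, Im in Hb; rewrite <- surjective_pairing in Hb; fold (Im (arcpt a q p)) in Hb.
  specialize (Hb HN); set (E := argE l L (arcpt a q p)) in *; set (y := Im (arcpt a q p)) in *.
  assert (Hy2 : (1 + y) * sin p <= 2).
  { assert (y * sin p <= a * cos p).
    { apply Rle_trans with (hgt a p * sin p); [apply Rmult_le_compat_r; lra|].
      unfold hgt; right; field; lra. }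
    generalize (SIN_bound p) (COS_bound p); nra. }
  rewrite <- sqrt_div_alt by auto.
  rewrite <- sqrt_Rsqr_abs; apply sqrt_le_1_alt; unfold Rsqr.
  apply Rmult_le_reg_r with (sin p); auto.
  replace (8 * K / sin p * sin p) with (8 * K) by (field; lra).
  replace (E * sin p * (E * sin p) * sin p) with (E * E * (sin p * sin p * sin p)) by ring.
  assert (S3 : 0 < sin p * sin p * sin p) by (repeat apply Rmult_lt_0_compat; auto).
  apply Rle_trans with (K * (1 + y) ^ 3 * (sin p * sin p * sin p)); [apply Rmult_le_compat_r; lra|].
  replace (K * (1 + y) ^ 3 * (sin p * sin p * sin p)) with (K * ((1 + y) * sin p) ^ 3) by ring.
  replace (8 * K) with (K * 2 ^ 3) by ring; apply Rmult_le_compat_l; [lra|].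
  apply pow_incr; split; auto; apply Rmult_le_pos; lra.
Qed.

(** The majorant is singular at 0, so a small initial interval is treated by boundedness of the
    integrable [f]. On the rest [1 <= 2 cos p] compares the majorant with the derivative of
    [4 C sqrt (sin p)]. *)
Lemma sqrt_sin_tail f p0 C : 0 < p0 < PI / 2 -> 1 / 2 <= cos p0 -> 0 <= C ->
  ex_RInt f 0 p0 -> (forall p, 0 < p < p0 -> f p <= C / sqrt (sin p)) ->
  RInt f 0 p0 <= 4 * C * sqrt (sin p0).
Proof.
  intros Hp Hc HC If Hf; generalize PI_RGT_0; intros HP.
  destruct (ex_RInt_ub f 0 p0 If) as [B HB]; rewrite Rmin_left, Rmax_right in HB by lra.
  assert (HB' : forall t, 0 <= t <= p0 -> f t <= Rabs B).
  { intros t Ht; specialize (HB t Ht); change (norm (f t)) with (Rabs (f t)) in HB.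
    generalize (Rle_abs (f t)) (Rle_abs B); lra. }
  apply le_epsilon; intros e He.
  assert (PB := Rabs_pos B).
  set (d := Rmin (p0 / 2) (e / (Rabs B + 1))).
  assert (Hd1 : 0 < d) by (unfold d; apply Rmin_glb_lt; [lra|apply Rdiv_lt_0_compat; lra]).
  assert (Hd2 : d < p0) by (eapply Rle_lt_trans; [apply Rmin_l|lra]).
  assert (Hd3 : Rabs B * d <= e).
  { apply Rle_trans with ((Rabs B + 1) * (e / (Rabs B + 1))); [|right; field; lra].
    apply Rmult_le_compat; try lra; apply Rmin_r. }
  assert (I1 : ex_RInt f 0 d) by (apply ex_RInt_sub with 0 p0; auto; lra).
  assert (I2 : ex_RInt f d p0) by (apply ex_RInt_sub with 0 p0; auto; lra).
  rewrite <- (RInt_Chasles_R f 0 d p0) by auto.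
  assert (A1 : RInt f 0 d <= Rabs B * d).
  { replace (Rabs B * d) with (RInt (fun _ => Rabs B) 0 d).
    - apply RInt_le; auto; [lra|apply ex_RInt_const|]; intros; apply HB'; lra.
    - rewrite RInt_const; change ((d - 0) * Rabs B = Rabs B * d); ring. }
  assert (Sp : forall p, d <= p <= p0 -> 0 < sin p) by (intros; apply sin_gt_0; lra).
  assert (J : is_RInt (fun p => 4 * C * (cos p / (2 * sqrt (sin p)))) d p0
    (4 * C * sqrt (sin p0) - 4 * C * sqrt (sin d))).
  { apply (is_RInt_cont_FTC _ (fun p => 4 * C * sqrt (sin p))); [lra| |].
    - intros p Hpp; specialize (Sp p Hpp); auto_derive; auto.
      field; apply Rgt_not_eq, sqrt_lt_R0; auto.
    - intros p Hpp; specialize (Sp p Hpp).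
      apply continuous_Rmult; [apply continuous_const|]; apply continuous_Rdiv; [apply continuous_cos| |].
      + apply continuous_Rmult; [apply continuous_const|].
        apply (continuous_comp sin sqrt); [apply continuous_sin|apply continuous_sqrt].
      + assert (0 < sqrt (sin p)) by (apply sqrt_lt_R0; auto); lra. }
  assert (A2 : RInt f d p0 <= 4 * C * sqrt (sin p0) - 4 * C * sqrt (sin d)).
  { rewrite <- (is_RInt_unique _ _ _ _ J); apply RInt_le; auto; [lra|eexists; exact J|].
    intros p Hpp; apply Rle_trans with (1 := Hf p ltac:(lra)).
    assert (Q : 0 < sqrt (sin p)) by (apply sqrt_lt_R0; apply Sp; lra).
    assert (cos p0 <= cos p) by (apply cos_decr_1; lra).
    replace (4 * C * (cos p / (2 * sqrt (sin p)))) with (C / sqrt (sin p) * (2 * cos p)) by (field; lra).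
    rewrite <- (Rmult_1_r (C / sqrt (sin p))) at 1; apply Rmult_le_compat_l; [|lra].
    apply Rdiv_le_0_compat; auto. }
  assert (0 <= 4 * C * sqrt (sin d)) by (apply Rmult_le_pos; [lra|apply sqrt_pos]).
  lra.
Qed.

Lemma int_upper f g p0 M N C : 0 < p0 < PI / 2 -> 1 / 2 <= cos p0 -> 0 <= C ->
  is_RInt f 0 (PI / 2) M -> is_RInt g p0 (PI / 2) N ->
  (forall p, 0 < p < p0 -> f p <= C / sqrt (sin p)) ->
  (forall p, p0 < p < PI / 2 -> f p <= g p) -> M <= N + 4 * C * sqrt (sin p0).
Proof.
  intros Hp Hc HC If Ig H1 H2; assert (Ef : ex_RInt f 0 (PI / 2)) by (eexists; exact If).
  assert (I1 : ex_RInt f 0 p0) by (apply ex_RInt_sub with 0 (PI / 2); auto; lra).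
  assert (I2 : ex_RInt f p0 (PI / 2)) by (apply ex_RInt_sub with 0 (PI / 2); auto; lra).
  rewrite <- (is_RInt_unique _ _ _ _ If), <- (is_RInt_unique _ _ _ _ Ig).
  rewrite <- (RInt_Chasles_R f 0 p0 (PI / 2)) by auto.
  assert (A := sqrt_sin_tail f p0 C Hp Hc HC I1 H1).
  assert (B : RInt f p0 (PI / 2) <= RInt g p0 (PI / 2)).
  { apply RInt_le; auto; [lra|eexists; exact Ig]. }
  lra.
Qed.

(** For [p] above [pc a S] the arc is compared with the line up to height [S] by [near_line_argE];
    below, the growth bound leaves only the term in [sqrt (sin (pc a S))]. The constant [C] depends
    neither on [q] nor on [S], so [q] can tend to 1 before [S] grows. The two sides are separate
    since only one inequality is available for a zero to the right. Applying the upper estimate to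
    [- Lam] gives the lower one. *)
Lemma arc_compare : exists C, 0 < C /\ forall a S T0 l0 L0 VS e,
  0 < a <= 1 / 2 -> 0 < S < T0 -> 1 / 2 <= cos (pc a S) -> full_fact T0 l0 L0 ->
  subst_ok a (fun t => argE l0 L0 (1 - a, t)) 0 S VS -> 0 < e ->
  exists d, 0 < d < 1 /\ forall q T l L, 1 - d < q < 1 -> 2 / (1 - q * q) <= T -> full_fact T l L ->
    (forall p, 0 < p < PI / 2 -> Fz (arcpt a q p) <> RtoC 0) ->
    forall Lam M, is_RInt (fun p => Lam p * sin p) 0 (PI / 2) M ->
    ((forall p, 0 < p < PI / 2 -> Lam p <= argE l L (arcpt a q p)) ->
       M <= a * a * VS + C * sqrt (sin (pc a S)) + e) /\
    ((forall p, 0 < p < PI / 2 -> argE l L (arcpt a q p) <= Lam p) ->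
       a * a * VS - C * sqrt (sin (pc a S)) - e <= M).
Proof.
  destruct argE_arc_bound as [K [HK Hb]]; exists (4 * K); split; [lra|].
  intros a S T0 l0 L0 VS e Ha HS Hc HF0 HV He; generalize PI_RGT_0; intros HP.
  assert (Haa : 0 < a * a) by nra.
  destruct (near_line_argE a T0 l0 L0 S Ha HS HF0 (e / (a * a))) as [h [V [d [Hd [Ch [Ih [HVe Hnear]]]]]]].
  { apply Rdiv_lt_0_compat; auto. }
  destruct (subst_ok_cont a h 0 S) as [V' [J1 J2]]; [lra|lra|auto|].
  assert (EV : V' = V) by exact (eq_trans (eq_sym (is_RInt_unique _ _ _ _ J1)) (is_RInt_unique _ _ _ _ Ih)).
  rewrite EV in J2; clear EV J1 V'.
  destruct HV as [_ IA]; rewrite (pc_0 a (proj1 Ha)) in IA, J2.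
  destruct (arc_line a S d (proj1 Ha) (proj1 HS) Hd) as [d1 [Hd1 Hl]].
  assert (B := pc_bound a S (proj1 Ha) ltac:(lra)).
  assert (Hpc : pc a S < PI / 2) by (rewrite <- (pc_0 a) by lra; apply pc_lt; lra).
  assert (Hev : a * a * V <= e).
  { apply Rle_trans with (a * a * (e / (a * a))); [apply Rmult_le_compat_l; lra|right; field; lra]. }
  exists d1; split; auto; intros q T l L Hq HT HF HN Lam M IM.
  assert (Hq' : 0 < q < 1) by lra.
  assert (Near : forall p, pc a S < p < PI / 2 ->
    Rabs (argE l L (arcpt a q p) - argE l0 L0 (1 - a, hgt a p)) <= h (hgt a p)).
  { intros p Hp.
    assert (Hh := hgt_le a 0 S p (proj1 Ha) ltac:(lra) ltac:(lra)); rewrite pc_0 in Hh by lra; specialize (Hh ltac:(lra)).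
    destruct (arcpt_Im_hgt a q p (proj1 Ha) Hq' ltac:(lra)) as [HI _].
    destruct (arcpt_strip a q T p Ha Hq' HT) as [HR HT'].
    destruct (arcpt_Im a q p (proj1 Ha) Hq' ltac:(lra)) as [_ Hy]; specialize (Hy ltac:(lra)).
    rewrite Rabs_pos_eq in HT' by lra.
    rewrite (argE_eq T l L T0 l0 L0) by (auto; try lra; apply HN; lra).
    apply Hnear; auto; apply Hl; lra. }
  assert (Hb' := fun p Hp => Hb a q p T l L Ha Hq' Hp HT HF (HN p Hp)).
  split; intros HL.
  - assert (U := int_upper _ _ (pc a S) M _ K ltac:(lra) Hc ltac:(lra) IM (is_RInt_Rplus _ _ _ _ _ _ IA J2)).
    assert (M <= a * a * VS + a * a * V + 4 * K * sqrt (sin (pc a S))); [apply U|lra].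
    + intros p Hp; apply Rle_trans with (argE l L (arcpt a q p) * sin p).
      * apply Rmult_le_compat_r; [apply sin_ge_0; lra|apply HL; lra].
      * apply Rle_trans with (1 := Rle_abs _); apply Hb'; lra.
    + intros p Hp; rewrite <- Rmult_plus_distr_r; apply Rmult_le_compat_r; [apply sin_ge_0; lra|].
      assert (A := Near p Hp); apply Rabs_le_between in A; specialize (HL p ltac:(lra)); lra.
  - assert (IM' : is_RInt (fun p => -1 * (Lam p * sin p)) 0 (PI / 2) (-1 * M)) by (apply is_RInt_Rscal; auto).
    assert (U := int_upper _ _ (pc a S) (-1 * M) _ K ltac:(lra) Hc ltac:(lra) IM'
      (is_RInt_Rminus _ _ _ _ _ _ J2 IA)).
    assert (-1 * M <= a * a * V - a * a * VS + 4 * K * sqrt (sin (pc a S))); [apply U|lra].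
    + intros p Hp; apply Rle_trans with (- (argE l L (arcpt a q p) * sin p)).
      * assert (S0 : 0 <= sin p) by (apply sin_ge_0; lra).
        assert (Q := Rmult_le_compat_r _ _ _ S0 (HL p ltac:(lra))); lra.
      * apply Rle_trans with (1 := Rle_abs _); rewrite Rabs_Ropp; apply Hb'; lra.
    + intros p Hp; assert (S0 : 0 <= sin p) by (apply sin_ge_0; lra).
      assert (A := Near p Hp); apply Rabs_le_between in A; specialize (HL p ltac:(lra)).
      assert (Q : - Lam p <= h (hgt a p) - argE l0 L0 (1 - a, hgt a p)) by lra.
      assert (Q' := Rmult_le_compat_r _ _ _ S0 Q); lra.
Qed.

(** * Conclusion *)

Lemma good_radius a d T1 : 0 < a <= 1 / 2 -> 0 < d -> exists q T l L,
  0 < q < 1 /\ 1 - d < q /\ T1 <= T /\ 2 / (1 - q * q) <= T /\ full_fact T l L /\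
  (forall rho, In rho l -> q * q * Cmod (rho - 1 + RtoC (2 * a)) <> Cmod (rho - 1)) /\
  forall p, 0 < p < PI / 2 -> Fz (arcpt a q p) <> RtoC 0.
Proof.
  intros Ha Hd; set (d' := Rmin d (1 / 2)).
  assert (D1 : 0 < d') by (apply Rmin_glb_lt; lra).
  assert (D2 : d' <= d) by apply Rmin_l; assert (D3 : d' <= 1 / 2) by apply Rmin_r.
  (* The height [T] is fixed through [q1] before [q < q1] is chosen, so the list of zeros, and with
     it the finite set of radii to avoid, does not depend on [q]. *)
  set (q1 := 1 - d' / 2); assert (Hq1 : 1 / 2 < q1 < 1) by (unfold q1; lra).
  set (T := Rmax T1 (2 / (1 - q1 * q1))).
  assert (HT0 : 0 < T).
  { apply Rlt_le_trans with (2 := Rmax_r _ _); apply Rdiv_lt_0_compat; nra. }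
  destruct (full_fact_ex T HT0) as [l [L HF]].
  destruct (avoid_finite (map (fun rho => sqrt (Cmod (rho - 1) / Cmod (rho - 1 + RtoC (2 * a)))) l) (1 - d') q1)
    as [u [v [Hu [Hv Hno]]]]; [unfold q1; lra|].
  set (q := (u + v) / 2); assert (Hq : 1 - d' < q < q1) by (unfold q; lra).
  assert (HT : 2 / (1 - q * q) <= T).
  { apply Rle_trans with (2 := Rmax_r _ _); apply Rmult_le_compat_l; [lra|]; apply Rinv_le_contravar; nra. }
  assert (Good : forall rho, In rho l -> q * q * Cmod (rho - 1 + RtoC (2 * a)) <> Cmod (rho - 1)).
  { intros rho Hr E; apply (Hno q); [unfold q; lra|].
    apply in_map_iff; exists rho; split; auto.
    assert (Hi : 0 < Im rho) by (destruct HF as [G [[Hl _] _]]; apply Hl; auto).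
    assert (Nd : 0 < Cmod (rho - 1 + RtoC (2 * a))).
    { apply Cmod_pos; intros E'; apply (f_equal snd) in E'; unfold Im in Hi; simpl in E'; lra. }
    rewrite <- E; replace (q * q * Cmod (rho - 1 + RtoC (2 * a)) / Cmod (rho - 1 + RtoC (2 * a))) with (q * q) by (field; lra).
    apply sqrt_square; lra. }
  exists q, T, l, L; split; [lra|split; [lra|split; [apply Rmax_l|split; [auto|split; [auto|split; [auto|]]]]]].
  (* A zero on the arc would belong to the list and have a preimage of modulus [q^2], against
     [Good]. *)
  intros p Hp Hz.
  assert (Hr : In (arcpt a q p) l).
  { apply (list_zero T l L); auto; [apply arcpt_strip; auto; lra|].
    apply arcpt_Im; lra. }
  apply (Good _ Hr); set (rho := arcpt a q p) in *.
  assert (Hw : Cmod (circ 0 (q * q) (2 * p)) = q * q) by (rewrite Cmod_circ0, Rabs_pos_eq; nra).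
  assert (A := sz_sub a (circ 0 (q * q) (2 * p)) rho ltac:(rewrite Hw; nra)).
  fold (arcpt a q p) in A; fold rho in A.
  assert (A2 : (circ 0 (q * q) (2 * p) * (rho - 1 + RtoC (2 * a)))%C = (rho - 1)%C).
  { transitivity ((rho - rho) * (1 - circ 0 (q * q) (2 * p)) + (rho - 1))%C; [rewrite A; ring|ring]. }
  apply (f_equal Cmod) in A2; rewrite Cmod_mult, Hw in A2; exact A2.
Qed.

Lemma le_of_small_error X Y Z : (forall e, 0 < e <= 1 -> X <= Y + Z * e) -> X <= Y.
Proof.
  intros H; apply le_epsilon; intros e He.
  assert (PZ := Rabs_pos Z).
  set (t := Rmin 1 (e / (Rabs Z + 1))).
  assert (Ht : 0 < t <= 1) by (split; [apply Rmin_glb_lt; [lra|apply Rdiv_lt_0_compat; lra]|apply Rmin_l]).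
  assert (Q : Rabs Z * t <= e).
  { apply Rle_trans with ((Rabs Z + 1) * (e / (Rabs Z + 1))); [|right; field; lra].
    apply Rmult_le_compat; try lra; apply Rmin_r. }
  specialize (H t Ht); assert (Z * t <= Rabs Z * t) by (apply Rmult_le_compat_r; [lra|apply Rle_abs]); lra.
Qed.

(** The gain [g] depends on the zero but not on [S], and [K] on neither. As [S] grows the last term
    vanishes, so the limiting sum is at least [g] and cannot be 0. *)
Lemma zero_forces_gap : exists K, 0 < K /\ forall (a : R) (H : R -> R) (rho : C), 0 < a <= 1 / 2 -> (forall y, continuous H y) ->
  (forall y, ln (Re (Fz (xpt a y))) = y * y * H y) ->
  0 < Im rho -> 1 - a < Re rho -> Fz rho = RtoC 0 ->
  exists g, 0 < g /\ forall S T0 l0 L0 VS, 0 < S < T0 -> 1 / 2 <= cos (pc a S) -> full_fact T0 l0 L0 ->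
    subst_ok a (fun t => argE l0 L0 (1 - a, t)) 0 S VS ->
    g <= 2 * (a * a) * VS + RInt (fun y => (y * y + 1) * H y) 0 1 + K * sqrt (sin (pc a S)).
Proof.
  destruct arc_compare as [C [HC Hcmp]]; exists (2 * C); split; [lra|].
  intros a H rho Ha CH EH Hi Hre Hz; generalize PI_RGT_0; intros HP.
  set (xi := Re rho - (1 - a)); assert (Hxi : 0 < xi) by (unfold xi; lra).
  set (gap := cos (psi a xi (Im rho)) - cos (psi a (xi / 2) (Im rho))).
  assert (Hgap : 0 < gap) by (assert (A := psi_gap a xi (Im rho) (proj1 Ha) Hi Hxi); unfold gap; lra).
  assert (Hg : 0 < 2 * PI * gap) by (apply Rmult_lt_0_compat; lra).
  exists (2 * PI * gap); split; auto; intros S T0 l0 L0 VS HS Hc HF0 HV.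
  set (v1 := RInt (fun y => (y * y + 1) * H y) 0 1).
  set (tail := sqrt (sin (pc a S))).
  set (kap := Cmod (rho - 1) / Cmod (rho - 1 + RtoC (2 * a))).
  assert (Nd : 0 < Cmod (rho - 1 + RtoC (2 * a))).
  { apply Cmod_pos; intros E'; apply (f_equal snd) in E'; unfold Im in Hi; simpl in E'; lra. }
  assert (Hk : kap < 1).
  { unfold kap; apply Rmult_lt_reg_r with (Cmod (rho - 1 + RtoC (2 * a))); auto.
    unfold Rdiv; rewrite Rmult_assoc, Rinv_l, Rmult_1_r, Rmult_1_l by lra.
    apply Rsqr_incrst_0; try apply Cmod_ge_0; unfold Rsqr; rewrite !Cmod_sqr.
    unfold xi, Re, Im in *; simpl; nra. }
  set (B := xi * xi + Im rho * Im rho + a * a).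
  assert (HB : 0 < B) by (unfold B; nra).
  assert (Hax : 0 < a * xi) by (apply Rmult_lt_0_compat; lra).
  (* The errors come from the arc comparison, from the modulus limit, and from replacing [q] by 1 in
     front of [VS], which costs a multiple of [(1 - q) * Rabs VS]. *)
  apply le_of_small_error with (3 * 1 + 2 + 2 * (a * a) * Rabs VS); intros e He.
  destruct (Hcmp a S T0 l0 L0 VS e) as [d1 [Hd1 H1]]; auto; [lra|].
  destruct (modulus_limit a H e Ha CH EH ltac:(lra)) as [d2 [Hd2 H2]]; fold v1 in H2.
  (* The bound [(1 - kap)/2] puts the zero inside the arc, [a xi/(4 B)] gives the last hypothesis of
     [zero_contrib_pos] through [1 - q^4 <= 4 (1 - q)], and [1/2] makes [4 PI q gap] at least
     [2 PI gap]. *)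
  set (d := Rmin (Rmin d1 d2) (Rmin (Rmin ((1 - kap) / 2) (a * xi / (4 * B))) (Rmin (1 / 2) e))).
  assert (Q : 0 < d).
  { unfold d; repeat apply Rmin_glb_lt; try lra; apply Rdiv_lt_0_compat; lra. }
  assert (Q1 : d <= d1) by (eapply Rle_trans; [apply Rmin_l|apply Rmin_l]).
  assert (Q2 : d <= d2) by (eapply Rle_trans; [apply Rmin_l|apply Rmin_r]).
  assert (Q3 : d <= (1 - kap) / 2) by (eapply Rle_trans; [apply Rmin_r|eapply Rle_trans; [apply Rmin_l|apply Rmin_l]]).
  assert (Q4 : d <= a * xi / (4 * B)) by (eapply Rle_trans; [apply Rmin_r|eapply Rle_trans; [apply Rmin_l|apply Rmin_r]]).
  assert (Q5 : d <= 1 / 2) by (eapply Rle_trans; [apply Rmin_r|eapply Rle_trans; [apply Rmin_r|apply Rmin_l]]).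
  assert (Q6 : d <= e) by (eapply Rle_trans; [apply Rmin_r|eapply Rle_trans; [apply Rmin_r|apply Rmin_r]]).
  clearbody d.
  destruct (good_radius a d (Im rho + 1) Ha Q) as [q [T [l [L [Hq [Hqd [HT1 [HT [HF [Hgood HN]]]]]]]]]].
  assert (Hin : In rho l).
  { apply (list_zero T l L); auto; [split; [lra|rewrite Rabs_pos_eq; lra]|lra]. }
  (* Only [rho] is credited with its gain; every other zero is merely counted as nonnegative. *)
  set (del := fun r => if excluded_middle_informative (r = rho) then 4 * PI * q * gap else 0).
  assert (Pdel : 0 <= 4 * PI * q * gap).
  { apply Rmult_le_pos; [|lra]; apply Rmult_le_pos; lra. }
  destruct (contrib_argE a q T l L del False Ha Hq HT HF) as [Lam [c [[M [V [IM [IV Ec]]]] [Hc1 [HL _]]]]].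
  { intros r Hr; unfold del; destruct excluded_middle_informative as [->|Hn].
    - apply zero_contrib_pos; auto.
      + replace (Cmod (rho - 1)) with (kap * Cmod (rho - 1 + RtoC (2 * a))) by (unfold kap; field; lra).
        apply Rmult_lt_compat_r; auto; nra.
      + fold xi; fold B.
        assert (Hqq : 0 < q * q < 1 /\ 1 - q * q <= 2 * (1 - q)) by nra.
        assert (Hr4 : 0 < 1 - q * q * (q * q) <= 4 * (1 - q)).
        { destruct Hqq as [Hqq1 Hqq2]; revert Hqq1 Hqq2; generalize (q * q); intros r Hr1 Hr2; nra. }
        assert (Hb4 : 4 * (1 - q) * B <= a * xi).
        { apply Rle_trans with (4 * B * (a * xi / (4 * B))); [|right; field; lra].
          replace (4 * (1 - q) * B) with (4 * B * (1 - q)) by ring; apply Rmult_le_compat_l; lra. }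
        apply Rmult_le_reg_r with (1 - q * q * (q * q)); [lra|].
        replace (a * (1 + q * q * (q * q)) / (1 - q * q * (q * q)) * xi * (1 - q * q * (q * q)))
          with (a * xi + a * xi * (q * q * (q * q))) by (field; lra).
        assert (0 <= a * xi * (q * q * (q * q))) by (apply Rmult_le_pos; [lra|nra]).
        assert (B * (1 - q * q * (q * q)) <= B * (4 * (1 - q))) by (apply Rmult_le_compat_l; lra).
        lra.
    - assert (Hl : 1 / 4 < Re r /\ 0 < Im r < T) by (destruct HF as [G [[Hl _] _]]; apply Hl; auto).
      apply zero_contrib_nonneg; auto; try lra; tauto. }
  assert (Hsum := sum_ge del l rho).
  assert (Hs : 4 * PI * q * gap <= c).
  { assert (A : del rho = 4 * PI * q * gap) by (unfold del; destruct excluded_middle_informative; tauto).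
    rewrite <- A; apply Rle_trans with (2 := Hc1); apply Hsum; auto.
    intros r _; unfold del; destruct excluded_middle_informative; lra. }
  destruct (H1 q T l L ltac:(lra) HT HF HN Lam M IM) as [HM _]; specialize (HM HL); fold tail in HM.
  assert (HVq := H2 q V Hq ltac:(lra) IV); apply Rabs_def2 in HVq.
  assert (HM2 : 2 * q * M <= 2 * q * (a * a * VS + C * tail + e)) by (apply Rmult_le_compat_l; lra).
  assert (Ht : 0 <= C * tail) by (apply Rmult_le_pos; [lra|apply sqrt_pos]).
  assert (HVS : q * (a * a * VS) <= a * a * VS + e * (a * a * Rabs VS)).
  { assert (Z := Rle_abs (- VS)); rewrite Rabs_Ropp in Z; assert (Z2 := Rabs_pos VS).
    assert (0 < a * a) by nra.
    assert (Z3 : - (a * a * VS) <= a * a * Rabs VS) by nra.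
    assert (Z4 : 0 <= a * a * Rabs VS) by (apply Rmult_le_pos; lra).
    assert (Z5 : (1 - q) * (- (a * a * VS)) <= (1 - q) * (a * a * Rabs VS)) by (apply Rmult_le_compat_l; lra).
    assert (Z6 : (1 - q) * (a * a * Rabs VS) <= e * (a * a * Rabs VS)) by (apply Rmult_le_compat_r; lra).
    lra. }
  assert (Hq1 : q * (C * tail) <= C * tail) by (rewrite <- (Rmult_1_l (C * tail)) at 2; apply Rmult_le_compat_r; lra).
  assert (Hq2 : q * e <= e) by nra.
  assert (Hg2 : 2 * PI * gap <= 4 * PI * q * gap).
  { replace (4 * PI * q * gap) with (2 * q * (2 * PI * gap)) by ring.
    rewrite <- (Rmult_1_l (2 * PI * gap)) at 1; apply Rmult_le_compat_r; lra. }
  lra.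
Qed.

(** With no zero to the right of the line every pair lies outside the arc and contributes exactly 0,
    so both halves of [arc_compare] apply. *)
Lemma balance_of_no_zeros : exists K, 0 < K /\ forall (a : R) (H : R -> R), 0 < a <= 1 / 2 -> (forall y, continuous H y) ->
  (forall y, ln (Re (Fz (xpt a y))) = y * y * H y) ->
  (forall s, 1 - a < Re s -> Fz s <> RtoC 0) ->
  forall S T0 l0 L0 VS, 0 < S < T0 -> 1 / 2 <= cos (pc a S) -> full_fact T0 l0 L0 ->
    subst_ok a (fun t => argE l0 L0 (1 - a, t)) 0 S VS ->
    Rabs (2 * (a * a) * VS + RInt (fun y => (y * y + 1) * H y) 0 1) <= K * sqrt (sin (pc a S)).
Proof.
  destruct arc_compare as [C [HC Hcmp]]; exists (2 * C); split; [lra|].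
  intros a H Ha CH EH Hnz S T0 l0 L0 VS HS Hc HF0 HV.
  set (v1 := RInt (fun y => (y * y + 1) * H y) 0 1).
  set (tail := sqrt (sin (pc a S))).
  apply le_of_small_error with (3 * 1 + 2 * (a * a) * Rabs VS); intros e He.
  destruct (Hcmp a S T0 l0 L0 VS e) as [d1 [Hd1 H1]]; auto; [lra|].
  destruct (modulus_limit a H e Ha CH EH ltac:(lra)) as [d2 [Hd2 H2]]; fold v1 in H2.
  set (d := Rmin (Rmin d1 d2) e).
  assert (Q : 0 < d) by (unfold d; repeat apply Rmin_glb_lt; lra).
  assert (Q1 : d <= d1) by (eapply Rle_trans; [apply Rmin_l|apply Rmin_l]).
  assert (Q2 : d <= d2) by (eapply Rle_trans; [apply Rmin_l|apply Rmin_r]).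
  assert (Q3 : d <= e) by apply Rmin_r.
  clearbody d.
  destruct (good_radius a d 0 Ha Q) as [q [T [l [L [Hq [Hqd [_ [HT [HF [Hgood HN]]]]]]]]]].
  destruct (contrib_argE a q T l L (fun _ => 0) True Ha Hq HT HF) as [Lam [c [[M [V [IM [IV Ec]]]] [_ [_ HL]]]]].
  { intros r Hr.
    assert (Hl : 1 / 4 < Re r /\ 0 < Im r < T) by (destruct HF as [G [[Hl _] _]]; apply Hl; auto).
    apply zero_contrib_nonneg; auto; try lra.
    intros _; apply Rnot_lt_le; intros Hr1; apply (Hnz r Hr1), (zero_in_list T l L); auto. }
  destruct (HL Logic.I) as [-> HL'].
  destruct (H1 q T l L ltac:(lra) HT HF HN Lam M IM) as [HM1 HM2]; fold tail in HM1, HM2.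
  specialize (HM1 (fun p Hp => Req_le _ _ (HL' p Hp))).
  specialize (HM2 (fun p Hp => Req_le _ _ (eq_sym (HL' p Hp)))).
  assert (HVq := H2 q V Hq ltac:(lra) IV); apply Rabs_def2 in HVq.
  assert (HM3 : 2 * q * M <= 2 * q * (a * a * VS + C * tail + e)) by (apply Rmult_le_compat_l; lra).
  assert (HM4 : 2 * q * (a * a * VS - C * tail - e) <= 2 * q * M) by (apply Rmult_le_compat_l; lra).
  assert (Ht : 0 <= C * tail) by (apply Rmult_le_pos; [lra|apply sqrt_pos]).
  assert (HVS : Rabs ((1 - q) * (a * a * VS)) <= e * (a * a * Rabs VS)).
  { rewrite Rabs_mult, (Rabs_mult (a * a)), (Rabs_pos_eq (1 - q)), (Rabs_pos_eq (a * a)) by nra.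
    apply Rmult_le_compat_r; [|lra]; apply Rmult_le_pos; [nra|apply Rabs_pos]. }
  apply Rabs_le_between in HVS.
  assert (Hq1 : q * (C * tail) <= C * tail) by (rewrite <- (Rmult_1_l (C * tail)) at 2; apply Rmult_le_compat_r; lra).
  assert (Hq2 : q * e <= e) by nra.
  apply Rabs_le_between; split; lra.
Qed.

Lemma is_RInt_off_finite (f g : R -> R) (bad : list R) a b I : a <= b ->
  (forall x, a < x < b -> ~ In x bad -> f x = g x) -> is_RInt f a b I -> is_RInt g a b I.
Proof.
  revert a b I; induction bad as [|x bad IH]; intros a b I Hab E HI.
  - apply is_RInt_extR with (3 := HI); auto.
  - destruct (Rlt_dec a x) as [H1|H1]; [destruct (Rlt_dec x b) as [H2|H2]|].
    + assert (Ef : ex_RInt f a b) by (eexists; exact HI).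
      assert (E1 : ex_RInt f a x) by (apply ex_RInt_sub with a b; auto; lra).
      assert (E2 : ex_RInt f x b) by (apply ex_RInt_sub with a b; auto; lra).
      replace I with (RInt f a x + RInt f x b).
      * apply (is_RInt_Chasles (V := R_NormedModule)) with x; (apply IH; [lra| |apply is_RInt_RInt; auto]);
          intros y Hy Hn; apply E; try lra; intros [Hyx|Hyx]; auto; lra.
      * rewrite RInt_Chasles_R by auto; apply is_RInt_unique; auto.
    + apply IH; auto; intros y Hy Hn; apply E; auto; intros [Hyx|Hyx]; auto; lra.
    + apply IH; auto; intros y Hy Hn; apply E; auto; intros [Hyx|Hyx]; auto; lra.
Qed.

Lemma height_integral a S : 0 < a <= 1 / 2 -> 0 < S -> exists T l L V,
  S < T /\ full_fact T l L /\ subst_ok a (fun t => argE l L (1 - a, t)) 0 S V /\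
  is_RInt (fun t => arg_zetaF (1 - a) t / wt a t) 0 S V.
Proof.
  intros Ha HS; destruct (full_fact_ex (S + 1) ltac:(lra)) as [l [L HF]].
  destruct (subst_ok_argE a (S + 1) l L S Ha ltac:(lra) HF) as [V HV].
  exists (S + 1), l, L, V; split; [lra|split; [auto|split; [auto|]]].
  destruct HV as [I _].
  apply is_RInt_off_finite with (bad := map Im l) (3 := I); [lra|].
  intros t Ht Hn; rewrite (arg_zetaF_argE (S + 1) l L); auto; try lra.
  intros rho Hr E; apply Hn; rewrite E; apply in_map; auto.
Qed.

Lemma tail_small a C e : 0 < a -> 0 < C -> 0 < e -> exists S0, 0 < S0 /\
  forall S, S0 < S -> 1 / 2 <= cos (pc a S) /\ C * sqrt (sin (pc a S)) < e.
Proof.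
  intros Ha HC He; generalize PI_RGT_0; intros HP.
  set (e' := e / C); assert (He' : 0 < e') by (apply Rdiv_lt_0_compat; auto).
  exists (Rmax (2 * a) (a / (e' * e'))).
  split; [apply Rlt_le_trans with (2 := Rmax_l _ _); lra|].
  intros S HS.
  assert (S1 : 2 * a < S) by (eapply Rle_lt_trans; [apply Rmax_l|exact HS]).
  assert (S2 : a / (e' * e') < S) by (eapply Rle_lt_trans; [apply Rmax_r|exact HS]).
  assert (B := pc_bound a S Ha ltac:(lra)); assert (E := hgt_pc a S Ha ltac:(lra)).
  set (p := pc a S) in *; unfold hgt in E.
  assert (Sp := sin_gt_0 p ltac:(lra) ltac:(lra)); assert (Cp := cos_ge_0 p ltac:(lra) ltac:(lra)).
  assert (E2 : a * cos p = S * sin p) by (rewrite <- E at 1; field; lra).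
  assert (C1 := COS_bound p); assert (SC := sin2cos2 p).
  assert (Le : S * sin p <= a) by nra.
  split.
  - assert (sin p <= 1 / 2) by nra; nra.
  - apply Rlt_le_trans with (C * e'); [|right; unfold e'; field; lra].
    apply Rmult_lt_compat_l; auto.
    rewrite <- (sqrt_square e') by lra; apply sqrt_lt_1_alt; split; [lra|].
    apply Rmult_lt_reg_l with S; [lra|].
    apply Rle_lt_trans with (1 := Le).
    apply Rmult_lt_reg_r with (/ (e' * e')); [apply Rinv_0_lt_compat; nra|].
    replace (S * (e' * e') * / (e' * e')) with S by (field; lra); exact S2.
Qed.

Lemma zeta_zero_Fz s : 0 < Re s -> s <> RtoC 1 -> (zeta s = RtoC 0 <-> Fz s = RtoC 0).
Proof.
  intros Hs H1; rewrite <- zetaF_Fz by auto; unfold zetaF; split.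
  - intros ->; ring.
  - intros E; destruct (Ceq_dec (zeta s) 0) as [|N]; auto.
    exfalso; apply (Cmult_neq_0 _ _ N (Csub_neq _ _ H1)); auto.
Qed.

Theorem theorem7 (alpha : R) (Halpha : 0 <= alpha < 1 / 2) :
  (exists I1 I2 : R,
     is_RInt_gen
       (fun t => arg_zetaF (1/2 + alpha) t
                 / Rpower ((1/2 - alpha) ^ 2 + t ^ 2) (3/2))
       (at_point 0) (Rbar_locally p_infty) I1 /\
     is_RInt_gen
       (fun sigma => ln (Re (zetaF (RtoC sigma)))
                     / (Rpower (1 - sigma) (3/2) * Rpower (sigma - 2 * alpha) (3/2)))
       (at_point (1/2 + alpha)) (at_left 1) I2 /\
     I1 + I2 = 0)
  <->
  (forall s : C, 1/2 + alpha < Re s -> s <> RtoC 1 -> zeta s <> RtoC 0).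
Proof.
  set (a := 1 / 2 - alpha); assert (Ha : 0 < a <= 1 / 2) by (unfold a; lra).
  replace (1 / 2 + alpha) with (1 - a) by (unfold a; lra).
  replace (2 * alpha) with (1 - 2 * a) by (unfold a; lra).
  assert (Haa : 0 < a * a <= 1 / 4) by nra.
  destruct (ln_Fz_slope a Ha) as [H [CH EH]].
  set (v1 := RInt (fun y => (y * y + 1) * H y) 0 1).
  assert (IS : is_RInt_gen (fun sigma => ln (Re (zetaF (RtoC sigma)))
                     / (Rpower (1 - sigma) (3/2) * Rpower (sigma - (1 - 2 * a)) (3/2)))
       (at_point (1 - a)) (at_left 1) (v1 / (2 * (a * a)))).
  { apply is_RInt_gen_ext with (2 := real_axis_integral a H Ha CH EH).
    apply filter_forall; intros x y _; f_equal; f_equal; f_equal; ring. }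
  split.
  - intros [I1 [I2 [G1 [G2 Esum]]]] s Hs Hs1 Hz.
    apply zeta_zero_Fz in Hz; auto; [|lra].
    (* The list of zeros uses the upper half plane: a lower zero is conjugated, and [Fz_real]
       excludes a real one. *)
    assert (Hrho : exists rho, 0 < Im rho /\ 1 - a < Re rho /\ Fz rho = RtoC 0).
    { destruct (Rtotal_order (Im s) 0) as [N|[E|P]].
      - exists (Cconj s); rewrite im_conj, re_conj; split; [lra|split; auto].
        rewrite Fz_conj by (unfold rhp; lra); rewrite Hz; creal; ring.
      - exfalso; assert (F := Fz_real (Re s) ltac:(lra)).
        replace (RtoC (Re s)) with s in F by (destruct s; simpl in *; rewrite E; auto).
        rewrite Hz in F; simpl in F; lra.
      - exists s; auto. }
    destruct Hrho as [rho [Hi [Hre Hzr]]].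
    destruct zero_forces_gap as [C [HC HP]].
    destruct (HP a H rho Ha CH EH Hi Hre Hzr) as [g [Hg HPg]]; fold v1 in HPg.
    assert (EI2 : I2 = v1 / (2 * (a * a))).
    { rewrite <- (is_RInt_gen_unique _ _ G2); apply is_RInt_gen_unique; exact IS. }
    apply is_RInt_gen_inv in G1; [|apply Rbar_locally_filter].
    destruct G1 as [_ G1].
    (* Since [2 a^2 <= 1/2], an error [g/8] in the integral costs at most [g/16]; with a tail below
       [g/8] the total stays under [g], a contradiction. *)
    destruct (G1 (fun y => Rabs (y - I1) < g / 8)) as [M0 HM0].
    { exists (mkposreal (g / 8) ltac:(lra)); intros y Hy; exact Hy. }
    destruct (tail_small a C (g / 8) (proj1 Ha) HC ltac:(lra)) as [S0 [HS0 Htail]].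
    set (S := Rmax M0 S0 + 1).
    assert (HSM : M0 < S) by (unfold S; generalize (Rmax_l M0 S0); lra).
    assert (HSS : S0 < S) by (unfold S; generalize (Rmax_r M0 S0); lra).
    destruct (Htail S HSS) as [Hc Ht].
    destruct (height_integral a S Ha ltac:(lra)) as [T [l [L [V [HT [HF [HV IV]]]]]]].
    specialize (HPg S T l L V ltac:(lra) Hc HF HV).
    assert (HM1 : Rabs (V - I1) < g / 8).
    { rewrite <- (is_RInt_unique _ _ _ _ IV); exact (HM0 S HSM). }
    apply Rabs_def2 in HM1.
    assert (E0 : 2 * (a * a) * I1 + v1 = 0).
    { replace I1 with (- I2) by lra; rewrite EI2; field; lra. }
    assert (2 * (a * a) * (V - I1) <= 2 * (a * a) * (g / 8)) by (apply Rmult_le_compat_l; lra).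
    assert (2 * (a * a) * (g / 8) <= 1 / 2 * (g / 8)) by (apply Rmult_le_compat_r; lra).
    lra.
  - intros Hnz.
    assert (HFz : forall s, 1 - a < Re s -> Fz s <> RtoC 0).
    { intros s Hs; destruct (Ceq_dec s 1) as [->|N].
      - rewrite Fz_1; intros E; apply (f_equal fst) in E; simpl in E; lra.
      - intros E; apply (Hnz s Hs N); apply zeta_zero_Fz; auto; lra. }
    (* The convergence of the first integral is part of the claim; it follows from the balance up to
       height [S], whose error tends to 0. *)
    exists (- (v1 / (2 * (a * a)))), (v1 / (2 * (a * a))); split; [|split; [exact IS|ring]].
    destruct balance_of_no_zeros as [C [HC HZ]]; specialize (HZ a H Ha CH EH HFz); fold v1 in HZ.
    apply is_RInt_gen_of with (fun b => RInt (fun t => arg_zetaF (1 - a) t / wt a t) 0 b).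
    + apply Rbar_locally_filter.
    + exists 0; intros S HS; destruct (height_integral a S Ha HS) as [T [l [L [V [_ [_ [_ IV]]]]]]].
      apply is_RInt_RInt; eexists; exact IV.
    + intros P [eps HP].
      destruct (tail_small a C (2 * (a * a) * eps) (proj1 Ha) HC) as [S0 [HS0 Htail]].
      { apply Rmult_lt_0_compat; [lra|apply cond_pos]. }
      exists S0; intros S HS; apply HP; destruct (Htail S HS) as [Hc Ht].
      destruct (height_integral a S Ha ltac:(lra)) as [T [l [L [V [HT [HF [HV IV]]]]]]].
      rewrite (is_RInt_unique _ _ _ _ IV).
      change (Rabs (V - - (v1 / (2 * (a * a)))) < eps).
      specialize (HZ S T l L V ltac:(lra) Hc HF HV).
      apply Rmult_lt_reg_l with (2 * (a * a)); [lra|].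
      rewrite <- (Rabs_pos_eq (2 * (a * a))) at 1 by lra; rewrite <- Rabs_mult.
      replace (2 * (a * a) * (V - - (v1 / (2 * (a * a))))) with (2 * (a * a) * V + v1) by (field; lra).
      lra.
Qed.
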